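(* Let $(M^{2n+1},\theta)$, $n\geqslant1$, be a closed, oriented, strictly pseudoconvex CR manifold of hypersurface type with contact form $\theta$, such that $$\operatorname{Ric}(Z,Z)\geqslant(n+1)\langle Z,Z\rangle_{L_\theta},\qquad \operatorname{Tor}(Z,Z)=0,\qquad\forall Z\in T^{(1,0)}M.$$ If $1<\alpha<\frac{n+2}{n}$ and $0<\lambda\leqslant\frac{n}{2(\alpha-1)}$, then the only positive solution $u\in C^\infty(M)$ of $$\Delta u-\lambda u+u^\alpha=0\quad\text{on }M$$ is the constant $u\equiv\lambda^{\frac1{\alpha-1}}$.
   Context: CR conventions: $T^{(1,0)}M\subset\mathbb CTM$ is the CR structure, of complex rank $n$; $\theta$ is a real contact form annihilating $T^{(1,0)}M\oplus T^{(0,1)}M$; $T$ is the Reeb field ($\theta(T)=1$, $d\theta(T,\cdot)=0$). $\{Z_i\}_{i=1}^n$ is a local frame of $T^{(1,0)}M$, $Z_{\overline i}=\overline{Z_i}$, with dual coframe $\theta^i$ ($\theta^i(T)=0$), and $d\theta=2\sqrt{-1}\,h_{i\overline j}\theta^i\wedge\theta^{\overline j}$ with $h_{i\overline j}$ a positive definite Hermitian matrix (strict pseudoconvexity); $\langle Z,W\rangle_{L_\theta}=h_{i\overline j}Z^i\overline{W^j}$. Indices are raised and lowered with $h$. Covariant derivatives are those of the Tanaka–Webster connection, indices being written in the order of differentiation, with $f_i=Z_if$, $f_{\overline i}=Z_{\overline i}f$, $f_0=Tf$, and the commutation formulas are $f_{ij}=f_{ji}$ (second derivatives), $f_{i\overline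 j}-f_{\overline ji}=2\sqrt{-1}h_{i\overline j}f_0$, $f_{0i}-f_{i0}=A_{ij}f^j$, $f_{ij\overline k}-f_{i\overline kj}=2\sqrt{-1}h_{j\overline k}f_{i0}+R_{i\ j\overline k}^{\ l}f_l$. Here $R_{i\overline jk\overline l}$ is the Webster curvature, $\operatorname{Ric}(Z_i,Z_j)=R_{i\overline j}=R_{i\ k\overline j}^{\ k}$ the pseudohermitian Ricci tensor, $\operatorname{Tor}(Z_i,Z_j)=A_{ij}$ the Webster torsion. The sub-Laplacian is $\Delta f=\frac12(f_i{}^i+f^i{}_i)=\operatorname{Re}f_i{}^i$, where $f_i{}^i=h^{i\overline j}f_{i\overline j}$. *)

(* Defs.v *)
From HB Require Import structures.
From mathcomp Require Import all_boot all_order all_algebra.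
From mathcomp Require Import all_classical all_reals all_analysis.
From mathcomp Require Import complex.

Set Implicit Arguments.
Unset Strict Implicit.
Unset Printing Implicit Defensive.

Import Order.TTheory GRing.Theory Num.Theory.
Import numFieldNormedType.Exports.

Local Open Scope classical_set_scope.
Local Open Scope ring_scope.
Local Open Scope complex_scope.

(** * Smooth manifolds *)

(* [C^k] on an open set [V] of [R^m], through iterated partial derivatives. *)
Fixpoint Ck_on (R : realType) (m k : nat) (V : set 'rV[R]_m)
    (f : 'rV[R]_m -> R) : Prop :=
  {in V, continuous f} /\
  match k with
  | 0 => True
  | k'.+1 => forall i : 'I_m,
      (forall x, V x -> derivable f x (delta_mx 0 i)) /\
      Ck_on k' V ('D_(delta_mx 0 i) f)
  end.

Definition Cinf_on (R : realType) (m : nat) (V : set 'rV[R]_m)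
  (f : 'rV[R]_m -> R) : Prop := forall k, Ck_on k V f.

(* [cmap] and [cinv] are total functions; they are meaningful only on [cdom]
   and on [cmap @` cdom] respectively. *)
Record chart (R : realType) (m : nat) (M : topologicalType) := Chart {
  cdom : set M;
  cmap : M -> 'rV[R]_m;
  cinv : 'rV[R]_m -> M }.

Definition is_chart (R : realType) (m : nat) (M : topologicalType)
    (c : chart R m M) : Prop :=
  [/\ open (cdom c), open (cmap c @` cdom c),
      (forall p, cdom c p -> cinv c (cmap c p) = p),
      {in cdom c, continuous (cmap c)} &
      {in cmap c @` cdom c, continuous (cinv c)}].

(* A smooth structure together with an orientation: all the changes of charts
   have a positive Jacobian determinant. The choice [chart_at] of a chart around
   each point serves to represent tangent vectors by their components. *)
Record oriented_atlas (R : realType) (m : nat) (M : topologicalType) :=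
  OrientedAtlas {
  charts : set (chart R m M);
  chart_at : M -> chart R m M;
  charts_chart : forall c, charts c -> is_chart c;
  chart_at_charts : forall p, charts (chart_at p);
  chart_at_dom : forall p, cdom (chart_at p) p;
  charts_smooth : forall c c', charts c -> charts c' -> forall i,
    Cinf_on (cmap c @` (cdom c `&` cdom c'))
            (fun x => cmap c' (cinv c x) 0 i);
  charts_oriented : forall c c', charts c -> charts c' ->
    forall x, (cmap c @` (cdom c `&` cdom c')) x ->
    0 < \det (jacobian (cmap c' \o cinv c) x) }.

(* Compact without boundary: charts take their values in open sets of [R^m]. *)
Definition closed_manifold (M : topologicalType) : Prop :=
  [/\ hausdorff_space M, @second_countable M & compact [set: M]].

Section SmoothManifold.
Context (R : realType) (m : nat) (M : topologicalType).
Context (A : oriented_atlas R m M).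
Local Notation C := R[i].

Definition smoothR_on (U : set M) (f : M -> R) : Prop :=
  forall c, charts A c -> Cinf_on (cmap c @` (U `&` cdom c)) (f \o cinv c).

Definition smooth_on (U : set M) (f : M -> C) : Prop :=
  smoothR_on U (fun p => complex.Re (f p)) /\
  smoothR_on U (fun p => complex.Im (f p)).

(* An element of the complexified tangent space at [p] is the row of its
   components in the coordinate basis of [chart_at A p]; complex conjugation is
   componentwise since coordinates are real. *)
Definition tvec : Type := 'rV[C]_m.
Definition vfield : Type := M -> 'rV[C]_m.

Definition conjv (v : 'rV[C]_m) : 'rV[C]_m := map_mx (@conjc R) v.
Definition conjf (X : vfield) : vfield := fun p => conjv (X p).

Definition cpartial (i : 'I_m) (g : 'rV[R]_m -> C) (x : 'rV[R]_m) : C :=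
  ('D_(delta_mx 0 i) (fun y => complex.Re (g y)) x)
  +i* ('D_(delta_mx 0 i) (fun y => complex.Im (g y)) x).

(* The derivative [v f] of [f] along the tangent vector [v] at [p]. *)
Definition dtan (p : M) (v : 'rV[C]_m) (f : M -> C) : C :=
  let c := chart_at A p in
  \sum_i v 0 i * cpartial i (f \o cinv c) (cmap c p).

Definition vapp (X : vfield) (f : M -> C) : M -> C := fun p => dtan p (X p) f.

Definition ccoord (c : chart R m M) (i : 'I_m) : M -> C :=
  fun p => (cmap c p 0 i)%:C.

(* [vapp X (ccoord c i)] is the [i]-th component of [X] in the chart [c]. *)
Definition vsmooth_on (U : set M) (X : vfield) : Prop :=
  forall c, charts A c -> forall i,
    smooth_on (U `&` cdom c) (vapp X (ccoord c i)).

Definition bracket (X Y : vfield) : vfield := fun p =>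
  \row_i (vapp X (vapp Y (ccoord (chart_at A p) i)) p
          - vapp Y (vapp X (ccoord (chart_at A p) i)) p).

(* A real one-form, given by its components in [chart_at A p]. *)
Definition form1 : Type := M -> 'rV[R]_m.

Definition pair1 (theta : form1) (X : vfield) : M -> C :=
  fun p => \sum_i X p 0 i * (theta p 0 i)%:C.

Definition form1_smooth (theta : form1) : Prop :=
  forall (U : set M) (X : vfield), open U -> vsmooth_on U X ->
    smooth_on U (pair1 theta X).

Definition dform (theta : form1) (X Y : vfield) : M -> C := fun p =>
  vapp X (pair1 theta Y) p - vapp Y (pair1 theta X) p
  - pair1 theta (bracket X Y) p.

(* An affine connection on the complexified tangent bundle, acting on local
   sections: [nabla X Y p] is used only when [X] and [Y] are smooth around [p]. *)
Definition connection (nabla : vfield -> vfield -> vfield) : Prop :=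
  forall U : set M, open U ->
  [/\ (forall X Y, vsmooth_on U X -> vsmooth_on U Y ->
         vsmooth_on U (nabla X Y)),
      (forall f X X' Y, smooth_on U f ->
         vsmooth_on U X -> vsmooth_on U X' -> vsmooth_on U Y ->
         forall p, U p -> nabla (fun q => f q *: X q + X' q) Y p
                          = f p *: nabla X Y p + nabla X' Y p),
      (forall X Y Y', vsmooth_on U X -> vsmooth_on U Y -> vsmooth_on U Y' ->
         forall p, U p -> nabla X (fun q => Y q + Y' q) p
                          = nabla X Y p + nabla X Y' p) &
      (forall f X Y, smooth_on U f -> vsmooth_on U X -> vsmooth_on U Y ->
         forall p, U p -> nabla X (fun q => f q *: Y q) p
                          = vapp X f p *: Y p + f p *: nabla X Y p)].

Definition torsion (nabla : vfield -> vfield -> vfield) (X Y : vfield)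
  : vfield := fun p => nabla X Y p - nabla Y X p - bracket X Y p.

Definition curvature (nabla : vfield -> vfield -> vfield) (X Y W : vfield)
  : vfield := fun p => nabla X (nabla Y W) p - nabla Y (nabla X W) p
                       - nabla (bracket X Y) W p.

End SmoothManifold.

Arguments vfield R m M : clear implicits.
Arguments form1 R m M : clear implicits.

(** * Pseudohermitian geometry, in dimension 2n+1 *)

Section Pseudohermitian.
Context (R : realType) (n : nat) (M : topologicalType).
Context (A : oriented_atlas R n.*2.+1 M).
Local Notation C := R[i].
Local Notation vfield := (vfield R n.*2.+1 M).

(* [T10 p] is the fibre at [p] of the CR structure. *)
Context (T10 : M -> {vspace 'rV[C]_(n.*2.+1)}).

Definition section_on (U : set M) (Z : vfield) : Prop :=
  vsmooth_on A U Z /\ forall p, U p -> Z p \in T10 p.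

Definition at_point (Z : 'I_n -> vfield) (p : M)
  : n.-tuple 'rV[C]_(n.*2.+1) := [tuple Z i p | i < n].

Definition local_frame (U : set M) (Z : 'I_n -> vfield) : Prop :=
  [/\ open U, (forall i, vsmooth_on A U (Z i)) &
      forall p, U p -> basis_of (T10 p) (at_point Z p)].

(* A CR structure of hypersurface type: a smooth complex subbundle of rank [n],
   transverse to its conjugate and formally integrable. *)
Definition cr_structure : Prop :=
  [/\ (forall p, exists U Z, U p /\ local_frame U Z),
      (forall p v, v \in T10 p -> conjv v \in T10 p -> v = 0) &
      (forall U Z W, open U -> section_on U Z -> section_on U W ->
         section_on U (bracket A Z W))].

Context (theta : form1 R n.*2.+1 M).

(* [theta] is nowhere zero and [d theta] is nondegenerate on its kernel. *)
Definition contact_form : Prop :=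
  [/\ form1_smooth A theta, (forall p, theta p != 0) &
      forall (U : set M) (X : vfield) p, open U -> U p ->
        vsmooth_on A U X -> (forall q, U q -> pair1 theta X q = 0) ->
        (forall Y : vfield, vsmooth_on A U Y ->
           (forall q, U q -> pair1 theta Y q = 0) ->
           dform A theta X Y p = 0) ->
        X p = 0].

(* Annihilating the (0,1) vectors is then automatic, [theta] being real. *)
Definition annihilates_T10 : Prop :=
  forall (Z : vfield) p, Z p \in T10 p -> pair1 theta Z p = 0.

(* [<Z, W> = h_{i \bar j} Z^i \bar{W^j}] for sections [Z], [W] of [T10], where
   [d theta = 2 sqrt(-1) h_{i \bar j} theta^i /\ theta^{\bar j}], that is
   [d theta (Z, \bar W) = 2 sqrt(-1) <Z, W>]. *)
Definition levi (Z W : vfield) : M -> C :=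
  fun p => dform A theta Z (conjf W) p / (2%:R * 'i%C).

Definition strictly_pseudoconvex : Prop :=
  forall U Z p, open U -> section_on U Z -> U p -> Z p != 0 -> 0 < levi Z Z p.

Context (T : vfield).

Definition reeb_field : Prop :=
  [/\ vsmooth_on A setT T, (forall p, conjv (T p) = T p),
      (forall p, pair1 theta T p = 1) &
      forall U X, open U -> vsmooth_on A U X ->
        forall p, U p -> dform A theta T X p = 0].

Context (nabla : vfield -> vfield -> vfield).

(* The real connection preserving [T10], [T] and the Levi form whose torsion
   satisfies [Tor(Z, W) = 0], [Tor(Z, \bar W) = 2 sqrt(-1) <Z, W> T], and maps
   [(T, Z)] to a (0,1) vector. *)
Definition tanaka_webster : Prop :=
  connection A nabla /\
  forall U : set M, open U ->
  [/\ (forall X Y, vsmooth_on A U X -> vsmooth_on A U Y -> forall p, U p ->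
         nabla (conjf X) (conjf Y) p = conjv (nabla X Y p)),
      (forall X, vsmooth_on A U X -> forall p, U p -> nabla X T p = 0),
      (forall X Z, vsmooth_on A U X -> section_on U Z ->
         section_on U (nabla X Z)),
      (forall X Z W, vsmooth_on A U X -> section_on U Z -> section_on U W ->
         forall p, U p -> vapp A X (levi Z W) p
           = levi (nabla X Z) W p + levi Z (nabla (conjf X) W) p) &
      (forall Z W, section_on U Z -> section_on U W -> forall p, U p ->
         [/\ torsion A nabla Z W p = 0,
             torsion A nabla Z (conjf W) p = (2%:R * 'i%C * levi Z W p) *: T p &
             conjv (torsion A nabla T Z p) \in T10 p])].

Section Frame.
Variable Z : 'I_n -> vfield.

(* [theta^k (v)], for [v] in [T10 p]. *)
Definition coframe (k : 'I_n) (p : M) (v : 'rV[C]_(n.*2.+1)) : C :=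
  coord (at_point Z p) k v.

(* [h_{i \bar j}] *)
Definition hmat (p : M) : 'M[C]_n := \matrix_(i, j) levi (Z i) (Z j) p.

(* [h^{i \bar j}], with [h^{i \bar j} h_{k \bar j} = delta^i_k]: hence the
   transpose. *)
Definition hinv (p : M) : 'M[C]_n := (invmx (hmat p))^T.

(* [R_{i \bar j} = R_i^k_{k \bar j}], where the commutation formula of the
   covariant derivatives means [R(Z_k, Z_{\bar l}) Z_i = R_i^m_{k \bar l} Z_m]. *)
Definition ric (i j : 'I_n) (p : M) : C :=
  \sum_k coframe k p (curvature A nabla (Z k) (conjf (Z j)) (Z i) p).

(* [A_{ij}], where [Tor(T, Z_i) = A_i^{\bar k} Z_{\bar k}] and
   [A_{ij} = h_{j \bar k} A_i^{\bar k}]; this is the sign for which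
   [f_{0i} - f_{i0} = A_{ij} f^j]. *)
Definition tor (i j : 'I_n) (p : M) : C :=
  \sum_k hmat p j k
         * conjc (coframe k p (conjv (torsion A nabla T (Z i) p))).

(* [f_{i \bar j}]: first [Z_i], then [Z_{\bar j}]. *)
Definition hess (f : M -> C) (i j : 'I_n) (p : M) : C :=
  vapp A (conjf (Z j)) (vapp A (Z i) f) p
  - vapp A (nabla (conjf (Z j)) (Z i)) f p.

(* [Re f_i^i] *)
Definition sublaplacian (f : M -> R) (p : M) : R :=
  complex.Re (\sum_i \sum_j hinv p i j * hess (fun q => (f q)%:C) i j p).

End Frame.

(* The next two conditions are stated on the vector [Z = a^i Z_i] at [p], and
   [z <= w] in [R[i]] means that [w - z] is a nonnegative real; here both sides
   are real, as [h] and [Ric] are Hermitian. *)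
Definition ric_bound : Prop :=
  forall U Z, local_frame U Z -> forall p, U p -> forall a : 'I_n -> C,
    n.+1%:R * (\sum_i \sum_j hmat Z p i j * a i * conjc (a j))
    <= \sum_i \sum_j ric Z i j p * a i * conjc (a j).

Definition torsion_free : Prop :=
  forall U Z, local_frame U Z -> forall p, U p -> forall a : 'I_n -> C,
    \sum_i \sum_j tor Z i j p * a i * a j = 0.

(* [Delta u - lambda u + u^alpha = 0] on [M]; the value of the sub-Laplacian
   does not depend on the local frame. *)
Definition solution (lambda alpha : R) (u : M -> R) : Prop :=
  forall U Z, local_frame U Z -> forall p, U p ->
    sublaplacian Z u p - lambda * u p + u p `^ alpha = 0.

End Pseudohermitian.

(* Main.v *)
(* Put psi = (alpha - 1) ln u, F = (alpha - 1) u^(alpha - 1), L = (alpha - 1) lambda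
   and nu = 1 / (alpha - 1), and let G be the (1,0) gradient of psi. The equation
   says that div G = L - F - nu |G|^2 - n sqrt(-1) T psi. With w = u^(3 - alpha), a
   suitable combination of nabla_{conj G} G, nabla_G G, nabla_T G and G, multiplied
   by w, has a divergence whose real part is w times a sum of squares and of terms
   which are nonnegative by the Ricci bound and by L <= n/2, and is at least
   k w |G|^6 with k > 0, because alpha < (n + 2)/n. When the torsion vanishes the
   divergence of a section of T10 has integral 0 over the closed manifold M; hence
   G = 0, and F = L.

   The divergence theorem uses the density p |-> 1 / int bump (g_p (z, z)) dz, a
   constant multiple of sqrt (det g), where g is the Webster metric: it transforms
   correctly by linear change of variables alone, and its derivatives are computed
   from nabla g = 0 by integrating by parts in z. *)
Require Import Defs.
From HB Require Import structures.
From mathcomp Require Import all_boot all_order all_algebra.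
From mathcomp Require Import all_classical all_reals all_analysis.
From mathcomp Require Import complex ring lra zify.

Import Order.TTheory GRing.Theory Num.Theory.
Import numFieldNormedType.Exports.

Local Open Scope classical_set_scope.
Local Open Scope ring_scope.
Local Open Scope complex_scope.

Set Implicit Arguments.
Unset Strict Implicit.
Unset Printing Implicit Defensive.

(** * Calculus in R^m *)

Section Calculus.
Context {R : realType}.

(** Independence of the chart is proved without a Jacobian. For a transition map psi, the kernel
    a(x) a'(y) bump(gm_x((psi x - y) / eta)) concentrates on the graph of psi as eta tends to 0; its
    double integral, computed in the two orders, rescales in each case to a fibre integral of bump,
    which the density normalizes. Translation, dyadic scaling and Fubini for Riemann sums of
    continuous functions are enough for this. The Tanaka-Webster connection has torsion, so it is
    not the Levi-Civita connection of the metric; its divergence is nevertheless the one adapted to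
    the density, because Tor(X, .) has trace zero when X is the sum of a section of T10 and its
    conjugate. The bound on alpha enters only as eps = 2 nu / n - 1 > 0. The Ricci bound and L <=
    n/2 meet in a single term, Ric(G, G) - 2 (n + 1) / n L |G|^2. Vanishing Webster torsion removes
    every curvature term except Ric from the three divergences. *)

Lemma row_coord_le m (x : 'rV[R]_m) i : `|x 0 i| <= `|x|.
Proof.
rewrite [leRHS]/Num.Def.normr /= mx_normrE.
by rewrite (le_bigmax _ (fun ij : 'I_1 * 'I_m => `|x ij.1 ij.2|) (0, i)).
Qed.

Lemma row_norm_le m (x : 'rV[R]_m) (e : R) :
  0 <= e -> (forall i, `|x 0 i| <= e) -> `|x| <= e.
Proof.
move=> e0 H; rewrite [leLHS]/Num.Def.normr /= mx_normrE.
by apply/bigmax_leP; split=> // -[i j] _ /=; rewrite (ord1 i).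
Qed.

Lemma norm_delta_le m (i : 'I_m) : `|delta_mx 0 i : 'rV[R]_m| <= 1.
Proof.
by apply: row_norm_le => // j; rewrite mxE eqxx /=; case: eqP; rewrite ?normr1 ?normr0.
Qed.

Lemma is_derive_line (V W : normedModType R) (f : V -> W) (x v : V) (t : R) :
  derivable f (x + t *: v) v ->
  is_derive t (1 : R) (fun s => f (x + s *: v)) ('D_v f (x + t *: v)).
Proof.
move=> df.
have E : (fun h : R => h^-1 *: (((fun s => f (x + s *: v)) \o shift t) (h *: 1) -
    f (x + t *: v))) =
  (fun h => h^-1 *: ((f \o shift (x + t *: v)) (h *: v) - f (x + t *: v))).
  apply/funext=> h /=; congr (_ *: (f _ - _)).
  by rewrite scalerDl [h *: 1]mulr1 addrCA.
by split; rewrite ?/derivable ?/derive E.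
Qed.

(** Measuring the increment against a candidate slope [c], instead of naming a mean value, lets one
    estimate serve for differentials, for mixed partial derivatives and for derivatives of
    integrals. *)
Lemma mvt_bound (g : R -> R) (c e h : R) :
  (forall t, `|t| <= `|h| -> exists2 d, is_derive t (1 : R) g d & `|d - c| <= e) ->
  `|g h - g 0 - c * h| <= e * `|h|.
Proof.
move=> H.
have dE t : `|t| <= `|h| -> is_derive t (1 : R) g ('D_1 g t) /\ `|'D_1 g t - c| <= e.
  by move=> /H[d dd de]; rewrite (@derive_val _ _ _ _ _ _ _ dd).
have cont t : `|t| <= `|h| -> {for t, continuous g}.
  move=> /dE[[dg _] _]; apply: differentiable_continuous.
  exact/derivable1_diffP.
have [h0|h0] := leP 0 h.
  have := @MVT_segment R g ('D_1 g) 0 h h0.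
  case.
  - move=> x; rewrite in_itv /= => /andP[x0 xh].
    by case: (dE x) => //; rewrite !ger0_norm // ltW.
  - apply: continuous_in_subspaceT => x; rewrite inE /= in_itv /= => /andP[x0 xh].
    by apply: cont; rewrite !ger0_norm.
  - move=> x; rewrite in_itv /= => /andP[x0 xh]; rewrite subr0 => ->.
    rewrite -mulrBl normrM ler_wpM2r //.
    by case: (dE x) => //; rewrite !ger0_norm.
have h0' := ltW h0.
have := @MVT_segment R g ('D_1 g) h 0 h0'.
case.
- move=> x; rewrite in_itv /= => /andP[x0 xh].
  by case: (dE x) => //; rewrite !ler0_norm ?lerN2 // ltW.
- apply: continuous_in_subspaceT => x; rewrite inE /= in_itv /= => /andP[x0 xh].
  by apply: cont; rewrite !ler0_norm ?lerN2.
- move=> x; rewrite in_itv /= => /andP[x0 xh]; rewrite sub0r => E.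
  have -> : g h - g 0 - c * h = ('D_1 g x - c) * h.
    by rewrite mulrBl -[g h - g 0]opprB E mulrN opprK.
  rewrite normrM ler_wpM2r //.
  by case: (dE x) => //; rewrite !ler0_norm ?lerN2.
Qed.

Lemma row_mvt m (f : 'rV[R]_m -> R) (x h : 'rV[R]_m) (c : 'I_m -> R) (e : R) :
  (forall y, `|y - x| <= `|h| -> forall i, derivable f y (delta_mx 0 i) /\
     `|'D_(delta_mx 0 i) f y - c i| <= e) ->
  `|f (x + h) - f x - \sum_i c i * h 0 i| <= m%:R * e * `|h|.
Proof.
move=> H.
(* [hk k] keeps the first [k] coordinates of [h]. In the max norm the polygonal path through these
   points never leaves the ball of radius [|h|], so the hypothesis covers every leg. *)
pose hk k : 'rV[R]_m := \row_i (if (i < k)%N then h 0 i else 0).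
suff S k : (k <= m)%N ->
  `|f (x + hk k) - f x - \sum_(i < m | (i < k)%N) c i * h 0 i| <= k%:R * e * `|h|.
  have := S m (leqnn m).
  have -> : hk m = h by apply/rowP=> i; rewrite mxE ltn_ord.
  by rewrite (eq_bigl xpredT) // => i; rewrite ltn_ord.
elim: k => [|k IH] km.
  have -> : hk 0%N = 0 by apply/rowP=> i; rewrite !mxE.
  by rewrite addr0 subrr big_pred0 // subr0 normr0 !mul0r.
pose K := Ordinal km.
have E : hk k.+1 = hk k + h 0 K *: delta_mx 0 K.
  apply/rowP=> i; rewrite !mxE ltnS leq_eqVlt eqxx /=.
  have [->|iK] := eqVneq i K; first by rewrite eqxx ltnn add0r mulr1.
  by rewrite mulr0 addr0 (negbTE (_ : (i : nat) != k)) //; apply: contra iK => /eqP e'; apply/eqP/val_inj.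
have hkh t : `|t| <= `|h 0 K| -> `|hk k + t *: delta_mx 0 K| <= `|h|.
  move=> tK; apply: row_norm_le => // i; rewrite !mxE eqxx /=.
  have [->|iK] := eqVneq i K.
    by rewrite ltnn add0r mulr1 (le_trans tK) // row_coord_le.
  rewrite mulr0 addr0; case: ifP => _; first exact: row_coord_le.
  by rewrite normr0.
rewrite (bigD1 K) //= (eq_bigl (fun i : 'I_m => (i < k)%N)); last first.
  move=> i; rewrite ltnS leq_eqVlt andb_orl -(inj_eq val_inj) /=.
  case: eqP => //= [->|]; first by rewrite ltnn.
  by rewrite andbT.
have B : `|f (x + hk k.+1) - f (x + hk k) - c K * h 0 K| <= e * `|h|.
  rewrite E addrA -[X in _ - f X - _]addr0 -[X in _ - f (_ + X)](scale0r (delta_mx 0 K)).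
  apply: (le_trans (@mvt_bound (fun t => f (x + hk k + t *: delta_mx 0 K)) (c K) e _ _)).
    move=> t tK; have yx : `|x + hk k + t *: delta_mx 0 K - x| <= `|h|.
      have -> : x + hk k + t *: delta_mx 0 K - x = hk k + t *: delta_mx 0 K.
        by rewrite -[x + _ + _]addrA [LHS]addrC addKr.
      exact: hkh.
    have [dt de] := H _ yx K.
    exists ('D_(delta_mx 0 K) f (x + hk k + t *: delta_mx 0 K)); last exact: de.
    exact: (@is_derive_line _ _ f (x + hk k) (delta_mx 0 K) t dt).
  rewrite ler_wpM2l ?row_coord_le //.
  have xx : `|x - x| <= `|h| by rewrite subrr normr0.
  by have [_] := H x xx K; exact: le_trans.
have -> : f (x + hk k.+1) - f x - (c K * h 0 K + \sum_(i < m | (i < k)%N) c i * h 0 i)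
  = (f (x + hk k.+1) - f (x + hk k) - c K * h 0 K) +
    (f (x + hk k) - f x - \sum_(i < m | (i < k)%N) c i * h 0 i) by ring.
apply: (le_trans (ler_normD _ _)).
by rewrite -natr1 mulrDl mul1r mulrDl addrC lerD // IH // ltnW.
Qed.

Lemma cvg_sumr (T : Type) (F : set_system T) {FF : Filter F} (V : normedModType R) (I : Type) (r : seq I)
  (P : pred I) (f : I -> T -> V) (l : I -> V) :
  (forall i, P i -> f i @ F --> l i) ->
  (fun x => \sum_(i <- r | P i) f i x) @ F --> \sum_(i <- r | P i) l i.
Proof. by move=> H; apply: cvg_big => // ; exact: add_continuous. Qed.

Lemma continuous_sumr (T : topologicalType) (V : normedModType R) (I : Type) (r : seq I)
  (P : pred I) (f : I -> T -> V) (x : T) :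
  (forall i, P i -> {for x, continuous (f i)}) ->
  {for x, continuous (fun x => \sum_(i <- r | P i) f i x)}.
Proof. by move=> H; apply: cvg_sumr => // ; exact: add_continuous. Qed.

Section PointwiseContinuity.
Variables (T : topologicalType) (x : T) (f g : T -> R).
Hypotheses (cf : {for x, continuous f}) (cg : {for x, continuous g}).
Lemma continuousDp : {for x, continuous (fun y => f y + g y)}.
Proof. exact: cvgD. Qed.
Lemma continuousMp : {for x, continuous (fun y => f y * g y)}.
Proof. exact: cvgM. Qed.
Lemma continuousNp : {for x, continuous (fun y => - f y)}.
Proof. exact: cvgN. Qed.
Lemma continuousVp : f x != 0 -> {for x, continuous (fun y => (f y)^-1)}.
Proof. by move=> f0; exact: cvgV. Qed.
End PointwiseContinuity.

Lemma continuous_cstp (T : topologicalType) (x : T) (a : R) :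
  {for x, continuous (fun _ : T => a)}.
Proof. exact: cvg_cst. Qed.

(** Near [x] the partial derivatives differ little from those at [x]; [row_mvt], with the latter as
    slopes, then bounds the remainder by a small multiple of the norm of [h]. *)
Lemma C1_differentiable m (V : set 'rV[R]_m) f x :
  open V -> V x -> Ck_on 1 V f -> differentiable f x.
Proof.
move=> oV Vx [_ H].
pose L := (fun h : 'rV[R]_m => \sum_i ('D_(delta_mx 0 i) f x) * h 0 i).
have Llin : linear L.
  move=> a u v; rewrite /L scaler_sumr -big_split /=; apply: eq_bigr => i _.
  by rewrite !mxE mulrDr mulrCA.
pose L' : {linear 'rV[R]_m -> R} := HB.pack L (GRing.isLinear.Build _ _ _ _ L Llin).
have Lc : continuous L'.
  rewrite -[GRing.Linear.sort L']/L => z; apply: continuous_sumr => i _.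
  by apply: continuousMp; [exact: continuous_cstp|exact: coord_continuous].
have near0 (e : R) : 0 < e -> \forall h \near (0 : 'rV[R]_m),
    `|f (x + h) - f x - L h| <= e * `|h|.
  move=> e0.
  (* Division by [m.+1] rather than [m] stays meaningful for [m = 0], and the [m] errors still add
     up to at most [e]. *)
  have e0' : 0 < e / m.+1%:R by rewrite divr_gt0.
  have Hi (i : 'I_m) : \forall y \near x, V y /\
      `|'D_(delta_mx 0 i) f y - 'D_(delta_mx 0 i) f x| <= e / m.+1%:R.
    apply: filterI; first exact: open_nbhs_nbhs.
    case: (H i) => _ [Dc _].
    have /cvgrPdist_le/(_ _ e0') := Dc x (mem_set Vx).
    by apply: filterS => y; rewrite distrC.
  have := filter_forall (nbhs_filter x) Hi.
  move=> /nbhs_ballP[r r0 Hr]; apply/nbhs_ballP; exists r => // h.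
  rewrite -ball_normE /= sub0r normrN => hr.
  have := @row_mvt m f x h (fun i => 'D_(delta_mx 0 i) f x) (e / m.+1%:R) _.
  move=> /(_ _)/le_trans; apply.
    move=> y yx i; case: (Hr y _ i).
      by rewrite -ball_normE /= distrC (le_lt_trans yx).
    by move=> Vy ?; split=> //; apply: (H i).1.
  rewrite ler_wpM2r // mulrCA ler_piMr ?ltW //.
  by rewrite ltr_pdivrMr // mul1r ltr_nat.
have := @diff_unique _ _ _ f L' x Lc.
match goal with |- (?P -> _) -> _ => have D0 : P end.
  apply/eqaddoP => e e0; near=> h; rewrite !fctE /=.
  have -> : f (h + x) - (f x + L h) = f (x + h) - f x - L h by rewrite opprD addrA [h + x]addrC.
  by near: h; exact: near0.
by move=> /(_ D0) DE; apply/diff_locallyP; rewrite DE.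
Unshelve. all: by end_near. Qed.

(** Reduces a derivative along a vector to one real variable, where having a derivative and being
    differentiable are the same thing, so that the chain rule for differentials applies. *)
Lemma is_derive_lineP (V W : normedModType R) (f : V -> W) (x v : V) d :
  is_derive x v f d <-> is_derive (0 : R) (1 : R) (fun h => f (h *: v + x)) d.
Proof.
have E : (fun h : R => h^-1 *: (((fun h => f (h *: v + x)) \o shift 0) (h *: 1) -
    f (0 *: v + x))) =
  (fun h => h^-1 *: ((f \o shift x) (h *: v) - f x)).
  apply/funext=> h /=; congr (_ *: (f _ - f _)); last by rewrite scale0r add0r.
  by rewrite addr0 [h *: 1]mulr1.
by split=> -[+ <-]; rewrite /derivable /derive ?E => D; split=> //;
   rewrite /derivable /derive ?E.
Qed.

Lemma diff_row l (f : 'rV[R]_l -> R) y w : differentiable f y ->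
  'd f y w = \sum_j w 0 j * 'D_(delta_mx 0 j) f y.
Proof.
move=> df; rewrite {1}(row_sum_delta w) linear_sum; apply: eq_bigr => j _.
by rewrite linearZ /= deriveE.
Qed.

Lemma is_derive_chain (U : normedModType R) l (g : U -> 'rV[R]_l) (f : 'rV[R]_l -> R) x v :
  derivable g x v -> differentiable f (g x) ->
  is_derive x v (fun z => f (g z)) (\sum_j ('D_v g x) 0 j * 'D_(delta_mx 0 j) f (g x)).
Proof.
move=> dg df; apply/is_derive_lineP.
have /is_derive_lineP D : is_derive x v g ('D_v g x) by [].
have d1 : differentiable (fun h : R => g (h *: v + x)) 0.
  by apply/derivable1_diffP; case: D.
have df' : differentiable f ((fun h : R => g (h *: v + x)) 0).
  by rewrite scale0r add0r.
have d2 := differentiable_comp d1 df'.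
have d3 : derivable (f \o (fun h : R => g (h *: v + x))) 0 1 by exact: diff_derivable.
have dv : 'd (fun h : R => g (h *: v + x)) 0 1 = 'D_v g x.
  by rewrite -deriveE //; case: D.
split; first exact: d3.
by rewrite deriveE // diff_comp // /comp dv scale0r add0r diff_row.
Qed.

Lemma continuous_rowp (T : topologicalType) l (g : T -> 'rV[R]_l) (x : T) :
  (forall j, {for x, continuous (fun z => g z 0 j)}) -> {for x, continuous g}.
Proof.
move=> H; apply/cvgrPdist_le => e e0.
have Hj (j : 'I_l) : \forall t \near x, `|g x 0 j - g t 0 j| <= e.
  by have /cvgrPdist_le/(_ _ e0) := H j.
have := filter_forall (nbhs_filter x) Hj.
apply: filterS => t Ht; apply: row_norm_le; first exact: ltW.
by move=> i; rewrite !mxE; exact: Ht.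
Qed.

Section CkOn.
Variable m : nat.
Implicit Types (V : set 'rV[R]_m) (f g : 'rV[R]_m -> R).

Lemma CkS_cont k V f : Ck_on k V f -> {in V, continuous f}.
Proof. by case: k => [|k] []. Qed.

Lemma Ck_cont k V f x : Ck_on k V f -> V x -> {for x, continuous f}.
Proof. by move=> /CkS_cont H Vx; exact: (H x (mem_set Vx)). Qed.

Lemma Ck_derive k V f i : Ck_on k.+1 V f -> Ck_on k V ('D_(delta_mx 0 i) f).
Proof. by case=> _ /(_ i) []. Qed.

Lemma Ck_derivable k V f i x : Ck_on k.+1 V f -> V x ->
  is_derive x (delta_mx 0 i) f ('D_(delta_mx 0 i) f x).
Proof. by case=> _ /(_ i) [H _] Vx; split=> //; exact: H. Qed.

Lemma Ck_pred k V f : Ck_on k.+1 V f -> Ck_on k V f.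
Proof.
elim: k f => [|k IH] f [cf H]; first by split.
by split=> // i; case: (H i) => H1 H2; split=> //; apply: IH.
Qed.

Lemma Ck_le k l V f : (k <= l)%N -> Ck_on l V f -> Ck_on k V f.
Proof.
move=> kl; rewrite -(subnKC kl) addnC; elim: (l - k)%N => [|d IH] //.
by rewrite addSn => /Ck_pred.
Qed.

Lemma Ck_sub k V W f : W `<=` V -> Ck_on k V f -> Ck_on k W f.
Proof.
move=> WV; elim: k f => [|k IH] f [cf H].
  by split=> // x /set_mem /WV /mem_set /cf.
split=> [x /set_mem /WV /mem_set /cf //|i]; case: (H i) => H1 H2.
by split=> [x /WV|]; [exact: H1|exact: IH].
Qed.

Lemma near_open V (P : 'rV[R]_m -> Prop) x : open V -> V x ->
  (forall y, V y -> P y) -> \near x, P x.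
Proof. by move=> oV Vx H; apply: filterS H _; exact: open_nbhs_nbhs. Qed.

Lemma eq_is_derive (U W : normedModType R) (V : set U) (f g : U -> W) x v d : open V -> V x ->
  (forall y, V y -> f y = g y) -> is_derive x v f d -> is_derive x v g d.
Proof.
move=> oV Vx fg [D <-].
have E : \near x, f x = g x by apply: filterS fg _; exact: open_nbhs_nbhs.
split; first exact: near_eq_derivable D.
by apply/esym; exact: near_eq_derive.
Qed.

Lemma eq_continuous_at (T : topologicalType) (V : set T) (f g : T -> R) x : open V -> V x ->
  (forall y, V y -> f y = g y) -> {for x, continuous f} -> {for x, continuous g}.
Proof.
move=> oV Vx fg cf; rewrite /prop_for /continuous_at -(fg _ Vx).
apply: cvg_trans cf; apply: near_eq_cvg.
by apply: filterS fg _; exact: open_nbhs_nbhs.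
Qed.

Lemma Ck_eq k V f g : open V -> (forall x, V x -> f x = g x) -> Ck_on k V f -> Ck_on k V g.
Proof.
move=> oV; elim: k f g => [|k IH] f g E H.
  by split=> // x /set_mem Vx; exact: (eq_continuous_at oV Vx E (Ck_cont H Vx)).
split=> [x /set_mem Vx|i]; first exact: (eq_continuous_at oV Vx E (Ck_cont H Vx)).
have D x : V x -> is_derive x (delta_mx 0 i) g ('D_(delta_mx 0 i) f x).
  by move=> Vx; exact: (eq_is_derive oV Vx E (Ck_derivable i H Vx)).
split=> [x /D [] //|].
by apply: IH (Ck_derive i H) => x /D [_ ->].
Qed.

(** [Ck_on] speaks of ['D f] itself. Here any function that is a derivative of [f] on [V] will do,
    which suits derivatives computed by rules valid on [V] only. *)
Lemma Ck_intro k V f : open V -> {in V, continuous f} ->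
  (forall i, exists2 df, (forall x, V x -> is_derive x (delta_mx 0 i) f (df x)) &
     Ck_on k V df) -> Ck_on k.+1 V f.
Proof.
move=> oV cf H; split=> // i; case: (H i) => df dfE dfC; split.
  by move=> x /dfE [].
by apply: Ck_eq dfC => // x /dfE [_ ->].
Qed.

Lemma Ck_cst k V a : open V -> Ck_on k V (fun _ => a).
Proof.
move=> oV; elim: k a => [|k IH] a.
  by split=> // x _; exact: continuous_cstp.
apply: Ck_intro => // [x _|i]; first exact: continuous_cstp.
by exists (fun=> 0) => [x _|]; [exact: is_derive_cst|exact: IH].
Qed.

Lemma Ck_coord k V i : open V -> Ck_on k V (fun x : 'rV[R]_m => x 0 i).
Proof.
move=> oV; have c V' : {in V', continuous (fun x : 'rV[R]_m => x 0 i)}.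
  by move=> x _; exact: coord_continuous.
case: k => [|k]; first by split.
apply: Ck_intro => // j; exists (fun=> (delta_mx 0 j : 'rV[R]_m) 0 i); last exact: Ck_cst.
move=> x Vx.
have [D E] := is_derive_id x (delta_mx 0 j : 'rV[R]_m).
have D' := (derivable_mxP _ _ _).1 D 0 i.
split=> //; have := derive_mx D; rewrite E => /(congr1 (fun M : 'rV[R]_m => M 0 i)).
by rewrite [in RHS]mxE => <-.
Qed.

Lemma Ck_add k V f g : open V -> Ck_on k V f -> Ck_on k V g ->
  Ck_on k V (fun x => f x + g x).
Proof.
move=> oV; elim: k f g => [|k IH] f g Cf Cg.
  by split=> // x /set_mem Vx; apply: continuousDp; [exact: Ck_cont Cf Vx|exact: Ck_cont Cg Vx].
apply: Ck_intro => // [x /set_mem Vx|i].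
  by apply: continuousDp; [exact: Ck_cont Cf Vx|exact: Ck_cont Cg Vx].
exists (fun x => 'D_(delta_mx 0 i) f x + 'D_(delta_mx 0 i) g x).
  move=> x Vx; have Df := Ck_derivable i Cf Vx; have Dg := Ck_derivable i Cg Vx.
  exact: is_deriveD.
by apply: IH; exact: Ck_derive.
Qed.

Lemma Ck_mul k V f g : open V -> Ck_on k V f -> Ck_on k V g ->
  Ck_on k V (fun x => f x * g x).
Proof.
move=> oV; elim: k f g => [|k IH] f g Cf Cg.
  by split=> // x /set_mem Vx; apply: continuousMp; [exact: Ck_cont Cf Vx|exact: Ck_cont Cg Vx].
apply: Ck_intro => // [x /set_mem Vx|i].
  by apply: continuousMp; [exact: Ck_cont Cf Vx|exact: Ck_cont Cg Vx].
exists (fun x => f x * 'D_(delta_mx 0 i) g x + g x * 'D_(delta_mx 0 i) f x).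
  move=> x Vx; have Df := Ck_derivable i Cf Vx; have Dg := Ck_derivable i Cg Vx.
  exact: is_deriveM.
apply: Ck_add => //; apply: IH; by [exact: Ck_pred|exact: Ck_derive].
Qed.

Lemma Ck_opp k V f : open V -> Ck_on k V f -> Ck_on k V (fun x => - f x).
Proof.
move=> oV Cf; apply: (@Ck_eq _ _ (fun x => (-1) * f x)) => // [x _|].
  by rewrite mulN1r.
by apply: Ck_mul => //; exact: Ck_cst.
Qed.

Lemma Ck_sum k V (I : Type) (r : seq I) (P : pred I) (f : I -> 'rV[R]_m -> R) : open V ->
  (forall i, P i -> Ck_on k V (f i)) -> Ck_on k V (fun x => \sum_(i <- r | P i) f i x).
Proof.
move=> oV H; elim: r => [|i r IH].
  by apply: Ck_eq (Ck_cst k 0 oV) => // x _; rewrite big_nil.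
have [Pi|nPi] := boolP (P i).
  apply: Ck_eq (Ck_add oV (H _ Pi) IH) => // x _.
  by rewrite big_cons Pi.
by apply: Ck_eq IH => // x _; rewrite big_cons (negbTE nPi).
Qed.

Lemma Ck_inv k V f : open V -> (forall x, V x -> f x != 0) -> Ck_on k V f ->
  Ck_on k V (fun x => (f x)^-1).
Proof.
move=> oV f0; elim: k f f0 => [|k IH] f f0 Cf.
  by split=> // x /set_mem Vx; apply: continuousVp; [exact: Ck_cont Cf Vx|exact: f0].
apply: Ck_intro => // [x /set_mem Vx|i].
  by apply: continuousVp; [exact: Ck_cont Cf Vx|exact: f0].
exists (fun x => - ((f x)^-1 * (f x)^-1) * 'D_(delta_mx 0 i) f x).
  move=> x Vx; have Df := Ck_derivable i Cf Vx.
  have -> : - ((f x)^-1 * (f x)^-1) * 'D_(delta_mx 0 i) f x =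
     - (f x) ^- 2 *: 'D_(delta_mx 0 i) f x.
    by rewrite -invfM -expr2.
  apply: DeriveDef; first by apply: derivableV => //; exact: f0.
  by rewrite deriveV //; exact: f0.
have C := IH _ f0 (Ck_pred Cf).
by do !apply: Ck_mul => //; [apply: Ck_opp => //; exact: Ck_mul|exact: Ck_derive].
Qed.

End CkOn.

(** The induction leaves [f] free and [g] fixed: the partial derivatives of the composite are sums
    of products of those of [g] with composites of the partial derivatives of [f] with the same
    [g]. *)
Lemma Ck_comp m l k (V : set 'rV[R]_m) (W : set 'rV[R]_l) (f : 'rV[R]_l -> R)
    (g : 'rV[R]_m -> 'rV[R]_l) : open V -> open W -> (forall x, V x -> W (g x)) ->
  (forall j, Ck_on k V (fun x => g x 0 j)) -> Ck_on k W f ->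
  Ck_on k V (fun x => f (g x)).
Proof.
move=> oV oW VW Cg Cf.
have cg x : V x -> {for x, continuous g}.
  by move=> Vx; apply: continuous_rowp => j; exact: Ck_cont (Cg j) Vx.
have cfg (h : 'rV[R]_l -> R) k' : Ck_on k' W h -> {in V, continuous (fun x => h (g x))}.
  move=> Ch x /set_mem Vx; apply: continuous_comp; first exact: cg.
  by apply: Ck_cont Ch _; exact: VW.
elim: k f Cg Cf => [|k IH] f Cg Cf; first by split=> //; exact: cfg Cf.
apply: Ck_intro => // [|i]; first exact: cfg Cf.
exists (fun x => \sum_j 'D_(delta_mx 0 i) (fun x => g x 0 j) x * 'D_(delta_mx 0 j) f (g x)).
  move=> x Vx.
  have dg : derivable g x (delta_mx 0 i).
    by apply/derivable_mxP => a j; rewrite (ord1 a); case: (Ck_derivable i (Cg j) Vx).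
  have df : differentiable f (g x).
    by apply: (C1_differentiable oW (VW _ Vx)); apply: Ck_le Cf.
  have := is_derive_chain dg df; rewrite derive_mx //.
  by under eq_bigr do rewrite mxE.
apply: Ck_sum => // j _; apply: Ck_mul => //; first exact: Ck_derive (Cg j).
exact: (IH ('D_(delta_mx 0 j) f) (fun j' => Ck_pred (Cg j')) (Ck_derive j Cf)).
Qed.

Lemma derive_chain m l (V : set 'rV[R]_m) (W : set 'rV[R]_l) (f : 'rV[R]_l -> R)
    (g : 'rV[R]_m -> 'rV[R]_l) i x : open V -> open W -> V x -> W (g x) ->
  (forall j, Ck_on 1 V (fun x => g x 0 j)) -> Ck_on 1 W f ->
  'D_(delta_mx 0 i) (fun x => f (g x)) x =
  \sum_j 'D_(delta_mx 0 i) (fun x => g x 0 j) x * 'D_(delta_mx 0 j) f (g x).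
Proof.
move=> oV oW Vx Wgx Cg Cf.
have dg : derivable g x (delta_mx 0 i).
  by apply/derivable_mxP => a j; rewrite (ord1 a); case: (Ck_derivable i (Cg j) Vx).
have [_ ->] := is_derive_chain dg (C1_differentiable oW Wgx Cf).
by rewrite derive_mx //; under eq_bigr do rewrite mxE.
Qed.

Lemma continuous_dist (T : topologicalType) (f : T -> R) x e : 0 < e ->
  {for x, continuous f} -> \forall y \near x, `|f y - f x| <= e.
Proof.
move=> e0 /cvgrPdist_le/(_ _ e0); apply: filterS => y.
by rewrite distrC.
Qed.

(** [u - v - w + z] stands for the second difference over a square of side [h]; [a] and [b] are the
    two candidates for the mixed derivative. *)
Lemma second_difference_bound (u v w z a b h e : R) :
  `|u - v - w + z - a * h * h| <= e / 2 * h * h ->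
  `|u - w - v + z - b * h * h| <= e / 2 * h * h ->
  `|(b - a) * (h * h)| <= e * (h * h).
Proof.
rewrite !ler_norml => /andP[? ?] /andP[? ?].
by apply/andP; split; lra.
Qed.

Section Schwarz.
Variable m : nat.
Local Notation e_ i := (delta_mx 0 i : 'rV[R]_m).

(** Both mixed derivatives are approximated by one and the same second difference over a small
    square, expanded first in one direction or first in the other. *)
Lemma schwarz (V : set 'rV[R]_m) (f : 'rV[R]_m -> R) x i j :
  open V -> V x -> Ck_on 2 V f ->
  'D_(delta_mx 0 i) ('D_(delta_mx 0 j) f) x = 'D_(delta_mx 0 j) ('D_(delta_mx 0 i) f) x.
Proof.
move=> oV Vx Cf.
have ball_in y h k (a b : 'I_m) (r : R) : `|h| < r / 2 -> `|k| < r / 2 ->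
    y = x + h *: (e_ a) + k *: (e_ b) -> `|y - x| < r.
  move=> hr kr ->; have -> : x + h *: (e_ a) + k *: (e_ b) - x = h *: (e_ a) + k *: (e_ b).
    by rewrite -[x + _ + _]addrA [LHS]addrC addKr.
  rewrite (splitr r) (le_lt_trans (ler_normD _ _)) // ltrD // normrZ.
    by rewrite (le_lt_trans _ hr) // ler_piMr // norm_delta_le.
  by rewrite (le_lt_trans _ kr) // ler_piMr // norm_delta_le.
have key e (a b : 'I_m) : 0 < e -> exists2 r, 0 < r & forall h k, `|h| < r -> `|k| < r ->
    `|f (x + h *: (e_ a) + k *: (e_ b)) - f (x + h *: (e_ a)) - f (x + k *: (e_ b)) + f x
      - 'D_(e_ b) ('D_(e_ a) f) x * k * h| <= e * `|k| * `|h|.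
  move=> e0.
  have : \forall y \near x, V y /\
     `|'D_(e_ b) ('D_(e_ a) f) y - 'D_(e_ b) ('D_(e_ a) f) x| <= e.
    apply: filterI; first exact: open_nbhs_nbhs.
    exact: (continuous_dist e0 (Ck_cont (Ck_derive b (Ck_derive a Cf)) Vx)).
  move=> /nbhs_ballP[r /= r0 Hr]; exists (r / 2); first by rewrite divr_gt0.
  have {}Hr y : `|y - x| < r -> V y /\
     `|'D_(e_ b) ('D_(e_ a) f) y - 'D_(e_ b) ('D_(e_ a) f) x| <= e.
    by move=> yx; apply: Hr; rewrite -ball_normE /= distrC.
  move=> h k hr kr.
  (* The mean value bound is used twice: for the difference [g] in direction [a], and, at each
     intermediate [t], for the partial derivative [p] in direction [b]. *)
  pose g t := f (x + k *: (e_ b) + t *: (e_ a)) - f (x + t *: (e_ a)).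
  have := @mvt_bound g ('D_(e_ b) ('D_(e_ a) f) x * k) (e * `|k|) h.
  have -> : g h - g 0 = f (x + h *: (e_ a) + k *: (e_ b)) - f (x + h *: (e_ a)) - f (x + k *: (e_ b)) + f x.
    rewrite /g scale0r !addr0 opprB [x + k *: _ + _]addrAC; ring.
  apply => t th.
  have tr := le_lt_trans th hr.
  have V1 : V (x + t *: (e_ a)).
    apply: (Hr _ _).1; apply: (@ball_in _ t 0 a b) => //.
      by rewrite normr0 divr_gt0.
    by rewrite scale0r addr0.
  have V2 : V (x + k *: (e_ b) + t *: (e_ a)).
    apply: (Hr _ _).1; apply: (@ball_in _ t k a b) => //.
    by rewrite addrAC.
  exists ('D_(e_ a) f (x + k *: (e_ b) + t *: (e_ a)) - 'D_(e_ a) f (x + t *: (e_ a))).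
    have D1 : is_derive t (1 : R) (fun t => f (x + k *: (e_ b) + t *: (e_ a))) ('D_(e_ a) f (x + k *: (e_ b) + t *: (e_ a))).
      by apply: is_derive_line; case: (Ck_derivable a Cf V2).
    have D2 : is_derive t (1 : R) (fun t => f (x + t *: (e_ a))) ('D_(e_ a) f (x + t *: (e_ a))).
      by apply: is_derive_line; case: (Ck_derivable a Cf V1).
    exact: is_deriveB.
  pose p s := 'D_(e_ a) f (x + t *: (e_ a) + s *: (e_ b)).
  have := @mvt_bound p ('D_(e_ b) ('D_(e_ a) f) x) e k.
  have -> : p k - p 0 = 'D_(e_ a) f (x + k *: (e_ b) + t *: (e_ a)) - 'D_(e_ a) f (x + t *: (e_ a)).
    by rewrite /p scale0r addr0 addrAC.
  apply => s sk; have sr := le_lt_trans sk kr.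
  have [V3 B3] := Hr _ (@ball_in _ t s a b r tr sr erefl).
  exists ('D_(e_ b) ('D_(e_ a) f) (x + t *: (e_ a) + s *: (e_ b))); last exact: B3.
  by apply: is_derive_line; case: (Ck_derivable b (Ck_derive a Cf) V3).
apply/eqP; rewrite -subr_eq0 -normr_le0; apply/ler_addgt0Pr => e e0; rewrite add0r.
have e2 : 0 < e / 2 by rewrite divr_gt0.
have [r1 r10 H1] := key _ j i e2; have [r2 r20 H2] := key _ i j e2.
pose h := Num.min r1 r2 / 2.
have h0 : 0 < h by rewrite divr_gt0 // lt_min r10.
have hm : `|h| < Num.min r1 r2.
  by rewrite gtr0_norm // /h gtr_pMr ?invf_lt1 ?ltr1n // lt_min r10.
have h1 : `|h| < r1 by rewrite (lt_le_trans hm) // ge_min lexx.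
have h2 : `|h| < r2 by rewrite (lt_le_trans hm) // ge_min lexx orbT.
have := H1 h h h1 h1; have := H2 h h h2 h2.
rewrite [x + h *: (e_ j) + h *: (e_ i)]addrAC.
rewrite (gtr0_norm h0) => A B.
have hh : 0 < h * h by rewrite mulr_gt0.
rewrite -(ler_pM2r hh) -[X in _ * X <= _](gtr0_norm hh) -normrM.
exact: (second_difference_bound A B).
Qed.

End Schwarz.

End Calculus.
(** * Functions and vector fields on a manifold *)

Section ComplexParts.
Context {R : realType}.
Local Notation C := R[i].
Implicit Types x y : C.

Lemma ReD x y : complex.Re (x + y) = complex.Re x + complex.Re y.
Proof. by case: x; case: y. Qed.
Lemma ImD x y : complex.Im (x + y) = complex.Im x + complex.Im y.
Proof. by case: x; case: y. Qed.
Lemma ReN x : complex.Re (- x) = - complex.Re x.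
Proof. by case: x. Qed.
Lemma ImN x : complex.Im (- x) = - complex.Im x.
Proof. by case: x. Qed.
Lemma ReM x y : complex.Re (x * y) =
  complex.Re x * complex.Re y - complex.Im x * complex.Im y.
Proof. by case: x; case: y. Qed.
Lemma ImM x y : complex.Im (x * y) =
  complex.Re x * complex.Im y + complex.Im x * complex.Re y.
Proof. by case: x; case: y. Qed.
Lemma ReJ x : complex.Re (conjc x) = complex.Re x.
Proof. by case: x. Qed.
Lemma ImJ x : complex.Im (conjc x) = - complex.Im x.
Proof. by case: x. Qed.
Lemma ReC (a : R) : complex.Re a%:C = a. Proof. by []. Qed.
Lemma ImC (a : R) : complex.Im a%:C = 0. Proof. by []. Qed.
Lemma ReV x : complex.Re x^-1 = complex.Re x * (complex.Re x ^+ 2 + complex.Im x ^+ 2)^-1.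
Proof. by case: x. Qed.
Lemma ImV x : complex.Im x^-1 = - (complex.Im x * (complex.Re x ^+ 2 + complex.Im x ^+ 2)^-1).
Proof. by case: x. Qed.
Lemma complex_eqP x y : complex.Re x = complex.Re y -> complex.Im x = complex.Im y -> x = y.
Proof. by case: x; case: y => ? ? ? ? /= -> ->. Qed.
Lemma complex_sqnorm_neq0 x : x != 0 -> complex.Re x ^+ 2 + complex.Im x ^+ 2 != 0.
Proof.
case: x => a b; rewrite eq_complex /= => H.
by rewrite paddr_eq0 ?sqr_ge0 // !sqrf_eq0.
Qed.
Lemma Re_sum (I : Type) (r : seq I) (P : pred I) (f : I -> C) :
  complex.Re (\sum_(i <- r | P i) f i) = \sum_(i <- r | P i) complex.Re (f i).
Proof. by apply: big_morph => [x y|]; rewrite ?ReD. Qed.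
Lemma Im_sum (I : Type) (r : seq I) (P : pred I) (f : I -> C) :
  complex.Im (\sum_(i <- r | P i) f i) = \sum_(i <- r | P i) complex.Im (f i).
Proof. by apply: big_morph => [x y|]; rewrite ?ImD. Qed.
Lemma jacobi_term (a b c d : C) : a - b - (c - d) = a - b - c + d.
Proof. ring. Qed.

Lemma jacobi_sum (a b c d e f : C) :
  (a - b - c + d) + (c - e - f + b) + (f - d - a + e) = 0.
Proof. ring. Qed.
End ComplexParts.

Section ManifoldCalculus.
Context (R : realType) (m : nat) (M : topologicalType).
Context (A : oriented_atlas R m M).
Local Notation C := R[i].
Local Notation e_ i := (delta_mx 0 i : 'rV[R]_m).
Local Notation charts := (charts A).
Local Notation chart_at := (chart_at A).
Implicit Types (U V W : set M) (p q : M) (c : chart R m M).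

Lemma chart_open_dom c : charts c -> open (cdom c).
Proof. by move=> /charts_chart []. Qed.

Lemma cmapK c p : charts c -> cdom c p -> cinv c (cmap c p) = p.
Proof. by move=> /charts_chart [_ _ + _ _]; apply. Qed.

Lemma open_chart_image c U : charts c -> open U -> open (cmap c @` (U `&` cdom c)).
Proof.
move=> cc oU; have [_ oI K _ cinvC] := charts_chart cc.
rewrite openE => _ [p [Up cp] <-]; rewrite /interior.
have Ip : (cmap c @` cdom c) (cmap c p) by exists p.
have ci := cinvC _ (mem_set Ip).
have : \forall x \near cmap c p, U (cinv c x) /\ (cmap c @` cdom c) x.
  apply: filterI; last exact: open_nbhs_nbhs.
  by apply: ci; rewrite K //; exact: open_nbhs_nbhs.
apply: filterS => x [+ [q cq qx]]; rewrite -qx K // => Uq.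
by exists q.
Qed.

(** The order of differentiability is tracked because [bump], and with it the cutoff functions and
    the density, is handled at order 1 only. *)
Definition ckM (k : nat) (U : set M) (f : M -> R) : Prop :=
  forall c, charts c -> Ck_on k (cmap c @` (U `&` cdom c)) (f \o cinv c).

Lemma smoothRP U f : smoothR_on A U f <-> forall k, ckM k U f.
Proof. by split=> [H k c cc|H c cc k]; [exact: H|exact: H]. Qed.

Lemma ckM_sub k U V f : V `<=` U -> ckM k U f -> ckM k V f.
Proof.
move=> VU H c cc; apply: Ck_sub (H c cc).
by apply: image_subset; apply: setSI.
Qed.

Lemma ckM_le k l U f : (k <= l)%N -> ckM l U f -> ckM k U f.
Proof. by move=> kl H c cc; apply: Ck_le kl (H c cc). Qed.

Lemma ckM_eq k U f g : open U -> (forall p, U p -> f p = g p) -> ckM k U f -> ckM k U g.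
Proof.
move=> oU E H c cc; apply: Ck_eq (H c cc); first exact: open_chart_image.
by move=> _ [p [Up cp] <-] /=; rewrite cmapK // E.
Qed.

Lemma ckM_local k U f : (forall c, charts c -> ckM k (U `&` cdom c) f) -> ckM k U f.
Proof.
by move=> H c cc; have := H c cc c cc; rewrite -setIA setIid.
Qed.

Section ClosedUnder.
Variables (k : nat) (U : set M).
Hypothesis oU : open U.
Implicit Types f g : M -> R.

Lemma ckM_cst a : ckM k U (fun=> a).
Proof. by move=> c cc; apply: Ck_cst; exact: open_chart_image. Qed.
Lemma ckM_add f g : ckM k U f -> ckM k U g -> ckM k U (fun p => f p + g p).
Proof. by move=> F G c cc; apply: Ck_add (F c cc) (G c cc); exact: open_chart_image. Qed.
Lemma ckM_mul f g : ckM k U f -> ckM k U g -> ckM k U (fun p => f p * g p).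
Proof. by move=> F G c cc; apply: Ck_mul (F c cc) (G c cc); exact: open_chart_image. Qed.
Lemma ckM_opp f : ckM k U f -> ckM k U (fun p => - f p).
Proof. by move=> F c cc; apply: Ck_opp (F c cc); exact: open_chart_image. Qed.
Lemma ckM_inv f : (forall p, U p -> f p != 0) -> ckM k U f -> ckM k U (fun p => (f p)^-1).
Proof.
move=> f0 F c cc; apply: Ck_inv (F c cc); first exact: open_chart_image.
by move=> _ [p [Up cp] <-] /=; rewrite cmapK // f0.
Qed.
Lemma ckM_sum (I : Type) (r : seq I) (P : pred I) (f : I -> M -> R) :
  (forall i, P i -> ckM k U (f i)) -> ckM k U (fun p => \sum_(i <- r | P i) f i p).
Proof.
move=> F c cc; apply: Ck_sum; first exact: open_chart_image.
by move=> i Pi; exact: F.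
Qed.
End ClosedUnder.

Definition rcoord c i : M -> R := fun p => cmap c p 0 i.

Lemma ckM_rcoord k c i : charts c -> ckM k (cdom c) (rcoord c i).
Proof.
move=> cc c' cc'; have := charts_smooth cc' cc i k.
by rewrite setIC.
Qed.

Definition rpart c (i : 'I_m) (f : M -> R) p : R := 'D_(e_ i) (f \o cinv c) (cmap c p).

Lemma rpart_chart c c' U f i p : charts c -> charts c' -> open U -> U p -> cdom c p ->
  cdom c' p -> ckM 1 U f ->
  rpart c i f p = \sum_j rpart c i (rcoord c' j) p * rpart c' j f p.
Proof.
move=> cc cc' oU Up cp cp' F.
pose V := cmap c @` ((U `&` cdom c') `&` cdom c).
pose W := cmap c' @` (U `&` cdom c').
have oUc : open (U `&` cdom c') by apply: openI => //; exact: chart_open_dom.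
have oV : open V by exact: open_chart_image.
have oW : open W by exact: open_chart_image.
have Vp : V (cmap c p) by exists p.
have -> : rpart c i f p = 'D_(e_ i) (fun x => (f \o cinv c') (cmap c' (cinv c x))) (cmap c p).
  apply: near_eq_derive; apply: near_open oV Vp _ => _ [q [[Uq cq'] cq] <-] /=.
  by rewrite !cmapK.
rewrite (@derive_chain _ _ _ V W (f \o cinv c') (fun x => cmap c' (cinv c x))) //.
- by rewrite cmapK //; apply: eq_bigr => j _; rewrite /rpart.
- by rewrite cmapK //; exists p.
- move=> j; apply: Ck_sub (@ckM_rcoord 1 c' j cc' c cc).
  by apply: image_subset => q [[_ ?] ?].
- exact: F.
Qed.

Lemma rpart_eq c i U f g p : charts c -> open U -> U p -> cdom c p ->
  (forall q, U q -> f q = g q) -> rpart c i f p = rpart c i g p.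
Proof.
move=> cc oU Up cp E; apply: near_eq_derive.
have Vp : (cmap c @` (U `&` cdom c)) (cmap c p) by exists p.
apply: near_open (open_chart_image cc oU) Vp _ => _ [q [Uq cq] <-] /=.
by rewrite cmapK // E.
Qed.

Lemma rpartP c i U f p : charts c -> U p -> cdom c p -> ckM 1 U f ->
  is_derive (cmap c p) (e_ i) (f \o cinv c) (rpart c i f p).
Proof.
by move=> cc Up cp F; apply: (Ck_derivable i (F c cc)); exists p.
Qed.

Lemma rpartD c i U f g p : charts c -> U p -> cdom c p -> ckM 1 U f -> ckM 1 U g ->
  rpart c i (fun q => f q + g q) p = rpart c i f p + rpart c i g p.
Proof.
move=> cc Up cp F G; have [dF _] := rpartP i cc Up cp F; have [dG _] := rpartP i cc Up cp G.
exact: (deriveD dF dG).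
Qed.

Lemma rpartN c i U f p : charts c -> U p -> cdom c p -> ckM 1 U f ->
  rpart c i (fun q => - f q) p = - rpart c i f p.
Proof.
move=> cc Up cp F; have [dF _] := rpartP i cc Up cp F.
exact: (deriveN dF).
Qed.

Lemma rpartM c i U f g p : charts c -> U p -> cdom c p -> ckM 1 U f -> ckM 1 U g ->
  rpart c i (fun q => f q * g q) p = f p * rpart c i g p + g p * rpart c i f p.
Proof.
move=> cc Up cp F G; have [dF _] := rpartP i cc Up cp F; have [dG _] := rpartP i cc Up cp G.
rewrite {1}/rpart (_ : _ \o _ = (f \o cinv c) * (g \o cinv c)) // (deriveM dF dG) /=.
by rewrite cmapK.
Qed.

Lemma rpart_cst c i a p : rpart c i (fun=> a) p = 0.
Proof. by rewrite /rpart (_ : _ \o _ = cst a) // derive_cst. Qed.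

Lemma rpart_rcoord c i j p : charts c -> cdom c p -> rpart c i (rcoord c j) p = (i == j)%:R.
Proof.
move=> cc cp; have -> : rpart c i (rcoord c j) p = 'D_(e_ i) (fun x : 'rV[R]_m => x 0 j) (cmap c p).
  have Vp : (cmap c @` (setT `&` cdom c)) (cmap c p) by exists p.
  apply: near_eq_derive; apply: near_open (open_chart_image cc openT) Vp _ => _ [q [_ cq] <-] /=.
  by rewrite /rcoord cmapK.
have [_ E] := is_derive_id (cmap c p) (e_ i).
have [D _] := is_derive_id (cmap c p) (e_ i).
have := derive_mx D; rewrite E => /(congr1 (fun M : 'rV[R]_m => M 0 j)).
by rewrite [in RHS]mxE mxE eqxx /= eq_sym => ->.
Qed.

Lemma ckM_rpart k c i U f : charts c -> open U -> ckM k.+1 U f ->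
  ckM k (U `&` cdom c) (rpart c i f).
Proof.
move=> cc oU F c' cc'.
have oUc : open (U `&` cdom c) by apply: openI => //; exact: chart_open_dom.
apply: (@Ck_comp _ _ _ _ _ (cmap c @` (U `&` cdom c)) ('D_(e_ i) (f \o cinv c))
  (fun x => cmap c (cinv c' x))).
- exact: open_chart_image.
- exact: open_chart_image.
- by move=> _ [q [[Uq cq] cq'] <-]; rewrite cmapK //; exists q.
- move=> j; apply: Ck_sub (@ckM_rcoord k c j cc c' cc').
  by apply: image_subset => q [[_ ?] ?].
- exact: Ck_derive (F c cc).
Qed.

Definition ckC k U (f : M -> C) : Prop :=
  ckM k U (fun p => complex.Re (f p)) /\ ckM k U (fun p => complex.Im (f p)).

Lemma smoothP U f : smooth_on A U f <-> forall k, ckC k U f.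
Proof.
split=> [[/smoothRP H1 /smoothRP H2] k|H]; first by split.
by split; apply/smoothRP => k; case: (H k).
Qed.

Lemma smooth_ckC k U f : smooth_on A U f -> ckC k U f.
Proof. by move=> /smoothP. Qed.

Lemma ckC_sub k U V f : V `<=` U -> ckC k U f -> ckC k V f.
Proof. by move=> VU [? ?]; split; exact: ckM_sub VU _. Qed.

Lemma ckC_le k l U f : (k <= l)%N -> ckC l U f -> ckC k U f.
Proof. by move=> kl [? ?]; split; exact: ckM_le kl _. Qed.

Lemma ckC_eq k U f g : open U -> (forall p, U p -> f p = g p) -> ckC k U f -> ckC k U g.
Proof.
move=> oU E [F1 F2]; split.
  by apply: (ckM_eq oU _ F1) => p Up; rewrite E.
by apply: (ckM_eq oU _ F2) => p Up; rewrite E.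
Qed.

Lemma ckC_local k U f : (forall c, charts c -> ckC k (U `&` cdom c) f) -> ckC k U f.
Proof. by move=> H; split; apply: ckM_local => c /H []. Qed.

Section ComplexClosed.
Variables (k : nat) (U : set M).
Hypothesis oU : open U.
Implicit Types f g : M -> C.

Lemma ckC_cst a : ckC k U (fun=> a).
Proof. by split; exact: ckM_cst. Qed.
Lemma ckC_add f g : ckC k U f -> ckC k U g -> ckC k U (fun p => f p + g p).
Proof.
move=> [f1 f2] [g1 g2]; split.
  by apply: ckM_eq oU _ (ckM_add oU f1 g1) => p _; rewrite ReD.
by apply: ckM_eq oU _ (ckM_add oU f2 g2) => p _; rewrite ImD.
Qed.
Lemma ckC_opp f : ckC k U f -> ckC k U (fun p => - f p).
Proof.
move=> [f1 f2]; split.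
  by apply: ckM_eq oU _ (ckM_opp oU f1) => p _; rewrite ReN.
by apply: ckM_eq oU _ (ckM_opp oU f2) => p _; rewrite ImN.
Qed.
Lemma ckC_conj f : ckC k U f -> ckC k U (fun p => conjc (f p)).
Proof.
move=> [f1 f2]; split.
  by apply: ckM_eq oU _ f1 => p _; rewrite ReJ.
by apply: ckM_eq oU _ (ckM_opp oU f2) => p _; rewrite ImJ.
Qed.
Lemma ckC_mul f g : ckC k U f -> ckC k U g -> ckC k U (fun p => f p * g p).
Proof.
move=> [f1 f2] [g1 g2]; split.
  apply: ckM_eq oU _ (ckM_add oU (ckM_mul oU f1 g1) (ckM_opp oU (ckM_mul oU f2 g2))).
  by move=> p _; rewrite ReM.
apply: ckM_eq oU _ (ckM_add oU (ckM_mul oU f1 g2) (ckM_mul oU f2 g1)).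
by move=> p _; rewrite ImM.
Qed.
Lemma ckC_sum (I : Type) (r : seq I) (P : pred I) (f : I -> M -> C) :
  (forall i, P i -> ckC k U (f i)) -> ckC k U (fun p => \sum_(i <- r | P i) f i p).
Proof.
move=> F; split.
  apply: ckM_eq oU _ (@ckM_sum k U oU I r P (fun i p => complex.Re (f i p)) (fun i Pi => (F i Pi).1)) => p _.
  by rewrite Re_sum.
apply: ckM_eq oU _ (@ckM_sum k U oU I r P (fun i p => complex.Im (f i p)) (fun i Pi => (F i Pi).2)) => p _.
by rewrite Im_sum.
Qed.
Lemma ckC_real (f : M -> R) : ckM k U f -> ckC k U (fun p => (f p)%:C).
Proof. by move=> F; split=> //; exact: ckM_cst. Qed.
Lemma ckC_inv f : (forall p, U p -> f p != 0) -> ckC k U f -> ckC k U (fun p => (f p)^-1).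
Proof.
move=> f0 [f1 f2].
have N : ckM k U (fun p => (complex.Re (f p) ^+ 2 + complex.Im (f p) ^+ 2)^-1).
  apply: ckM_inv => // [p Up|]; first exact/complex_sqnorm_neq0/f0.
  by apply: ckM_add => //; under [X in ckM _ _ X]eq_fun do rewrite expr2; exact: ckM_mul.
split.
  by apply: ckM_eq oU _ (ckM_mul oU f1 N) => p _; rewrite ReV.
by apply: ckM_eq oU _ (ckM_opp oU (ckM_mul oU f2 N)) => p _; rewrite ImV.
Qed.
End ComplexClosed.

Definition cpart c i (f : M -> C) p : C :=
  rpart c i (fun q => complex.Re (f q)) p +i* rpart c i (fun q => complex.Im (f q)) p.

Lemma dtanE p v f : dtan A p v f = \sum_i v 0 i * cpart (chart_at p) i f p.
Proof. by []. Qed.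

Section CpartRules.
Variables (c : chart R m M) (i : 'I_m) (U : set M) (p : M).
Hypotheses (cc : charts c) (oU : open U) (Up : U p) (cp : cdom c p).
Implicit Types f g : M -> C.

Lemma cpart_eq f g : (forall q, U q -> f q = g q) -> cpart c i f p = cpart c i g p.
Proof.
by move=> E; congr (_ +i* _); apply: (rpart_eq i cc oU Up cp) => q Uq; rewrite E.
Qed.
Lemma cpartD f g : ckC 1 U f -> ckC 1 U g ->
  cpart c i (fun q => f q + g q) p = cpart c i f p + cpart c i g p.
Proof.
move=> [f1 f2] [g1 g2]; apply: complex_eqP; rewrite ?ReD ?ImD /=.
  by under [X in rpart _ _ X]eq_fun do rewrite ReD; exact: rpartD cc Up cp f1 g1.
by under [X in rpart _ _ X]eq_fun do rewrite ImD; exact: rpartD cc Up cp f2 g2.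
Qed.
Lemma cpartN f : ckC 1 U f -> cpart c i (fun q => - f q) p = - cpart c i f p.
Proof.
move=> [f1 f2]; apply: complex_eqP; rewrite ?ReN ?ImN /=.
  by under [X in rpart _ _ X]eq_fun do rewrite ReN; exact: rpartN cc Up cp f1.
by under [X in rpart _ _ X]eq_fun do rewrite ImN; exact: rpartN cc Up cp f2.
Qed.
Lemma cpart_conj f : ckC 1 U f -> cpart c i (fun q => conjc (f q)) p = conjc (cpart c i f p).
Proof.
move=> [f1 f2]; apply: complex_eqP; rewrite ?ReJ ?ImJ /=.
  by under [X in rpart _ _ X]eq_fun do rewrite ReJ.
by under [X in rpart _ _ X]eq_fun do rewrite ImJ; exact: rpartN cc Up cp f2.
Qed.
Lemma cpartM f g : ckC 1 U f -> ckC 1 U g ->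
  cpart c i (fun q => f q * g q) p = f p * cpart c i g p + g p * cpart c i f p.
Proof.
move=> [f1 f2] [g1 g2]; apply: complex_eqP.
  rewrite ReD !ReM /=; under [X in rpart _ _ X]eq_fun do rewrite ReM.
  rewrite (rpartD i cc Up cp (ckM_mul oU f1 g1) (ckM_opp oU (ckM_mul oU f2 g2))).
  rewrite (rpartN i cc Up cp (ckM_mul oU f2 g2)).
  by rewrite (rpartM i cc Up cp f1 g1) (rpartM i cc Up cp f2 g2); ring.
rewrite ImD !ImM /=; under [X in rpart _ _ X]eq_fun do rewrite ImM.
rewrite (rpartD i cc Up cp (ckM_mul oU f1 g2) (ckM_mul oU f2 g1)).
by rewrite (rpartM i cc Up cp f1 g2) (rpartM i cc Up cp f2 g1); ring.
Qed.
Lemma cpart_cst a : cpart c i (fun=> a) p = 0.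
Proof. by apply: complex_eqP; exact: rpart_cst. Qed.
End CpartRules.

Lemma cpart_ccoord c i j p : charts c -> cdom c p -> cpart c i (ccoord c j) p = (i == j)%:R.
Proof.
move=> cc cp; apply: complex_eqP => /=.
  by rewrite [LHS]rpart_rcoord //; case: eqP.
by rewrite rpart_cst; case: eqP.
Qed.

Lemma ckC_ccoord k c i : charts c -> ckC k (cdom c) (ccoord c i).
Proof.
move=> cc; split; first exact: ckM_rcoord.
by apply: ckM_cst; exact: chart_open_dom.
Qed.

Lemma ckC_cpart k c i U f : charts c -> open U -> ckC k.+1 U f ->
  ckC k (U `&` cdom c) (cpart c i f).
Proof. by move=> cc oU [f1 f2]; split; exact: ckM_rpart. Qed.

Lemma dtan_ccoord_at p v i : dtan A p v (ccoord (chart_at p) i) = v 0 i.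
Proof.
rewrite dtanE (bigD1 i) //= cpart_ccoord; [|exact: chart_at_charts|exact: chart_at_dom].
rewrite eqxx mulr1 big1 ?addr0 // => j ji.
rewrite cpart_ccoord; [|exact: chart_at_charts|exact: chart_at_dom].
by rewrite (negbTE ji) mulr0.
Qed.

Lemma vec_ext p (v w : 'rV[C]_m) : (forall i, dtan A p v (ccoord (chart_at p) i) =
  dtan A p w (ccoord (chart_at p) i)) -> v = w.
Proof. by move=> H; apply/rowP => i; have := H i; rewrite !dtan_ccoord_at. Qed.

(** [dtan] goes through [chart_at p], which varies with [p] without any regularity. Every smoothness
    argument first passes to a fixed chart by this formula. *)
Lemma dtan_chart c U p v f : charts c -> open U -> U p -> cdom c p -> ckC 1 U f ->
  dtan A p v f = \sum_j dtan A p v (ccoord c j) * cpart c j f p.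
Proof.
move=> cc oU Up cp [f1 f2].
have ac := chart_at_charts A p; have ap := chart_at_dom A p.
have E i : cpart (chart_at p) i f p = \sum_j cpart (chart_at p) i (ccoord c j) p * cpart c j f p.
  apply: complex_eqP.
    rewrite Re_sum [LHS](rpart_chart i ac cc oU Up ap cp f1).
    apply: eq_bigr => j _; rewrite ReM /= (rpart_cst (chart_at p)) mul0r subr0.
    by [].
  rewrite Im_sum [LHS](rpart_chart i ac cc oU Up ap cp f2).
  apply: eq_bigr => j _; rewrite ImM /= (rpart_cst (chart_at p)) mul0r addr0.
  by [].
rewrite dtanE; under eq_bigr do rewrite E mulr_sumr.
rewrite exchange_big; apply: eq_bigr => j _.
by rewrite dtanE mulr_suml; apply: eq_bigr => i _; rewrite mulrA.
Qed.

Section DtanRules.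
Variables (U : set M) (p : M).
Hypotheses (oU : open U) (Up : U p).
Implicit Types (v w : 'rV[C]_m) (f g : M -> C).
Let ac := chart_at_charts A p.
Let ap := chart_at_dom A p.

Lemma dtan_eq v f g : (forall q, U q -> f q = g q) -> dtan A p v f = dtan A p v g.
Proof.
by move=> E; rewrite !dtanE; apply: eq_bigr => i _; rewrite (cpart_eq i ac oU Up ap E).
Qed.
Lemma dtanD v f g : ckC 1 U f -> ckC 1 U g ->
  dtan A p v (fun q => f q + g q) = dtan A p v f + dtan A p v g.
Proof.
move=> F G; rewrite !dtanE -big_split; apply: eq_bigr => i _.
by rewrite (cpartD i ac Up ap F G) mulrDr.
Qed.
Lemma dtanN v f : ckC 1 U f -> dtan A p v (fun q => - f q) = - dtan A p v f.
Proof.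
move=> F; rewrite !dtanE -sumrN; apply: eq_bigr => i _.
by rewrite (cpartN i ac Up ap F) mulrN.
Qed.
Lemma dtanB v f g : ckC 1 U f -> ckC 1 U g ->
  dtan A p v (fun q => f q - g q) = dtan A p v f - dtan A p v g.
Proof. by move=> F G; rewrite dtanD ?dtanN //; exact: ckC_opp. Qed.
Lemma dtanM v f g : ckC 1 U f -> ckC 1 U g ->
  dtan A p v (fun q => f q * g q) = f p * dtan A p v g + g p * dtan A p v f.
Proof.
move=> F G; rewrite !dtanE !mulr_sumr -big_split; apply: eq_bigr => i _.
by rewrite (cpartM i ac oU Up ap F G) mulrDr !(mulrCA (v 0 i)).
Qed.
Lemma dtan_conj v f : ckC 1 U f ->
  dtan A p (conjv v) (fun q => conjc (f q)) = conjc (dtan A p v f).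
Proof.
move=> F; rewrite !dtanE rmorph_sum; apply: eq_bigr => i _.
by rewrite (cpart_conj i ac Up ap F) mxE -rmorphM.
Qed.
Lemma dtan_cst v a : dtan A p v (fun=> a) = 0.
Proof. by rewrite dtanE big1 // => i _; rewrite (cpart_cst _ _ _ a) mulr0. Qed.
Lemma dtan_sum v (I : Type) (r : seq I) (P : pred I) (f : I -> M -> C) :
  (forall i, P i -> ckC 1 U (f i)) ->
  dtan A p v (fun q => \sum_(i <- r | P i) f i q) = \sum_(i <- r | P i) dtan A p v (f i).
Proof.
move=> F; elim: r => [|i r IH].
  rewrite big_nil; apply: etrans (dtan_cst v 0); apply: dtan_eq => q _.
  by rewrite big_nil.
rewrite big_cons; case: ifP => Pi.
  rewrite -IH -dtanD; [|exact: F|exact: ckC_sum].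
  by apply: dtan_eq => q _; rewrite big_cons Pi.
by rewrite -IH; apply: dtan_eq => q _; rewrite big_cons Pi.
Qed.
End DtanRules.

Lemma dtan_linl p (a : C) v w f : dtan A p (a *: v + w) f = a * dtan A p v f + dtan A p w f.
Proof.
rewrite !dtanE mulr_sumr -big_split; apply: eq_bigr => i _.
by rewrite !mxE mulrDl mulrA.
Qed.
Lemma dtanDl p v w f : dtan A p (v + w) f = dtan A p v f + dtan A p w f.
Proof. by rewrite -[v]scale1r dtan_linl mul1r scale1r. Qed.
Lemma dtan0l p f : dtan A p 0 f = 0.
Proof. by rewrite dtanE big1 // => i _; rewrite mxE mul0r. Qed.
Lemma dtanZl p (a : C) v f : dtan A p (a *: v) f = a * dtan A p v f.
Proof. by rewrite -[a *: v]addr0 dtan_linl dtan0l addr0. Qed.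
Lemma dtanNl p v f : dtan A p (- v) f = - dtan A p v f.
Proof. by rewrite -scaleN1r dtanZl mulN1r. Qed.
Lemma dtanBl p v w f : dtan A p (v - w) f = dtan A p v f - dtan A p w f.
Proof. by rewrite dtanDl dtanNl. Qed.
Lemma dtan_suml p (I : Type) (r : seq I) (P : pred I) (v : I -> 'rV[C]_m) f :
  dtan A p (\sum_(i <- r | P i) v i) f = \sum_(i <- r | P i) dtan A p (v i) f.
Proof. by apply: (big_morph (fun v => dtan A p v f)) => [v' w|]; rewrite ?dtanDl ?dtan0l. Qed.

Lemma vappE X f p : vapp A X f p = dtan A p (X p) f.
Proof. by []. Qed.
Lemma vapp_comb (f : M -> C) X Y g p :
  vapp A (fun q => f q *: X q + Y q) g p = f p * vapp A X g p + vapp A Y g p.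
Proof. exact: dtan_linl. Qed.
Lemma vapp_scale (f : M -> C) X g p : vapp A (fun q => f q *: X q) g p = f p * vapp A X g p.
Proof. exact: dtanZl. Qed.
Lemma vapp_subl X Y g p : vapp A (fun q => X q - Y q) g p = vapp A X g p - vapp A Y g p.
Proof. exact: dtanBl. Qed.
Lemma vapp_suml (I : Type) (r : seq I) (P : pred I) (X : I -> vfield R m M) g p :
  vapp A (fun q => \sum_(i <- r | P i) X i q) g p = \sum_(i <- r | P i) vapp A (X i) g p.
Proof. exact: dtan_suml. Qed.
Lemma vapp_ext X Y g p : X p = Y p -> vapp A X g p = vapp A Y g p.
Proof. by rewrite /vapp => ->. Qed.

Definition vck k U (X : vfield R m M) : Prop :=
  forall c, charts c -> forall i, ckC k (U `&` cdom c) (vapp A X (ccoord c i)).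

Lemma vsmoothP U X : vsmooth_on A U X <-> forall k, vck k U X.
Proof.
split=> [H k c cc i|H c cc i]; first exact: smooth_ckC (H c cc i).
by apply/smoothP => k; exact: H.
Qed.

Lemma ckC_vapp k U X f : open U -> vck k U X -> ckC k.+1 U f -> ckC k U (vapp A X f).
Proof.
move=> oU HX F; apply: ckC_local => c cc.
have oUc : open (U `&` cdom c) by apply: openI => //; exact: chart_open_dom.
apply: (@ckC_eq _ _ (fun p => \sum_j vapp A X (ccoord c j) p * cpart c j f p)) => //.
  move=> p [Up cp]; rewrite /vapp (@dtan_chart c U) //; exact: ckC_le F.
apply: ckC_sum => // j _; apply: ckC_mul => //; first exact: HX.
exact: ckC_cpart.
Qed.

Lemma smooth_vapp U X f : open U -> vsmooth_on A U X -> smooth_on A U f ->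
  smooth_on A U (vapp A X f).
Proof.
move=> oU /vsmoothP HX /smoothP F; apply/smoothP => k.
by apply: ckC_vapp.
Qed.

(** [bracket] is defined by its action on the coordinates of one chart. On a general [f] the second
    derivatives of [f] also appear, and cancel by [schwarz]. *)
Lemma bracketE U X Y f p : open U -> U p -> vck 1 U X -> vck 1 U Y -> ckC 2 U f ->
  vapp A (bracket A X Y) f p = vapp A X (vapp A Y f) p - vapp A Y (vapp A X f) p.
Proof.
move=> oU Up HX HY F; set c := chart_at p.
have cc : charts c := chart_at_charts A p; have cp : cdom c p := chart_at_dom A p.
have oUc : open (U `&` cdom c) by apply: openI => //; exact: chart_open_dom.
have Ucp : (U `&` cdom c) p by [].
have F1 : ckC 1 U f by exact: ckC_le F.
have Fj j : ckC 1 (U `&` cdom c) (cpart c j f) by exact: ckC_cpart.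
have second X' Y' : vck 1 U X' -> vck 1 U Y' ->
  vapp A X' (vapp A Y' f) p = \sum_j vapp A X' (vapp A Y' (ccoord c j)) p * cpart c j f p
   + \sum_j \sum_k vapp A Y' (ccoord c j) p * vapp A X' (ccoord c k) p * cpart c k (cpart c j f) p.
  move=> HX' HY'.
  have -> : vapp A X' (vapp A Y' f) p =
      dtan A p (X' p) (fun q => \sum_j vapp A Y' (ccoord c j) q * cpart c j f q).
    by apply: (dtan_eq oUc Ucp) => q [Uq cq]; rewrite /vapp (@dtan_chart c U).
  rewrite (dtan_sum oUc Ucp); last first.
    by move=> j _; apply: ckC_mul => //; exact: HY'.
  rewrite -big_split; apply: eq_bigr => j _.
  rewrite (dtanM oUc Ucp _ (HY' c cc j) (Fj j)) addrC [cpart _ _ _ _ * _]mulrC.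
  congr (_ + _); rewrite [dtan A p (X' p) (cpart c j f)](@dtan_chart c (U `&` cdom c)) //.
  by rewrite mulr_sumr; apply: eq_bigr => k _; rewrite mulrA.
rewrite (second _ _ HX HY) (second _ _ HY HX).
have -> : vapp A (bracket A X Y) f p = \sum_j (vapp A X (vapp A Y (ccoord c j)) p -
    vapp A Y (vapp A X (ccoord c j)) p) * cpart c j f p.
  by rewrite /vapp dtanE; apply: eq_bigr => j _; rewrite mxE.
have S k j : cpart c k (cpart c j f) p = cpart c j (cpart c k f) p.
  have T (g : M -> R) : ckM 2 U g -> rpart c k (rpart c j g) p = rpart c j (rpart c k g) p.
    move=> G; pose V := cmap c @` (U `&` cdom c).
    have oV : open V by exact: open_chart_image.
    have Vp : V (cmap c p) by exists p.
    have E a b : rpart c a (rpart c b g) p = 'D_(e_ a) ('D_(e_ b) (g \o cinv c)) (cmap c p).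
      apply: near_eq_derive; apply: near_open oV Vp _ => _ [q [Uq cq] <-] /=.
      by rewrite /rpart cmapK.
    by rewrite !E; apply: schwarz oV Vp (G c cc).
  by case: F => f1 f2; apply: complex_eqP; [exact: (T _ f1)|exact: (T _ f2)].
set a := \sum_j \sum_k _; set b := \sum_j \sum_k _.
have -> : a = b.
  rewrite /a exchange_big; apply: eq_bigr => k _; apply: eq_bigr => j _.
  by rewrite S [vapp _ _ _ _ * vapp _ _ _ _]mulrC.
rewrite opprD addrACA subrr addr0 -sumrB.
by apply: eq_bigr => j _; rewrite mulrBl.
Qed.

Lemma vsmooth_sub U V X : V `<=` U -> vsmooth_on A U X -> vsmooth_on A V X.
Proof.
move=> VU /vsmoothP H; apply/vsmoothP => k c cc i.
by apply: ckC_sub (H k c cc i); exact: setSI.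
Qed.

Lemma smooth_sub U V f : V `<=` U -> smooth_on A U f -> smooth_on A V f.
Proof. by move=> VU /smoothP H; apply/smoothP => k; apply: ckC_sub (H k). Qed.

Lemma smooth_ccoord U c i : charts c -> smooth_on A (U `&` cdom c) (ccoord c i).
Proof.
move=> cc; apply/smoothP => k; apply: (@ckC_sub k (cdom c)); first by move=> ? [].
exact: ckC_ccoord.
Qed.

Section SmoothClosed.
Variable U : set M.
Hypothesis oU : open U.
Implicit Types (f g : M -> C) (X Y : vfield R m M).

Lemma smooth_cst a : smooth_on A U (fun=> a).
Proof. by apply/smoothP => k; exact: ckC_cst. Qed.
Lemma smooth_add f g : smooth_on A U f -> smooth_on A U g -> smooth_on A U (fun p => f p + g p).
Proof. by move=> /smoothP F /smoothP G; apply/smoothP => k; exact: ckC_add. Qed.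
Lemma smooth_opp f : smooth_on A U f -> smooth_on A U (fun p => - f p).
Proof. by move=> /smoothP F; apply/smoothP => k; exact: ckC_opp. Qed.
Lemma smooth_conj f : smooth_on A U f -> smooth_on A U (fun p => conjc (f p)).
Proof. by move=> /smoothP F; apply/smoothP => k; exact: ckC_conj. Qed.
Lemma smooth_mul f g : smooth_on A U f -> smooth_on A U g -> smooth_on A U (fun p => f p * g p).
Proof. by move=> /smoothP F /smoothP G; apply/smoothP => k; exact: ckC_mul. Qed.
Lemma smooth_inv f : (forall p, U p -> f p != 0) -> smooth_on A U f ->
  smooth_on A U (fun p => (f p)^-1).
Proof. by move=> f0 /smoothP F; apply/smoothP => k; exact: ckC_inv. Qed.
Lemma smooth_sum (I : Type) (r : seq I) (P : pred I) (f : I -> M -> C) :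
  (forall i, P i -> smooth_on A U (f i)) -> smooth_on A U (fun p => \sum_(i <- r | P i) f i p).
Proof.
by move=> F; apply/smoothP => k; apply: ckC_sum => // i Pi; exact: smooth_ckC (F i Pi).
Qed.
Lemma smooth_prod (I : Type) (r : seq I) (P : pred I) (f : I -> M -> C) :
  (forall i, P i -> smooth_on A U (f i)) -> smooth_on A U (fun p => \prod_(i <- r | P i) f i p).
Proof.
move=> F; elim: r => [|i r IH].
  by under [X in smooth_on _ _ X]eq_fun do rewrite big_nil; exact: smooth_cst.
case Pi : (P i); under [X in smooth_on _ _ X]eq_fun do rewrite big_cons Pi //.
  by apply: smooth_mul => //; exact: F.
exact: IH.
Qed.
Lemma smooth_real (f : M -> R) : smoothR_on A U f -> smooth_on A U (fun p => (f p)%:C).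
Proof. by move=> F; split=> //; case: (smooth_cst 0). Qed.
Lemma smooth_eq f g : (forall p, U p -> f p = g p) -> smooth_on A U f -> smooth_on A U g.
Proof. by move=> E /smoothP F; apply/smoothP => k; exact: ckC_eq (F k). Qed.

Lemma vsmooth_eq X Y : (forall p, U p -> X p = Y p) -> vsmooth_on A U X -> vsmooth_on A U Y.
Proof.
move=> E HX c cc i; have := HX c cc i => /smoothP F; apply/smoothP => k.
apply: ckC_eq (F k); first by apply: openI => //; exact: chart_open_dom.
by move=> p [Up _]; rewrite /vapp E.
Qed.
Lemma vsmooth_comb f X Y : smooth_on A U f -> vsmooth_on A U X -> vsmooth_on A U Y ->
  vsmooth_on A U (fun p => f p *: X p + Y p).
Proof.
move=> F HX HY c cc i; have /smoothP G := HX c cc i; have /smoothP H := HY c cc i.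
apply/smoothP => k; have oUc : open (U `&` cdom c) by apply: openI => //; exact: chart_open_dom.
apply: ckC_eq (ckC_add oUc (ckC_mul oUc (ckC_sub _ (smooth_ckC k F)) (G k)) (H k)) => //.
by move=> p _; rewrite /vapp dtan_linl.
Qed.
Lemma vsmooth0 : vsmooth_on A U (fun=> 0).
Proof.
move=> c cc i; apply/smoothP => k.
have oUc : open (U `&` cdom c) by apply: openI => //; exact: chart_open_dom.
by apply: ckC_eq (ckC_cst _ oUc 0) => // p _; rewrite /vapp dtan0l.
Qed.
Lemma vsmooth_scale f X : smooth_on A U f -> vsmooth_on A U X ->
  vsmooth_on A U (fun p => f p *: X p).
Proof.
move=> F HX; apply: vsmooth_eq (vsmooth_comb F HX vsmooth0) => p _.
by rewrite addr0.
Qed.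
Lemma vsmooth_add X Y : vsmooth_on A U X -> vsmooth_on A U Y ->
  vsmooth_on A U (fun p => X p + Y p).
Proof.
move=> HX HY; apply: vsmooth_eq (vsmooth_comb (smooth_cst 1) HX HY) => p _.
by rewrite scale1r.
Qed.
Lemma vsmooth_opp X : vsmooth_on A U X -> vsmooth_on A U (fun p => - X p).
Proof.
move=> HX; apply: vsmooth_eq (vsmooth_scale (smooth_cst (-1)) HX) => p _.
by rewrite scaleN1r.
Qed.
Lemma vsmooth_sum (I : Type) (r : seq I) (P : pred I) (X : I -> vfield R m M) :
  (forall i, P i -> vsmooth_on A U (X i)) -> vsmooth_on A U (fun p => \sum_(i <- r | P i) X i p).
Proof.
move=> F; elim: r => [|i r IH].
  by under [X in vsmooth_on _ _ X]eq_fun do rewrite big_nil; exact: vsmooth0.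
case Pi : (P i); under [X in vsmooth_on _ _ X]eq_fun do rewrite big_cons Pi //.
  by apply: vsmooth_add => //; exact: F.
exact: IH.
Qed.
Lemma vsmooth_conj X : vsmooth_on A U X -> vsmooth_on A U (conjf X).
Proof.
move=> HX c cc i; have /smoothP G := HX c cc i; apply/smoothP => k.
have oUc : open (U `&` cdom c) by apply: openI => //; exact: chart_open_dom.
apply: ckC_eq (ckC_conj oUc (G k)) => // p [Up cp].
rewrite /vapp /conjf -(dtan_conj cp _ (ckC_ccoord 1 i cc)).
apply: (dtan_eq (chart_open_dom cc) cp) => q _.
by apply: complex_eqP; rewrite ?ReJ ?ImJ //= oppr0.
Qed.
Lemma vsmooth_bracket X Y : vsmooth_on A U X -> vsmooth_on A U Y ->
  vsmooth_on A U (bracket A X Y).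
Proof.
move=> HX HY c cc i.
have oUc : open (U `&` cdom c) by apply: openI => //; exact: chart_open_dom.
have sub : U `&` cdom c `<=` U by move=> ? [].
have HXc := vsmooth_sub sub HX; have HYc := vsmooth_sub sub HY.
have S := smooth_ccoord U i cc.
have : smooth_on A (U `&` cdom c) (fun p => vapp A X (vapp A Y (ccoord c i)) p
   - vapp A Y (vapp A X (ccoord c i)) p).
  apply/smoothP => k; apply: ckC_add => //.
    by apply: smooth_ckC; do 2 apply: smooth_vapp => //.
  apply: ckC_opp => //.
  by apply: smooth_ckC; do 2 apply: smooth_vapp => //.
move=> /smoothP H; apply/smoothP => k; apply: ckC_eq (H k) => // p Ucp.
by rewrite (bracketE oUc Ucp ((vsmoothP _ _).1 HXc 1) ((vsmoothP _ _).1 HYc 1) (smooth_ckC 2 S)).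
Qed.

Section Vapp.
Variable p : M.
Hypothesis Up : U p.

Lemma vappD X f g : smooth_on A U f -> smooth_on A U g ->
  vapp A X (fun q => f q + g q) p = vapp A X f p + vapp A X g p.
Proof. by move=> F G; apply: (dtanD Up); exact: smooth_ckC. Qed.
Lemma vappB X f g : smooth_on A U f -> smooth_on A U g ->
  vapp A X (fun q => f q - g q) p = vapp A X f p - vapp A X g p.
Proof. by move=> F G; apply: (dtanB oU Up); exact: smooth_ckC. Qed.
Lemma vappM X f g : smooth_on A U f -> smooth_on A U g ->
  vapp A X (fun q => f q * g q) p = f p * vapp A X g p + g p * vapp A X f p.
Proof. by move=> F G; apply: (dtanM oU Up); exact: smooth_ckC. Qed.
Lemma vapp_sum X (I : Type) (r : seq I) (P : pred I) (f : I -> M -> C) :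
  (forall i, P i -> smooth_on A U (f i)) ->
  vapp A X (fun q => \sum_(i <- r | P i) f i q) p = \sum_(i <- r | P i) vapp A X (f i) p.
Proof. by move=> F; apply: (dtan_sum oU Up) => i Pi; exact: smooth_ckC (F i Pi). Qed.
Lemma vapp_conj X f : smooth_on A U f ->
  vapp A (conjf X) (fun q => conjc (f q)) p = conjc (vapp A X f p).
Proof. by move=> F; apply: (dtan_conj Up); exact: smooth_ckC. Qed.
Lemma vapp_cst X a : vapp A X (fun=> a) p = 0.
Proof. exact: dtan_cst. Qed.
Lemma vapp_eq X f g : (forall q, U q -> f q = g q) -> vapp A X f p = vapp A X g p.
Proof. by move=> E; apply: (dtan_eq oU Up). Qed.
Lemma vapp_bracket X Y f : vsmooth_on A U X -> vsmooth_on A U Y -> smooth_on A U f ->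
  vapp A (bracket A X Y) f p = vapp A X (vapp A Y f) p - vapp A Y (vapp A X f) p.
Proof.
move=> /vsmoothP HX /vsmoothP HY F; apply: (bracketE oU Up (HX 1) (HY 1)).
exact: smooth_ckC.
Qed.
End Vapp.

(* Two vectors with the same action on the coordinate functions are equal;
   hence identities between vector fields reduce to identities between
   derivations. *)
Lemma field_ext X Y p : U p ->
  (forall V f, open V -> V `<=` U -> V p -> smooth_on A V f -> vapp A X f p = vapp A Y f p) ->
  X p = Y p.
Proof.
move=> Up H; apply: (@vec_ext p) => i; set c := chart_at p.
have cc : charts c := chart_at_charts A p; have cp : cdom c p := chart_at_dom A p.
apply: (H (U `&` cdom c)) => //; first by apply: openI => //; exact: chart_open_dom.
exact: smooth_ccoord.
Qed.

End SmoothClosed.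

(** By [field_ext] the identity may be tested on functions, where each double bracket becomes four
    compositions of three derivations; the twelve terms cancel in pairs. *)
Lemma jacobi U X Y Z p : open U -> U p ->
  vsmooth_on A U X -> vsmooth_on A U Y -> vsmooth_on A U Z ->
  bracket A X (bracket A Y Z) p + bracket A Y (bracket A Z X) p
    + bracket A Z (bracket A X Y) p = 0.
Proof.
move=> oU Up HX HY HZ.
apply: (@field_ext U oU (fun p => bracket A X (bracket A Y Z) p + bracket A Y (bracket A Z X) p
    + bracket A Z (bracket A X Y) p) (fun=> 0)) => // V f oV VU Vp F.
have {}HX := vsmooth_sub VU HX; have {}HY := vsmooth_sub VU HY; have {}HZ := vsmooth_sub VU HZ.
rewrite /vapp !dtanDl dtan0l -!/(vapp A _ _ p).
have B X' Y' : vsmooth_on A V X' -> vsmooth_on A V Y' -> vsmooth_on A V (bracket A X' Y').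
  exact: vsmooth_bracket.
have key X' Y' Z' : vsmooth_on A V X' -> vsmooth_on A V Y' -> vsmooth_on A V Z' ->
  vapp A (bracket A X' (bracket A Y' Z')) f p =
   vapp A X' (vapp A Y' (vapp A Z' f)) p - vapp A X' (vapp A Z' (vapp A Y' f)) p
   - vapp A Y' (vapp A Z' (vapp A X' f)) p + vapp A Z' (vapp A Y' (vapp A X' f)) p.
  move=> HX' HY' HZ'.
  rewrite (vapp_bracket oV Vp HX' (B _ _ HY' HZ') F).
  rewrite (vapp_eq oV Vp _ (g := fun q => vapp A Y' (vapp A Z' f) q - vapp A Z' (vapp A Y' f) q)); last first.
    by move=> q Vq; apply: (vapp_bracket oV Vq).
  rewrite (vappB oV Vp); [|by do 2 apply: smooth_vapp => //..].
  rewrite (vapp_bracket oV Vp HY' HZ'); last exact: smooth_vapp.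
  exact: jacobi_term.
by rewrite !key // jacobi_sum.
Qed.

End ManifoldCalculus.
#[local] Opaque vapp.

(** * Lie brackets, connections, torsion and curvature *)

Section BracketRules.
Context (R : realType) (m : nat) (M : topologicalType).
Context (A : oriented_atlas R m M).
Local Notation C := R[i].
Implicit Types (U : set M) (p q : M) (X Y Z : vfield R m M).

Lemma conjvD (v w : 'rV[C]_m) : conjv (v + w) = conjv v + conjv w.
Proof. exact: map_mxD. Qed.
Lemma conjvN (v : 'rV[C]_m) : conjv (- v) = - conjv v.
Proof. exact: map_mxN. Qed.
Lemma conjvB (v w : 'rV[C]_m) : conjv (v - w) = conjv v - conjv w.
Proof. exact: map_mxB. Qed.
Lemma conjvZ (a : C) (v : 'rV[C]_m) : conjv (a *: v) = conjc a *: conjv v.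
Proof. exact: map_mxZ. Qed.
Lemma conjv0 : conjv (0 : 'rV[C]_m) = 0.
Proof. exact: map_mx0. Qed.
Lemma conjvK (v : 'rV[C]_m) : conjv (conjv v) = v.
Proof. by apply/rowP => i; rewrite !mxE conjcK. Qed.
Lemma conjv_sum (I : Type) (r : seq I) (P : pred I) (v : I -> 'rV[C]_m) :
  conjv (\sum_(i <- r | P i) v i) = \sum_(i <- r | P i) conjv (v i).
Proof. by apply: big_morph => [x y|]; rewrite ?conjvD ?conjv0. Qed.
Lemma conjfK X : conjf (conjf X) = X.
Proof. by apply/funext => p; rewrite /conjf conjvK. Qed.

Lemma bracket_anti X Y p : bracket A Y X p = - bracket A X Y p.
Proof. by apply/rowP => i; rewrite !mxE opprB. Qed.

Lemma bracket_eq U X X' Y Y' p : open U -> U p -> (forall q, U q -> X q = X' q) ->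
  (forall q, U q -> Y q = Y' q) -> bracket A X Y p = bracket A X' Y' p.
Proof.
move=> oU Up EX EY; apply/rowP => i; rewrite !mxE.
have E Z Z' f : (forall q, U q -> Z q = Z' q) -> forall q, U q -> vapp A Z f q = vapp A Z' f q.
  by move=> EZ q Uq; apply: vapp_ext; exact: EZ.
rewrite (E _ _ _ EX _ Up) (E _ _ _ EY _ Up).
by rewrite (vapp_eq A oU Up X' (E _ _ _ EY)) (vapp_eq A oU Up Y' (E _ _ _ EX)).
Qed.

Lemma bracket_comb U (f : M -> C) X X' Y p : open U -> U p -> smooth_on A U f ->
  vsmooth_on A U X -> vsmooth_on A U X' -> vsmooth_on A U Y ->
  bracket A (fun q => f q *: X q + X' q) Y p =
    f p *: bracket A X Y p + bracket A X' Y p - vapp A Y f p *: X p.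
Proof.
move=> oU Up F HX HX' HY.
apply: (field_ext (A := A) oU (X := bracket A (fun q => f q *: X q + X' q) Y)
  (Y := fun p => f p *: bracket A X Y p + bracket A X' Y p - vapp A Y f p *: X p) Up).
move=> V g oV VU Vp Gs.
have {}F := smooth_sub VU F; have {}HX := vsmooth_sub VU HX.
have {}HX' := vsmooth_sub VU HX'; have {}HY := vsmooth_sub VU HY.
rewrite (vapp_bracket oV Vp _ HY Gs); last exact: vsmooth_comb.
rewrite vapp_subl vapp_scale !vapp_comb (vapp_bracket oV Vp HX HY Gs) (vapp_bracket oV Vp HX' HY Gs).
have -> : vapp A Y (vapp A (fun q => f q *: X q + X' q) g) p =
   f p * vapp A Y (vapp A X g) p + vapp A X g p * vapp A Y f p + vapp A Y (vapp A X' g) p.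
  have S1 := smooth_vapp oV HX Gs; have S2 := smooth_vapp oV HX' Gs.
  have -> : vapp A Y (vapp A (fun q => f q *: X q + X' q) g) p =
     vapp A Y (fun q => f q * vapp A X g q + vapp A X' g q) p.
    by apply: (vapp_eq A oV Vp) => q _; exact: vapp_comb.
  rewrite (vappD Vp _ _ S2); last exact: smooth_mul.
  by rewrite (vappM oV Vp _ F S1).
move: (vapp A X (vapp A Y g) p) (vapp A Y (vapp A X g) p) (vapp A X' _ p) (vapp A Y (vapp A X' g) p) (vapp A Y f p) (vapp A X g p) (f p).
by clear=> *; ring.
Qed.

Lemma vapp_ccoord_conj U c i X p : open U -> charts A c -> U p -> cdom c p ->
  vapp A (conjf X) (ccoord c i) p = conjc (vapp A X (ccoord c i) p).
Proof.
move=> oU cc Up cp; have oUc : open (U `&` cdom c) by apply: openI => //; exact: chart_open_dom cc.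
have Ucp : (U `&` cdom c) p by [].
rewrite -(vapp_conj Ucp X (smooth_ccoord U i cc)).
apply: (vapp_eq A oUc Ucp) => q _; apply: complex_eqP; rewrite ?ReJ ?ImJ //=.
by rewrite oppr0.
Qed.

Lemma bracket_conj U X Y p : open U -> U p -> vsmooth_on A U X -> vsmooth_on A U Y ->
  bracket A (conjf X) (conjf Y) p = conjv (bracket A X Y p).
Proof.
move=> oU Up HX HY; apply/rowP => i; rewrite !mxE rmorphB.
set c := chart_at A p.
have cc := chart_at_charts A p : charts A c; have cp := chart_at_dom A p : cdom c p.
have oUc : open (U `&` cdom c) by apply: openI => //; exact: chart_open_dom cc.
have Ucp : (U `&` cdom c) p by [].
have key X' Y' : vsmooth_on A U Y' ->
    vapp A (conjf X') (vapp A (conjf Y') (ccoord c i)) p = conjc (vapp A X' (vapp A Y' (ccoord c i)) p).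
  move=> HY'.
  have S : smooth_on A (U `&` cdom c) (vapp A Y' (ccoord c i)).
    by apply: smooth_vapp => //; [apply: vsmooth_sub HY' => ? []|exact: smooth_ccoord].
  rewrite -(vapp_conj Ucp X' S); apply: (vapp_eq A oUc Ucp) => q [Uq cq].
  exact: (vapp_ccoord_conj i _ oU).
by rewrite !key.
Qed.

Lemma pair1D (th : form1 R m M) X Y p :
  pair1 th (fun q => X q + Y q) p = pair1 th X p + pair1 th Y p.
Proof. by rewrite /pair1 -big_split; apply: eq_bigr => i _; rewrite mxE mulrDl. Qed.
Lemma pair1Z (th : form1 R m M) (f : M -> C) X p :
  pair1 th (fun q => f q *: X q) p = f p * pair1 th X p.
Proof. by rewrite /pair1 mulr_sumr; apply: eq_bigr => i _; rewrite mxE mulrA. Qed.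
Lemma pair1N (th : form1 R m M) X p : pair1 th (fun q => - X q) p = - pair1 th X p.
Proof. by rewrite /pair1 -sumrN; apply: eq_bigr => i _; rewrite mxE mulNr. Qed.
Lemma pair1_conj (th : form1 R m M) X p : pair1 th (conjf X) p = conjc (pair1 th X p).
Proof.
by rewrite /pair1 rmorph_sum; apply: eq_bigr => i _; rewrite mxE [in RHS]rmorphM; congr (_ * _); rewrite /= oppr0.
Qed.
Lemma pair1_ext (th : form1 R m M) X Y p : X p = Y p -> pair1 th X p = pair1 th Y p.
Proof. by rewrite /pair1 => ->. Qed.

End BracketRules.

Section ConnectionRules.
Context (R : realType) (m : nat) (M : topologicalType).
Context (A : oriented_atlas R m M).
Local Notation C := R[i].
Variable nabla : vfield R m M -> vfield R m M -> vfield R m M.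
Hypothesis hc : connection A nabla.
Variable U : set M.
Hypothesis oU : open U.
Implicit Types (p q : M) (X Y Z : vfield R m M) (f : M -> C).

Lemma nabla_smooth X Y : vsmooth_on A U X -> vsmooth_on A U Y -> vsmooth_on A U (nabla X Y).
Proof. by case: (hc oU) => + _ _ _; apply. Qed.

Lemma nabla_combl f X X' Y p : smooth_on A U f -> vsmooth_on A U X -> vsmooth_on A U X' ->
  vsmooth_on A U Y -> U p ->
  nabla (fun q => f q *: X q + X' q) Y p = f p *: nabla X Y p + nabla X' Y p.
Proof. by move=> F HX HX' HY Up; case: (hc oU) => _ + _ _; apply. Qed.

Lemma nablaDr X Y Y' p : vsmooth_on A U X -> vsmooth_on A U Y -> vsmooth_on A U Y' -> U p ->
  nabla X (fun q => Y q + Y' q) p = nabla X Y p + nabla X Y' p.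
Proof. by move=> HX HY HY' Up; case: (hc oU) => _ _ + _; apply. Qed.

Lemma nablaZr f X Y p : smooth_on A U f -> vsmooth_on A U X -> vsmooth_on A U Y -> U p ->
  nabla X (fun q => f q *: Y q) p = vapp A X f p *: Y p + f p *: nabla X Y p.
Proof. by move=> F HX HY Up; case: (hc oU) => _ _ _ +; apply. Qed.

Lemma nabla0l Y p : vsmooth_on A U Y -> U p -> nabla (fun=> 0) Y p = 0.
Proof.
move=> HY Up; have V0 : vsmooth_on A U (fun=> 0) by exact: vsmooth0.
have := nabla_combl (smooth_cst A oU 1) V0 V0 HY Up.
have -> : (fun q : M => 1 *: (0 : 'rV[C]_m) + 0) = fun=> 0.
  by apply/funext => q; rewrite scaler0 addr0.
by rewrite scale1r => /esym /eqP; rewrite -subr_eq0 addrK => /eqP.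
Qed.

(* The indicator function of the complement of [U] is smooth on [U], where it
   vanishes; multiplying by it localizes the connection. *)
Let ind : M -> C := fun q => (~~ `[< U q >])%:R.

Let ind_smooth : smooth_on A U ind.
Proof.
apply: smooth_eq (smooth_cst A oU 0) => // q Uq.
by rewrite /ind asboolT.
Qed.

Let ind0 p : U p -> ind p = 0.
Proof. by move=> Up; rewrite /ind asboolT. Qed.

Let ind_scale X : (forall q, U q -> X q = 0) -> X = fun q => ind q *: X q.
Proof.
move=> X0; apply/funext => q; rewrite /ind; case: asboolP => [Uq|_] /=.
  by rewrite X0 // scaler0.
by rewrite scale1r.
Qed.

Lemma nabla_eql X X' Y p : vsmooth_on A U X -> vsmooth_on A U X' -> vsmooth_on A U Y -> U p ->
  (forall q, U q -> X q = X' q) -> nabla X Y p = nabla X' Y p.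
Proof.
move=> HX HX' HY Up E; pose D : vfield R m M := fun q => X q - X' q.
have D0 q : U q -> D q = 0 by move=> Uq; rewrite /D E // subrr.
have HD : vsmooth_on A U D by exact: (vsmooth_add oU HX (vsmooth_opp oU HX')).
have -> : X = fun q => ind q *: D q + X' q.
  apply/funext => q; have := congr1 (fun h : vfield R m M => h q) (ind_scale D0).
  by rewrite /= => <-; rewrite /D subrK.
by rewrite nabla_combl // ind0 // scale0r add0r.
Qed.

Lemma nabla_eqr X Y Y' p : vsmooth_on A U X -> vsmooth_on A U Y -> vsmooth_on A U Y' -> U p ->
  (forall q, U q -> Y q = Y' q) -> nabla X Y p = nabla X Y' p.
Proof.
move=> HX HY HY' Up E; pose D : vfield R m M := fun q => Y q - Y' q.
have D0 q : U q -> D q = 0 by move=> Uq; rewrite /D E // subrr.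
have HD : vsmooth_on A U D by exact: (vsmooth_add oU HY (vsmooth_opp oU HY')).
have -> : Y = fun q => ind q *: D q + Y' q.
  apply/funext => q; have := congr1 (fun h : vfield R m M => h q) (ind_scale D0).
  by rewrite /= => <-; rewrite /D subrK.
rewrite nablaDr // ?nablaZr //; last by apply: vsmooth_scale.
rewrite ind0 // scale0r addr0 (_ : vapp A X ind p = 0) ?scale0r ?add0r //.
rewrite -(vapp_cst A p X 0); apply: (vapp_eq A oU Up) => q Uq.
by rewrite ind0.
Qed.

Lemma nablaZl f X Y p : smooth_on A U f -> vsmooth_on A U X -> vsmooth_on A U Y -> U p ->
  nabla (fun q => f q *: X q) Y p = f p *: nabla X Y p.
Proof.
move=> F HX HY Up; have V0 : vsmooth_on A U (fun=> 0) by exact: vsmooth0.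
rewrite -[RHS]addr0 -(nabla0l HY Up) -nabla_combl //.
apply: nabla_eql => // [||q _]; [exact: vsmooth_scale|exact: vsmooth_comb|].
by rewrite addr0.
Qed.

Lemma nablaDl X X' Y p : vsmooth_on A U X -> vsmooth_on A U X' -> vsmooth_on A U Y -> U p ->
  nabla (fun q => X q + X' q) Y p = nabla X Y p + nabla X' Y p.
Proof.
move=> HX HX' HY Up; rewrite -[X in _ = X + _]scale1r -(nabla_combl (smooth_cst A oU 1)) //.
apply: nabla_eql => // [||q _]; [exact: vsmooth_add| |by rewrite scale1r].
by apply: vsmooth_comb => //; exact: smooth_cst.
Qed.

Lemma nablaNl X Y p : vsmooth_on A U X -> vsmooth_on A U Y -> U p ->
  nabla (fun q => - X q) Y p = - nabla X Y p.
Proof.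
move=> HX HY Up; rewrite -scaleN1r -(nablaZl (smooth_cst A oU (-1))) //.
apply: nabla_eql => // [||q _]; [exact: vsmooth_opp| |by rewrite scaleN1r].
by apply: vsmooth_scale => //; exact: smooth_cst.
Qed.

Lemma nabla_suml (I : Type) (r : seq I) (f : I -> M -> C) (X : I -> vfield R m M) Y p :
  (forall i, smooth_on A U (f i)) -> (forall i, vsmooth_on A U (X i)) -> vsmooth_on A U Y -> U p ->
  nabla (fun q => \sum_(i <- r) f i q *: X i q) Y p = \sum_(i <- r) f i p *: nabla (X i) Y p.
Proof.
move=> F HX HY Up; have V0 : vsmooth_on A U (fun=> 0) by exact: vsmooth0.
have S r' : vsmooth_on A U (fun q => \sum_(i <- r') f i q *: X i q).
  by apply: vsmooth_sum => // j _; exact: vsmooth_scale.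
elim: r => [|i r IH].
  rewrite big_nil; transitivity (nabla (fun=> 0) Y p); last exact: nabla0l.
  by apply: (nabla_eql (S [::]) V0 HY Up) => q _; rewrite big_nil.
rewrite big_cons -IH -(nabla_combl (F i) (HX i) (S r) HY Up).
apply: (nabla_eql (S _) (vsmooth_comb oU (F i) (HX i) (S r)) HY Up) => q _.
by rewrite big_cons.
Qed.

Lemma nabla_sumr (I : Type) (r : seq I) (f : I -> M -> C) (Y : I -> vfield R m M) X p :
  (forall i, smooth_on A U (f i)) -> (forall i, vsmooth_on A U (Y i)) -> vsmooth_on A U X -> U p ->
  nabla X (fun q => \sum_(i <- r) f i q *: Y i q) p =
    \sum_(i <- r) (vapp A X (f i) p *: Y i p + f i p *: nabla X (Y i) p).
Proof.
move=> F HY HX Up; have V0 : vsmooth_on A U (fun=> 0) by exact: vsmooth0.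
have S r' : vsmooth_on A U (fun q => \sum_(i <- r') f i q *: Y i q).
  by apply: vsmooth_sum => // j _; exact: vsmooth_scale.
have S0 := smooth_cst A oU 0.
elim: r => [|i r IH].
  rewrite big_nil (nabla_eqr HX (S [::]) (vsmooth_scale oU S0 V0) Up) => [|q _].
    by rewrite nablaZr // vapp_cst !scale0r addr0.
  by rewrite big_nil scaler0.
have Si := vsmooth_scale oU (F i) (HY i).
rewrite big_cons -IH -(nablaZr (F i) HX (HY i) Up) -(nablaDr HX Si (S r) Up).
apply: (nabla_eqr HX (S _) (vsmooth_add oU Si (S r)) Up) => q _.
by rewrite big_cons.
Qed.

Lemma torsion_anti X Y p : torsion A nabla Y X p = - torsion A nabla X Y p.
Proof.
rewrite /torsion bracket_anti; move: (nabla X Y p) (nabla Y X p) (bracket A X Y p) => a b c.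
by apply/rowP => i; rewrite !mxE; ring.
Qed.

Lemma torsion_combl f X X' Y p : smooth_on A U f -> vsmooth_on A U X -> vsmooth_on A U X' ->
  vsmooth_on A U Y -> U p ->
  torsion A nabla (fun q => f q *: X q + X' q) Y p =
    f p *: torsion A nabla X Y p + torsion A nabla X' Y p.
Proof.
move=> F HX HX' HY Up; rewrite /torsion nabla_combl // (bracket_comb oU) //.
rewrite nablaDr // ?nablaZr //; last exact: vsmooth_scale.
move: (nabla X Y p) (nabla X' Y p) (nabla Y X p) (nabla Y X' p) (vapp A Y f p) (f p) (X p)
  (bracket A X Y p) (bracket A X' Y p); clear=> a b c d e g v x y.
by rewrite !scalerBr; apply/rowP => i; rewrite !mxE; ring.
Qed.

Lemma torsion_eq X X' Y Y' p : vsmooth_on A U X -> vsmooth_on A U X' ->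
  vsmooth_on A U Y -> vsmooth_on A U Y' -> U p ->
  (forall q, U q -> X q = X' q) -> (forall q, U q -> Y q = Y' q) ->
  torsion A nabla X Y p = torsion A nabla X' Y' p.
Proof.
move=> HX HX' HY HY' Up EX EY; rewrite /torsion (bracket_eq A oU Up EX EY).
rewrite (nabla_eql HX HX' HY Up EX) (nabla_eqr HX' HY HY' Up EY).
by rewrite (nabla_eql HY HY' HX Up EY) (nabla_eqr HY' HX HX' Up EX).
Qed.

Lemma bracket_torsion X Y p : bracket A X Y p = nabla X Y p - nabla Y X p - torsion A nabla X Y p.
Proof. by rewrite /torsion opprB addrC subrK. Qed.

(* The Jacobi identity removes the double brackets. *)
Lemma bianchi X Y Z p : vsmooth_on A U X -> vsmooth_on A U Y -> vsmooth_on A U Z -> U p ->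
  curvature A nabla X Y Z p + curvature A nabla Y Z X p + curvature A nabla Z X Y p =
    (nabla X (torsion A nabla Y Z) p + torsion A nabla X (bracket A Y Z) p) +
    (nabla Y (torsion A nabla Z X) p + torsion A nabla Y (bracket A Z X) p) +
    (nabla Z (torsion A nabla X Y) p + torsion A nabla Z (bracket A X Y) p).
Proof.
move=> HX HY HZ Up.
have HN X' Y' : vsmooth_on A U X' -> vsmooth_on A U Y' -> vsmooth_on A U (nabla X' Y').
  exact: nabla_smooth.
have HB X' Y' : vsmooth_on A U X' -> vsmooth_on A U Y' -> vsmooth_on A U (bracket A X' Y').
  exact: vsmooth_bracket.
have HT X' Y' : vsmooth_on A U X' -> vsmooth_on A U Y' -> vsmooth_on A U (torsion A nabla X' Y').
  move=> HX' HY'; apply: vsmooth_add => //; last by apply: vsmooth_opp => //; exact: HB.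
  by apply: vsmooth_add; [|exact: HN|apply: vsmooth_opp => //; exact: HN].
have key X' Y' Z' : vsmooth_on A U X' -> vsmooth_on A U Y' -> vsmooth_on A U Z' ->
  nabla X' (nabla Y' Z') p - nabla X' (nabla Z' Y') p =
   bracket A X' (bracket A Y' Z') p + nabla (bracket A Y' Z') X' p
   + torsion A nabla X' (bracket A Y' Z') p + nabla X' (torsion A nabla Y' Z') p.
  move=> HX' HY' HZ'.
  have -> : nabla X' (nabla Y' Z') p = nabla X' (fun q => nabla Z' Y' q + (bracket A Y' Z' q + torsion A nabla Y' Z' q)) p.
    apply: nabla_eqr => //; first exact: HN.
      by apply: vsmooth_add => //; [exact: HN|apply: vsmooth_add => //; [exact: HB|exact: HT]].
    by move=> q Uq; rewrite /torsion [X in _ + X]addrC subrK addrC subrK.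
  rewrite (nablaDr HX' (HN _ _ HZ' HY') (vsmooth_add oU (HB _ _ HY' HZ') (HT _ _ HY' HZ')) Up).
  rewrite (nablaDr HX' (HB _ _ HY' HZ') (HT _ _ HY' HZ') Up).
  rewrite [torsion A nabla X' (bracket A Y' Z') p]/torsion.
  move: (nabla X' (nabla Z' Y') p) (nabla X' (bracket A Y' Z') p) (nabla X' (torsion A nabla Y' Z') p)
    (bracket A X' (bracket A Y' Z') p) (nabla (bracket A Y' Z') X' p); clear=> a b c d e.
  by apply/rowP => i; rewrite !mxE; ring.
have K1 := key _ _ _ HX HY HZ; have K2 := key _ _ _ HY HZ HX; have K3 := key _ _ _ HZ HX HY.
have J := jacobi oU Up HX HY HZ.
rewrite /curvature; move: K1 K2 K3 J.
move: (nabla X (nabla Y Z) p) (nabla X (nabla Z Y) p) (nabla Y (nabla Z X) p) (nabla Y (nabla X Z) p)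
  (nabla Z (nabla X Y) p) (nabla Z (nabla Y X) p) (bracket A X (bracket A Y Z) p)
  (bracket A Y (bracket A Z X) p) (bracket A Z (bracket A X Y) p)
  (nabla (bracket A Y Z) X p) (nabla (bracket A Z X) Y p) (nabla (bracket A X Y) Z p)
  (torsion A nabla X (bracket A Y Z) p) (torsion A nabla Y (bracket A Z X) p) (torsion A nabla Z (bracket A X Y) p)
  (nabla X (torsion A nabla Y Z) p) (nabla Y (torsion A nabla Z X) p) (nabla Z (torsion A nabla X Y) p).
clear=> a b c d e f j1 j2 j3 k1 k2 k3 t1 t2 t3 u1 u2 u3 K1 K2 K3 J.
have -> : a - d - k3 + (c - f - k1) + (e - b - k2) = (a - b) + (c - d) + (e - f) - k1 - k2 - k3.
  by apply/rowP => i; rewrite !mxE; ring.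
rewrite K1 K2 K3; apply/rowP => i; have := congr1 (fun v : 'rV[C]_m => v 0 i) J.
rewrite !mxE => {}J.
rewrite (_ : _ - k3 0 i = (j1 0 i + j2 0 i + j3 0 i) + (t1 0 i + u1 0 i + (t2 0 i + u2 0 i) + (t3 0 i + u3 0 i))).
  by rewrite J; ring.
by ring.
Qed.

(** The first derivatives of [f] cancel in the commutator of the two covariant derivatives, and the
    commutator of its second derivatives is compensated by the bracket term. *)
Lemma curvature_combr f X Y Z Z' p : smooth_on A U f -> vsmooth_on A U X -> vsmooth_on A U Y ->
  vsmooth_on A U Z -> vsmooth_on A U Z' -> U p ->
  curvature A nabla X Y (fun q => f q *: Z q + Z' q) p =
    f p *: curvature A nabla X Y Z p + curvature A nabla X Y Z' p.
Proof.
move=> F HX HY HZ HZ' Up.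
have HN X' Y' : vsmooth_on A U X' -> vsmooth_on A U Y' -> vsmooth_on A U (nabla X' Y').
  exact: nabla_smooth.
have HfZ : vsmooth_on A U (fun q => f q *: Z q) by exact: vsmooth_scale.
have two X' Y' : vsmooth_on A U X' -> vsmooth_on A U Y' ->
  nabla X' (nabla Y' (fun q => f q *: Z q + Z' q)) p =
   vapp A X' (vapp A Y' f) p *: Z p + vapp A Y' f p *: nabla X' Z p +
   (vapp A X' f p *: nabla Y' Z p + f p *: nabla X' (nabla Y' Z) p) + nabla X' (nabla Y' Z') p.
  move=> HX' HY'.
  have SY := smooth_vapp oU HY' F.
  rewrite (nabla_eqr HX' (HN _ _ HY' (vsmooth_comb oU F HZ HZ'))
    (_ : vsmooth_on A U (fun q => (vapp A Y' f q *: Z q + f q *: nabla Y' Z q) + nabla Y' Z' q))) //; last 2 first.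
  - apply: vsmooth_add => //; last exact: HN.
    by apply: vsmooth_comb => //; apply: vsmooth_scale => //; exact: HN.
  - by move=> q Uq; rewrite nablaDr // nablaZr.
  rewrite nablaDr //; last 2 first.
  - by apply: vsmooth_comb => //; apply: vsmooth_scale => //; exact: HN.
  - exact: HN.
  rewrite nablaDr //; last 2 first.
  - exact: vsmooth_scale.
  - by apply: vsmooth_scale => //; exact: HN.
  by rewrite !nablaZr //; exact: HN.
have HB := vsmooth_bracket oU HX HY.
rewrite /curvature (two _ _ HX HY) (two _ _ HY HX) nablaDr // nablaZr //.
rewrite (vapp_bracket oU Up HX HY F).
move: (vapp A X (vapp A Y f) p) (vapp A Y (vapp A X f) p) (vapp A X f p) (vapp A Y f p) (f p) (Z p)
  (nabla X Z p) (nabla Y Z p) (nabla X (nabla Y Z) p) (nabla Y (nabla X Z) p) (nabla X (nabla Y Z') p)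
  (nabla Y (nabla X Z') p) (nabla (bracket A X Y) Z p) (nabla (bracket A X Y) Z' p).
by clear=> *; apply/rowP => i; rewrite !mxE; ring.
Qed.

Lemma curvature_anti X Y Z p : vsmooth_on A U X -> vsmooth_on A U Y -> vsmooth_on A U Z -> U p ->
  curvature A nabla Y X Z p = - curvature A nabla X Y Z p.
Proof.
move=> HX HY HZ Up; have HB := vsmooth_bracket oU HX HY.
rewrite /curvature (_ : nabla (bracket A Y X) Z p = - nabla (bracket A X Y) Z p).
  move: (nabla Y (nabla X Z) p) (nabla X (nabla Y Z) p) (nabla (bracket A X Y) Z p) => a b c.
  by apply/rowP => i; rewrite !mxE; ring.
rewrite -(nablaNl HB HZ Up).
apply: (nabla_eql (vsmooth_bracket oU HY HX) (vsmooth_opp oU HB) HZ Up) => q _.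
exact: bracket_anti.
Qed.

Lemma curvature_combl f X X' Y Z p : smooth_on A U f -> vsmooth_on A U X -> vsmooth_on A U X' ->
  vsmooth_on A U Y -> vsmooth_on A U Z -> U p ->
  curvature A nabla (fun q => f q *: X q + X' q) Y Z p =
    f p *: curvature A nabla X Y Z p + curvature A nabla X' Y Z p.
Proof.
move=> F HX HX' HY HZ Up.
have HN X1 Y1 : vsmooth_on A U X1 -> vsmooth_on A U Y1 -> vsmooth_on A U (nabla X1 Y1).
  exact: nabla_smooth.
have HB X1 Y1 : vsmooth_on A U X1 -> vsmooth_on A U Y1 -> vsmooth_on A U (bracket A X1 Y1).
  exact: vsmooth_bracket.
have SY := smooth_vapp oU HY F.
have Hc := vsmooth_comb oU F HX HX'.
rewrite /curvature (nabla_combl F HX HX' (HN _ _ HY HZ) Up).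
have -> : nabla Y (nabla (fun q => f q *: X q + X' q) Z) p =
   vapp A Y f p *: nabla X Z p + f p *: nabla Y (nabla X Z) p + nabla Y (nabla X' Z) p.
  rewrite (nabla_eqr HY (HN _ _ Hc HZ) (vsmooth_comb oU F (HN _ _ HX HZ) (HN _ _ HX' HZ))) //.
    rewrite nablaDr // ?nablaZr //; [exact: HN|apply: vsmooth_scale => //; exact: HN|exact: HN].
  by move=> q Uq; rewrite nabla_combl.
have -> : nabla (bracket A (fun q => f q *: X q + X' q) Y) Z p =
   f p *: nabla (bracket A X Y) Z p + nabla (bracket A X' Y) Z p - vapp A Y f p *: nabla X Z p.
  have H1 : vsmooth_on A U (fun q => f q *: bracket A X Y q + bracket A X' Y q).
    by apply: vsmooth_comb => //; exact: HB.
  have H2 : vsmooth_on A U (fun q => - (vapp A Y f q *: X q)).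
    by apply: vsmooth_opp => //; exact: vsmooth_scale.
  rewrite (nabla_eql (HB _ _ Hc HY) (vsmooth_add oU H1 H2) HZ Up).
    rewrite (nablaDl H1 H2 HZ Up) (nabla_combl F (HB _ _ HX HY) (HB _ _ HX' HY) HZ Up).
    by rewrite (nablaNl (vsmooth_scale oU SY HX) HZ Up) (nablaZl SY HX HZ Up).
  by move=> q Uq; rewrite (bracket_comb oU Uq).
move: (nabla X (nabla Y Z) p) (nabla X' (nabla Y Z) p) (vapp A Y f p) (f p) (nabla X Z p)
  (nabla Y (nabla X Z) p) (nabla Y (nabla X' Z) p) (nabla (bracket A X Y) Z p) (nabla (bracket A X' Y) Z p).
by clear=> *; apply/rowP => i; rewrite !mxE; ring.
Qed.

Lemma curvature_eq X X' Y Y' Z Z' p : vsmooth_on A U X -> vsmooth_on A U X' ->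
  vsmooth_on A U Y -> vsmooth_on A U Y' -> vsmooth_on A U Z -> vsmooth_on A U Z' -> U p ->
  (forall q, U q -> X q = X' q) -> (forall q, U q -> Y q = Y' q) -> (forall q, U q -> Z q = Z' q) ->
  curvature A nabla X Y Z p = curvature A nabla X' Y' Z' p.
Proof.
move=> HX HX' HY HY' HZ HZ' Up EX EY EZ.
have HN X1 Y1 : vsmooth_on A U X1 -> vsmooth_on A U Y1 -> vsmooth_on A U (nabla X1 Y1).
  exact: nabla_smooth.
have EN X1 X2 Y1 Y2 : vsmooth_on A U X1 -> vsmooth_on A U X2 -> vsmooth_on A U Y1 -> vsmooth_on A U Y2 ->
   (forall q, U q -> X1 q = X2 q) -> (forall q, U q -> Y1 q = Y2 q) ->
   forall q, U q -> nabla X1 Y1 q = nabla X2 Y2 q.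
  move=> H1 H2 H3 H4 E1 E2 q Uq.
  by rewrite (nabla_eql H1 H2 H3 Uq E1) (nabla_eqr H2 H3 H4 Uq E2).
rewrite /curvature; congr (_ - _ - _).
- exact: (EN _ _ _ _ HX HX' (HN _ _ HY HZ) (HN _ _ HY' HZ') EX (EN _ _ _ _ HY HY' HZ HZ' EY EZ)).
- exact: (EN _ _ _ _ HY HY' (HN _ _ HX HZ) (HN _ _ HX' HZ') EY (EN _ _ _ _ HX HX' HZ HZ' EX EZ)).
- apply: (EN _ _ _ _ (vsmooth_bracket oU HX HY) (vsmooth_bracket oU HX' HY') HZ HZ' _ EZ) => //.
  by move=> q Uq; exact: (bracket_eq A oU Uq EX EY).
Qed.

End ConnectionRules.

(** * Smooth matrices, smooth coefficients, gluing of local smoothness *)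

Section SmoothMatrices.
Context (R : realType) (m : nat) (M : topologicalType).
Context (A : oriented_atlas R m M).
Local Notation C := R[i].
Variable U : set M.
Hypothesis oU : open U.

Lemma smooth_det N (F : 'I_N -> 'I_N -> M -> C) :
  (forall i j, smooth_on A U (F i j)) -> smooth_on A U (fun p => \det (\matrix_(i, j) F i j p)).
Proof.
move=> HF; rewrite /determinant; apply: smooth_sum => // s _.
apply: smooth_mul => //; first exact: smooth_cst.
apply: smooth_prod => // i _.
have E p : U p -> F i (perm.fun_of_perm s i) p = (\matrix_(i, j) F i j p) i (perm.fun_of_perm s i) by rewrite mxE.
exact (smooth_eq oU E (HF _ _)).
Qed.

Lemma smooth_invmx N (F : 'I_N -> 'I_N -> M -> C) i j :
  (forall i j, smooth_on A U (F i j)) -> (forall p, U p -> (\matrix_(i, j) F i j p) \in unitmx) ->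
  smooth_on A U (fun p => invmx (\matrix_(i, j) F i j p) i j).
Proof.
move=> HF HU.
apply: (@smooth_eq _ _ _ A U oU (fun p => (\det (\matrix_(i, j) F i j p))^-1 *
   cofactor (\matrix_(i, j) F i j p) j i)).
  by move=> p Up; rewrite /invmx HU // !mxE.
have S1 : smooth_on A U (fun p => (\det (\matrix_(i, j) F i j p))^-1).
  apply: (smooth_inv oU); last exact: smooth_det.
  by move=> p /HU; rewrite unitmxE unitfE.
apply: (smooth_mul oU S1); rewrite /cofactor.
apply: (smooth_mul oU); first exact: smooth_cst.
have S2 := smooth_det (F := fun a b => F (lift j a) (lift i b)) (fun a b => HF _ _).
apply: (smooth_eq oU _ S2) => p _.
by congr (\det _); apply/matrixP => a b; rewrite !mxE.
Qed.

Lemma vec0_chart c p (v : 'rV[C]_m) : charts A c -> cdom c p ->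
  (forall j, dtan A p v (ccoord c j) = 0) -> v = 0.
Proof.
move=> cc cp H; apply: (@vec_ext _ _ _ A p) => i; rewrite dtan0l.
set c' := chart_at A p.
have cc' := chart_at_charts A p : charts A c'; have cp' := chart_at_dom A p : cdom c' p.
rewrite (@dtan_chart _ _ _ A c (cdom c')) //.
- by rewrite big1 // => j _; rewrite H mul0r.
- exact: chart_open_dom cc'.
- exact: ckC_ccoord.
Qed.

Lemma sum_norm0 (N : nat) (x : 'I_N -> C) : \sum_j x j * conjc (x j) = 0 -> forall j, x j = 0.
Proof.
move=> H j.
have : \sum_j `|x j| ^+ 2 = 0 by rewrite -[RHS]H; apply: eq_bigr => k _; rewrite sqr_normc.
move/eqP; rewrite psumr_eq0; last by move=> k _; rewrite exprn_ge0.
by move=> /allP/(_ j); rewrite mem_index_enum => /(_ isT) /implyP/(_ isT); rewrite sqrf_eq0 normr_eq0 => /eqP.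
Qed.

End SmoothMatrices.

Section Coefficients.
Context (R : realType) (m : nat) (M : topologicalType).
Context (A : oriented_atlas R m M).
Local Notation C := R[i].
Variable U : set M.
Hypothesis oU : open U.

(* The coefficients solve a linear system whose matrix is the Gram matrix of the
   fields in a chart. *)
Lemma smooth_coeffs N (e : 'I_N -> vfield R m M) (a : 'I_N -> M -> C) :
  (forall k, vsmooth_on A U (e k)) ->
  (forall p, U p -> forall x : 'I_N -> C, \sum_k x k *: e k p = 0 -> forall k, x k = 0) ->
  vsmooth_on A U (fun p => \sum_k a k p *: e k p) -> forall k, smooth_on A U (a k).
Proof.
move=> He Hf HW k0; apply/smoothP => K; apply: ckC_local => c cc.
set V := U `&` cdom c.
have oV : open V by apply: openI => //; exact: chart_open_dom cc.
have VU : V `<=` U by move=> ? [].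
pose E k j := vapp A (e k) (ccoord c j).
have SE k j : smooth_on A V (E k j).
  by have := He k c cc j.
pose G k l p := \sum_j E k j p * conjc (E l j p).
have SG k l : smooth_on A V (G k l).
  by apply: smooth_sum => // j _; apply: smooth_mul => //; exact: smooth_conj.
(* A row killed by the Gram matrix gives a combination of the fields whose components have zero sum
   of squared moduli; the combination is then zero and independence kills the row. *)
have GU p : V p -> (\matrix_(k, l) G k l p) \in unitmx.
  move=> [Up cp]; rewrite -row_free_unit -kermx_eq0; apply/eqP/row_matrixP => i; rewrite row0.
  set K0 := kermx _; have : row i K0 *m (\matrix_(k, l) G k l p) = 0.
    by rewrite -row_mul mulmx_ker row0.
  move: (row i K0) => {K0} x x0.
  have Z : \sum_k x 0 k *: e k p = 0.
    apply: (vec0_chart cc cp) => j; rewrite dtan_suml.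
    under eq_bigr do rewrite dtanZl.
    apply: (sum_norm0 (x := fun j => \sum_k x 0 k * dtan A p (e k p) (ccoord c j))) => {j}.
    transitivity ((x *m (\matrix_(k, l) G k l p) *m (\col_l conjc (x 0 l))) 0 0); last first.
      by rewrite x0 mul0mx mxE.
    rewrite mxE; under eq_bigr do rewrite rmorph_sum mulr_sumr.
    rewrite exchange_big; apply: eq_bigr => l _; rewrite !mxE mulr_suml.
    under eq_bigr do rewrite mulr_suml.
    rewrite exchange_big; apply: eq_bigr => k _; rewrite mxE /G mulr_sumr mulr_suml.
    apply: eq_bigr => j _; rewrite rmorphM /E !vappE.
    by rewrite -!mulrA; congr (_ * (_ * _)); exact: mulrC.
  by apply/rowP => k; rewrite (Hf p Up _ Z k) mxE.
pose W j := vapp A (fun p => \sum_k a k p *: e k p) (ccoord c j).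
have SW j : smooth_on A V (W j) by have := HW c cc j.
pose y l p := \sum_j W j p * conjc (E l j p).
have Sy l : smooth_on A V (y l).
  by apply: smooth_sum => // j _; apply: smooth_mul => //; exact: smooth_conj.
(* The pairings [y] of the field with the [e l] are the row of coefficients times the Gram matrix.
   Hence the coefficients are [y] times its inverse, which is smooth by Cramer's formula. *)
apply: (@ckC_eq _ _ _ _ _ _ (fun p => \sum_l y l p * invmx (\matrix_(k, l) G k l p) l k0) _ oV).
  move=> p Vp.
  have -> : a k0 p = (\row_k a k p) 0 k0 by rewrite mxE.
  have -> : \row_k a k p = (\row_l y l p) *m invmx (\matrix_(k, l) G k l p).
    rewrite -[LHS](mulmxK (GU p Vp)); congr (_ *m _); apply/rowP => l; rewrite !mxE.
    under eq_bigr do rewrite !mxE /G mulr_sumr.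
    rewrite exchange_big; apply: eq_bigr => j _; rewrite /W vapp_suml mulr_suml.
    by apply: eq_bigr => k _; rewrite vapp_scale mulrA.
  by rewrite mxE; apply: eq_bigr => l _; rewrite mxE.
apply: smooth_ckC; apply: smooth_sum => // l _; apply: smooth_mul => //.
exact: (smooth_invmx oV).
Qed.
End Coefficients.

Section SmoothLocal.
Context (R : realType).

Lemma Ck_local m k (V : set 'rV[R]_m) f :
  (forall x, V x -> exists2 W, open W /\ W x & Ck_on k (V `&` W) f) -> Ck_on k V f.
Proof.
elim: k f => [|k IH] f H.
  split => // x; rewrite inE => Vx; have [W [oW Wx] HW] := H x Vx.
  exact: (Ck_cont HW).
split=> [x|i].
  rewrite inE => Vx; have [W [oW Wx] HW] := H x Vx.
  exact: (Ck_cont HW).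
split=> [x Vx|].
  have [W [oW Wx] HW] := H x Vx; case: (Ck_derivable i HW (x := x)) => //.
apply: IH => x Vx; have [W WW HW] := H x Vx; exists W => //.
exact: (Ck_derive i HW).
Qed.

Context (m : nat) (M : topologicalType) (A : oriented_atlas R m M).

Lemma ckM_pointwise k (U : set M) (f : M -> R) :
  (forall p, U p -> exists2 W, open W /\ W p & ckM A k (U `&` W) f) -> ckM A k U f.
Proof.
move=> H c cc; apply: Ck_local => _ [p [Up cp] <-]; have [W [oW Wp] HW] := H p Up.
exists (cmap c @` (W `&` cdom c)).
  by split; [exact: (open_chart_image cc oW)|exists p].
apply: (Ck_sub _ (HW c cc)) => _ [[q [Uq cq] <-] [r [Wr cr] E]]; exists q => //; split=> //; split=> //.
by rewrite -(@cmapK _ _ _ A _ _ cc cq) -E (@cmapK _ _ _ A _ _ cc cr).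
Qed.

Lemma smooth_pointwise (U : set M) (f : M -> R[i]) :
  (forall p, U p -> exists2 W, open W /\ W p & smooth_on A (U `&` W) f) -> smooth_on A U f.
Proof.
move=> H; apply/smoothP => k; split; apply: ckM_pointwise => p /H[W WW /smoothP/(_ k)[H1 H2]];
  by exists W.
Qed.

Lemma vsmooth_pointwise (U : set M) (X : vfield R m M) :
  (forall p, U p -> exists2 W, open W /\ W p & vsmooth_on A (U `&` W) X) -> vsmooth_on A U X.
Proof.
move=> H c cc i; apply: smooth_pointwise => p [Up cp]; have [W WW HW] := H p Up.
by exists W => //; have := HW c cc i; rewrite setIAC.
Qed.

End SmoothLocal.

(** Sasakian is the usual name of a strictly pseudoconvex pseudohermitian manifold whose Webster
    torsion vanishes. *)
Record sasakian (R : realType) (n : nat) (M : topologicalType) (A : oriented_atlas R n.*2.+1 M)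
    (T10 : M -> {vspace 'rV[R[i]]_(n.*2.+1)}) (theta : form1 R n.*2.+1 M)
    (T : vfield R n.*2.+1 M)
    (nabla : vfield R n.*2.+1 M -> vfield R n.*2.+1 M -> vfield R n.*2.+1 M) : Prop := Sasakian {
  sas_cr : cr_structure A T10;
  sas_smooth : form1_smooth A theta;
  sas_ann : annihilates_T10 T10 theta;
  sas_spc : strictly_pseudoconvex A T10 theta;
  sas_reeb : reeb_field A theta T;
  sas_tw : tanaka_webster A T10 theta T nabla;
  sas_tor : torsion_free A T10 theta T nabla }.

(** * Pseudohermitian geometry *)

Section LeviForm.
Context (R : realType) (n : nat) (M : topologicalType) (A : oriented_atlas R n.*2.+1 M).
Context (T10 : M -> {vspace 'rV[R[i]]_(n.*2.+1)}) (theta : form1 R n.*2.+1 M).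
Context (T : vfield R n.*2.+1 M).
Context (nabla : vfield R n.*2.+1 M -> vfield R n.*2.+1 M -> vfield R n.*2.+1 M).
Hypothesis S : sasakian A T10 theta T nabla.
Local Notation C := R[i].
Local Notation vfield := (vfield R n.*2.+1 M).
Local Notation sec := (section_on A T10).
Local Notation lv := (levi A theta).
Implicit Types (p q : M) (X Y W : vfield) (f : M -> C).

Section LocalRules.
Variable U : set M.
Hypothesis oU : open U.

Implicit Types (Z : vfield).

Lemma sec_smooth Z : sec U Z -> vsmooth_on A U Z. Proof. by case. Qed.

Lemma sec_mem Z p : sec U Z -> U p -> Z p \in T10 p. Proof. by case=> _; exact. Qed.

Lemma sec_sub V Z : V `<=` U -> sec U Z -> sec V Z.
Proof. by move=> VU [Zs Zm]; split=> [|p /VU]; [exact: vsmooth_sub Zs|exact: Zm]. Qed.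

Lemma sec_eq Z Z' : (forall p, U p -> Z p = Z' p) -> sec U Z -> sec U Z'.
Proof.
move=> E [Zs Zm]; split; first exact: (vsmooth_eq oU E Zs).
by move=> p Up; rewrite -E //; exact: Zm.
Qed.

Lemma sec_comb f Z Z' : smooth_on A U f -> sec U Z -> sec U Z' ->
  sec U (fun p => f p *: Z p + Z' p).
Proof.
move=> fs [Zs Zm] [Zs' Zm']; split; first exact: vsmooth_comb.
by move=> p Up; rewrite memvD ?memvZ ?Zm ?Zm'.
Qed.

Lemma sec_scale f Z : smooth_on A U f -> sec U Z -> sec U (fun p => f p *: Z p).
Proof.
move=> fs [Zs Zm]; split; first exact: vsmooth_scale.
by move=> p Up; rewrite memvZ ?Zm.
Qed.

Lemma sec_add Z Z' : sec U Z -> sec U Z' -> sec U (fun p => Z p + Z' p).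
Proof.
move=> [Zs Zm] [Zs' Zm']; split; first exact: vsmooth_add.
by move=> p Up; rewrite memvD ?Zm ?Zm'.
Qed.

Lemma sec_sum (I : Type) (r : seq I) (P : pred I) (Z : I -> vfield) :
  (forall i, P i -> sec U (Z i)) -> sec U (fun p => \sum_(i <- r | P i) Z i p).
Proof.
move=> H; split; first by apply: vsmooth_sum => // i /H[].
by move=> p Up; apply: memv_suml => i /H[_]; exact.
Qed.

Lemma sec_nabla X Z : vsmooth_on A U X -> sec U Z -> sec U (nabla X Z).
Proof. by move=> Xs Zs; case: (sas_tw S) => _ /(_ U oU)[_ _ H _ _]; exact: H. Qed.

Lemma sec_bracket Z W : sec U Z -> sec U W -> sec U (bracket A Z W).
Proof. by case: (sas_cr S) => _ _ H; exact: H. Qed.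

Lemma pair1_sec Z p : sec U Z -> U p -> pair1 theta Z p = 0.
Proof. by move=> [_ Zm] Up; apply: (sas_ann S); exact: Zm. Qed.

Lemma pair1_secJ Z p : sec U Z -> U p -> pair1 theta (conjf Z) p = 0.
Proof. by move=> Zs Up; rewrite pair1_conj (pair1_sec Zs Up) conjc0. Qed.

Lemma pair1_smooth X : vsmooth_on A U X -> smooth_on A U (pair1 theta X).
Proof. exact: (sas_smooth S oU). Qed.

(** [theta] vanishes on both arguments along all of [U], so of the three terms of [dform] only the
    bracket survives. *)
Lemma leviE Z W p : sec U Z -> sec U W -> U p ->
  lv Z W p = - pair1 theta (bracket A Z (conjf W)) p / (2%:R * 'i%C).
Proof.
move=> Zs Ws Up; rewrite /levi /dform.
rewrite (vapp_eq A oU Up Z (fun q Uq => pair1_secJ Ws Uq)) vapp_cst.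
rewrite (vapp_eq A oU Up (conjf W) (fun q Uq => pair1_sec Zs Uq)) vapp_cst.
by rewrite subr0 sub0r.
Qed.

Lemma levi_smooth Z W : sec U Z -> sec U W -> smooth_on A U (lv Z W).
Proof.
move=> Zs Ws; have Zv := sec_smooth Zs; have Wv := vsmooth_conj oU (sec_smooth Ws).
apply: (@smooth_eq _ _ _ A U oU
  (fun p => - pair1 theta (bracket A Z (conjf W)) p * (2%:R * 'i%C)^-1)).
  by move=> p Up; rewrite (leviE Zs Ws Up).
apply: (smooth_mul oU); last exact: smooth_cst.
by apply: (smooth_opp oU); apply: pair1_smooth; exact: vsmooth_bracket.
Qed.

(** Exchanging the two fields conjugates the bracket up to a sign, [theta] being real; conjugating
    [2 sqrt(-1)] gives a second sign, and the two cancel. *)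
Lemma levi_hermitian Z W p : sec U Z -> sec U W -> U p -> lv W Z p = conjc (lv Z W p).
Proof.
move=> Zs Ws Up; rewrite (leviE Zs Ws Up) (leviE Ws Zs Up).
have -> : pair1 theta (bracket A W (conjf Z)) p =
    - conjc (pair1 theta (bracket A Z (conjf W)) p).
  rewrite -pair1_conj -pair1N; apply: pair1_ext.
  rewrite [LHS]bracket_anti; congr (- _).
  rewrite -[RHS]/(conjv (bracket A Z (conjf W) p)).
  rewrite -(bracket_conj oU Up) ?conjfK //; last exact: (vsmooth_conj oU (sec_smooth Ws)).
  exact: (sec_smooth Zs).
move: (pair1 _ _ _) => x.
have E : conjc (2%:R * 'i%C : C) = - (2%:R * 'i%C).
  by apply/eqP; rewrite eq_complex /=; apply/andP; split; apply/eqP; ring.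
move: (2%:R * 'i%C) E => y E; rewrite opprK rmorphM fmorphV [X in _ = _ * X^-1]E rmorphN.
by rewrite invrN mulrNN.
Qed.

(** The derivative of [f] produced by the bracket multiplies [Z], which [theta] kills: the form is
    linear over functions although it is defined by derivatives. *)
Lemma levi_combl f Z Z' W p : smooth_on A U f -> sec U Z -> sec U Z' -> sec U W -> U p ->
  lv (fun q => f q *: Z q + Z' q) W p = f p * lv Z W p + lv Z' W p.
Proof.
move=> fs Zs Zs' Ws Up; have Wv := vsmooth_conj oU (sec_smooth Ws).
rewrite (leviE (sec_comb fs Zs Zs') Ws Up) (leviE Zs Ws Up) (leviE Zs' Ws Up).
have -> : pair1 theta (bracket A (fun q => f q *: Z q + Z' q) (conjf W)) p =
    f p * pair1 theta (bracket A Z (conjf W)) p + pair1 theta (bracket A Z' (conjf W)) p.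
  pose B1 := bracket A Z (conjf W); pose B2 := bracket A Z' (conjf W).
  rewrite (pair1_ext theta (Y := fun q => f q *: B1 q + (B2 q + - (vapp A (conjf W) f q *: Z q))));
    last by rewrite (bracket_comb oU Up fs (sec_smooth Zs) (sec_smooth Zs') Wv) addrA.
  by rewrite pair1D pair1Z pair1D pair1N pair1Z (pair1_sec Zs Up) mulr0 oppr0 addr0.
move: (pair1 _ _ _) (pair1 _ _ _) => x y.
by rewrite opprD mulrDl -mulrN mulrA.
Qed.

Lemma levi_eq Z Z' W W' p : U p -> sec U Z -> sec U W -> (forall q, U q -> Z q = Z' q) ->
  (forall q, U q -> W q = W' q) -> lv Z W p = lv Z' W' p.
Proof.
move=> Up Zs Ws EZ EW; have Zs' := sec_eq EZ Zs; have Ws' := sec_eq EW Ws.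
rewrite (leviE Zs Ws Up) (leviE Zs' Ws' Up).
have E : bracket A Z (conjf W) p = bracket A Z' (conjf W') p.
  by apply: (bracket_eq _ oU Up EZ) => q Uq; rewrite /conjf EW.
by rewrite (pair1_ext theta E).
Qed.

Lemma levi0l W p : sec U W -> U p -> lv (fun=> 0) W p = 0.
Proof.
move=> Ws Up; have Zs : sec U (fun=> 0).
  by split=> [|q _]; [exact: vsmooth0|exact: mem0v].
have := levi_combl (smooth_cst A oU 1) Zs Zs Ws Up.
rewrite (@levi_eq _ (fun=> 0) _ W p Up (sec_comb (smooth_cst A oU 1) Zs Zs) Ws) //; last first.
  by move=> q _; rewrite scaler0 addr0.
by rewrite mul1r => /eqP; rewrite addrC -subr_eq subrr => /eqP <-.
Qed.

Lemma levi_suml (I : Type) (r : seq I) (a : I -> M -> C) (Z : I -> vfield) W p :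
  (forall i, smooth_on A U (a i)) -> (forall i, sec U (Z i)) -> sec U W -> U p ->
  lv (fun q => \sum_(i <- r) a i q *: Z i q) W p = \sum_(i <- r) a i p * lv (Z i) W p.
Proof.
move=> Ha HZ Ws Up.
have Hs r' : sec U (fun q => \sum_(i <- r') a i q *: Z i q).
  by apply: sec_sum => i _; exact: sec_scale.
elim: r => [|i r IH].
  rewrite big_nil -(levi0l Ws Up); apply: (levi_eq Up (Hs [::]) Ws) => // q _.
  by rewrite big_nil.
rewrite big_cons -IH -(levi_combl (Ha i) (HZ i) (Hs r) Ws Up).
by apply: (levi_eq Up (Hs (i :: r)) Ws) => // q _; rewrite big_cons.
Qed.

End LocalRules.

Lemma framePt p : exists U Z, U p /\ local_frame A T10 U Z.
Proof. by case: (sas_cr S). Qed.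

Section InFrame.
Variables (U : set M) (Z : 'I_n -> vfield).
Hypothesis frZ : local_frame A T10 U Z.

Lemma frame_open : open U. Proof. by case: frZ. Qed.
Let oU := frame_open.

Lemma frame_mem k p : U p -> Z k p \in T10 p.
Proof.
case: frZ => _ _ H /H/andP[/eqP <- _]; apply: memv_span.
by apply/tnthP; exists k; rewrite tnth_mktuple.
Qed.

Lemma frame_sec k : sec U (Z k).
Proof. by split=> [|p]; [case: frZ|exact: frame_mem]. Qed.

Lemma frame_exp p v : U p -> v \in T10 p -> v = \sum_k coframe Z k p v *: Z k p.
Proof.
case: frZ => _ _ H /H b vT; rewrite {1}(coord_basis b vT).
by apply: eq_bigr => i _; rewrite /coframe -tnth_nth tnth_mktuple.
Qed.

Lemma coframe_sum p (x : 'I_n -> C) k : U p -> coframe Z k p (\sum_l x l *: Z l p) = x k.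
Proof.
case: frZ => _ _ H /H/andP[_ fr]; rewrite /coframe.
rewrite -[RHS](coord_sum_free x k fr); congr (coord _ _ _); apply: eq_bigr => i _.
by rewrite -tnth_nth tnth_mktuple.
Qed.

Lemma frame_free p (x : 'I_n -> C) : U p -> \sum_k x k *: Z k p = 0 -> forall k, x k = 0.
Proof. by move=> Up E k; rewrite -(coframe_sum x k Up) E /coframe linear0. Qed.

Lemma coframe_smooth V W k : open V -> V `<=` U -> sec V W ->
  smooth_on A V (fun p => coframe Z k p (W p)).
Proof.
move=> oV VU Ws.
apply: (smooth_coeffs oV (e := Z) (a := fun k p => coframe Z k p (W p))).
- by move=> l; exact: (vsmooth_sub VU (sec_smooth (frame_sec l))).
- by move=> p /VU Up x; exact: frame_free.
- apply: (vsmooth_eq oV _ (sec_smooth Ws)) => p Vp.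
  by apply: frame_exp; [exact: VU|exact: (sec_mem Ws)].
Qed.

(** Consequently the form depends only on the values of the two sections at [p]; this is what allows
    it to be read on single vectors later. *)
Lemma levi_frame V W W' p : open V -> V `<=` U -> sec V W -> sec V W' -> V p ->
  lv W W' p = \sum_k \sum_l hmat A theta Z p k l * coframe Z k p (W p) * conjc (coframe Z l p (W' p)).
Proof.
move=> oV VU Ws Ws' Vp.
have HZ k : sec V (Z k) by exact: sec_sub VU (frame_sec k).
have E (Y : vfield) : sec V Y -> forall q, V q -> Y q = \sum_k coframe Z k q (Y q) *: Z k q.
  by move=> Ys q Vq; apply: frame_exp; [exact: VU|exact: (sec_mem Ys)].
have cs (Y : vfield) k : sec V Y -> smooth_on A V (fun q => coframe Z k q (Y q)).
  exact: coframe_smooth.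
rewrite (levi_eq oV Vp Ws Ws' (E _ Ws) (fun q _ => erefl _)).
rewrite (levi_suml oV _ (fun k => cs _ k Ws) HZ Ws' Vp); apply: eq_bigr => k _.
rewrite (levi_hermitian oV Ws' (HZ k) Vp).
rewrite (levi_eq oV Vp Ws' (HZ k) (E _ Ws') (fun q _ => erefl _)).
rewrite (levi_suml oV _ (fun k => cs _ k Ws') HZ (HZ k) Vp) rmorph_sum mulr_sumr.
apply: eq_bigr => l _; rewrite rmorphM /= -(levi_hermitian oV (HZ l) (HZ k) Vp) mxE.
by move: (coframe _ _ _ _) (conjc _) (lv _ _ _) => a b c; ring.
Qed.

End InFrame.

End LeviForm.

(** * Torsion and curvature under vanishing Webster torsion *)

Section Geometry.
Context (R : realType) (n : nat) (M : topologicalType) (A : oriented_atlas R n.*2.+1 M).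
Context (T10 : M -> {vspace 'rV[R[i]]_(n.*2.+1)}) (theta : form1 R n.*2.+1 M).
Context (T : vfield R n.*2.+1 M).
Context (nabla : vfield R n.*2.+1 M -> vfield R n.*2.+1 M -> vfield R n.*2.+1 M).
Hypothesis S : sasakian A T10 theta T nabla.
Local Notation C := R[i].
Local Notation vfield := (vfield R n.*2.+1 M).
Local Notation sec := (section_on A T10).
Local Notation lv := (levi A theta).
Local Notation Tor := (torsion A nabla).
Local Notation Rm := (curvature A nabla).
Local Notation vsm := (vsmooth_on A).
Implicit Types (p q : M) (X Y Z W : vfield) (f : M -> C).

Let hc : connection A nabla := proj1 (sas_tw S).

Section LocalGeometry.
Variable U : set M.
Hypothesis oU : open U.

Lemma sec0 : sec U (fun=> 0).
Proof. by split=> [|q _]; [exact: vsmooth0|exact: mem0v]. Qed.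

Lemma sec_opp Z : sec U Z -> sec U (fun p => - Z p).
Proof.
by case=> Zs Zm; split=> [|p Up]; [exact: vsmooth_opp|rewrite memvN Zm].
Qed.

Lemma levi_addl Z Z' W p : sec U Z -> sec U Z' -> sec U W -> U p ->
  lv (fun q => Z q + Z' q) W p = lv Z W p + lv Z' W p.
Proof.
move=> Zs Zs' Ws Up; have := levi_combl S oU (smooth_cst A oU 1) Zs Zs' Ws Up.
rewrite mul1r => <-; apply: (levi_eq S oU Up (sec_add oU Zs Zs') Ws) => // q _.
by rewrite scale1r.
Qed.

Lemma levi_oppl Z W p : sec U Z -> sec U W -> U p -> lv (fun q => - Z q) W p = - lv Z W p.
Proof.
move=> Zs Ws Up; have := levi_combl S oU (smooth_cst A oU (-1)) Zs sec0 Ws Up.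
rewrite (levi0l S oU Ws Up) addr0 mulN1r => <-.
by apply: (levi_eq S oU Up (sec_opp Zs) Ws) => // q _; rewrite scaleN1r addr0.
Qed.

Lemma levi_scalel f Z W p : smooth_on A U f -> sec U Z -> sec U W -> U p ->
  lv (fun q => f q *: Z q) W p = f p * lv Z W p.
Proof.
move=> fs Zs Ws Up; have := levi_combl S oU fs Zs sec0 Ws Up.
rewrite (levi0l S oU Ws Up) addr0 => <-.
by apply: (levi_eq S oU Up (sec_scale oU fs Zs) Ws) => // q _; rewrite addr0.
Qed.

Lemma levi_addr Z W W' p : sec U Z -> sec U W -> sec U W' -> U p ->
  lv Z (fun q => W q + W' q) p = lv Z W p + lv Z W' p.
Proof.
move=> Zs Ws Ws' Up; rewrite (levi_hermitian S oU (sec_add oU Ws Ws') Zs Up).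
rewrite levi_addl // rmorphD.
by rewrite (levi_hermitian S oU Ws Zs Up) (levi_hermitian S oU Ws' Zs Up).
Qed.

Lemma levi_oppr Z W p : sec U Z -> sec U W -> U p -> lv Z (fun q => - W q) p = - lv Z W p.
Proof.
move=> Zs Ws Up; rewrite (levi_hermitian S oU (sec_opp Ws) Zs Up).
by rewrite levi_oppl // rmorphN (levi_hermitian S oU Ws Zs Up).
Qed.

Lemma levi_scaler f Z W p : smooth_on A U f -> sec U Z -> sec U W -> U p ->
  lv Z (fun q => f q *: W q) p = conjc (f p) * lv Z W p.
Proof.
move=> fs Zs Ws Up; rewrite (levi_hermitian S oU (sec_scale oU fs Ws) Zs Up).
by rewrite levi_scalel // rmorphM (levi_hermitian S oU Ws Zs Up).
Qed.

Lemma levi_ge0 Z p : sec U Z -> U p -> 0 <= lv Z Z p.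
Proof.
move=> Zs Up; have [Z0|Z0] := eqVneq (Z p) 0; last by apply/ltW/(sas_spc S oU).
have [V [F [Vp frF]]] := framePt S p; have oV := frame_open frF.
have oW : open (U `&` V) by exact: openI.
have WU : U `&` V `<=` U by move=> ? [].
have WV : U `&` V `<=` V by move=> ? [].
rewrite (levi_frame S frF oW WV (sec_sub WU Zs) (sec_sub WU Zs) (conj Up Vp)) Z0.
rewrite big1 // => k _; rewrite big1 // => l _.
by rewrite (_ : coframe F k p 0 = 0) ?mulr0 ?mul0r //; exact: linear0.
Qed.

Lemma levi_eq0 Z p : sec U Z -> U p -> lv Z Z p = 0 -> Z p = 0.
Proof.
move=> Zs Up E; apply/eqP; apply: contraT => Z0.
by have := sas_spc S oU Zs Up Z0; rewrite E ltxx.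
Qed.

Lemma nabla_conj X Y p : vsm U X -> vsm U Y -> U p ->
  nabla (conjf X) (conjf Y) p = conjv (nabla X Y p).
Proof. by move=> Xs Ys Up; case: (sas_tw S) => _ /(_ U oU)[H _ _ _ _]; exact: H. Qed.

Lemma nabla_conjr X Y p : vsm U X -> vsm U Y -> U p ->
  nabla X (conjf Y) p = conjv (nabla (conjf X) Y p).
Proof.
move=> Xs Ys Up; rewrite -(nabla_conj (vsmooth_conj oU Xs) Ys Up).
by rewrite conjfK.
Qed.

Lemma nablaT X p : vsm U X -> U p -> nabla X T p = 0.
Proof. by move=> Xs Up; case: (sas_tw S) => _ /(_ U oU)[_ H _ _ _]; exact: H. Qed.

Lemma levi_nabla X Z W p : vsm U X -> sec U Z -> sec U W -> U p ->
  vapp A X (lv Z W) p = lv (nabla X Z) W p + lv Z (nabla (conjf X) W) p.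
Proof.
by move=> Xs Zs Ws Up; case: (sas_tw S) => _ /(_ U oU)[_ _ _ H _]; exact: H.
Qed.

Lemma tor20 Z W p : sec U Z -> sec U W -> U p -> Tor Z W p = 0.
Proof.
by move=> Zs Ws Up; case: (sas_tw S) => _ /(_ U oU)[_ _ _ _ H]; case: (H Z W Zs Ws p Up).
Qed.

Lemma tor11 Z W p : sec U Z -> sec U W -> U p ->
  Tor Z (conjf W) p = (2%:R * 'i%C * lv Z W p) *: T p.
Proof.
by move=> Zs Ws Up; case: (sas_tw S) => _ /(_ U oU)[_ _ _ _ H]; case: (H Z W Zs Ws p Up).
Qed.

Lemma reeb_smooth : vsm U T.
Proof. by case: (sas_reeb S) => Ts _ _ _; exact: vsmooth_sub Ts. Qed.
Let Ts := reeb_smooth.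

Lemma reeb_real p : conjv (T p) = T p.
Proof. by case: (sas_reeb S). Qed.

Lemma conjf_reeb : conjf T = T.
Proof. by apply/funext => p; exact: reeb_real. Qed.

Lemma theta_reeb p : pair1 theta T p = 1.
Proof. by case: (sas_reeb S). Qed.

Lemma torsion_smooth X Y : vsm U X -> vsm U Y -> vsm U (Tor X Y).
Proof.
move=> Xs Ys; apply: (vsmooth_add oU); last exact: (vsmooth_opp oU (vsmooth_bracket oU Xs Ys)).
by apply: (vsmooth_add oU (nabla_smooth hc oU Xs Ys)); exact: (vsmooth_opp oU (nabla_smooth hc oU Ys Xs)).
Qed.

Lemma sec_torT Z : sec U Z -> sec U (conjf (Tor T Z)).
Proof.
move=> Zs; split; first by apply: vsmooth_conj => //; exact: torsion_smooth Ts (sec_smooth Zs).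
move=> p Up; case: (sas_tw S) => _ /(_ U oU)[_ _ _ _ H].
by case: (H Z Z Zs Zs p Up).
Qed.

Lemma torsion_conj X Y p : vsm U X -> vsm U Y -> U p ->
  Tor (conjf X) (conjf Y) p = conjv (Tor X Y p).
Proof.
move=> Xs Ys Up; rewrite /torsion !nabla_conj // (bracket_conj oU Up Xs Ys).
by rewrite !conjvB.
Qed.

Definition thv p (v : 'rV[C]_(n.*2.+1)) : C := \sum_i v 0 i * (theta p 0 i)%:C.

Lemma thvD p v w : thv p (v + w) = thv p v + thv p w.
Proof. by rewrite /thv -big_split; apply: eq_bigr => i _; rewrite mxE mulrDl. Qed.
Lemma thvN p v : thv p (- v) = - thv p v.
Proof. by rewrite /thv -sumrN; apply: eq_bigr => i _; rewrite mxE mulNr. Qed.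
Lemma thvZ p a v : thv p (a *: v) = a * thv p v.
Proof. by rewrite /thv mulr_sumr; apply: eq_bigr => i _; rewrite mxE mulrA. Qed.
Lemma thv10 p v : v \in T10 p -> thv p v = 0.
Proof. by move=> H; exact: (sas_ann S (Z := fun=> v)). Qed.
Lemma thvJ p v : thv p (conjv v) = conjc (thv p v).
Proof. exact: (pair1_conj theta (fun=> v)). Qed.
Lemma thv01 p v : conjv v \in T10 p -> thv p v = 0.
Proof. by move=> /thv10; rewrite thvJ => /(congr1 (@conjc R)); rewrite conjcK conjc0. Qed.
Lemma thvT p : thv p (T p) = 1.
Proof. exact: theta_reeb. Qed.

Lemma nabla_mem X Z p : vsm U X -> sec U Z -> U p -> nabla X Z p \in T10 p.
Proof. by move=> Xs Zs; exact: (sec_mem (sec_nabla S oU Xs Zs)). Qed.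

Lemma thv_nabla X Z p : vsm U X -> sec U Z -> U p -> thv p (nabla X Z p) = 0.
Proof. by move=> Xs Zs Up; apply: thv10; exact: nabla_mem. Qed.

Lemma thv_nablaJ X Z p : vsm U X -> sec U (conjf Z) -> U p -> thv p (nabla X Z p) = 0.
Proof.
move=> Xs Zs Up; rewrite -[Z]conjfK (nabla_conjr Xs (sec_smooth Zs) Up) thvJ.
by rewrite thv_nabla ?conjc0 //; exact: vsmooth_conj.
Qed.

Lemma sec_curvature X Y W : vsm U X -> vsm U Y -> sec U W -> sec U (Rm X Y W).
Proof.
move=> Xs Ys Ws; apply: (sec_add oU (Z := fun p => nabla X (nabla Y W) p - nabla Y (nabla X W) p)).
  apply: (sec_add oU (Z := nabla X (nabla Y W)) (Z' := fun p => - nabla Y (nabla X W) p)).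
    exact: (sec_nabla S oU Xs (sec_nabla S oU Ys Ws)).
  exact: (sec_opp (sec_nabla S oU Ys (sec_nabla S oU Xs Ws))).
exact: (sec_opp (sec_nabla S oU (vsmooth_bracket oU Xs Ys) Ws)).
Qed.

Lemma thv_curvature X Y W p : vsm U X -> vsm U Y -> sec U W -> U p -> thv p (Rm X Y W p) = 0.
Proof. by move=> Xs Ys Ws Up; apply: thv10; exact: (sec_mem (sec_curvature Xs Ys Ws)). Qed.

Lemma torsionE X Y p : Tor X Y p = nabla X Y p - nabla Y X p - bracket A X Y p.
Proof. by []. Qed.
Lemma curvatureE X Y W p :
  Rm X Y W p = nabla X (nabla Y W) p - nabla Y (nabla X W) p - nabla (bracket A X Y) W p.
Proof. by []. Qed.
#[local] Opaque torsion curvature levi bracket.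

Let V0 : vsm U (fun=> 0).
Proof. exact: vsmooth0. Qed.

Lemma torsion0l X p : vsm U X -> U p -> Tor (fun=> 0) X p = 0.
Proof.
move=> Xs Up; have := torsion_combl hc oU (smooth_cst A oU 1) V0 V0 Xs Up.
have -> : Tor (fun q => 1 *: 0 + 0) X p = Tor (fun=> 0) X p.
  congr (Tor _ X p); apply/funext => q; by rewrite scaler0 addr0.
by move/eqP; rewrite scale1r addrC -subr_eq subrr => /eqP <-.
Qed.

Lemma torsionDl X X' Y p : vsm U X -> vsm U X' -> vsm U Y -> U p ->
  Tor (fun q => X q + X' q) Y p = Tor X Y p + Tor X' Y p.
Proof.
move=> Xs Xs' Ys Up; have := torsion_combl hc oU (smooth_cst A oU 1) Xs Xs' Ys Up.
have -> : Tor (fun q => 1 *: X q + X' q) Y p = Tor (fun q => X q + X' q) Y p.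
  congr (Tor _ Y p); apply/funext => q; by rewrite scale1r.
by rewrite scale1r.
Qed.

Lemma torsionZl f X Y p : smooth_on A U f -> vsm U X -> vsm U Y -> U p ->
  Tor (fun q => f q *: X q) Y p = f p *: Tor X Y p.
Proof.
move=> fs Xs Ys Up; have := torsion_combl hc oU fs Xs V0 Ys Up.
have -> : Tor (fun q => f q *: X q + 0) Y p = Tor (fun q => f q *: X q) Y p.
  congr (Tor _ Y p); apply/funext => q; by rewrite addr0.
by rewrite (torsion0l Ys Up) addr0.
Qed.

Lemma torsionDr X Y Y' p : vsm U X -> vsm U Y -> vsm U Y' -> U p ->
  Tor X (fun q => Y q + Y' q) p = Tor X Y p + Tor X Y' p.
Proof.
move=> Xs Ys Ys' Up; rewrite (torsion_anti _ _ (fun q => Y q + Y' q) X) torsionDl //.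
by rewrite opprD (torsion_anti _ _ Y X) (torsion_anti _ _ Y' X).
Qed.

Lemma torsionZr f X Y p : smooth_on A U f -> vsm U X -> vsm U Y -> U p ->
  Tor X (fun q => f q *: Y q) p = f p *: Tor X Y p.
Proof.
move=> fs Xs Ys Up; rewrite (torsion_anti _ _ (fun q => f q *: Y q) X) torsionZl //.
by rewrite (torsion_anti _ _ Y X) scalerN.
Qed.

Lemma torsionNr X Y p : vsm U X -> vsm U Y -> U p -> Tor X (fun q => - Y q) p = - Tor X Y p.
Proof.
move=> Xs Ys Up; rewrite -scaleN1r -(torsionZr (smooth_cst A oU (-1)) Xs Ys Up).
congr (Tor X _ p); apply/funext => q; by rewrite scaleN1r.
Qed.

(** With the bracket replaced by covariant derivatives and torsion, the right side of [bianchi] can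
    be evaluated from the torsion axioms alone. *)
Lemma torsion_bracket X Y Z p : vsm U X -> vsm U Y -> vsm U Z -> U p ->
  Tor X (bracket A Y Z) p = Tor X (nabla Y Z) p - Tor X (nabla Z Y) p - Tor X (Tor Y Z) p.
Proof.
move=> Xs Ys Zs Up.
have N1 := nabla_smooth hc oU Ys Zs; have N2 := nabla_smooth hc oU Zs Ys.
have N3 := torsion_smooth Ys Zs.
pose Q : vfield := fun q => (nabla Y Z q + - nabla Z Y q) + - Tor Y Z q.
have M2 := vsmooth_opp oU N2; have M3 := vsmooth_opp oU N3.
have M12 := vsmooth_add oU N1 M2.
rewrite (torsion_eq hc oU Xs Xs (vsmooth_bracket oU Ys Zs) (Y' := Q) (vsmooth_add oU M12 M3) Up)//.
  by rewrite /Q torsionDr // torsionDr // torsionNr // torsionNr.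
by move=> q Uq; rewrite (bracket_torsion A nabla).
Qed.

Lemma thv_bianchi p r1 r2 r3 a1 a2 a3 a4 a5 a6 x y :
  r1 + r2 + r3 = (a1 + a2) + (a3 + a4) + (a5 + a6) -> thv p r1 = 0 -> thv p r2 = 0 ->
  thv p r3 = 0 -> thv p a1 = 0 -> thv p a2 = 0 -> thv p a3 = 0 -> thv p a4 = x ->
  thv p a5 = 0 -> thv p a6 = - y -> x = y.
Proof.
move=> /(congr1 (thv p)); rewrite !thvD => E e1 e2 e3 e4 e5 e6 e7 e8 e9.
move: E; rewrite e1 e2 e3 e4 e5 e6 e7 e8 e9.
by rewrite !addr0 !add0r => /esym/eqP; rewrite subr_eq0 => /eqP.
Qed.

(* The component along the Reeb field of the Bianchi identity for [T], [Z], [W]. *)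
Lemma torsion_sym Z W p : sec U Z -> sec U W -> U p ->
  lv Z (conjf (Tor T W)) p = lv W (conjf (Tor T Z)) p.
Proof.
move=> Zs Ws Up; have Zv := sec_smooth Zs; have Wv := sec_smooth Ws.
have Ws' := sec_torT Ws; have Zs' := sec_torT Zs.
have E0 : thv p (Rm Z W T p) = 0.
  rewrite curvatureE (nablaT (vsmooth_bracket oU Zv Wv) Up).
  have V1 Y : vsm U Y -> nabla Y (fun=> 0) p = 0.
    move=> Ys; have := sec_nabla S oU Ys sec0.
    have := nablaZr hc oU (smooth_cst A oU 0) Ys V0 Up.
    have -> : nabla Y (fun q => 0 *: (fun=> 0) q) p = nabla Y (fun=> 0) p.
      congr (nabla Y _ p); apply/funext => q; by rewrite scaler0.
    by rewrite scaler0 scale0r addr0.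
  rewrite (nabla_eqr hc oU Zv (nabla_smooth hc oU Wv Ts) V0 Up (fun q => @nablaT W q Wv)) (V1 _ Zv).
  rewrite (nabla_eqr hc oU Wv (nabla_smooth hc oU Zv Ts) V0 Up (fun q => @nablaT Z q Zv)) (V1 _ Wv).
  by rewrite !subr0 -(scale0r 0) thvZ mul0r.
have E1 : thv p (nabla T (Tor Z W) p) = 0.
  apply: (thv_nabla Ts _ Up); apply: (sec_eq oU _ sec0) => q Uq.
  by rewrite (tor20 Zs Ws Uq).
have E2 : thv p (Tor T (bracket A Z W) p) = 0.
  by apply: thv01; exact: (sec_mem (sec_torT (sec_bracket S oU Zs Ws)) Up).
have anti Y : sec U Y -> sec U (conjf (Tor Y T)).
  move=> Ys; apply: (sec_eq oU _ (sec_opp (sec_torT Ys))) => q Uq.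
  by rewrite -[RHS]/(conjv (Tor Y T q)) (torsion_anti _ _ T Y) conjvN.
have E3 : thv p (nabla Z (Tor W T) p) = 0 by exact: (thv_nablaJ Zv (anti _ Ws) Up).
have E4 : thv p (nabla W (Tor T Z) p) = 0 by exact: (thv_nablaJ Wv Zs' Up).
have E5 Y Y' : sec U Y -> sec U Y' -> Tor Y (Tor T Y') p = (2%:R * 'i%C * lv Y (conjf (Tor T Y')) p) *: T p.
  by move=> Ys Ys'; rewrite -(tor11 Ys (sec_torT Ys') Up) conjfK.
have E6 : thv p (Tor W (bracket A T Z) p) = - (2%:R * 'i%C * lv W (conjf (Tor T Z)) p).
  rewrite torsion_bracket // thvD thvN thvD thvN (E5 _ _ Ws Zs) thvZ thvT mulr1.
  rewrite (tor20 Ws (sec_nabla S oU Ts Zs) Up).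
  rewrite (torsion_eq hc oU Wv Wv (nabla_smooth hc oU Zv Ts) V0 Up (fun q _ => erefl _) (fun q => @nablaT Z q Zv)).
  rewrite (torsion_anti _ _ (fun=> 0)) (torsion0l Wv Up) -(scale0r 0) -scalerN !thvZ !mul0r.
  by rewrite subr0 sub0r.
have E7 : thv p (Tor Z (bracket A W T) p) = 2%:R * 'i%C * lv Z (conjf (Tor T W)) p.
  rewrite torsion_bracket // thvD thvN thvD thvN.
  have -> : Tor Z (Tor W T) p = - Tor Z (Tor T W) p.
    rewrite -torsionNr //; last exact: torsion_smooth.
    congr (Tor Z _ p); apply/funext => q; exact: torsion_anti.
  rewrite (E5 _ _ Zs Ws) thvN thvZ thvT mulr1 opprK.
  rewrite (tor20 Zs (sec_nabla S oU Ts Ws) Up).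
  rewrite (torsion_eq hc oU Zv Zv (nabla_smooth hc oU Wv Ts) V0 Up (fun q _ => erefl _) (fun q => @nablaT W q Wv)).
  rewrite (torsion_anti _ _ (fun=> 0)) (torsion0l Zv Up) -(scale0r 0) -scalerN !thvZ !mul0r.
  by rewrite subr0 add0r.
have := thv_bianchi (bianchi hc oU Ts Zv Wv Up) (thv_curvature Ts Zv Ws Up) E0
  (thv_curvature Wv Ts Zs Up) E1 E2 E3 E7 E4 E6.
apply: mulfI.
rewrite mulf_neq0 ?pnatr_eq0 //; apply/eqP => /(congr1 (@complex.Im R)) /= /eqP.
by rewrite oner_eq0.
Qed.

Lemma levi_expl F V Y W p : local_frame A T10 V F -> U `<=` V -> sec U Y -> sec U W -> U p ->
  lv Y W p = \sum_k coframe F k p (Y p) * lv (F k) W p.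
Proof.
move=> frF UV Ys Ws Up; have Fs k : sec U (F k) := sec_sub UV (frame_sec frF k).
have cs k := coframe_smooth frF k oU UV Ys.
rewrite -(levi_suml S oU _ cs Fs Ws Up); apply: (levi_eq S oU Up Ys Ws) => // q Uq.
by apply: (frame_exp frF (UV _ Uq)); exact: (sec_mem Ys).
Qed.

Lemma levi_expr F V Y W p : local_frame A T10 V F -> U `<=` V -> sec U Y -> sec U W -> U p ->
  lv Y W p = \sum_k conjc (coframe F k p (W p)) * lv Y (F k) p.
Proof.
move=> frF UV Ys Ws Up; have Fs k : sec U (F k) := sec_sub UV (frame_sec frF k).
rewrite (levi_hermitian S oU Ws Ys Up) (levi_expl frF UV Ws Ys Up) rmorph_sum.
by apply: eq_bigr => k _; rewrite rmorphM (levi_hermitian S oU (Fs k) Ys Up).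
Qed.

End LocalGeometry.
#[local] Opaque torsion curvature levi bracket.

(** Polarization. [torsion_free] only controls a quadratic form; the symmetry supplied by
    [torsion_sym] is what turns this into the vanishing of each coefficient. *)
Lemma sub_quad0 N (t : 'I_N -> 'I_N -> C) : (forall i j, t i j = t j i) ->
  (forall a : 'I_N -> C, \sum_i \sum_j t i j * a i * a j = 0) -> forall i j, t i j = 0.
Proof.
move=> ts H i j.
pose q (a b : 'I_N -> C) := \sum_i \sum_j t i j * a i * b j.
pose e (i k : 'I_N) : C := (k == i)%:R.
have d (f : 'I_N -> C) k : \sum_i f i * e k i = f k.
  rewrite (bigD1 k) //= big1 ?addr0 => [|i' /negPf ik]; first by rewrite /e eqxx mulr1.
  by rewrite /e ik mulr0.
have qe k l : q (e k) (e l) = t k l.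
  transitivity (\sum_i t i l * e k i); last exact: (d (fun i => t i l)).
  by apply: eq_bigr => i' _; exact: (d (fun j => t i' j * e k i')).
have qD : q (fun k => e i k + e j k) (fun k => e i k + e j k) =
    q (e i) (e i) + q (e i) (e j) + (q (e j) (e i) + q (e j) (e j)).
  rewrite /q -!big_split; apply: eq_bigr => k _; rewrite -!big_split; apply: eq_bigr => l _ /=.
  by move: (e i k) (e i l) (e j k) (e j l) => a b c g; ring.
have qq a : q a a = 0 by exact: H.
move: qD; rewrite qq !qq add0r addr0 !qe (ts j i) => /esym/eqP.
by rewrite -mulr2n mulrn_eq0 => /eqP.
Qed.

Lemma torsion_reeb U Z p : open U -> sec U Z -> U p -> Tor T Z p = 0.
Proof.
move=> oU0 Zs0 Up0.
have [V [F [Vp frF]]] := framePt S p; have oV := frame_open frF.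
have Fs k := frame_sec frF k.
have HF q : V q -> forall i, conjf (Tor T (F i)) q = 0.
  move=> Vq i; have Ys k := sec_torT oV (Fs k).
  have torE k j : tor A theta T nabla F k j q = lv (F j) (conjf (Tor T (F k))) q.
    rewrite (levi_expr oV frF (fun _ => id) (Fs j) (Ys k) Vq) /tor.
    by apply: eq_bigr => l _; rewrite mxE mulrC.
  have t0 := sub_quad0 (t := fun i j => tor A theta T nabla F i j q) _ (sas_tor S frF Vq).
  apply: (levi_eq0 oV (Ys i) Vq).
  rewrite (levi_expl oV frF (fun _ => id) (Ys i) (Ys i) Vq) big1 // => k _.
  rewrite -torE t0 ?mulr0 // => {}k j; rewrite !torE.
  exact: (torsion_sym oV (Fs _) (Fs _)).
pose W := U `&` V; have oW : open W by exact: openI.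
have WV : W `<=` V by move=> ? [].
have Wp : W p by [].
have Zs : sec W Z by apply: sec_sub Zs0 => ? [].
have Fs' k : sec W (F k) by exact: sec_sub (Fs k).
have Xs := sec_torT oW Zs.
apply: (can_inj (@conjvK _ _)); rewrite conjv0.
apply: (levi_eq0 oW Xs Wp); rewrite (levi_expl oW frF WV Xs Xs Wp) big1 // => k _.
(* Symmetry moves the torsion from [Z] to a frame field, where it has just been shown to vanish. *)
rewrite (torsion_sym oW (Fs' k) Zs Wp).
rewrite (levi_expr oW frF WV Zs (sec_torT oW (Fs' k)) Wp) big1 ?mulr0 // => l _.
by rewrite HF // (_ : coframe F l p 0 = 0) ?conjc0 ?mul0r //; exact: linear0.
Qed.

(** The splitting of the complexified tangent bundle into [T10], its conjugate and the Reeb line.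
    The (0,1) part is stored as the section [b] of [T10] of which it is the conjugate, so that facts
    about [sec] cover it. *)
Definition split_field U Y := exists a b f, [/\ sec U a, sec U b, smooth_on A U f &
  forall q, U q -> Y q = (a q + conjf b q) + f q *: T q].

Section Split.
Variable U : set M.
Hypothesis oU : open U.
Let Ts : vsm U T := @reeb_smooth U.
Let s0 : smooth_on A U (fun=> 0).
Proof. exact: smooth_cst. Qed.

Lemma split_sec Z : sec U Z -> split_field U Z.
Proof.
move=> Zs; exists Z, (fun=> 0), (fun=> 0); split=> //; first exact: sec0.
by move=> q _; rewrite scale0r addr0 /conjf conjv0 addr0.
Qed.

Lemma split_secJ Z : sec U Z -> split_field U (conjf Z).
Proof.
move=> Zs; exists (fun=> 0), Z, (fun=> 0); split=> //; first exact: sec0.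
by move=> q _; rewrite scale0r addr0 add0r.
Qed.

Lemma split_reeb : split_field U T.
Proof.
exists (fun=> 0), (fun=> 0), (fun=> 1); split; try exact: sec0; first exact: smooth_cst.
by move=> q _; rewrite scale1r /conjf conjv0 !add0r.
Qed.

Lemma split_smooth Y : split_field U Y -> vsm U Y.
Proof.
move=> [a [b [f [As Bs fs E]]]].
have H : vsm U (fun q => (a q + conjf b q) + f q *: T q).
  apply: (vsmooth_add oU); last exact: vsmooth_scale.
  by apply: (vsmooth_add oU (sec_smooth As)); exact: (vsmooth_conj oU (sec_smooth Bs)).
by apply: (vsmooth_eq oU _ H) => q /E.
Qed.

Lemma split_opp Y : split_field U Y -> split_field U (fun q => - Y q).
Proof.
move=> [a [b [f [As Bs fs E]]]].
exists (fun q => - a q), (fun q => - b q), (fun q => - f q); split.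
- exact: sec_opp.
- exact: sec_opp.
- exact: smooth_opp.
- by move=> q Uq; rewrite E // /conjf conjvN scaleNr !opprD.
Qed.

Lemma split_add Y Y' : split_field U Y -> split_field U Y' -> split_field U (fun q => Y q + Y' q).
Proof.
move=> [a [b [f [As Bs fs E]]]] [a' [b' [f' [As' Bs' fs' E']]]].
exists (fun q => a q + a' q), (fun q => b q + b' q), (fun q => f q + f' q); split.
- exact: sec_add.
- exact: sec_add.
- exact: smooth_add.
- by move=> q Uq; rewrite E // E' // /conjf conjvD scalerDl (addrACA (a q)) (addrACA (a q + _)).
Qed.

Lemma split_eq Y Y' : (forall q, U q -> Y q = Y' q) -> split_field U Y -> split_field U Y'.
Proof.
move=> EY [a [b [f [As Bs fs E]]]]; exists a, b, f; split=> // q Uq.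
by rewrite -EY // E.
Qed.

Lemma nabla_split X a b f p : vsm U X -> sec U a -> sec U b -> smooth_on A U f -> U p ->
  nabla X (fun q => (a q + conjf b q) + f q *: T q) p =
  nabla X a p + conjv (nabla (conjf X) b p) + vapp A X f p *: T p.
Proof.
move=> Xs As Bs fs Up; have Bv := vsmooth_conj oU (sec_smooth Bs).
have fTs := vsmooth_scale oU fs Ts.
rewrite (nablaDr hc oU Xs (vsmooth_add oU (sec_smooth As) Bv) fTs Up).
rewrite (nablaDr hc oU Xs (sec_smooth As) Bv Up) (nablaZr hc oU fs Xs Ts Up).
by rewrite (nablaT oU Xs Up) scaler0 addr0 (nabla_conjr oU Xs (sec_smooth Bs) Up).
Qed.

Lemma split_nabla X Y : vsm U X -> split_field U Y -> split_field U (nabla X Y).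
Proof.
move=> Xs Ys; have Yv := split_smooth Ys; case: Ys => a [b [f [As Bs fs E]]].
have Xs' := vsmooth_conj oU Xs.
exists (nabla X a), (nabla (conjf X) b), (vapp A X f); split.
- exact: (sec_nabla S oU Xs As).
- exact: (sec_nabla S oU Xs' Bs).
- exact: smooth_vapp.
move=> q Uq; rewrite -(nabla_split Xs As Bs fs Uq); apply: (nabla_eqr hc oU Xs Yv _ Uq E).
exact: (vsmooth_eq oU E Yv).
Qed.

(** Since [Tor T] vanishes, the only torsion left is that of a (1,0) field with a (0,1) field, a
    multiple of [T]. This confines the right side of the Bianchi identity to the Reeb line. *)
Lemma torsion_split X Y : split_field U X -> split_field U Y ->
  exists2 f, smooth_on A U f & forall q, U q -> Tor X Y q = f q *: T q.
Proof.
move=> Xs Ys; have Xv := split_smooth Xs; have Yv := split_smooth Ys.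
case: Xs => a [b [f [As Bs fs EX]]]; case: Ys => a' [b' [f' [As' Bs' fs' EY]]].
have Av := sec_smooth As; have Bv := vsmooth_conj oU (sec_smooth Bs).
have Fv := vsmooth_scale oU fs Ts.
have Av' := sec_smooth As'; have Bv' := vsmooth_conj oU (sec_smooth Bs').
have Fv' := vsmooth_scale oU fs' Ts.
exists (fun q => 2%:R * 'i%C * lv a b' q - 2%:R * 'i%C * lv a' b q).
  apply: (smooth_add oU); first exact: (smooth_mul oU (smooth_cst A oU _) (levi_smooth S oU As Bs')).
  exact: (smooth_opp oU (smooth_mul oU (smooth_cst A oU _) (levi_smooth S oU As' Bs))).
move=> q Uq.
have t0 Z : sec U Z -> Tor Z T q = 0.
  by move=> Zs; rewrite torsion_anti (torsion_reeb oU Zs Uq) oppr0.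
have tJ Z : sec U Z -> Tor T (conjf Z) q = 0.
  move=> Zs; rewrite -{1}conjf_reeb (torsion_conj oU Ts (sec_smooth Zs) Uq).
  by rewrite (torsion_reeb oU Zs Uq) conjv0.
have tJ' Z : sec U Z -> Tor (conjf Z) T q = 0.
  by move=> Zs; rewrite torsion_anti tJ // oppr0.
have tT : Tor T T q = 0.
  have := torsion_anti A nabla T T q => /eqP; rewrite -subr_eq0 opprK -mulr2n -scaler_nat.
  by rewrite scaler_eq0 pnatr_eq0 /= => /eqP.
have ABv := vsmooth_add oU Av Bv; have ABv' := vsmooth_add oU Av' Bv'.
have Xv' := vsmooth_add oU ABv Fv; have Yv' := vsmooth_add oU ABv' Fv'.
rewrite (torsion_eq hc oU Xv Xv' Yv Yv' Uq EX EY).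
rewrite !(torsionDl oU) // !(torsionDr oU) // !(torsionZl oU) // !(torsionZr oU) //.
rewrite (tor20 oU As As' Uq) (tor11 oU As Bs' Uq) (torsion_anti A nabla a' (conjf b)).
rewrite (tor11 oU As' Bs Uq) (t0 _ As) (tJ' _ Bs) tT (torsion_reeb oU As' Uq) (tJ _ Bs').
rewrite (torsion_conj oU (sec_smooth Bs) (sec_smooth Bs') Uq) (tor20 oU Bs Bs' Uq) conjv0.
by rewrite !scaler0 !addr0 add0r scalerBl.
Qed.

Lemma split_bracket X Y : split_field U X -> split_field U Y -> split_field U (bracket A X Y).
Proof.
move=> Xs Ys; have [f fs E] := torsion_split Xs Ys.
have G : split_field U (fun q => (nabla X Y q + - nabla Y X q) + - Tor X Y q).
  apply: split_add; last first.
    apply: split_opp; exists (fun=> 0), (fun=> 0), f; split; try exact: sec0; first exact: fs.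
    by move=> q Uq; rewrite E // /conjf conjv0 !add0r.
  apply: split_add; first exact: split_nabla (split_smooth Xs) Ys.
  by apply: split_opp; exact: split_nabla (split_smooth Ys) Xs.
by apply: split_eq G => q Uq; rewrite (bracket_torsion A nabla).
Qed.

Let scale3 (v b1 b2 b3 t : 'rV[C]_(n.*2.+1)) c1 c2 c3 : v = b1 + b2 + b3 -> b1 = c1 *: t ->
  b2 = c2 *: t -> b3 = c3 *: t -> v = (c1 + c2 + c3) *: t.
Proof. by move=> -> -> -> ->; rewrite -!scalerDl. Qed.

(** Torsions are multiples of [T] by [torsion_split], and covariant derivatives of such multiples
    remain multiples of [T] because [T] is parallel. *)
Lemma bianchi_split X Y Z p : split_field U X -> split_field U Y -> split_field U Z -> U p ->
  exists c, Rm X Y Z p + Rm Y Z X p + Rm Z X Y p = c *: T p.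
Proof.
move=> Xs Ys Zs Up; have Xv := split_smooth Xs; have Yv := split_smooth Ys.
have Zv := split_smooth Zs.
have H X' Y' Z' : split_field U X' -> split_field U Y' -> split_field U Z' ->
  exists c, nabla X' (Tor Y' Z') p + Tor X' (bracket A Y' Z') p = c *: T p.
  move=> Xs' Ys' Zs'; have [f fs E] := torsion_split Ys' Zs'.
  have [g gs E'] := torsion_split Xs' (split_bracket Ys' Zs').
  exists (vapp A X' f p + g p); rewrite E' //.
  have Xv' := split_smooth Xs'; have fTs := vsmooth_scale oU fs Ts.
  rewrite (nabla_eqr hc oU Xv' (torsion_smooth oU (split_smooth Ys') (split_smooth Zs')) fTs Up E).
  by rewrite (nablaZr hc oU fs Xv' Ts Up) (nablaT oU Xv' Up) scaler0 addr0 scalerDl.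
have [c1 E1] := H _ _ _ Xs Ys Zs; have [c2 E2] := H _ _ _ Ys Zs Xs.
have [c3 E3] := H _ _ _ Zs Xs Ys.
by exists (c1 + c2 + c3); exact: (scale3 (bianchi hc oU Xv Yv Zv Up) E1 E2 E3).
Qed.

Lemma curvature_conj X Y W p : vsm U X -> vsm U Y -> vsm U W -> U p ->
  Rm (conjf X) (conjf Y) (conjf W) p = conjv (Rm X Y W p).
Proof.
move=> Xs Ys Ws Up; rewrite !curvatureE !conjvB.
have Xs' := vsmooth_conj oU Xs; have Ys' := vsmooth_conj oU Ys; have Ws' := vsmooth_conj oU Ws.
have HN X' Y' : vsm U X' -> vsm U Y' -> nabla (conjf X') (nabla (conjf Y') (conjf W)) p =
    conjv (nabla X' (nabla Y' W) p).
  move=> Hx Hy; have NW := nabla_smooth hc oU Hy Ws.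
  rewrite -(nabla_conj oU Hx NW Up).
  have Hx' := vsmooth_conj oU Hx; have Hy' := vsmooth_conj oU Hy.
  apply: (nabla_eqr hc oU Hx' (nabla_smooth hc oU Hy' Ws') (vsmooth_conj oU NW) Up) => q Uq.
  by rewrite (nabla_conj oU Hy Ws Uq).
rewrite (HN X Y Xs Ys) (HN Y X Ys Xs); congr (_ - _ - _).
have Bs := vsmooth_bracket oU Xs Ys.
rewrite -(nabla_conj oU Bs Ws Up).
apply: (nabla_eql hc oU (vsmooth_bracket oU Xs' Ys') (vsmooth_conj oU Bs) Ws' Up) => q Uq.
exact: (bracket_conj oU Uq Xs Ys).
Qed.

(** [theta] annihilates the left side and takes the value [c] on the right, so [c] is 0; then [v] is
    the opposite of [w], hence lies in both [T10] and its conjugate. *)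
Lemma mem_split p v w c : v \in T10 p -> conjv w \in T10 p -> v + w = c *: T p -> v = 0 /\ w = 0.
Proof.
move=> Hv Hw E; have := congr1 (thv p) E; rewrite thvD thvZ thvT mulr1 thv10 // thv01 // addr0.
move=> c0; move: E; rewrite -c0 scale0r => E; have w0 : w = 0; last by rewrite -[v]addr0 -{1}w0.
have wv : w = - v by apply/eqP; rewrite -subr_eq0 opprK addrC E.
case: (sas_cr S) => _ H _; rewrite -[w]conjvK (H p (conjv w)) ?conjv0 // conjvK.
by rewrite wv memvN.
Qed.

Lemma curvature_memJ X Y W p : vsm U X -> vsm U Y -> sec U W -> U p ->
  conjv (Rm X Y (conjf W) p) \in T10 p.
Proof.
move=> Xs Ys Ws Up; have Xs' := vsmooth_conj oU Xs; have Ys' := vsmooth_conj oU Ys.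
rewrite -(curvature_conj Xs Ys (vsmooth_conj oU (sec_smooth Ws)) Up) conjfK.
exact: (sec_mem (sec_curvature oU Xs' Ys' Ws) Up).
Qed.

Lemma levi_sub3l Z1 Z2 Z3 W p : sec U Z1 -> sec U Z2 -> sec U Z3 -> sec U W -> U p ->
  lv (fun q => Z1 q - Z2 q - Z3 q) W p = lv Z1 W p - lv Z2 W p - lv Z3 W p.
Proof.
move=> S1 S2 S3 Ws Up; have S2' := sec_opp oU S2; have S3' := sec_opp oU S3.
rewrite (levi_addl oU (sec_add oU S1 S2') S3' Ws Up) (levi_addl oU S1 S2' Ws Up).
by rewrite (levi_oppl oU S2 Ws Up) (levi_oppl oU S3 Ws Up).
Qed.

Lemma levi_sub3r Z1 Z2 Z3 W p : sec U W -> sec U Z1 -> sec U Z2 -> sec U Z3 -> U p ->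
  lv W (fun q => Z1 q - Z2 q - Z3 q) p = lv W Z1 p - lv W Z2 p - lv W Z3 p.
Proof.
move=> Ws S1 S2 S3 Up; have S2' := sec_opp oU S2; have S3' := sec_opp oU S3.
rewrite (levi_addr oU Ws (sec_add oU S1 S2') S3' Up) (levi_addr oU Ws S1 S2' Up).
by rewrite (levi_oppr oU Ws S2 Up) (levi_oppr oU Ws S3 Up).
Qed.

(** Apply the commutation of derivatives to the function [lv W V] and expand by compatibility with
    the Levi form: the mixed terms cancel, and skew-symmetry of the curvature remains. *)
Lemma curvature_levi X Y W V p : vsm U X -> vsm U Y -> sec U W -> sec U V -> U p ->
  lv (Rm X Y W) V p + lv W (Rm (conjf X) (conjf Y) V) p = 0.
Proof.
move=> Xs Ys Ws Vs Up.
have Xs' := vsmooth_conj oU Xs; have Ys' := vsmooth_conj oU Ys.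
have Bs := vsmooth_bracket oU Xs Ys.
have H X1 Y1 : vsm U X1 -> vsm U Y1 -> vapp A X1 (vapp A Y1 (lv W V)) p =
   (lv (nabla X1 (nabla Y1 W)) V p + lv (nabla Y1 W) (nabla (conjf X1) V) p) +
   (lv (nabla X1 W) (nabla (conjf Y1) V) p + lv W (nabla (conjf X1) (nabla (conjf Y1) V)) p).
  move=> Hx Hy; have Hx' := vsmooth_conj oU Hx; have Hy' := vsmooth_conj oU Hy.
  have S1 := sec_nabla S oU Hy Ws; have S2 := sec_nabla S oU Hy' Vs.
  rewrite (vapp_eq A oU Up X1 (fun q Uq => levi_nabla oU Hy Ws Vs Uq)).
  rewrite (vappD Up X1 (levi_smooth S oU S1 Vs) (levi_smooth S oU Ws S2)).
  exact: (f_equal2 +%R (levi_nabla oU Hx S1 Vs Up) (levi_nabla oU Hx Ws S2 Up)).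
have E := vapp_bracket oU Up Xs Ys (levi_smooth S oU Ws Vs).
rewrite (levi_nabla oU Bs Ws Vs Up) (H _ _ Xs Ys) (H _ _ Ys Xs) in E.
have e1 : lv (Rm X Y W) V p = lv (nabla X (nabla Y W)) V p - lv (nabla Y (nabla X W)) V p
    - lv (nabla (bracket A X Y) W) V p.
  have S1 := sec_nabla S oU Xs (sec_nabla S oU Ys Ws).
  have S2 := sec_nabla S oU Ys (sec_nabla S oU Xs Ws).
  have S3 := sec_nabla S oU Bs Ws.
  rewrite (levi_eq S oU Up (sec_curvature oU Xs Ys Ws) Vs (fun q _ => curvatureE X Y W q) (fun q _ => erefl _)).
  exact: (levi_sub3l S1 S2 S3 Vs Up).
have e2 : lv W (Rm (conjf X) (conjf Y) V) p =
    lv W (nabla (conjf X) (nabla (conjf Y) V)) p - lv W (nabla (conjf Y) (nabla (conjf X) V)) p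
    - lv W (nabla (conjf (bracket A X Y)) V) p.
  have S1 := sec_nabla S oU Xs' (sec_nabla S oU Ys' Vs).
  have S2 := sec_nabla S oU Ys' (sec_nabla S oU Xs' Vs).
  have S3 := sec_nabla S oU (vsmooth_conj oU Bs) Vs.
  have EE q : U q -> Rm (conjf X) (conjf Y) V q = (nabla (conjf X) (nabla (conjf Y) V) q
      + - nabla (conjf Y) (nabla (conjf X) V) q) + - nabla (conjf (bracket A X Y)) V q.
    move=> Uq; rewrite curvatureE; congr (_ - _).
    apply: (nabla_eql hc oU (vsmooth_bracket oU Xs' Ys') (vsmooth_conj oU Bs) (sec_smooth Vs) Uq).
    move=> r Ur; exact: (bracket_conj oU Ur Xs Ys).
  rewrite (levi_eq S oU Up Ws (sec_curvature oU Xs' Ys' Vs) (fun q _ => erefl _) EE).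
  exact: (levi_sub3r Ws S1 S2 S3 Up).
rewrite e1 e2; move: E.
move: (lv (nabla X (nabla Y W)) V p) (lv (nabla Y (nabla X W)) V p) => a1 a2.
move: (lv (nabla (bracket A X Y) W) V p) (lv W (nabla (conjf (bracket A X Y)) V) p) => a3 b3.
move: (lv W (nabla (conjf X) (nabla (conjf Y) V)) p) => b1.
move: (lv W (nabla (conjf Y) (nabla (conjf X) V)) p) => b2.
move: (lv (nabla X W) (nabla (conjf Y) V) p) (lv (nabla Y W) (nabla (conjf X) V) p) => c d E.
have -> : a1 - a2 - a3 + (b1 - b2 - b3) = a1 + d + (c + b1) - (a2 + c + (d + b2)) - (a3 + b3).
  by ring.
by rewrite -E subrr.
Qed.

(** In the Bianchi sum of [Z], [conjf W] and [V] the other two terms lie in [T10] and this one in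
    its conjugate, while the sum is a multiple of [T]; each type must then vanish separately. *)
Lemma curvature11J Z W V p : sec U Z -> sec U W -> sec U V -> U p -> Rm V Z (conjf W) p = 0.
Proof.
move=> Zs Ws Vs Up; have Wv := vsmooth_conj oU (sec_smooth Ws).
have [c E] := bianchi_split (split_sec Zs) (split_secJ Ws) (split_sec Vs) Up.
have H1 := sec_mem (sec_curvature oU (sec_smooth Zs) Wv Vs) Up.
have H2 := sec_mem (sec_curvature oU Wv (sec_smooth Vs) Zs) Up.
have H3 := curvature_memJ (sec_smooth Vs) (sec_smooth Zs) Ws Up.
by case: (mem_split (memvD H1 H2) H3 E).
Qed.

Lemma curvatureTJ Z W p : sec U Z -> sec U W -> U p -> Rm Z T (conjf W) p = 0.
Proof.
move=> Zs Ws Up; have Wv := vsmooth_conj oU (sec_smooth Ws).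
have [c] := bianchi_split (split_sec Zs) split_reeb (split_secJ Ws) Up.
rewrite -addrA addrC.
have H1 := sec_mem (sec_curvature oU Ts Wv Zs) Up.
have H3 := curvature_memJ (sec_smooth Zs) Ts Ws Up.
have E0 : Rm (conjf W) Z T p = 0.
  have V0 : vsm U (fun=> 0) by exact: vsmooth0.
  have V1 Y : vsm U Y -> nabla Y (fun=> 0) p = 0.
    move=> Ys; have := nablaZr hc oU (smooth_cst A oU 0) Ys V0 Up.
    have -> : nabla Y (fun q => 0 *: (fun=> 0) q) p = nabla Y (fun=> 0) p.
      congr (nabla Y _ p); apply/funext => q; by rewrite scaler0.
    by rewrite scaler0 scale0r addr0.
  have Zv := sec_smooth Zs.
  rewrite curvatureE (nablaT oU (vsmooth_bracket oU Wv Zv) Up).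
  rewrite (nabla_eqr hc oU Wv (nabla_smooth hc oU Zv Ts) V0 Up (fun q => nablaT oU Zv (p := q))).
  rewrite (nabla_eqr hc oU Zv (nabla_smooth hc oU Wv Ts) V0 Up (fun q => nablaT oU Wv (p := q))).
  by rewrite !V1 // !subr0.
by rewrite E0 addr0 => /(mem_split H1 H3)[].
Qed.

(** Skew-symmetry moves the curvature operator to the other argument of the Levi form. Tested
    against [Rm X Y W] itself, it leaves only the square norm of this vector. *)
Lemma curvature_dual X Y W p : vsm U X -> vsm U Y -> sec U W -> U p ->
  (forall V, sec U V -> Rm (conjf X) (conjf Y) V p = 0) -> Rm X Y W p = 0.
Proof.
move=> Xs Ys Ws Up H; have Rs := sec_curvature oU Xs Ys Ws.
have Xs' := vsmooth_conj oU Xs; have Ys' := vsmooth_conj oU Ys.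
apply: (levi_eq0 oU Rs Up).
have := curvature_levi Xs Ys Ws Rs Up.
have Rs' := sec_curvature oU Xs' Ys' Rs.
have [V [F [Vp frF]]] := framePt S p; have oV := frame_open frF.
have oI : open (U `&` V) by exact: openI.
have IU : U `&` V `<=` U by move=> ? [].
have IV : U `&` V `<=` V by move=> ? [].
rewrite (levi_expr oI frF IV (sec_sub IU Ws) (sec_sub IU Rs') (conj Up Vp)) H //.
by rewrite big1 ?addr0 // => k _; rewrite (_ : coframe F k p 0 = 0) ?conjc0 ?mul0r //; exact: linear0.
Qed.

(** For conjugate sections this is [curvature11J]; duality transfers the vanishing to sections of
    [T10]. *)
Lemma curvature20 Z V W p : sec U Z -> sec U V -> sec U W -> U p -> Rm Z V W p = 0.
Proof.
move=> Zs Vs Ws Up; apply: (curvature_dual (sec_smooth Zs) (sec_smooth Vs) Ws Up) => Y Ys.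
rewrite -[Y]conjfK.
rewrite (curvature_conj (sec_smooth Zs) (sec_smooth Vs) (vsmooth_conj oU (sec_smooth Ys)) Up).
by rewrite (curvature11J Vs Ys Zs Up) conjv0.
Qed.

Lemma curvature_reeb Z W p : sec U Z -> sec U W -> U p -> Rm Z T W p = 0.
Proof.
move=> Zs Ws Up; apply: (curvature_dual (sec_smooth Zs) Ts Ws Up) => Y Ys.
rewrite -[Y]conjfK.
rewrite (curvature_conj (sec_smooth Zs) Ts (vsmooth_conj oU (sec_smooth Ys)) Up).
by rewrite (curvatureTJ Zs Ys Up) conjv0.
Qed.

End Split.
End Geometry.
#[local] Opaque torsion curvature levi bracket.
(** Diagonalize [h] by a unitary matrix [P] and divide each row of [P] by the square root of its
    eigenvalue, which is the value of the positive form on that row. *)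
Lemma positive_unitary (R : realType) N (h : 'M[R[i]]_N) :
  (forall i j, h j i = conjc (h i j)) ->
  (forall x : 'I_N -> R[i], (exists k, x k != 0) ->
     0 < \sum_k \sum_l h k l * x k * conjc (x l)) ->
  exists2 a : 'M[R[i]]_N, a \in unitmx &
    forall i j, \sum_k \sum_l h k l * a i k * conjc (a j l) = (i == j)%:R.
Proof.
move=> hh hpos.
have nh : h \is normalmx.
  apply/normalmxP; suff -> : map_mx (@Num.conj R[i]) h^T = h by [].
  by apply/matrixP => i j; rewrite !mxE; exact: (esym (hh j i)).
set P := spectralmx h; set d := spectral_diag h.
have uP : P \is unitarymx := spectral_unitarymx h.
have Pu : P \in unitmx := unitarymx_unit uP.
have E : h = invmx P *m diag_mx d *m P by apply/orthomx_spectralP.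
have PhP : P *m h *m map_mx (@Num.conj R[i]) P^T = diag_mx d.
  rewrite [X in _ *m X *m _]E !mulmxA mulmxV // mul1mx -mulmxA.
  by move/unitarymxP: uP => ->; rewrite mulmx1.
have PhPE i j : \sum_k \sum_l h k l * P i k * conjc (P j l) = diag_mx d i j.
  rewrite -PhP mxE exchange_big; apply: eq_bigr => l _; rewrite mxE mulr_suml.
  by apply: eq_bigr => k _; rewrite !mxE (mulrC (h k l)).
have dpos i : 0 < d 0 i.
  have := hpos (fun k => P i k); rewrite PhPE mxE eqxx mulr1n; apply.
  apply/existsP; apply: contraT; rewrite negb_exists => /forallP H.
  move: (mulmxV Pu) => /matrixP/(_ i i); rewrite !mxE eqxx big1 => [/esym/eqP|k _].
    by rewrite oner_eq0.
  by have := H k; rewrite negbK => /eqP ->; rewrite mul0r.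
pose s i := (sqrtC (d 0 i))^-1.
have sc i : conjc (s i) = s i.
  by apply: (@CrealP R[i]); rewrite ger0_real // invr_ge0 sqrtC_ge0 ltW.
exists (diag_mx (\row_i s i) *m P).
  rewrite unitmx_mul Pu andbT unitmxE det_diag unitfE prodf_seq_neq0; apply/allP => i _.
  by rewrite mxE invr_eq0 sqrtC_eq0 gt_eqF.
move=> i j; rewrite mul_diag_mx.
transitivity (s i * conjc (s j) * (\sum_k \sum_l h k l * P i k * conjc (P j l))).
  rewrite mulr_sumr; apply: eq_bigr => k _; rewrite mulr_sumr; apply: eq_bigr => l _.
  rewrite !mxE rmorphM /=.
  by move: (h k l) (s i) (P i k) (conjc (s j)) (conjc (P j l)) => ? ? ? ? ?; ring.
rewrite PhPE mxE; have [<-|_] := eqVneq i j; last by rewrite mulr0n mulr0.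
rewrite mulr1n sc -expr2 /s exprVn sqrtCK mulVf // gt_eqF //.
Qed.

(** * Hessian and divergence *)

Section Gradient.
Context (R : realType) (n : nat) (M : topologicalType) (A : oriented_atlas R n.*2.+1 M).
Context (T10 : M -> {vspace 'rV[R[i]]_(n.*2.+1)}) (theta : form1 R n.*2.+1 M).
Context (T : vfield R n.*2.+1 M).
Context (nabla : vfield R n.*2.+1 M -> vfield R n.*2.+1 M -> vfield R n.*2.+1 M).
Hypothesis S : sasakian A T10 theta T nabla.
Local Notation C := R[i].
Local Notation vfield := (vfield R n.*2.+1 M).
Local Notation sec := (section_on A T10).
Local Notation lv := (levi A theta).
Local Notation Tor := (torsion A nabla).
Local Notation Rm := (curvature A nabla).
Local Notation vsm := (vsmooth_on A).
Implicit Types (p q : M) (X Y Z W : vfield) (F : 'I_n -> vfield) (U V : set M).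

Lemma hmatC F V q i j : local_frame A T10 V F -> V q ->
  hmat A theta F q j i = conjc (hmat A theta F q i j).
Proof.
move=> frF Vq; rewrite !mxE.
by rewrite (levi_hermitian S (frame_open frF) (frame_sec frF i) (frame_sec frF j) Vq).
Qed.

Lemma sec_const F V (x : 'I_n -> C) : local_frame A T10 V F ->
  sec V (fun q => \sum_k x k *: F k q).
Proof.
move=> frF; have oV := frame_open frF; apply: (sec_sum oV) => k _.
exact: (sec_scale oV (smooth_cst A oV (x k)) (frame_sec frF k)).
Qed.

Lemma levi_const F V (x y : 'I_n -> C) q : local_frame A T10 V F -> V q ->
  lv (fun q => \sum_k x k *: F k q) (fun q => \sum_k y k *: F k q) q =
  \sum_k \sum_l hmat A theta F q k l * x k * conjc (y l).
Proof.
move=> frF Vq; have oV := frame_open frF.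
rewrite (levi_frame S frF oV (fun _ => id) (sec_const x frF) (sec_const y frF) Vq).
by apply: eq_bigr => k _; apply: eq_bigr => l _; rewrite !(coframe_sum frF).
Qed.

Lemma hmat_pos F V q (x : 'I_n -> C) : local_frame A T10 V F -> V q -> (exists k, x k != 0) ->
  0 < \sum_k \sum_l hmat A theta F q k l * x k * conjc (x l).
Proof.
move=> frF Vq [k xk]; rewrite -(levi_const x x frF Vq).
apply: (sas_spc S (frame_open frF) (sec_const x frF) Vq).
by apply: contraNneq xk => E; rewrite (frame_free frF Vq E).
Qed.

Lemma hmat_unit F V q : local_frame A T10 V F -> V q -> hmat A theta F q \in unitmx.
Proof.
move=> frF Vq.
have [a au aE] := positive_unitary (fun i j => hmatC i j frF Vq) (fun x => hmat_pos frF Vq (x := x)).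
have : a *m hmat A theta F q *m map_mx (@conjc R) a^T = 1%:M.
  apply/matrixP => i j; rewrite !mxE -aE exchange_big; apply: eq_bigr => l _.
  rewrite [X in X * _]mxE mulr_suml; apply: eq_bigr => k _.
  by rewrite [map_mx _ _ _ _]mxE [a^T _ _]mxE (mulrC (hmat _ _ _ _ _ _)).
by move/mulmx1_unit => [/=]; rewrite unitmx_mul => /andP[].
Qed.

(** The change of frame has constant coefficients, so the frame is unitary at [p] only; the
    computations at one point ask no more. *)
Lemma unitary_frame p : exists U (Z : 'I_n -> vfield), [/\ U p, local_frame A T10 U Z & hmat A theta Z p = 1%:M].
Proof.
have [V [F [Vp frF]]] := framePt S p; have oV := frame_open frF.
have [a au aE] := positive_unitary (fun i j => hmatC i j frF Vp) (fun x => hmat_pos frF Vp (x := x)).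
exists V, (fun i q => \sum_k a i k *: F k q); split => //; last first.
  by apply/matrixP => i j; rewrite mxE (levi_const _ _ frF Vp) aE !mxE.
split=> // [i|q Vq]; first exact: (sec_smooth (sec_const _ frF)).
have dT : \dim (T10 q) = n.
  by case: frF => _ _ /(_ q Vq) b; exact: (size_basis b).
rewrite basisEdim dT size_tuple leqnn andbT; apply/subvP => v vT.
rewrite (frame_exp frF Vq vT).
have E k : F k q = \sum_i invmx a k i *: (\sum_l a i l *: F l q).
  under eq_bigr do rewrite scaler_sumr.
  rewrite exchange_big /= (bigD1 k) //= [X in X + _](_ : _ = F k q); last first.
    under eq_bigr do rewrite scalerA.
    rewrite -scaler_suml [X in X *: _](_ : _ = (invmx a *m a) k k); last by rewrite mxE.
    by rewrite mulVmx // mxE eqxx scale1r.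
  rewrite big1 ?addr0 // => l lk; under eq_bigr do rewrite scalerA.
  rewrite -scaler_suml [X in X *: _](_ : _ = (invmx a *m a) k l); last by rewrite mxE.
  by rewrite mulVmx // mxE eq_sym (negPf lk) scale0r.
apply: memv_suml => k _; apply: memvZ; rewrite E; apply: memv_suml => i _; apply: memvZ.
by apply: memv_span; apply/tnthP; exists i; rewrite tnth_mktuple.
Qed.

(** The solution of [lv W G = W f] in the frame. The conjugation is there because the Levi form is
    antilinear in its second argument. *)
Definition frame_grad F (f : M -> C) : vfield := fun q =>
  \sum_l conjc (\sum_i invmx (hmat A theta F q) l i * vapp A (F i) f q) *: F l q.

Section FrameGradient.
Variables (V : set M) (F : 'I_n -> vfield) (f : M -> C).
Hypotheses (frF : local_frame A T10 V F) (fs : smooth_on A setT f).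
Let oV := frame_open frF.

Lemma sec_frame_grad : sec V (frame_grad F f).
Proof.
have fsV : smooth_on A V f by exact: smooth_sub fs.
apply: (sec_sum oV) => l _; apply: (sec_scale oV _ (frame_sec frF l)).
apply: (smooth_conj oV); apply: (smooth_sum oV) => i _; apply: (smooth_mul oV).
  have H := @smooth_invmx _ _ _ A V oV n (fun i j q => lv (F i) (F j) q) l i.
  apply: H => [k j|q Vq]; first exact: (levi_smooth S oV (frame_sec frF k) (frame_sec frF j)).
  exact: (hmat_unit frF Vq).
exact: (smooth_vapp oV (sec_smooth (frame_sec frF i)) fsV).
Qed.

Lemma levi_frame_grad U W q : open U -> U `<=` V -> sec U W -> U q ->
  lv W (frame_grad F f) q = vapp A W f q.
Proof.
move=> oU UV Ws Uq; have Gs : sec U (frame_grad F f) := sec_sub UV sec_frame_grad.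
rewrite (levi_expl S oU frF UV Ws Gs Uq).
have H k : lv (F k) (frame_grad F f) q = vapp A (F k) f q.
  rewrite (levi_expr S oU frF UV (sec_sub UV (frame_sec frF k)) Gs Uq).
  transitivity ((hmat A theta F q *m (invmx (hmat A theta F q) *m \col_i vapp A (F i) f q)) k 0).
    rewrite mxE; apply: eq_bigr => l _; rewrite /frame_grad (coframe_sum frF _ _ (UV _ Uq)) conjcK.
    rewrite mulrC; congr (_ * _); first by rewrite mxE.
    by rewrite mxE; apply: eq_bigr => i _; rewrite mxE.
  by rewrite mulKVmx ?mxE //; exact: (hmat_unit frF (UV _ Uq)).
under eq_bigr do rewrite H.
rewrite vappE {2}(frame_exp frF (UV _ Uq) (sec_mem Ws Uq)) dtan_suml.
by apply: eq_bigr => k _; rewrite dtanZl vappE.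
Qed.
End FrameGradient.

Lemma levi_inj U G G' p : open U -> sec U G -> sec U G' -> U p ->
  (forall W, sec U W -> lv W G p = lv W G' p) -> G p = G' p.
Proof.
move=> oU Gs Gs' Up H; apply/eqP; rewrite -subr_eq0; apply/eqP.
have Ns := sec_opp oU Gs'; have Ds := sec_add oU Gs Ns.
apply: (levi_eq0 S oU Ds Up).
by rewrite (levi_addr S oU Ds Gs Ns Up) (levi_oppr S oU Ds Gs' Up) H // subrr.
Qed.

(** The local solutions agree on overlaps since the Levi form is nondegenerate. Hence their common
    value can be chosen at each point, and smoothness is inherited from any one frame. *)
Lemma gradient f : smooth_on A setT f -> exists2 G, sec setT G &
  forall U W p, open U -> sec U W -> U p -> lv W G p = vapp A W f p.
Proof.
move=> fs.
have : forall p, exists v, forall V F, local_frame A T10 V F -> V p -> frame_grad F f p = v.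
  move=> p; have [V [F [Vp frF]]] := framePt S p; exists (frame_grad F f p) => V' F' frF' Vp'.
  have oV := frame_open frF; have oV' := frame_open frF'.
  have oI : open (V' `&` V) by exact: openI.
  have IV : V' `&` V `<=` V by move=> ? [].
  have IV' : V' `&` V `<=` V' by move=> ? [].
  apply: (levi_inj oI (sec_sub IV' (sec_frame_grad frF' fs)) (sec_sub IV (sec_frame_grad frF fs))).
    by [].
  by move=> W Ws; rewrite (levi_frame_grad frF' fs oI IV' Ws) // (levi_frame_grad frF fs oI IV Ws).
move=> /choice[G HG]; exists G.
  split=> [|p _].
    apply: vsmooth_pointwise => p _; have [V [F [Vp frF]]] := framePt S p.
    have oV := frame_open frF; exists V => //; rewrite setTI.
    apply: (vsmooth_eq oV _ (sec_smooth (sec_frame_grad frF fs))) => q Vq.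
    exact: HG frF Vq.
  have [V [F [Vp frF]]] := framePt S p; rewrite -(HG p V F frF Vp).
  exact: (sec_mem (sec_frame_grad frF fs) Vp).
move=> U W p oU Ws Up; have [V [F [Vp frF]]] := framePt S p.
have oV := frame_open frF; have oI : open (U `&` V) by exact: openI.
have IV : U `&` V `<=` V by move=> ? [].
have Ws' : sec (U `&` V) W by apply: sec_sub Ws => ? [].
rewrite -(levi_frame_grad frF fs oI IV Ws' (conj Up Vp)).
apply/esym; apply: (levi_eq S oI (conj Up Vp) Ws' (sec_sub IV (sec_frame_grad frF fs))) => //.
by move=> q [Uq Vq]; exact: HG frF Vq.
Qed.

Section Hessian.
Variables (f : M -> C) (G : vfield).
Hypothesis fs : smooth_on A setT f.
Hypothesis freal : forall p, conjc (f p) = f p.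
Hypothesis Gs : sec setT G.
Hypothesis HG : forall U W p, open U -> sec U W -> U p -> lv W G p = vapp A W f p.
Variables (U : set M) (p : M).
Hypotheses (oU : open U) (Up : U p).
Let Ts : vsm U T. Proof. exact: (reeb_smooth S). Qed.
Let hc : connection A nabla := proj1 (sas_tw S).

Let GsU : sec U G. Proof. exact: sec_sub Gs. Qed.
Let fsU : smooth_on A U f. Proof. exact: smooth_sub fs. Qed.

Lemma vapp_bracket_torsion X Y : vapp A (bracket A X Y) f p =
  vapp A (nabla X Y) f p - vapp A (nabla Y X) f p - vapp A (Tor X Y) f p.
Proof. by rewrite !vappE (bracket_torsion A nabla) !dtanBl. Qed.

Lemma vapp_conj_real X q : U q -> vapp A (conjf X) f q = conjc (vapp A X f q).
Proof.
move=> Uq; rewrite -(vapp_conj Uq X fsU); apply: (vapp_eq A oU Uq) => r _.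
by rewrite freal.
Qed.

(** Obtained by differentiating [lv Z G = Z f] along [X]. The whole Hessian of [f] is thereby
    encoded in [nabla G]: the (2,0) part by (0,1) directions, the (1,1) part by (1,0) directions. *)
Lemma levi_nabla_grad X Z : vsm U X -> sec U Z ->
  lv Z (nabla (conjf X) G) p = vapp A X (vapp A Z f) p - vapp A (nabla X Z) f p.
Proof.
move=> Xs Zs; rewrite -(HG oU (sec_nabla S oU Xs Zs) Up).
rewrite -(vapp_eq A oU Up X (fun q Uq => HG oU Zs Uq)) (levi_nabla S oU Xs Zs GsU Up).
by rewrite addrC addKr.
Qed.

Lemma hess20_sym Z W : sec U Z -> sec U W ->
  lv Z (nabla (conjf W) G) p = lv W (nabla (conjf Z) G) p.
Proof.
move=> Zs Ws; have Zv := sec_smooth Zs; have Wv := sec_smooth Ws.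
rewrite (levi_nabla_grad Wv Zs) (levi_nabla_grad Zv Ws).
have := vapp_bracket oU Up Zv Wv fsU.
rewrite vapp_bracket_torsion.
have -> : vapp A (Tor Z W) f p = 0 by rewrite vappE (tor20 S oU Zs Ws Up) dtan0l.
rewrite subr0; move: (vapp A _ _ p) (vapp A _ _ p) (vapp A _ _ p) (vapp A _ _ p) => a b c d E.
apply/eqP; rewrite -subr_eq0 (_ : _ - _ = (d - c) - (b - a)); last by ring.
by rewrite E subrr.
Qed.

Lemma hess11 Z W : sec U Z -> sec U W ->
  lv Z (nabla W G) p = vapp A (conjf W) (vapp A Z f) p - vapp A (nabla (conjf W) Z) f p.
Proof.
move=> Zs Ws; have Wv := vsmooth_conj oU (sec_smooth Ws).
by have := levi_nabla_grad Wv Zs; rewrite conjfK.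
Qed.

Let sub_comm (a b c d t : C) : d - c - t = b - a -> a - c - (b - d) = t.
Proof.
move=> E; apply/eqP; rewrite -subr_eq0 (_ : _ - t = (d - c - t) - (b - a)); last by ring.
by rewrite E subrr.
Qed.

(** The right side is the torsion of [Z] and [conjf W] applied to [f]; that [f] is real turns the
    conjugated Hessian into the derivatives taken in the opposite order. *)
Lemma hess11_comm Z W : sec U Z -> sec U W ->
  lv Z (nabla W G) p - conjc (lv W (nabla Z G) p) = 2%:R * 'i%C * lv Z W p * vapp A T f p.
Proof.
move=> Zs Ws; have Zv := sec_smooth Zs; have Wv := sec_smooth Ws.
have Wv' := vsmooth_conj oU Wv; have Zv' := vsmooth_conj oU Zv.
rewrite !hess11 // rmorphB.
have E1 : conjc (vapp A (conjf Z) (vapp A W f) p) = vapp A Z (vapp A (conjf W) f) p.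
  rewrite -(vapp_conj Up (conjf Z) (smooth_vapp oU Wv fsU)) conjfK.
  by apply: (vapp_eq A oU Up) => q Uq; rewrite vapp_conj_real.
have E2 : conjc (vapp A (nabla (conjf Z) W) f p) = vapp A (nabla Z (conjf W)) f p.
  rewrite -vapp_conj_real //; apply: (vapp_ext A f).
  by rewrite (nabla_conjr S oU Zv Wv Up).
rewrite [X in _ - (X - _)]E1 [X in _ - (_ - X)]E2.
have := vapp_bracket oU Up Zv Wv' fsU.
rewrite vapp_bracket_torsion.
have -> : vapp A (Tor Z (conjf W)) f p = 2%:R * 'i%C * lv Z W p * vapp A T f p.
  by rewrite !vappE (tor11 S oU Zs Ws Up) dtanZl.
exact: sub_comm.
Qed.

(** Both [nabla Z T] and [Tor T Z] vanish, so the derivatives along [T] and [Z] may be exchanged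
    with no correction. *)
Lemma levi_nablaT_grad Z : sec U Z -> lv Z (nabla T G) p = vapp A Z (vapp A T f) p.
Proof.
move=> Zs; have Zv := sec_smooth Zs.
have := levi_nabla_grad Ts Zs; rewrite (conjf_reeb S) => ->.
have := vapp_bracket oU Up Ts Zv fsU.
rewrite vapp_bracket_torsion.
have -> : vapp A (Tor T Z) f p = 0 by rewrite vappE (torsion_reeb S oU Zs Up) dtan0l.
have -> : vapp A (nabla Z T) f p = 0 by rewrite vappE (nablaT S oU Zv Up) dtan0l.
rewrite !subr0 => ->; move: (vapp A _ _ p) (vapp A _ _ p) => a b; ring.
Qed.

End Hessian.
End Gradient.

(** * Divergence of sections of [T10], and of the covariant derivatives of a gradient *)

Section Divergence.
Context (R : realType) (n : nat) (M : topologicalType) (A : oriented_atlas R n.*2.+1 M).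
Context (T10 : M -> {vspace 'rV[R[i]]_(n.*2.+1)}) (theta : form1 R n.*2.+1 M).
Context (T : vfield R n.*2.+1 M).
Context (nabla : vfield R n.*2.+1 M -> vfield R n.*2.+1 M -> vfield R n.*2.+1 M).
Hypothesis S : sasakian A T10 theta T nabla.
Local Notation C := R[i].
Local Notation vfield := (vfield R n.*2.+1 M).
Local Notation sec := (section_on A T10).
Local Notation lv := (levi A theta).
Local Notation Tor := (torsion A nabla).
Local Notation Rm := (curvature A nabla).
Local Notation vsm := (vsmooth_on A).
Implicit Types (p q : M) (X Y W : vfield) (U V : set M).

Variables (U : set M) (Z : 'I_n -> vfield).
Hypothesis frZ : local_frame A T10 U Z.
Let oU : open U := frame_open frZ.
Let hc : connection A nabla := proj1 (sas_tw S).
Let Zs k : sec U (Z k) := frame_sec frZ k.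
Let Zv k : vsm U (Z k) := sec_smooth (Zs k).
Let Ts : vsm U T. Proof. exact: (reeb_smooth S). Qed.

Local Notation cf k W := (fun q => coframe Z k q (W q)).

(** For a section of [T10] this is the full trace of its covariant derivative: the values of [nabla]
    stay in [T10], so the directions of the conjugate bundle and of [T] contribute nothing. *)
Definition divergence W : M -> C := fun p => \sum_k coframe Z k p (nabla (Z k) W p).

Lemma cfD k p (v w : 'rV[C]_(n.*2.+1)) : coframe Z k p (v + w) = coframe Z k p v + coframe Z k p w.
Proof. exact: linearD. Qed.
Lemma cfN k p (v : 'rV[C]_(n.*2.+1)) : coframe Z k p (- v) = - coframe Z k p v.
Proof. exact: linearN. Qed.
Lemma cfZ k p a (v : 'rV[C]_(n.*2.+1)) : coframe Z k p (a *: v) = a * coframe Z k p v.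
Proof. exact: linearZ. Qed.
Lemma cf_sum k p (I : Type) (r : seq I) (v : I -> 'rV[C]_(n.*2.+1)) :
  coframe Z k p (\sum_(i <- r) v i) = \sum_(i <- r) coframe Z k p (v i).
Proof. exact: linear_sum. Qed.

Lemma cf_smooth k W : sec U W -> smooth_on A U (cf k W).
Proof. exact: (coframe_smooth frZ k oU (fun _ => id)). Qed.

Lemma sec_exp W q : sec U W -> U q -> W q = \sum_k coframe Z k q (W q) *: Z k q.
Proof. by move=> Ws Uq; exact: (frame_exp frZ Uq (sec_mem Ws Uq)). Qed.

Lemma vapp_exp W f q : sec U W -> U q -> vapp A W f q = \sum_k coframe Z k q (W q) * vapp A (Z k) f q.
Proof.
move=> Ws Uq; rewrite vappE {1}(sec_exp Ws Uq) dtan_suml.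
by apply: eq_bigr => k _; rewrite dtanZl vappE.
Qed.

Lemma nabla_exp W Y q : sec U W -> vsm U Y -> U q ->
  nabla W Y q = \sum_k coframe Z k q (W q) *: nabla (Z k) Y q.
Proof.
move=> Ws Ys Uq; have H k := cf_smooth k Ws.
have sm : vsm U (fun q => \sum_k coframe Z k q (W q) *: Z k q).
  by apply: (vsmooth_sum oU) => k _; exact: vsmooth_scale.
rewrite (nabla_eql hc oU (sec_smooth Ws) sm Ys Uq (fun r Ur => sec_exp Ws Ur)).
exact: (nabla_suml hc oU _ H Zv Ys Uq).
Qed.

Lemma nablaJ_exp W Y q : sec U W -> vsm U Y -> U q ->
  nabla (conjf W) Y q = \sum_k conjc (coframe Z k q (W q)) *: nabla (conjf (Z k)) Y q.
Proof.
move=> Ws Ys Uq; have H k := smooth_conj oU (cf_smooth k Ws).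
have Zv' k := vsmooth_conj oU (Zv k).
have sm : vsm U (fun q => \sum_k conjc (coframe Z k q (W q)) *: conjf (Z k) q).
  by apply: (vsmooth_sum oU) => k _; exact: vsmooth_scale.
have E r : U r -> conjf W r = \sum_k conjc (coframe Z k r (W r)) *: conjf (Z k) r.
  move=> Ur; rewrite /conjf {1}(sec_exp Ws Ur) conjv_sum.
  by apply: eq_bigr => k _; rewrite conjvZ.
rewrite (nabla_eql hc oU (vsmooth_conj oU (sec_smooth Ws)) sm Ys Uq E).
exact: (nabla_suml hc oU _ H Zv' Ys Uq).
Qed.

Lemma nabla_expr X W q : vsm U X -> sec U W -> U q -> forall k,
  coframe Z k q (nabla X W q) =
  vapp A X (cf k W) q + \sum_l coframe Z l q (W q) * coframe Z k q (nabla X (Z l) q).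
Proof.
move=> Xs Ws Uq k; have H l := cf_smooth l Ws.
have sm : vsm U (fun q => \sum_k coframe Z k q (W q) *: Z k q).
  by apply: (vsmooth_sum oU) => l _; exact: vsmooth_scale.
rewrite (nabla_eqr hc oU Xs (sec_smooth Ws) sm Uq (fun r Ur => sec_exp Ws Ur)).
rewrite (nabla_sumr hc oU _ H Zv Xs Uq) big_split cfD cf_sum /=; congr (_ + _).
  by rewrite -cf_sum (coframe_sum frZ _ _ Uq).
by rewrite cf_sum; apply: eq_bigr => l _; rewrite cfZ.
Qed.

Lemma div_smooth W : sec U W -> smooth_on A U (divergence W).
Proof. by move=> Ws; apply: (smooth_sum oU) => k _; exact: (cf_smooth k (sec_nabla S oU (Zv k) Ws)). Qed.

Lemma divD W W' p : sec U W -> sec U W' -> U p ->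
  divergence (fun q => W q + W' q) p = divergence W p + divergence W' p.
Proof.
move=> Ws Ws' Up; rewrite /divergence -big_split; apply: eq_bigr => k _ /=.
by rewrite (nablaDr hc oU (Zv k) (sec_smooth Ws) (sec_smooth Ws') Up) cfD.
Qed.

Lemma divZ f W p : smooth_on A U f -> sec U W -> U p ->
  divergence (fun q => f q *: W q) p = f p * divergence W p + vapp A W f p.
Proof.
move=> fs Ws Up; rewrite /divergence (vapp_exp f Ws Up) mulr_sumr -big_split; apply: eq_bigr => k _ /=.
by rewrite (nablaZr hc oU fs (Zv k) (sec_smooth Ws) Up) cfD !cfZ addrC [in LHS]addrC [LHS]addrC mulrC.
Qed.

Let cf_split k p r a b c d : coframe Z k p (r + a + (b - c - d)) = coframe Z k p r +
  coframe Z k p a + (coframe Z k p b - coframe Z k p c - coframe Z k p d).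
Proof. by rewrite !cfD !cfN. Qed.

Let sum_alg (r a b d e : C) : r + (a + e) + (b - e - d) = a + b - d + r.
Proof. by ring. Qed.

(* The trace of [nabla G] is differentiated by means of the local frame: the
   derivatives of the frame cancel in the trace. *)
Lemma div_nabla Y G p : vsm U Y -> sec U G -> U p ->
  divergence (nabla Y G) p = vapp A Y (divergence G) p +
    \sum_k coframe Z k p (nabla (nabla (Z k) Y) G p)
    - \sum_k coframe Z k p (nabla (Tor (Z k) Y) G p)
    + \sum_k coframe Z k p (Rm (Z k) Y G p).
Proof.
move=> Ys Gs Up; have Gv := sec_smooth Gs.
have ZG k : sec U (nabla (Z k) G) := sec_nabla S oU (Zv k) Gs.
have YZ k : sec U (nabla Y (Z k)) := sec_nabla S oU Ys (Zs k).
rewrite /divergence (vapp_sum oU Up Y _ (P := xpredT) (fun k _ => cf_smooth k (ZG k))).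
have E1 k : nabla (Z k) (nabla Y G) p = Rm (Z k) Y G p + nabla Y (nabla (Z k) G) p +
    (nabla (nabla (Z k) Y) G p - nabla (nabla Y (Z k)) G p - nabla (Tor (Z k) Y) G p).
  have N1 := nabla_smooth hc oU (Zv k) Ys; have N2 := nabla_smooth hc oU Ys (Zv k).
  have N3 := torsion_smooth S oU (Zv k) Ys.
  have M2 := vsmooth_opp oU N2; have M3 := vsmooth_opp oU N3.
  have M12 := vsmooth_add oU N1 M2; have M123 := vsmooth_add oU M12 M3.
  have -> : nabla (nabla (Z k) Y) G p - nabla (nabla Y (Z k)) G p - nabla (Tor (Z k) Y) G p =
      nabla (bracket A (Z k) Y) G p.
    rewrite (nabla_eql hc oU (vsmooth_bracket oU (Zv k) Ys) M123 Gv Up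
      (fun q _ => bracket_torsion A nabla (Z k) Y q)).
    rewrite (nablaDl hc oU M12 M3 Gv Up) (nablaDl hc oU N1 M2 Gv Up).
    by rewrite (nablaNl hc oU N2 Gv Up) (nablaNl hc oU N3 Gv Up).
  rewrite curvatureE.
  by rewrite -(addrA (_ - _ - _)) (addrC (nabla Y _ _)) addrA subrK subrK.
under eq_bigr do rewrite E1 cf_split (nabla_expr Ys (ZG _) Up).
rewrite !big_split /= !sumrN.
have -> : \sum_k coframe Z k p (nabla (nabla Y (Z k)) G p) =
   \sum_k \sum_l coframe Z l p (nabla (Z k) G p) * coframe Z k p (nabla Y (Z l) p).
  rewrite exchange_big; apply: eq_bigr => l _.
  rewrite (nabla_exp (YZ l) Gv Up) cf_sum; apply: eq_bigr => k _.
  by rewrite cfZ mulrC.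
exact: sum_alg.
Qed.

Lemma curvature_suml X (a : 'I_n -> M -> C) (Y : 'I_n -> vfield) W p :
  (forall k, smooth_on A U (a k)) -> vsm U X -> (forall k, vsm U (Y k)) -> vsm U W -> U p ->
  Rm X (fun q => \sum_k a k q *: Y k q) W p = \sum_k a k p *: Rm X (Y k) W p.
Proof.
move=> As Xs Ys Ws Up.
have V0 : vsm U (fun=> 0) by exact: vsmooth0.
have sm r : vsm U (fun q => \sum_(k <- r) a k q *: Y k q).
  by apply: (vsmooth_sum oU) => k _; exact: vsmooth_scale.
have R0 : Rm (fun=> 0) X W p = 0.
  have := curvature_combl hc oU (smooth_cst A oU 1) V0 V0 Xs Ws Up.
  have -> : Rm (fun q => 1 *: 0 + 0) X W p = Rm (fun=> 0) X W p.
    congr (Rm _ X W p); apply/funext => q; by rewrite scaler0 addr0.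
  by move/eqP; rewrite scale1r addrC -subr_eq subrr => /eqP <-.
rewrite (curvature_anti hc oU (sm _) Xs Ws Up).
have -> : Rm (fun q => \sum_k a k q *: Y k q) X W p = \sum_k a k p *: Rm (Y k) X W p.
  elim: (index_enum _) => [|k r IH].
    rewrite big_nil -R0; congr (Rm _ X W p); apply/funext => q; by rewrite big_nil.
  rewrite big_cons -IH -(curvature_combl hc oU (As k) (Ys k) (sm r) Xs Ws Up).
  by congr (Rm _ X W p); apply/funext => q; rewrite big_cons.
rewrite -sumrN; apply: eq_bigr => k _.
by rewrite (curvature_anti hc oU (Ys k) Xs Ws Up) scalerN.
Qed.

Lemma curvature_sumr X Y (a : 'I_n -> M -> C) (W : 'I_n -> vfield) p :
  (forall k, smooth_on A U (a k)) -> vsm U X -> vsm U Y -> (forall k, vsm U (W k)) -> U p ->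
  Rm X Y (fun q => \sum_k a k q *: W k q) p = \sum_k a k p *: Rm X Y (W k) p.
Proof.
move=> As Xs Ys Ws Up.
have V0 : vsm U (fun=> 0) by exact: vsmooth0.
have sm r : vsm U (fun q => \sum_(k <- r) a k q *: W k q).
  by apply: (vsmooth_sum oU) => k _; exact: vsmooth_scale.
have R0 : Rm X Y (fun=> 0) p = 0.
  have := curvature_combr hc oU (smooth_cst A oU 1) Xs Ys V0 V0 Up.
  have -> : Rm X Y (fun q => 1 *: 0 + 0) p = Rm X Y (fun=> 0) p.
    congr (Rm X Y _ p); apply/funext => q; by rewrite scaler0 addr0.
  by move/eqP; rewrite scale1r addrC -subr_eq subrr => /eqP <-.
elim: (index_enum _) => [|k r IH].
  rewrite big_nil -R0; congr (Rm X Y _ p); apply/funext => q; by rewrite big_nil.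
rewrite big_cons -IH -(curvature_combr hc oU (As k) Xs Ys (Ws k) (sm r) Up).
by congr (Rm X Y _ p); apply/funext => q; rewrite big_cons.
Qed.

Lemma ric_trace G p : sec U G -> U p -> \sum_k coframe Z k p (Rm (Z k) (conjf G) G p) =
  \sum_i \sum_j ric A nabla Z i j p * coframe Z i p (G p) * conjc (coframe Z j p (G p)).
Proof.
move=> Gs Up; have Gv := sec_smooth Gs; have cs k := cf_smooth k Gs.
have cs' k := smooth_conj oU (cs k); have Zv' k := vsmooth_conj oU (Zv k).
have smZ : vsm U (fun q => \sum_k coframe Z k q (G q) *: Z k q).
  by apply: (vsmooth_sum oU) => k _; exact: vsmooth_scale.
have smJ : vsm U (fun q => \sum_k conjc (coframe Z k q (G q)) *: conjf (Z k) q).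
  by apply: (vsmooth_sum oU) => k _; exact: vsmooth_scale.
have EJ r : U r -> conjf G r = \sum_k conjc (coframe Z k r (G r)) *: conjf (Z k) r.
  move=> Ur; rewrite /conjf {1}(sec_exp Gs Ur) conjv_sum.
  by apply: eq_bigr => k _; rewrite conjvZ.
have E k : Rm (Z k) (conjf G) G p = \sum_j \sum_i conjc (coframe Z j p (G p)) *:
    (coframe Z i p (G p) *: Rm (Z k) (conjf (Z j)) (Z i) p).
  rewrite (curvature_eq hc oU (Zv k) (Zv k) (vsmooth_conj oU Gv) smJ Gv smZ Up (fun _ _ => erefl _)
    EJ (fun r Ur => sec_exp Gs Ur)).
  rewrite (curvature_suml cs' (Zv k) Zv' smZ Up); apply: eq_bigr => j _.
  by rewrite (curvature_sumr cs (Zv k) (Zv' j) Zv Up) scaler_sumr.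
under eq_bigr do rewrite E cf_sum.
rewrite exchange_big [RHS]exchange_big; apply: eq_bigr => j _ /=.
under eq_bigr do rewrite cf_sum.
rewrite exchange_big; apply: eq_bigr => i _ /=.
rewrite /ric !mulr_suml; apply: eq_bigr => k _; rewrite !cfZ.
by move: (coframe _ _ _ _) (coframe _ _ _ _) (conjc _) => a b c; ring.
Qed.

Section GradientDivergence.
Variables (f : M -> C) (G : vfield).
Hypothesis fs : smooth_on A setT f.
Hypothesis freal : forall p, conjc (f p) = f p.
Hypothesis Gs0 : sec setT G.
Hypothesis HG : forall U W p, open U -> sec U W -> U p -> lv W G p = vapp A W f p.
Variable p : M.
Hypothesis Up : U p.
Let Gs : sec U G. Proof. exact: sec_sub Gs0. Qed.
Let Gv : vsm U G := sec_smooth Gs.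
Let Gv' : vsm U (conjf G) := vsmooth_conj oU Gv.

(** All fields are of type (1,0), so the torsion and curvature terms of [div_nabla] vanish; what
    remains is the trace of the square of the matrix of [nabla G] in (1,0) directions. *)
Lemma div_nablaG : divergence (nabla G G) p = vapp A G (divergence G) p +
  \sum_k \sum_l coframe Z l p (nabla (Z k) G p) * coframe Z k p (nabla (Z l) G p).
Proof.
rewrite (div_nabla Gv Gs Up) [X in _ - X + _]big1 ?[X in _ - _ + X]big1 ?subr0 ?addr0.
- congr (_ + _); apply: eq_bigr => k _.
  rewrite (nabla_exp (sec_nabla S oU (Zv k) Gs) Gv Up) cf_sum.
  by apply: eq_bigr => l _; rewrite cfZ.
- move=> k _; rewrite (curvature20 S oU (Zs k) Gs Gs Up); exact: linear0.
- move=> k _; have V0 : vsm U (fun=> 0) by exact: vsmooth0.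
  rewrite (nabla_eql hc oU (torsion_smooth S oU (Zv k) Gv) V0 Gv Up (fun q Uq => tor20 S oU (Zs k) Gs Uq)).
  rewrite (nabla0l hc oU Gv Up); exact: linear0.
Qed.

(** Every correction in [div_nabla] vanishes: [T] is parallel, its torsion with the frame is zero,
    and [curvature_reeb] kills the curvature. *)
Lemma div_nablaT : divergence (nabla T G) p = vapp A T (divergence G) p.
Proof.
have V0 : vsm U (fun=> 0) by exact: vsmooth0.
rewrite (div_nabla Ts Gs Up) big1 ?[X in _ - X + _]big1 ?[X in _ - _ + X]big1 ?subr0 ?addr0 //.
- move=> k _; rewrite (curvature_reeb S oU (Zs k) Gs Up); exact: linear0.
- move=> k _.
  have E q : U q -> Tor (Z k) T q = 0.
    by move=> Uq; rewrite torsion_anti (torsion_reeb S oU (Zs k) Uq) oppr0.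
  rewrite (nabla_eql hc oU (torsion_smooth S oU (Zv k) Ts) V0 Gv Up E).
  rewrite (nabla0l hc oU Gv Up); exact: linear0.
- move=> k _; rewrite (nabla_eql hc oU (nabla_smooth hc oU (Zv k) Ts) V0 Gv Up).
    rewrite (nabla0l hc oU Gv Up); exact: linear0.
  by move=> q Uq; exact: (nablaT S oU (Zv k) Uq).
Qed.

(** The Bochner formula of the argument: the curvature term gives the Ricci tensor, and the torsion
    of (1,0) with (0,1) vectors gives the term in [nabla T G]. *)
Lemma div_nablaJ : divergence (nabla (conjf G) G) p = vapp A (conjf G) (divergence G) p +
  \sum_k \sum_l conjc (coframe Z l p (nabla (conjf (Z k)) G p)) * coframe Z k p (nabla (conjf (Z l)) G p)
  - \sum_k 2%:R * 'i%C * vapp A (Z k) f p * coframe Z k p (nabla T G p)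
  + \sum_i \sum_j ric A nabla Z i j p * coframe Z i p (G p) * conjc (coframe Z j p (G p)).
Proof.
rewrite (div_nabla Gv' Gs Up) (ric_trace Gs Up); congr (_ + _ - _ + _).
  apply: eq_bigr => k _; have Zv' := vsmooth_conj oU (Zv k).
  have Ns := sec_nabla S oU Zv' Gs.
  rewrite (nabla_eql hc oU (nabla_smooth hc oU (Zv k) Gv') (vsmooth_conj oU (sec_smooth Ns)) Gv Up); last first.
    by move=> q Uq; rewrite (nabla_conjr S oU (Zv k) Gv Uq).
  by rewrite (nablaJ_exp Ns Gv Up) cf_sum; apply: eq_bigr => l _; rewrite cfZ.
apply: eq_bigr => k _; rewrite -(HG oU (Zs k) Up) -cfZ; congr (coframe _ _ _ _).
have ls := smooth_mul oU (smooth_cst A oU (2%:R * 'i%C)) (levi_smooth S oU (Zs k) Gs).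
rewrite (nabla_eql hc oU (torsion_smooth S oU (Zv k) Gv') (vsmooth_scale oU ls Ts) Gv Up
  (fun q Uq => tor11 S oU (Zs k) Gs Uq)).
exact: (nablaZl hc oU ls Ts Gv Up).
Qed.

(* [f_i^i] is conjugate to the divergence of the gradient because
   [f_{i \bar j} = <Z_i, nabla_{Z_j} G>]. *)
Lemma trace_hess : \sum_i \sum_j hinv A theta Z p i j * hess A nabla Z f i j p =
  conjc (divergence G p).
Proof.
have ZG k : sec U (nabla (Z k) G) := sec_nabla S oU (Zv k) Gs.
have E i j : hess A nabla Z f i j p =
    \sum_k hmat A theta Z p i k * conjc (coframe Z k p (nabla (Z j) G p)).
  rewrite /hess -(hess11 S Gs0 HG oU Up (Zs i) (Zs j)).
  rewrite (levi_expr S oU frZ (fun _ => id) (Zs i) (ZG j) Up).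
  by apply: eq_bigr => k _; rewrite mxE mulrC.
rewrite exchange_big /= rmorph_sum; apply: eq_bigr => j _.
transitivity (\sum_k (invmx (hmat A theta Z p) *m hmat A theta Z p) j k *
   conjc (coframe Z k p (nabla (Z j) G p))).
  under eq_bigr do rewrite E mulr_sumr.
  rewrite exchange_big; apply: eq_bigr => k _; rewrite mxE mulr_suml; apply: eq_bigr => i _.
  by rewrite mxE mulrA.
rewrite mulVmx ?(hmat_unit S frZ Up) // (bigD1 j) //= big1 ?addr0; first by rewrite mxE eqxx mul1r.
by move=> k kj; rewrite mxE eq_sym (negPf kj) mul0r.
Qed.

(** The trace of [hess11_comm] against the inverse of the Levi matrix. Later it determines the
    imaginary part of the divergence of [G], on which the equation is silent. *)
Lemma div_grad_comm : conjc (divergence G p) - divergence G p = 2%:R * 'i%C * n%:R * vapp A T f p.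
Proof.
have ZG k : sec U (nabla (Z k) G) := sec_nabla S oU (Zv k) Gs.
set h := hmat A theta Z p; have hu : h \in unitmx := hmat_unit S frZ Up.
have hC i j : conjc (h i j) = h j i by rewrite (hmatC S i j frZ Up).
pose B := \matrix_(k, j) coframe Z k p (nabla (Z j) G p).
have E i j : lv (Z i) (nabla (Z j) G) p = (h *m map_mx (@conjc R) B) i j.
  rewrite (levi_expr S oU frZ (fun _ => id) (Zs i) (ZG j) Up) mxE.
  by apply: eq_bigr => k _; rewrite !mxE mulrC.
have E2 : h *m map_mx (@conjc R) B - B^T *m h = (2%:R * 'i%C * vapp A T f p) *: h.
  apply/matrixP => i j; have := hess11_comm S fs freal Gs0 HG oU Up (Zs i) (Zs j).
  rewrite !E => H; rewrite [LHS]mxE [RHS]mxE [h i j]mxE [RHS]mulrAC -H; congr (_ + _).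
  rewrite mxE; congr (- _); rewrite !mxE rmorph_sum; apply: eq_bigr => k _.
  rewrite rmorphM mulrC; congr (_ * _); first exact: (esym (hC j k)).
  by rewrite !mxE; exact: (esym (conjcK _)).
have := congr1 (fun x => \tr (x *m invmx h)) E2 => /=.
rewrite mulmxBl linearB -scalemxAl linearZ /= mulmxV // mxtrace1 -(mulmxA B^T) mulmxV // mulmx1.
rewrite mxtrace_mulC mulmxA mulVmx // mul1mx mxtrace_tr => H.
have -> : divergence G p = \tr B by apply: eq_bigr => k _; rewrite mxE.
have -> : conjc (\tr B) = \tr (map_mx (@conjc R) B).
  rewrite /mxtrace rmorph_sum; apply: eq_bigr => k _; by rewrite [RHS]mxE.
by rewrite H; ring.
Qed.

End GradientDivergence.
End Divergence.
(** * The Riemann integral in R^m *)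

Section GridFunctional.
Context {R : realType}.

(** Compactness gives one radius for all base points in [K]. If only the second point lies in [K]
    the roles are exchanged, and if neither does both values are 0. *)
Lemma unif_continuous_compact (E : normedModType R) (f : E -> R) (K : set E) : compact K ->
  continuous f -> (forall x, ~ K x -> f x = 0) ->
  forall e, 0 < e -> exists2 d, 0 < d & forall x y, `|x - y| < d -> `|f x - f y| <= e.
Proof.
move=> cK cf f0 e e0.
have near0 : \forall h \near (0 : E), K `<=` (fun x => `|f (x + h) - f x| <= e).
  apply: (proj1 (compact_near_coveringP K) cK) => x Kx.
  have c1 : (fun z : E * E => f (z.1 + z.2) - f z.1) @ nbhs (x, (0 : E)) --> f x - f x.
    apply: cvgB; last by apply: (cvg_comp _ _ (@cvg_fst _ _ _ _ _)); exact: cf.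
    have c2 : (fun z : E * E => z.1 + z.2) @ nbhs (x, (0 : E)) --> x + 0.
      by apply: cvgD; [exact: cvg_fst|exact: cvg_snd].
    by apply: (cvg_comp _ _ c2); rewrite addr0; exact: cf.
  rewrite subrr in c1; move/cvgrPdist_le: c1 => /(_ e e0).
  by apply: filterS => z /=; rewrite sub0r normrN.
move/nbhs_norm0P: near0 => [d d0 H]; exists d => // x y xy.
have H' z h : K z -> `|h| < d -> `|f (z + h) - f z| <= e by move=> Kz hd; exact: (H h hd z Kz).
have [Kx|Kx] := pselect (K x).
  by rewrite distrC; have := H' x (y - x) Kx; rewrite subrKC; apply; rewrite distrC.
have [Ky|Ky] := pselect (K y); first by have := H' y (x - y) Ky; rewrite subrKC; apply.
by rewrite !f0 // subrr normr0 ltW.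
Qed.

Lemma continuous_compp (T U W : topologicalType) (g : T -> U) (f : U -> W) x :
  {for x, continuous g} -> {for g x, continuous f} -> {for x, continuous (fun y => f (g y))}.
Proof. exact: continuous_comp. Qed.

Section Normed.
Variables E F : normedModType R.

Lemma continuous_addr (x v : E) : {for x, continuous (fun y : E => y + v)}.
Proof. by apply: cvgD; [exact: cvg_id|exact: cvg_cst]. Qed.

Lemma continuous_scaler (x : E) (a : R) : {for x, continuous (fun y : E => a *: y)}.
Proof. by apply: cvgZ; [exact: cvg_cst|exact: cvg_id]. Qed.

Lemma continuous_unif (f : E -> R) : (forall e, 0 < e -> exists2 d, 0 < d & forall x y, `|x - y| < d ->
  `|f x - f y| <= e) -> continuous f.
Proof.
move=> H x; apply/cvgrPdist_le => e e0; have [d d0 Hd] := H e e0.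
by apply/nbhs_normP; exists d => // y /= xy; exact: Hd.
Qed.

Lemma continuous_pairl (K : E * F -> R) x : continuous K -> continuous (fun y => K (x, y)).
Proof.
move=> cK y; apply: (cvg_comp (fun y => (x, y)) K); last exact: cK.
by apply: cvg_pair; [exact: cvg_cst|exact: cvg_id].
Qed.

Lemma continuous_pairr (K : E * F -> R) y : continuous K -> continuous (fun x => K (x, y)).
Proof.
move=> cK x; apply: (cvg_comp (fun x => (x, y)) K); last exact: cK.
by apply: cvg_pair; [exact: cvg_id|exact: cvg_cst].
Qed.
End Normed.

Variable m : nat.
Local Notation V := 'rV[R]_m.
Local Notation Z := 'rV[int]_m.
Definition half (k : nat) : R := 2%:R^-1 ^+ k.

Definition supported (b : nat) (f : V -> R) : Prop := forall x, b%:R < `|x| -> f x = 0.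
Definition test (f : V -> R) : Prop := continuous f /\ exists b, supported b f.

Definition grid k (z : Z) : V := \row_i ((z 0 i)%:~R * half k).
(** The sum runs over the whole grid, with finitely many nonzero terms when the support is bounded;
    translation by a grid vector is then an exact reindexing. *)
Definition gsum k (f : V -> R) : R := half k ^+ m * \sum_(z \in [set: Z]) f (grid k z).
Definition box N : seq Z := [seq \row_i ((w 0 i)%:Z - N%:Z) | w : 'rV['I_(N.*2.+1)]_m].
(** Bounds the mass of the grid points of norm at most [b] at every mesh; the extra unit absorbs the
    odd number of points on each axis, the mesh being at most 1. *)
Definition vol b : R := (b.*2.+1%:R) ^+ m.

Lemma half_gt0 k : 0 < half k. Proof. by rewrite exprn_gt0 // invr_gt0 ltr0n. Qed.
Lemma half_ge0 k : 0 <= half k. Proof. exact: ltW (half_gt0 k). Qed.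
Lemma halfK k : half k * (2 ^ k)%:R = 1.
Proof. by rewrite /half natrX -exprMn mulVf ?expr1n // pnatr_eq0. Qed.
Lemma half_le1 k : half k <= 1.
Proof. by apply: exprn_ile1; rewrite ?invr_ge0 ?ler0n // invf_le1 ?ler1n ?ltr0n. Qed.
Lemma halfD k j : half (k + j) = half k * half j. Proof. exact: exprD. Qed.
Lemma half_le k j : (k <= j)%N -> half j <= half k.
Proof. by move=> /subnKC <-; rewrite halfD ler_piMr ?half_ge0 ?half_le1. Qed.

Lemma half_lt e : 0 < e -> exists k, half k < e.
Proof.
move=> e0; have [k ek] : exists k : nat, e^-1 < k%:R.
  by exists (Num.trunc e^-1).+1; rewrite truncnS_gt.
exists k; rewrite -(ltr_pM2r (x := (2 ^ k)%:R)) ?ltr0n ?expn_gt0 // halfK.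
rewrite mulrC -ltr_pdivrMr // mul1r (lt_trans ek) // ltr_nat ltn_expl //.
Qed.

Lemma vol_gt0 b : 0 < vol b. Proof. by rewrite exprn_gt0 // ltr0n. Qed.

Lemma mem_box N (z : Z) : (forall i, `|z 0 i| <= N%:Z) -> z \in box N.
Proof.
move=> H; apply/mapP.
pose a i : nat := absz (z 0 i + N%:Z).
have P i : (a i < N.*2.+1)%N by rewrite /a; have := H i; lia.
exists (\row_i Ordinal (P i)); first by rewrite mem_enum.
by apply/rowP => i; rewrite !mxE /= /a; have := H i; lia.
Qed.

Lemma box_uniq N : uniq (box N).
Proof.
rewrite map_inj_uniq ?enum_uniq // => w w' /rowP H; apply/rowP => i.
by have := H i; rewrite !mxE => /addIr[] /val_inj.
Qed.

Lemma size_box N : size (box N) = (N.*2.+1 ^ m)%N.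
Proof. by rewrite size_map -cardE card_mx card_ord mul1n. Qed.

Lemma grid_out b k (z : Z) f : supported b f -> z \notin box (b * 2 ^ k) -> f (grid k z) = 0.
Proof.
move=> fb zb; apply: fb; rewrite ltNge; apply: contra zb => H; apply: mem_box => i.
have := le_trans (row_coord_le (grid k z) i) H; rewrite mxE normrM (gtr0_norm (half_gt0 k)).
rewrite -(ler_pM2r (x := (2 ^ k)%:R)) ?ltr0n ?expn_gt0 // -mulrA halfK mulr1 -natrM -intr_norm.
by rewrite -[X in _ <= X]/((b * 2 ^ k)%:Z%:~R) ler_int.
Qed.

Lemma gsumE b k f : supported b f ->
  gsum k f = half k ^+ m * \sum_(z <- box (b * 2 ^ k)) f (grid k z).
Proof.
move=> fb; rewrite /gsum (fsbigE (box (b * 2 ^ k)) (fun z => f (grid k z)) (box_uniq _)) //.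
  by congr (_ * _); apply: eq_bigl => z; rewrite in_setT.
by move=> z _; exact: grid_out.
Qed.

Lemma supported_le b c f : (b <= c)%N -> supported b f -> supported c f.
Proof. by move=> bc fb x xc; apply: fb; apply: le_lt_trans xc; rewrite ler_nat. Qed.

Lemma half_box b k : half k ^+ m * (size (box (b * 2 ^ k)))%:R <= vol b.
Proof.
rewrite size_box natrX -exprMn; apply: lerXn2r; rewrite ?nnegrE ?mulr_ge0 ?ler0n ?half_ge0 //.
rewrite doubleMl -addn1 natrD mulrDr mulr1 natrM mulrCA halfK mulr1.
by rewrite -addn1 natrD lerD2l half_le1.
Qed.

Lemma gsum_bound b k f e : supported b f -> 0 <= e -> (forall x, `|f x| <= e) ->
  `|gsum k f| <= e * vol b.
Proof.
move=> fb e0 fe; rewrite (gsumE _ fb) normrM (ger0_norm (exprn_ge0 _ (half_ge0 k))).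
apply: (le_trans (y := half k ^+ m * \sum_(z <- box (b * 2 ^ k)) e)).
  rewrite ler_wpM2l ?exprn_ge0 ?half_ge0 //.
  by apply: (le_trans (ler_norm_sum _ _ _)); apply: ler_sum.
rewrite big_const_seq count_predT iter_addr_0 -[e *+ _]mulr_natr mulrCA.
by rewrite ler_wpM2l // half_box.
Qed.

Lemma gsumD b k f g : supported b f -> supported b g ->
  gsum k (fun x => f x + g x) = gsum k f + gsum k g.
Proof.
move=> fb gb; rewrite (gsumE _ fb) (gsumE _ gb) (gsumE (b := b)) ?big_split ?mulrDr //.
by move=> x xb; rewrite fb // gb // addr0.
Qed.

Lemma gsumZ k a f : gsum k (fun x => a * f x) = a * gsum k f.
Proof. by rewrite /gsum -mulr_fsumr mulrCA. Qed.

Lemma gsumB b k f g : supported b f -> supported b g ->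
  gsum k (fun x => f x - g x) = gsum k f - gsum k g.
Proof.
move=> fb gb; rewrite (gsumE _ fb) (gsumE _ gb) (gsumE (b := b)) ?sumrB ?mulrBr //.
by move=> x xb; rewrite fb // gb // subr0.
Qed.

Lemma gsum_shift k v f : gsum k (fun x => f (x + grid k v)) = gsum k f.
Proof.
rewrite /gsum; congr (_ * _).
rewrite [RHS](reindex_fsbigT (fun z => z + v)); last by exists (fun z => z - v) => z; [exact: addrK|exact: subrK].
apply: eq_fsbigr => z _; congr (f _); apply/rowP => i; rewrite !mxE intrD mulrDl; by [].
Qed.

Lemma gsum_ge_term b k f z : supported b f -> (forall x, 0 <= f x) ->
  half k ^+ m * f (grid k z) <= gsum k f.
Proof.
move=> fb f0; rewrite (gsumE _ fb) ler_wpM2l ?exprn_ge0 ?half_ge0 //.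
have [zb|zb] := boolP (z \in box (b * 2 ^ k)); last by rewrite (grid_out fb zb) sumr_ge0.
by rewrite (bigD1_seq z) ?box_uniq //= lerDl sumr_ge0.
Qed.

Definition sub_grid j (u : 'rV['I_(2 ^ j)]_m) : Z := \row_i (u 0 i)%:Z.

Lemma sub_grid_bounds k j u i : 0 <= grid (k + j) (@sub_grid j u) 0 i < half k.
Proof.
rewrite !mxE mulr_ge0 ?ler0z ?half_ge0 //= halfD mulrCA -[X in _ < X]mulr1.
by rewrite ltr_pM2l ?half_gt0 // -[X in _ < X](halfK j) mulrC ltr_pM2l ?half_gt0 // -[X in X < _]/((u 0 i)%:R) ltr_nat ltn_ord.
Qed.

Lemma supported_shift b c f v : supported b f -> `|v| <= c%:R -> supported (b + c) (fun x => f (x + v)).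
Proof.
move=> fb vc x; rewrite natrD => xb; apply: fb.
have := ler_normB (x + v) v; rewrite addrK => H.
by rewrite -(ltrD2r c%:R) (lt_le_trans xb) // (le_trans H) // lerD2l.
Qed.

Lemma grid_norm_le k j u : `|grid (k + j) (@sub_grid j u)| <= half k.
Proof.
apply: row_norm_le => [|i]; first exact: ltW (half_gt0 k).
by have /andP[h0 h1] := sub_grid_bounds k u i; rewrite ger0_norm // ltW.
Qed.

(* The fine grid is a disjoint union of translates of the coarse one. *)
Lemma gsum_refine b k j f : supported b f -> gsum (k + j) f =
  half j ^+ m * \sum_(u : 'rV['I_(2 ^ j)]_m) gsum k (fun x => f (x + grid (k + j) (sub_grid u))).
Proof.
move=> fb; have j2 : (0 < 2 ^ j)%N by rewrite expn_gt0.
pose N2 : int := (2 ^ j)%N.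
pose h (p : Z * 'rV['I_(2 ^ j)]_m) : Z := \row_i (p.1 0 i * N2 + (p.2 0 i)%:Z).
have N2p : 0 < N2 by rewrite ltz_nat.
pose md (z : Z) i : nat := absz (modz (z 0 i) N2).
have P (z : Z) i : (md z i < 2 ^ j)%N.
  have := ltz_pmod (z 0 i) N2p; have := modz_ge0 (z 0 i) (lt0r_neq0 N2p).
  by rewrite /md /N2; lia.
pose g (z : Z) : Z * 'rV['I_(2 ^ j)]_m := (\row_i divz (z 0 i) N2, \row_i Ordinal (P z i)).
have hE p i : h p 0 i = p.1 0 i * N2 + (p.2 0 i)%:Z.
  by rewrite mxE.
have ub (p : Z * 'rV['I_(2 ^ j)]_m) i : (p.2 0 i)%:Z < N2 by rewrite ltz_nat.
have bij : bijective h.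
  exists g => [p|z].
    have d i : divz (h p 0 i) N2 = p.1 0 i.
      by rewrite hE divzMDl ?gt_eqF // divz_small ?addr0 // gtz0_abs // ub andbT.
    have r i : modz (h p 0 i) N2 = (p.2 0 i)%:Z.
      by rewrite hE modzMDl modz_small // ub andbT.
    rewrite [RHS]surjective_pairing /g; congr pair; apply/rowP => i; rewrite mxE ?d //.
    by apply: val_inj; rewrite [RHS]/= -[LHS]/(md (h p) i) /md r.
  apply/rowP => i; rewrite hE !mxE /= [RHS](divz_eq _ N2); congr (_ + _).
  by rewrite gez0_abs // modz_ge0 // gt_eqF.
have gE p : grid (k + j) (h p) = grid k p.1 + grid (k + j) (sub_grid p.2).
  apply/rowP => i; rewrite mxE hE [RHS]mxE [X in _ = X + _]mxE [X in _ = _ + X]mxE.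
  rewrite intrD mulrDl; congr (_ + _); last by rewrite mxE.
  rewrite halfD intrM -[N2%:~R]/((2 ^ j)%:R) -mulrA (mulrC (half k)) (mulrA _ (half j)).
  by rewrite (mulrC _ (half j)) halfK mul1r.
have sf u : supported (b + 1) (fun x => f (x + grid (k + j) (@sub_grid j u))).
  by apply: (supported_shift fb); exact: le_trans (grid_norm_le k u) (half_le1 k).
rewrite {1}/gsum (reindex_fsbigT h) //.
pose r := [seq (w, u) | w <- box ((b + 1) * 2 ^ k), u <- enum {: 'rV['I_(2 ^ j)]_m}].
have ur : uniq r.
  by apply: allpairs_uniq; rewrite ?box_uniq ?enum_uniq // => -[? ?] [? ?].
rewrite (fsbigE r (fun p => f (grid (k + j) (h p))) ur) //; last first.
  move=> [w u] _; rewrite gE => H; apply: (grid_out (f := fun x => f (x + grid (k + j) (@sub_grid j u))) (sf u)).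
  apply: contra H => wb; apply/allpairsP; exists (w, u); split=> //; exact: mem_enum.
transitivity (half (k + j) ^+ m * \sum_(p <- r) f (grid (k + j) (h p))).
  by congr (_ * _); apply: eq_bigl => p; rewrite in_setT.
rewrite big_allpairs exchange_big halfD exprMn [X in X * _]mulrC -mulrA big_enum /=.
congr (_ * _); rewrite mulr_sumr; apply: eq_bigr => u _; rewrite (gsumE _ (sf u)); congr (_ * _).
by apply: eq_bigr => w _; rewrite gE.
Qed.

(** By [gsum_refine] the fine sum is the average of the coarse sums of translates of [f] by less
    than one mesh, each of which differs from [f] by at most [e]. The support may grow by one mesh,
    hence [b + 1]. *)
Lemma gsum_cauchy b e k j f : supported b f ->
  (forall x y, `|x - y| <= half k -> `|f x - f y| <= e) ->
  `|gsum (k + j) f - gsum k f| <= e * vol (b + 1).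
Proof.
move=> fb fe; have e0 : 0 <= e by apply: le_trans (normr_ge0 _) (fe 0 0 _); rewrite subrr normr0 half_ge0.
have sf u : supported (b + 1) (fun x => f (x + grid (k + j) (@sub_grid j u))).
  by apply: (supported_shift fb); exact: le_trans (grid_norm_le k u) (half_le1 k).
have sf' : supported (b + 1) f by apply: supported_le fb; rewrite leq_addr.
have c1 : half j ^+ m * (#|{: 'rV['I_(2 ^ j)]_m}|)%:R = 1.
  by rewrite card_mx card_ord mul1n natrX -exprMn halfK expr1n.
rewrite (gsum_refine _ _ fb) -[X in _ - X]mul1r -c1 -mulrA -mulrBr mulr_natl -sumr_const -sumrB.
rewrite normrM (ger0_norm (exprn_ge0 _ (half_ge0 j))) -[X in _ <= X]mul1r -c1 -mulrA.
rewrite ler_wpM2l ?exprn_ge0 ?half_ge0 // mulr_natl -sumr_const.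
apply: (le_trans (ler_norm_sum _ _ _)); apply: ler_sum => u _.
rewrite -(gsumB _ (sf u) sf'); apply: gsum_bound => // [x xb|x].
  by rewrite sf // sf' // subrr.
by apply: fe; rewrite addrAC subrr add0r grid_norm_le.
Qed.

Lemma test_uniform f e : test f -> 0 < e ->
  exists k, forall x y, `|x - y| <= half k -> `|f x - f y| <= e.
Proof.
move=> [cf [b fb]] e0; pose K := [set x : V | `|x| <= b%:R].
have cK : compact K.
  apply: bounded_closed_compact; first by exists b%:R; split=> // M bM x /= /le_trans; apply; exact: ltW.
  by apply: (@closed_comp _ _ (fun x : V => `|x|) [set y | y <= b%:R]); [move=> x _; exact: norm_continuous|exact: closed_le].
have f0 x : ~ K x -> f x = 0 by move=> /negP; rewrite -ltNge; exact: fb.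
have [d d0 H] := unif_continuous_compact cK cf f0 e0.
have [k kd] := half_lt d0; exists k => x y xy; apply: H; exact: le_lt_trans xy kd.
Qed.

(* Riemann sums over the dyadic grids; they converge for the continuous functions
   with bounded support. *)
Definition integral f : R := limn (fun k => gsum k f).

Lemma integral_approx f e k b : test f -> supported b f ->
  (forall x y, `|x - y| <= half k -> `|f x - f y| <= e) -> `|integral f - gsum k f| <= e * vol (b + 1).
Proof.
move=> tf fb fe.
have cv : cvgn (fun k => gsum k f).
  apply: cauchy_cvg; apply: cauchy_exP => d d0.
  have d' : 0 < d / 2 / vol (b + 1) by rewrite !divr_gt0 ?vol_gt0.
  have [k0 H] := test_uniform tf d'; exists (gsum k0 f).
  exists k0 => // n /= /subnKC <-; rewrite -ball_normE /= distrC.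
  apply: le_lt_trans (gsum_cauchy _ fb H) _.
  by rewrite divfK ?gt_eqF ?vol_gt0 // ltr_pdivrMr // ltr_pMr // ltr1n.
apply: (cvgr_to_le (f := fun n => `|gsum n f - gsum k f|) (F := \oo)).
  by apply: cvg_norm; apply: cvgB; [exact: cv|exact: cvg_cst].
by exists k => // n /= /subnKC <-; exact: gsum_cauchy.
Qed.

Lemma integral_approxP f e : test f -> 0 < e ->
  exists k0, forall k, (k0 <= k)%N -> `|integral f - gsum k f| <= e.
Proof.
move=> tf e0; have [_ [b fb]] := tf.
have d' : 0 < e / vol (b + 1) by rewrite divr_gt0 ?vol_gt0.
have [k0 H] := test_uniform tf d'; exists k0 => k kk.
have := integral_approx (k := k) tf fb (fun x y xy => H x y (le_trans xy (half_le kk))).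
by rewrite divfK ?gt_eqF ?vol_gt0.
Qed.

(** The rules for [integral] are obtained through this criterion from statements that hold exactly,
    or up to a uniform error, for grid sums. *)
Lemma integral_unique f l : test f ->
  (forall e, 0 < e -> exists k0, forall k, (k0 <= k)%N -> `|l - gsum k f| <= e) -> integral f = l.
Proof.
move=> tf H; apply/eqP; rewrite -subr_eq0 -normr_le0; apply/ler_addgt0Pl => e e0.
have e2 : 0 < e / 2 by rewrite divr_gt0.
have [k1 H1] := integral_approxP tf e2; have [k2 H2] := H _ e2.
rewrite addr0 [e]splitr -[_ - l](subrKA (gsum (maxn k1 k2) f)).
apply: (le_trans (ler_normD _ _)); apply: lerD; first by apply: H1; rewrite leq_maxl.
by rewrite distrC; apply: H2; rewrite leq_maxr.
Qed.

Lemma eq_integral f g : (forall x, f x = g x) -> integral f = integral g.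
Proof. by move=> /funext ->. Qed.

Definition gfloor k (v : V) : Z := \row_i Num.floor (v 0 i * (2 ^ k)%:R).

Lemma gfloor_bounds k (v : V) i : 0 <= v 0 i - grid k (gfloor k v) 0 i < half k.
Proof.
rewrite !mxE; have /andP[h1 h2] := floor_itv (v 0 i * (2 ^ k)%:R).
have E : v 0 i = v 0 i * (2 ^ k)%:R * half k by rewrite -mulrA (mulrC _ (half k)) halfK mulr1.
rewrite {1 3}E -mulrBl pmulr_lge0 ?half_gt0 // subr_ge0 h1 /=.
rewrite -[X in _ < X]mul1r ltr_pM2r ?half_gt0 // ltrBlDl; move: h2; by rewrite intrD.
Qed.

Lemma gfloor_near k (v : V) : `|v - grid k (gfloor k v)| <= half k.
Proof.
apply: row_norm_le => [|i]; first exact: half_ge0.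
have /andP[h0 h1] := gfloor_bounds k v i; rewrite mxE [X in _ + X]mxE.
by rewrite ger0_norm // ltW.
Qed.

Lemma normal_bounded (v : V) : exists c : nat, `|v| <= c%:R.
Proof. by exists (Num.trunc `|v|).+1; rewrite ltW // truncnS_gt. Qed.

Lemma test_shift f v : test f -> test (fun x => f (x + v)).
Proof.
move=> [cf [b fb]]; split.
  by move=> x; exact: (continuous_compp (@continuous_addr _ x v) (cf (x + v))).
by have [c vc] := normal_bounded v; exists (b + c); exact: supported_shift.
Qed.

Lemma testD f g : test f -> test g -> test (fun x => f x + g x).
Proof.
move=> [cf [b fb]] [cg [c gc]]; split; first by move=> x; exact: (continuousDp (cf x) (cg x)).
exists (b + c) => x xb; rewrite (supported_le (leq_addr c b) fb) // (supported_le (leq_addl b c) gc) //.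
by rewrite addr0.
Qed.

Lemma testM (f g : V -> R) : test f -> continuous g -> test (fun x => g x * f x).
Proof.
move=> [cf [b fb]] cg; split; first by move=> x; exact: (continuousMp (cg x) (cf x)).
by exists b => x xb; rewrite fb // mulr0.
Qed.

Lemma testZ f a : test f -> test (fun x => a * f x).
Proof. by move=> tf; apply: testM => // x; exact: continuous_cstp. Qed.

Lemma test0 : test (fun=> 0).
Proof. by split; [move=> x; exact: continuous_cstp|exists 0%N]. Qed.

Lemma test_sum (I : Type) (r : seq I) (f : I -> V -> R) : (forall i, test (f i)) ->
  test (fun x => \sum_(i <- r) f i x).
Proof.
move=> H; elim: r => [|i r IH].
  by rewrite (_ : (fun x => _) = fun=> 0); [exact: test0|apply/funext => x; rewrite big_nil].
rewrite (_ : (fun x => _) = fun x => f i x + \sum_(j <- r) f j x); first exact: testD.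
by apply/funext => x; rewrite big_cons.
Qed.

Lemma test_scale f j : test f -> test (fun x => f ((2 ^ j)%:R *: x)).
Proof.
move=> [cf [b fb]]; split.
  by move=> x; exact: (continuous_compp (@continuous_scaler _ x (2 ^ j)%:R) (cf _)).
exists b => x xb; apply: fb; rewrite normrZ ger0_norm ?ler0n // (lt_le_trans xb) //.
by rewrite ler_peMl // ler1n expn_gt0.
Qed.

Lemma integralD f g : test f -> test g -> integral (fun x => f x + g x) = integral f + integral g.
Proof.
move=> tf tg; apply: integral_unique => [|e e0]; first exact: testD.
have e2 : 0 < e / 2 by rewrite divr_gt0.
have [k1 H1] := integral_approxP tf e2; have [k2 H2] := integral_approxP tg e2.
have [[_ [b fb]] [_ [c gc]]] := (tf, tg).
exists (maxn k1 k2) => k kk.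
rewrite (gsumD _ (supported_le (leq_addr c b) fb) (supported_le (leq_addl b c) gc)).
rewrite opprD addrACA [e]splitr; apply: (le_trans (ler_normD _ _)).
by apply: lerD; [apply: H1|apply: H2]; apply: leq_trans kk; rewrite ?leq_maxl ?leq_maxr.
Qed.

Lemma integralZ a f : test f -> integral (fun x => a * f x) = a * integral f.
Proof.
move=> tf; apply: integral_unique => [|e e0]; first exact: testZ.
have a0 : 0 < `|a| + 1 by rewrite ltr_wpDl.
have e2 : 0 < e / (`|a| + 1) by rewrite divr_gt0.
have [k1 H1] := integral_approxP tf e2; exists k1 => k /H1 H.
rewrite gsumZ -mulrBr normrM (le_trans (ler_wpM2l (normr_ge0 a) H)) //.
by rewrite mulrA ler_pdivrMr // mulrC ler_pM2l // lerDl.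
Qed.

Lemma integralN f : test f -> integral (fun x => - f x) = - integral f.
Proof.
by move=> tf; rewrite -mulN1r -integralZ //; apply: eq_integral => x; rewrite mulN1r.
Qed.

Lemma integralB f g : test f -> test g -> integral (fun x => f x - g x) = integral f - integral g.
Proof.
move=> tf tg; rewrite -(integralN tg) -integralD //.
by rewrite (_ : (fun x => - g x) = fun x => -1 * g x); [exact: testZ|apply/funext => x; rewrite mulN1r].
Qed.

Lemma testN f : test f -> test (fun x => - f x).
Proof.
by move=> tf; rewrite (_ : (fun x => - f x) = fun x => -1 * f x);
  [exact: testZ|apply/funext => x; rewrite mulN1r].
Qed.

Lemma integral0 : integral (fun=> 0) = 0.
Proof.
apply: integral_unique => [|e e0]; first exact: test0.
exists 0 => k _; rewrite (gsumE (b := 0)) // big1 // mulr0 subrr normr0 ltW //.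
Qed.

Lemma integral_sum (I : Type) (r : seq I) (f : I -> V -> R) : (forall i, test (f i)) ->
  integral (fun x => \sum_(i <- r) f i x) = \sum_(i <- r) integral (f i).
Proof.
move=> H; elim: r => [|i r IH].
  transitivity (integral (fun=> 0)); last by rewrite integral0 big_nil.
  by apply: eq_integral => x; rewrite big_nil.
rewrite big_cons -IH -integralD //; last exact: test_sum.
by apply: eq_integral => x; rewrite big_cons.
Qed.

Lemma integral_ge0 f : test f -> (forall x, 0 <= f x) -> 0 <= integral f.
Proof.
move=> tf f0; apply/ler_addgt0Pl => e e0; have [k H] := integral_approxP tf e0.
have g0 : 0 <= gsum k f by rewrite mulr_ge0 ?exprn_ge0 ?half_ge0 // fsumr_ge0.
have := H k (leqnn k); rewrite ler_norml => /andP[h _]; rewrite addrC -subr_ge0 in h *.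
by apply: le_trans g0 _; rewrite -subr_ge0; move: h; lra.
Qed.

Lemma integral_bound b f e : test f -> supported b f -> 0 <= e -> (forall x, `|f x| <= e) ->
  `|integral f| <= e * vol b.
Proof.
move=> tf fb e0 fe; apply/ler_addgt0Pl => d d0; have [k H] := integral_approxP tf d0.
rewrite -[integral f](subrK (gsum k f)); apply: (le_trans (ler_normD _ _)).
by apply: lerD; [exact: H|exact: gsum_bound].
Qed.

(** For a grid vector the translation merely reindexes the sum; a general [v] lies within one mesh
    of a grid vector, and uniform continuity absorbs the difference. *)
Lemma integral_shift f v : test f -> integral (fun x => f (x + v)) = integral f.
Proof.
move=> tf; apply: integral_unique => [|e e0]; first exact: test_shift.
have [_ [b fb]] := tf; have [c vc] := normal_bounded v.
have d0 : 0 < e / 2 / vol (b + c.+1) by rewrite !divr_gt0 ?vol_gt0.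
have [k1 H1] := test_uniform tf d0.
have [k2 H2] := integral_approxP tf (divr_gt0 e0 (ltr0n R 2)).
exists (maxn k1 k2) => k; rewrite geq_max => /andP[kk1 kk2].
set w := grid k (gfloor k v).
have wc : `|w| <= c.+1%:R.
  have := ler_normB v (v - w); rewrite opprB subrKC => h; apply: le_trans h _.
  by rewrite -[c.+1%:R]natr1 lerD // (le_trans (gfloor_near k v)) // half_le1.
have s1 : supported (b + c.+1) (fun x => f (x + w)) by exact: supported_shift.
have s2 : supported (b + c.+1) (fun x => f (x + v)).
  by apply: supported_shift => //; apply: le_trans vc _; rewrite ler_nat.
rewrite -(subrKA (gsum k f)) [e]splitr; apply: (le_trans (ler_normD _ _)).
apply: lerD; first exact: H2.
rewrite -(gsum_shift k (gfloor k v) f) -(gsumB _ s1 s2) -[X in _ <= X](divfK (lt0r_neq0 (vol_gt0 (b + c.+1)))).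
apply: gsum_bound; [by move=> x xb; rewrite s1 // s2 // subrr|exact: ltW|move=> x].
apply: H1; rewrite opprD addrACA subrr add0r distrC; apply: le_trans (gfloor_near k v) _.
exact: half_le.
Qed.

(** Only powers of two are considered: they carry dyadic grids to dyadic grids exactly, and they
    provide the scales tending to 0 of the change of variables. *)
Lemma integral_scale f j : test f ->
  integral (fun x => f ((2 ^ j)%:R *: x)) = half j ^+ m * integral f.
Proof.
move=> tf; apply: integral_unique => [|e e0]; first exact: test_scale.
have [k1 H1] := integral_approxP tf e0.
exists (k1 + j)%N => k kk; have kj : (j <= k)%N by apply: leq_trans kk; rewrite leq_addl.
have -> : gsum k (fun x => f ((2 ^ j)%:R *: x)) = half j ^+ m * gsum (k - j) f.
  rewrite /gsum mulrA -exprMn -halfD subnKC //; congr (_ * _); apply: eq_fsbigr => z _.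
  congr (f _); apply/rowP => i; rewrite !mxE -{1}(subnKC kj) halfD.
  by rewrite mulrCA; congr (_ * _); rewrite mulrA (mulrC _ (half j)) halfK mul1r.
rewrite -mulrBr normrM ger0_norm ?exprn_ge0 ?half_ge0 //.
apply: (@le_trans _ _ (1 * e)); last by rewrite mul1r.
apply: ler_pM; rewrite ?exprn_ge0 ?half_ge0 //.
  by rewrite exprn_ile1 ?half_ge0 ?half_le1.
by apply: H1; rewrite leq_subRL // addnC.
Qed.

(** Near [x0] the function exceeds half its value there. At every finer level each translated coarse
    grid has a point in that neighbourhood, which bounds all the sums below by one constant [c]. *)
Lemma integral_gt0 f x0 : test f -> (forall x, 0 <= f x) -> 0 < f x0 -> 0 < integral f.
Proof.
move=> tf f0 fx0; have c0 : 0 < f x0 / 2 by rewrite divr_gt0.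
have [k0 H0] := test_uniform tf c0; have [_ [b fb]] := tf.
have low x : `|x - x0| <= half k0 -> f x0 / 2 <= f x.
  move=> /H0; rewrite ler_norml => /andP[h _]; move: h; lra.
pose c := half k0 ^+ m * (f x0 / 2).
have cpos : 0 < c by rewrite mulr_gt0 ?exprn_gt0 ?half_gt0.
have lowk j : c <= gsum (k0 + j) f.
  rewrite (gsum_refine _ _ fb).
  have c1 : half j ^+ m * (#|{: 'rV['I_(2 ^ j)]_m}|)%:R = 1.
    by rewrite card_mx card_ord mul1n natrX -exprMn halfK expr1n.
  rewrite -[c]mul1r -c1 -mulrA ler_wpM2l ?exprn_ge0 ?half_ge0 // mulr_natl -sumr_const.
  apply: ler_sum => u _.
  have sf : supported (b + 1) (fun x => f (x + grid (k0 + j) (@sub_grid j u))).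
    by apply: (supported_shift fb); exact: le_trans (grid_norm_le k0 u) (half_le1 k0).
  apply: le_trans (gsum_ge_term k0 (gfloor k0 x0) sf (fun x => f0 _)).
  rewrite /c ler_wpM2l ?exprn_ge0 ?half_ge0 //; apply: low; apply: row_norm_le => [|i].
    exact: half_ge0.
  have /andP[h1 h2] := gfloor_bounds k0 x0 i; have /andP[h3 h4] := sub_grid_bounds k0 u i.
  move: h1 h2 h3 h4; rewrite [in X in _ -> _ -> _ -> _ -> X]mxE [X in `|X + _|]mxE [X in `|_ + X|]mxE.
  move: (grid _ _ 0 i) (grid _ _ 0 i) (x0 0 i) => g h y h1 h2 h3 h4.
  by rewrite ler_norml; apply/andP; split; lra.
have c2 : 0 < c / 2 by rewrite divr_gt0.
have [k1 H1] := integral_approxP tf c2.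
have := H1 (k0 + k1)%N (leq_addl _ _); have := lowk k1.
rewrite ler_norml => h /andP[h1 _]; clearbody c; move: h h1 cpos; lra.
Qed.

(** The difference quotient over one grid step has grid sum exactly 0 by translation invariance, and
    it is uniformly close to [df] by the mean value bound. *)
Lemma integral_derive f df (i : 'I_m) : test f -> test df ->
  (forall x, is_derive x (delta_mx 0 i) f (df x)) -> integral df = 0.
Proof.
move=> tf tdf Hd; apply: integral_unique => // e e0.
have [[_ [b fb]] [_ [c gc]]] := (tf, tdf).
pose N := (b + c + 1)%N.
have d0 : 0 < e / vol N by rewrite divr_gt0 ?vol_gt0.
have [k1 H1] := test_uniform tdf d0; exists k1 => k kk.
pose w : Z := \row_j (j == i)%:Z.
have wE : grid k w = half k *: delta_mx 0 i.
  by apply/rowP => j; rewrite !mxE mulrC eqxx /=; case: eqP.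
have wn : `|grid k w| <= half k.
  by rewrite wE normrZ gtr0_norm ?half_gt0 // -[X in _ <= X]mulr1 ler_wpM2l ?half_ge0 // norm_delta_le.
have sf : supported N (fun x => f (x + grid k w)).
  apply: (@supported_le (b + 1)); first by rewrite /N addnAC leq_addr.
  by apply: (supported_shift fb); exact: le_trans wn (half_le1 k).
have sf' : supported N f by apply: supported_le fb; rewrite /N -addnA leq_addr.
have sdf : supported N df by apply: supported_le gc; rewrite /N addnAC leq_addl.
pose q x := (2 ^ k)%:R * (f (x + grid k w) - f x).
have sq : supported N q by move=> x xb; rewrite /q sf // sf' // subrr mulr0.
have q0 : gsum k q = 0.
  by rewrite /q gsumZ (gsumB _ sf sf') gsum_shift subrr mulr0.
rewrite -q0 -(gsumB _ sq sdf) -[e](divfK (lt0r_neq0 (vol_gt0 N))); apply: gsum_bound.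
- by move=> x xb; rewrite sq // sdf // subrr.
- exact: ltW.
move=> x; have := @mvt_bound R (fun t => f (x + t *: delta_mx 0 i)) (df x) (e / vol N) (half k).
have h1 (t : R) : `|t| <= `|half k| -> exists2 d,
    is_derive t (1 : R) (fun s => f (x + s *: delta_mx 0 i)) d & `|d - df x| <= e / vol N.
  move=> tk; exists (df (x + t *: delta_mx 0 i)).
    have Hx := Hd (x + t *: delta_mx 0 i).
    have ex : derivable f (x + t *: delta_mx 0 i) (delta_mx 0 i) by case: Hx.
    by have := is_derive_line ex; rewrite (derive_val (is_derive := Hx)).
  apply: H1; rewrite addrAC subrr add0r normrZ (le_trans _ (half_le kk)) //.
  rewrite -[X in _ <= X]mulr1; apply: ler_pM => //; last exact: norm_delta_le.
  by apply: le_trans tk _; rewrite gtr0_norm ?half_gt0.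
move=> /(_ h1); rewrite scale0r addr0 -wE (gtr0_norm (half_gt0 k)) => h2.
have -> : q x - df x = (2 ^ k)%:R * (f (x + grid k w) - f x - df x * half k).
  by rewrite mulrBr /q mulrCA (mulrC _ (half k)) halfK mulr1.
rewrite normrM ger0_norm ?ler0n // -(ler_pM2l (half_gt0 k)) mulrA halfK mul1r.
by rewrite mulrC in h2 *; rewrite [X in _ <= X]mulrC.
Qed.

Section Fubini.
Variable K : V * V -> R.
Hypothesis cK : continuous K.
Variable b : nat.
Hypothesis Kb : forall x y, b%:R < `|x| \/ b%:R < `|y| -> K (x, y) = 0.

Let unif e : 0 < e -> exists k, forall p q : V * V, `|p.1 - q.1| <= half k -> `|p.2 - q.2| <= half k ->
  `|K p - K q| <= e.
Proof.
move=> e0; pose B := [set x : V | `|x| <= b%:R].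
have cB : compact B.
  apply: bounded_closed_compact; first by exists b%:R; split=> // M bM x /= /le_trans; apply; exact: ltW.
  by apply: (@closed_comp _ _ (fun x : V => `|x|) [set y | y <= b%:R]); [move=> x _; exact: norm_continuous|exact: closed_le].
have cBB : compact (B `*` B) by exact: compact_setX.
have f0 p : ~ (B `*` B) p -> K p = 0.
  move: p => [x y] /= /not_andP[] /negP; rewrite -ltNge => h; apply: Kb; [by left|by right].
have [d d0 H] := unif_continuous_compact cBB cK f0 e0.
have [k kd] := half_lt d0; exists k => p q h1 h2; apply: H.
rewrite prod_normE /= comparable_gt_max ?real_comparable ?num_real //.
by rewrite !(le_lt_trans _ kd).
Qed.

Lemma fubini_testl x : test (fun y => K (x, y)).
Proof.
split; last by exists b => y yb; apply: Kb; right.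
exact: continuous_pairl.
Qed.

Lemma fubini_testr y : test (fun x => K (x, y)).
Proof.
split; last by exists b => x xb; apply: Kb; left.
exact: continuous_pairr.
Qed.

Let supl x : supported b (fun y => K (x, y)). Proof. by move=> y yb; apply: Kb; right. Qed.
Let supr y : supported b (fun x => K (x, y)). Proof. by move=> x xb; apply: Kb; left. Qed.

Lemma integral_dist b' f g e : test f -> test g -> supported b' f -> supported b' g -> 0 <= e ->
  (forall x, `|f x - g x| <= e) -> `|integral f - integral g| <= e * vol b'.
Proof.
move=> tf tg fb gb e0 H; rewrite -(integralB tf tg); apply: integral_bound => //.
  exact: testD tf (testN tg).
by move=> x xb; rewrite fb // gb // subrr.
Qed.

Lemma fubini_supl : supported b (fun x => integral (fun y => K (x, y))).
Proof. by move=> x xb; rewrite -integral0; apply: eq_integral => y; rewrite Kb //; left. Qed.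
Lemma fubini_supr : supported b (fun y => integral (fun x => K (x, y))).
Proof. by move=> y yb; rewrite -integral0; apply: eq_integral => x; rewrite Kb //; right. Qed.

Lemma uniform_continuous_half (f : V -> R) : (forall e, 0 < e -> exists k, forall x y, `|x - y| <= half k ->
  `|f x - f y| <= e) -> continuous f.
Proof.
move=> H; apply: continuous_unif => e e0; have [k Hk] := H e e0.
exists (half k); first exact: half_gt0.
by move=> x y xy; apply: Hk; exact: ltW.
Qed.

Lemma test_fubinil : test (fun x => integral (fun y => K (x, y))).
Proof.
split; last by exists b; exact: fubini_supl.
apply: uniform_continuous_half => e e0; have [k H] := unif (divr_gt0 e0 (vol_gt0 b)).
exists k => x x' xx; rewrite -[e](divfK (lt0r_neq0 (vol_gt0 b))).
apply: integral_dist => //; try exact: fubini_testl; first by rewrite divr_ge0 ?ltW ?vol_gt0.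
by move=> y; apply: H => //=; rewrite subrr normr0 half_ge0.
Qed.

Lemma test_fubinir : test (fun y => integral (fun x => K (x, y))).
Proof.
split; last by exists b; exact: fubini_supr.
apply: uniform_continuous_half => e e0; have [k H] := unif (divr_gt0 e0 (vol_gt0 b)).
exists k => x x' xx; rewrite -[e](divfK (lt0r_neq0 (vol_gt0 b))).
apply: integral_dist => //; try exact: fubini_testr; first by rewrite divr_ge0 ?ltW ?vol_gt0.
by move=> y; apply: H => //=; rewrite subrr normr0 half_ge0.
Qed.

(** A grid sum in [x] commutes with the integral in [y]. Uniform continuity of [K] makes the
    replacement of the integral in [x] by its grid sum uniform in [y]. *)
Lemma fubini : integral (fun x => integral (fun y => K (x, y))) =
  integral (fun y => integral (fun x => K (x, y))).
Proof.
apply: integral_unique; first exact: test_fubinil.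
move=> e e0; pose v := vol (b + 1).
have v0 : 0 < v by exact: vol_gt0.
have d0 : 0 < e / v / v by rewrite !divr_gt0.
have [k1 H1] := unif d0; exists k1 => k kk.
have Hk p q : `|p.1 - q.1| <= half k -> `|p.2 - q.2| <= half k -> `|K p - K q| <= e / v / v.
  by move=> h1 h2; apply: H1; [exact: le_trans h1 (half_le kk)|exact: le_trans h2 (half_le kk)].
have E1 : gsum k (fun x => integral (fun y => K (x, y))) = integral (fun y => gsum k (fun x => K (x, y))).
  rewrite (gsumE _ fubini_supl) -integral_sum => [|z]; last exact: fubini_testl.
  rewrite -integralZ; last by apply: test_sum => z; exact: fubini_testl.
  by apply: eq_integral => y; rewrite (gsumE _ (supr y)).
have tg : test (fun y => gsum k (fun x => K (x, y))).
  rewrite (_ : (fun y => _) = fun y => half k ^+ m * \sum_(z <- box (b * 2 ^ k)) K (grid k z, y)).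
    by apply: testZ; apply: test_sum => z; exact: fubini_testl.
  by apply/funext => y; rewrite (gsumE _ (supr y)).
have sg : supported (b + 1) (fun y => gsum k (fun x => K (x, y))).
  move=> y yb; rewrite (gsumE _ (supr y)) big1 ?mulr0 // => z _; apply: Kb; right.
  by apply: le_lt_trans yb; rewrite ler_nat leq_addr.
have sr : supported (b + 1) (fun y => integral (fun x => K (x, y))).
  by apply: supported_le fubini_supr; rewrite leq_addr.
rewrite E1 -[e](divfK (lt0r_neq0 v0)).
apply: integral_dist => //; first exact: test_fubinir; first by rewrite divr_ge0 ?ltW.
move=> y; rewrite -[e / v](divfK (lt0r_neq0 v0)); apply: integral_approx (fubini_testr y) (supr y) _.
by move=> x x' xx; apply: Hk => //=; rewrite subrr normr0 half_ge0.
Qed.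

End Fubini.

End GridFunctional.
(** * The Webster metric and its density *)

Section ParallelMetric.
Context (R : realType) (n : nat) (M : topologicalType) (A : oriented_atlas R n.*2.+1 M).
Context (T10 : M -> {vspace 'rV[R[i]]_(n.*2.+1)}) (theta : form1 R n.*2.+1 M).
Context (T : vfield R n.*2.+1 M).
Context (nabla : vfield R n.*2.+1 M -> vfield R n.*2.+1 M -> vfield R n.*2.+1 M).
Hypothesis S : sasakian A T10 theta T nabla.
Local Notation C := R[i].
Local Notation vfield := (vfield R n.*2.+1 M).
Local Notation vec := 'rV[C]_(n.*2.+1).
Local Notation sec := (section_on A T10).
Local Notation lv := (levi A theta).
Local Notation vsm := (vsmooth_on A).
Local Notation thv := (thv theta).
Implicit Types (p q : M) (X Y W : vfield) (F : 'I_n -> vfield) (U V : set M).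

Definition full_frame F (i : 'I_(n + n + 1)) : vfield :=
  match fintype.split i with
  | inl j => match fintype.split j with inl k => F k | inr k => conjf (F k) end
  | inr _ => T
  end.

Lemma full_frame_sum F (x : 'I_(n + n + 1) -> C) p : \sum_i x i *: full_frame F i p =
  (\sum_k x (lshift 1 (lshift n k)) *: F k p)
  + conjv (\sum_k conjc (x (lshift 1 (rshift n k))) *: F k p) + x (rshift (n + n) ord0) *: T p.
Proof.
rewrite big_split_ord big_split_ord big_ord1 /= conjv_sum; congr (_ + _ + _).
- apply: eq_bigr => k _; rewrite /full_frame.
  by rewrite -[lshift 1 _]/(unsplit (inl _)) unsplitK -[lshift n k]/(unsplit (inl _)) unsplitK.
- apply: eq_bigr => k _; rewrite /full_frame conjvZ conjcK.
  by rewrite -[lshift 1 _]/(unsplit (inl _)) unsplitK -[rshift n k]/(unsplit (inr _)) unsplitK.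
- by rewrite /full_frame -[rshift _ _]/(unsplit (inr _)) unsplitK.
Qed.

Lemma split_inj p a b t a' b' t' : a \in T10 p -> b \in T10 p -> a' \in T10 p -> b' \in T10 p ->
  a + conjv b + t *: T p = a' + conjv b' + t' *: T p -> [/\ a = a', b = b' & t = t'].
Proof.
move=> Ha Hb Ha' Hb' E.
have E1 : (a - a') + conjv (b - b') = (t' - t) *: T p.
  rewrite conjvB scalerBl; apply/eqP; rewrite -subr_eq0; apply/eqP.
  transitivity (a + conjv b + t *: T p - (a' + conjv b' + t' *: T p)); last by rewrite E subrr.
  by apply/rowP => i; rewrite !mxE; ring.
have H1 : a - a' \in T10 p by rewrite memvB.
have H2 : conjv (conjv (b - b')) \in T10 p by rewrite conjvK memvB.
have [/eqP z1 /(congr1 (@conjv R _)) z2] := mem_split S H1 H2 E1.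
move/eqP: z2; rewrite conjvK conjv0 subr_eq0 => /eqP bb; move: z1; rewrite subr_eq0 => /eqP aa.
split=> //; move: E; rewrite aa bb => /addrI/(congr1 (thv p)).
by rewrite !(thvZ theta) (thvT S) !mulr1.
Qed.

Lemma full_frame_free F U p (x : 'I_(n + n + 1) -> C) : local_frame A T10 U F -> U p ->
  \sum_i x i *: full_frame F i p = 0 -> forall i, x i = 0.
Proof.
move=> frF Up; rewrite full_frame_sum => E.
have mem (y : 'I_n -> C) : \sum_k y k *: F k p \in T10 p.
  by apply: memv_suml => k _; rewrite memvZ // (frame_mem frF).
have := @split_inj p _ _ _ 0 0 0 (mem _) (mem _) (mem0v _) (mem0v _).
rewrite conjv0 scale0r !addr0 => /(_ _ _ _ E)[e1 e2 e3].
have z1 := frame_free frF Up e1; have z2 := frame_free frF Up e2.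
move=> i; case: (splitP i) => j ij.
  case: (splitP j) => k jk.
    by rewrite (_ : i = lshift 1 (lshift n k)) //; apply: val_inj; rewrite /= ij jk.
  rewrite (_ : i = lshift 1 (rshift n k)); last by apply: val_inj; rewrite /= ij jk.
  by apply: (can_inj (@conjcK R)); rewrite z2 conjc0.
rewrite (_ : i = rshift (n + n) ord0) //; apply: val_inj; rewrite /= ij.
by case: j {ij} => -[].
Qed.

(** A free family of [n + n + 1] vectors in a space of dimension [n.*2.+1] spans it. *)
Lemma full_frame_span F U p v : local_frame A T10 U F -> U p ->
  exists x : 'I_(n + n + 1) -> C, v = \sum_i x i *: full_frame F i p.
Proof.
move=> frF Up; pose B : 'M[C]_(n + n + 1, n.*2.+1) := \matrix_i full_frame F i p.
have sumB (x : 'rV[C]_(n + n + 1)) : x *m B = \sum_i x 0 i *: full_frame F i p.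
  by rewrite mulmx_sum_row; apply: eq_bigr => i _; rewrite rowK.
have fB : row_free B.
  rewrite -kermx_eq0; apply/eqP/row_matrixP => i; rewrite row0.
  have : row i (kermx B) *m B = 0 by rewrite -row_mul mulmx_ker row0.
  move: (row i (kermx B)) => x; rewrite sumB => /(full_frame_free frF Up) H.
  by apply/rowP => j; rewrite H mxE.
have uB : row_full B by move: fB; rewrite /row_free /row_full => /eqP ->; rewrite addn1 addnn.
have /submxP[x xB] := submx_full v uB.
by exists (fun i => x 0 i); rewrite -sumB.
Qed.

Lemma full_frame_smooth F U i : local_frame A T10 U F -> vsm U (full_frame F i).
Proof.
move=> frF; have oU := frame_open frF; have Fs k := sec_smooth (frame_sec frF k).
rewrite /full_frame; case: (fintype.split i) => [j|_]; last exact: (reeb_smooth S).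
by case: (fintype.split j) => k; [exact: Fs|exact: (vsmooth_conj oU (Fs k))].
Qed.

(** The coefficients in the full frame are chosen point by point; [smooth_coeffs] makes them smooth,
    and grouping them by type gives the three parts. *)
Lemma split_exists F U V X : local_frame A T10 U F -> open V -> V `<=` U -> vsm V X ->
  split_field A T10 T V X.
Proof.
move=> frF oV VU Xs.
have H p : exists x : 'I_(n + n + 1) -> C, U p -> X p = \sum_i x i *: full_frame F i p.
  have [Up|Up] := pselect (U p); last by exists (fun=> 0) => /Up.
  by have [x xE] := full_frame_span (X p) frF Up; exists x.
have [x xE] := choice H.
have es i := vsmooth_sub VU (full_frame_smooth i frF).
have xs i : smooth_on A V (fun p => x p i).
  apply: (smooth_coeffs oV (e := full_frame F) (a := fun i p => x p i)) => //.
    by move=> p /VU Up y; exact: full_frame_free frF Up.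
  by apply: (vsmooth_eq oV _ Xs) => p /VU; exact: xE.
have Fs k : sec V (F k) := sec_sub VU (frame_sec frF k).
exists (fun p => \sum_k x p (lshift 1 (lshift n k)) *: F k p),
  (fun p => \sum_k conjc (x p (lshift 1 (rshift n k))) *: F k p), (fun p => x p (rshift (n + n) ord0)).
split=> //.
- by apply: (sec_sum oV) => k _; exact: (sec_scale oV).
- by apply: (sec_sum oV) => k _; apply: (sec_scale oV) => //; exact: (smooth_conj oV).
- by move=> p Vp; rewrite (xE p (VU p Vp)) full_frame_sum.
Qed.

Lemma vec_split p v : exists abt : (vec * vec) * C, [/\ abt.1.1 \in T10 p, abt.1.2 \in T10 p &
  v = abt.1.1 + conjv abt.1.2 + abt.2 *: T p].
Proof.
have [U [F [Up frF]]] := framePt S p; have [x ->] := full_frame_span v frF Up.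
rewrite full_frame_sum.
exists ((\sum_k x (lshift 1 (lshift n k)) *: F k p,
  \sum_k conjc (x (lshift 1 (rshift n k))) *: F k p), x (rshift (n + n) ord0)).
by split=> //=; apply: memv_suml => k _; rewrite memvZ // (frame_mem frF).
Qed.

(** The three parts are chosen, and [split_inj] shows that there is only one choice. *)
Definition part10 p v : vec := (projT1 (cid (vec_split p v))).1.1.
Definition part01 p v : vec := (projT1 (cid (vec_split p v))).1.2.
Definition part_reeb p v : C := (projT1 (cid (vec_split p v))).2.

Lemma partsP p v : [/\ part10 p v \in T10 p, part01 p v \in T10 p &
  v = part10 p v + conjv (part01 p v) + part_reeb p v *: T p].
Proof. by rewrite /part10 /part01 /part_reeb; case: cid => abt /= []. Qed.

Lemma parts_unique p a b t : a \in T10 p -> b \in T10 p ->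
  [/\ part10 p (a + conjv b + t *: T p) = a, part01 p (a + conjv b + t *: T p) = b &
      part_reeb p (a + conjv b + t *: T p) = t].
Proof.
move=> Ha Hb; have [H1 H2 E] := partsP p (a + conjv b + t *: T p).
have [e1 e2 e3] := split_inj Ha Hb H1 H2 E.
by split; [exact: (esym e1)|exact: (esym e2)|exact: (esym e3)].
Qed.

Let some_frame p : {UF : set M * ('I_n -> vfield) | UF.1 p /\ local_frame A T10 UF.1 UF.2}.
Proof.
by apply: cid; have [U [F [Up frF]]] := framePt S p; exists (U, F).
Qed.

(** [levi] takes fields. The same form is read here on single vectors through some frame at [p], and
    [levi_atE] shows that the frame does not matter. *)
Definition levi_at p (v w : vec) : C := let F := (projT1 (some_frame p)).2 in
  \sum_k \sum_l hmat A theta F p k l * coframe F k p v * conjc (coframe F l p w).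

Lemma levi_atE U Z W p : open U -> sec U Z -> sec U W -> U p -> levi_at p (Z p) (W p) = lv Z W p.
Proof.
move=> oU Zs Ws Up; rewrite /levi_at; case: some_frame => -[V F] /= [Vp frF].
have oV := frame_open frF; have oI : open (U `&` V) by exact: openI.
have IU : U `&` V `<=` U by move=> ? [].
have IV : U `&` V `<=` V by move=> ? [].
by rewrite (levi_frame S frF oI IV (sec_sub IU Zs) (sec_sub IU Ws) (conj Up Vp)).
Qed.

Lemma sec_through p v : v \in T10 p -> exists U Z, [/\ open U, U p, sec U Z & Z p = v].
Proof.
move=> Hv; have [U [F [Up frF]]] := framePt S p.
exists U, (fun q => \sum_k coframe F k p v *: F k q); split=> //; first exact: frame_open frF.
  exact: (sec_const _ frF).
by rewrite -(frame_exp frF Up Hv).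
Qed.

(** The Webster metric extended sesquilinearly to complex vectors. The (0,1) parts are stored
    conjugated, so they enter in exchanged order to keep the form linear in [v]. *)
Definition metric p (v w : vec) : C := levi_at p (part10 p v) (part10 p w)
  + levi_at p (part01 p w) (part01 p v) + part_reeb p v * conjc (part_reeb p w).

Lemma metricE U X Y a b f a' b' f' p : open U -> U p -> sec U a -> sec U b -> sec U a' -> sec U b' ->
  X p = a p + conjf b p + f p *: T p -> Y p = a' p + conjf b' p + f' p *: T p ->
  metric p (X p) (Y p) = lv a a' p + lv b' b p + f p * conjc (f' p).
Proof.
move=> oU Up As Bs As' Bs' -> ->; rewrite /metric /conjf.
have [-> -> ->] := parts_unique (f p) (sec_mem As Up) (sec_mem Bs Up).
have [-> -> ->] := parts_unique (f' p) (sec_mem As' Up) (sec_mem Bs' Up).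
by rewrite (levi_atE oU As As' Up) (levi_atE oU Bs' Bs Up).
Qed.

Lemma metric_smooth U X Y : open U -> vsm U X -> vsm U Y ->
  smooth_on A U (fun p => metric p (X p) (Y p)).
Proof.
move=> oU Xs Ys; apply: smooth_pointwise => p Up; have [V [F [Vp frF]]] := framePt S p.
have oV := frame_open frF; have oI : open (U `&` V) by exact: openI.
have IU : U `&` V `<=` U by move=> ? [].
have IV : U `&` V `<=` V by move=> ? [].
have [a [b [f [As Bs fs E]]]] := split_exists frF oI IV (vsmooth_sub IU Xs).
have [a' [b' [f' [As' Bs' fs' E']]]] := split_exists frF oI IV (vsmooth_sub IU Ys).
exists V => //; have h : smooth_on A (U `&` V) (fun q => lv a a' q + lv b' b q + f q * conjc (f' q)).
  apply: (smooth_add oI); last exact: (smooth_mul oI fs (smooth_conj oI fs')).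
  exact: (smooth_add oI (levi_smooth S oI As As') (levi_smooth S oI Bs' Bs)).
apply: (smooth_eq oI _ h) => q Iq.
by rewrite (metricE oI Iq As Bs As' Bs' (E q Iq) (E' q Iq)).
Qed.

Let metric_alg (a b c d e f g h : C) : a + b + (c + d) + (e * f + g * h) = a + d + h * g + (b + c + e * f).
Proof. by ring. Qed.

(** [nabla] preserves the splitting, the Levi form and [T]; the conjugate of [X] in the last term
    comes from antilinearity in the second argument. *)
Lemma metric_parallel U X Y Y' p : open U -> U p -> vsm U X -> vsm U Y -> vsm U Y' ->
  vapp A X (fun q => metric q (Y q) (Y' q)) p =
  metric p (nabla X Y p) (Y' p) + metric p (Y p) (nabla (conjf X) Y' p).
Proof.
move=> oU Up Xs Ys Ys'; have [V [F [Vp frF]]] := framePt S p.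
have oV := frame_open frF; have oI : open (U `&` V) by exact: openI.
have IU : U `&` V `<=` U by move=> ? [].
have IV : U `&` V `<=` V by move=> ? [].
have Xv := vsmooth_sub IU Xs; have Yv := vsmooth_sub IU Ys; have Yv' := vsmooth_sub IU Ys'.
have [a [b [f [As Bs fs E]]]] := split_exists frF oI IV Yv.
have [a' [b' [f' [As' Bs' fs' E']]]] := split_exists frF oI IV Yv'.
have Ip : (U `&` V) p by [].
have hc := proj1 (sas_tw S); have Xv' := vsmooth_conj oI Xv.
have N1 : nabla X Y p = nabla X a p + conjf (nabla (conjf X) b) p + vapp A X f p *: T p.
  rewrite -(nabla_split S oI Xv As Bs fs Ip).
  by apply: (nabla_eqr hc oI Xv Yv (vsmooth_eq oI E Yv) Ip E).
have N2 : nabla (conjf X) Y' p = nabla (conjf X) a' p + conjf (nabla X b') p + vapp A (conjf X) f' p *: T p.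
  have := nabla_split S oI Xv' As' Bs' fs' Ip; rewrite conjfK => h; rewrite -[RHS]h.
  by apply: (nabla_eqr hc oI Xv' Yv' (vsmooth_eq oI E' Yv') Ip E').
rewrite (metricE (f := vapp A X f) oI Ip (sec_nabla S oI Xv As) (sec_nabla S oI Xv' Bs) As' Bs' N1 (E' p Ip)).
rewrite (metricE (f' := vapp A (conjf X) f') oI Ip As Bs (sec_nabla S oI Xv' As') (sec_nabla S oI Xv Bs') (E p Ip) N2).
have H q : (U `&` V) q -> metric q (Y q) (Y' q) = lv a a' q + lv b' b q + f q * conjc (f' q).
  by move=> Iq; rewrite (metricE oI Iq As Bs As' Bs' (E q Iq) (E' q Iq)).
rewrite (vapp_eq A oI Ip X H).
have s1 := levi_smooth S oI As As'; have s2 := levi_smooth S oI Bs' Bs.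
have s3 := smooth_conj oI fs'.
rewrite (vappD Ip X (smooth_add oI s1 s2) (smooth_mul oI fs s3)) (vappD Ip X s1 s2).
have e3 : vapp A X (fun q => f q * conjc (f' q)) p =
    f p * conjc (vapp A (conjf X) f' p) + conjc (f' p) * vapp A X f p.
  rewrite (vappM oI Ip X fs s3); congr (_ * _ + _).
  by rewrite -(vapp_conj Ip (conjf X) fs') conjfK.
have e1 := levi_nabla S oI Xv As As' Ip; have e2 := levi_nabla S oI Xv Bs' Bs Ip.
apply: etrans (f_equal2 +%R (f_equal2 +%R e1 e2) e3) _.
exact: metric_alg.
Qed.

Lemma levi_at_linl p c v v' w : levi_at p (c *: v + v') w = c * levi_at p v w + levi_at p v' w.
Proof.
rewrite /levi_at; case: some_frame => -[V F] /= _; rewrite mulr_sumr -big_split; apply: eq_bigr => k _.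
rewrite mulr_sumr -big_split; apply: eq_bigr => l _ /=.
rewrite cfD cfZ; move: (hmat _ _ _ _ _ _) (coframe _ _ _ _) (coframe _ _ _ v') (conjc _) => *; ring.
Qed.

Lemma levi_at_linr p c v w w' : levi_at p v (c *: w + w') = conjc c * levi_at p v w + levi_at p v w'.
Proof.
rewrite /levi_at; case: some_frame => -[V F] /= _; rewrite mulr_sumr -big_split; apply: eq_bigr => k _.
rewrite mulr_sumr -big_split; apply: eq_bigr => l _ /=.
rewrite cfD cfZ rmorphD rmorphM /=.
move: (hmat _ _ _ _ _ _) (coframe _ _ _ _) (conjc c) (conjc _) (conjc _) => *; ring.
Qed.

Lemma levi_at_hermitian p v w : v \in T10 p -> w \in T10 p -> levi_at p w v = conjc (levi_at p v w).
Proof.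
move=> /sec_through[U [Z [oU Up Zs <-]]] /sec_through[V [W [oV Vp Ws <-]]].
have oI : open (U `&` V) by exact: openI.
have IU : U `&` V `<=` U by move=> ? [].
have IV : U `&` V `<=` V by move=> ? [].
have Ip : (U `&` V) p by [].
have Zs' := sec_sub IU Zs; have Ws' := sec_sub IV Ws.
by rewrite (levi_atE oI Zs' Ws' Ip) (levi_atE oI Ws' Zs' Ip) (levi_hermitian S oI Zs' Ws' Ip).
Qed.

Lemma levi_at_gt0 p v : v \in T10 p -> v != 0 -> 0 < levi_at p v v.
Proof.
move=> /sec_through[U [Z [oU Up Zs <-]]] Z0.
by rewrite (levi_atE oU Zs Zs Up); exact: (sas_spc S oU Zs Up).
Qed.

Lemma levi_at_ge0 p v : v \in T10 p -> 0 <= levi_at p v v.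
Proof.
move=> Hv; have [->|v0] := eqVneq v 0; last exact: ltW (levi_at_gt0 Hv v0).
have := levi_at_linl p (-1) 0 0 0; rewrite scaler0 addr0 mulN1r addNr => ->; exact: lexx.
Qed.

Lemma metric_gt0 p v : v != 0 -> 0 < metric p v v.
Proof.
move=> v0; have [H1 H2 E] := partsP p v; rewrite /metric.
have t0 : 0 <= part_reeb p v * conjc (part_reeb p v) by rewrite -sqr_normc exprn_ge0.
have [a0|a0] := eqVneq (part10 p v) 0; last first.
  by rewrite -addrA ltr_wpDr ?levi_at_gt0 // addr_ge0 // levi_at_ge0.
have [b0|b0] := eqVneq (part01 p v) 0; last first.
  by rewrite ltr_wpDr // ltr_wpDl ?levi_at_gt0 // levi_at_ge0.
rewrite ltr_wpDl ?addr_ge0 ?levi_at_ge0 // lt_neqAle t0 andbT eq_sym.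
have nt : part_reeb p v != 0.
  by apply: contraNneq v0 => z; rewrite E a0 b0 z conjv0 scale0r !addr0.
by rewrite -sqr_normc expf_neq0 // normr_eq0.
Qed.

Lemma metric_hermitian p v w : metric p w v = conjc (metric p v w).
Proof.
have [H1 H2 _] := partsP p v; have [H3 H4 _] := partsP p w; rewrite /metric !rmorphD.
have c : conjc (part_reeb p v * conjc (part_reeb p w)) = part_reeb p w * conjc (part_reeb p v).
  by rewrite rmorphM mulrC; congr (_ * _); exact: conjcK.
by rewrite [X in _ = _ + X]c (levi_at_hermitian H1 H3) (levi_at_hermitian H4 H2).
Qed.

Lemma metric_linl p a v v' w : metric p (a *: v + v') w = a * metric p v w + metric p v' w.
Proof.
have [H1 H2 E] := partsP p v; have [H3 H4 E'] := partsP p v'.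
have [h1 h2 h3] : [/\ part10 p (a *: v + v') = a *: part10 p v + part10 p v',
    part01 p (a *: v + v') = conjc a *: part01 p v + part01 p v' &
    part_reeb p (a *: v + v') = a * part_reeb p v + part_reeb p v'].
  have [K1 K2 K] := partsP p (a *: v + v'); apply: (split_inj K1 K2 _ _ (esym _)).
  - by rewrite memvD ?memvZ.
  - by rewrite memvD ?memvZ.
  rewrite -K; transitivity (a *: (part10 p v + conjv (part01 p v) + part_reeb p v *: T p) +
    (part10 p v' + conjv (part01 p v') + part_reeb p v' *: T p)); last by rewrite -E -E'.
  rewrite conjvD conjvZ conjcK.
  by apply/rowP => i; rewrite !mxE; ring.
rewrite /metric h1 h2 h3 levi_at_linl levi_at_linr conjcK.
by move: (levi_at _ _ _) (levi_at _ _ _) (levi_at _ _ _) (levi_at _ _ _) (conjc _) => *; ring.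
Qed.

End ParallelMetric.

(** * A bump profile and integrals depending on a parameter *)

Section ParameterDerivative.
Context {R : realType}.

Definition ramp (s : R) : R := (s + `|s|) / 2.
(** The square of the positive part of [1 - t]: composed with a positive quadratic form it has
    bounded support, and it is continuously differentiable with the global second order estimate
    [bump_taylor]. *)
Definition bump (t : R) : R := ramp (1 - t) ^+ 2.
Definition dbump (t : R) : R := - 2 * ramp (1 - t).

Lemma ramp_ge0 s : 0 <= ramp s.
Proof. by rewrite /ramp; have := ler_norm (- s); rewrite normrN; lra. Qed.

Lemma ramp_neg s : s <= 0 -> ramp s = 0.
Proof. by move=> s0; rewrite /ramp ler0_norm // subrr mul0r. Qed.

Lemma ramp_pos s : 0 <= s -> ramp s = s.
Proof. by move=> s0; rewrite /ramp ger0_norm //; lra. Qed.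

Lemma bump_ge0 t : 0 <= bump t. Proof. exact: sqr_ge0. Qed.
Lemma bump_out t : 1 <= t -> bump t = 0.
Proof. by move=> t1; rewrite /bump ramp_neg ?expr0n // subr_le0. Qed.
Lemma dbump_out t : 1 <= t -> dbump t = 0.
Proof. by move=> t1; rewrite /dbump ramp_neg ?mulr0 // subr_le0. Qed.
Lemma bump0 : bump 0 = 1. Proof. by rewrite /bump subr0 ramp_pos // expr1n. Qed.

Lemma bump_taylor t h : `|bump (t + h) - bump t - dbump t * h| <= h ^+ 2.
Proof.
rewrite /bump /dbump ler_norml.
have -> : 1 - (t + h) = (1 - t) - h by ring.
move: (1 - t) => s; have [s0|s0] := lerP 0 s.
  rewrite (ramp_pos s0); have [u0|u0] := lerP 0 (s - h); first by rewrite (ramp_pos u0); apply/andP; split; nra.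
  by rewrite (ramp_neg (ltW u0)); apply/andP; split; nra.
rewrite (ramp_neg (ltW s0)); have [u0|u0] := lerP 0 (s - h); first by rewrite (ramp_pos u0); apply/andP; split; nra.
by rewrite (ramp_neg (ltW u0)); apply/andP; split; nra.
Qed.

Lemma continuous_ramp : continuous ramp.
Proof.
move=> s; apply: cvgMl; apply: cvgD; first exact: cvg_id.
by apply: cvg_norm; exact: cvg_id.
Qed.

Lemma continuous_bump : continuous bump.
Proof.
move=> t; have h : {for t, continuous (fun t : R => ramp (1 - t))}.
  apply: (continuous_compp (g := fun t : R => 1 - t)); last exact: continuous_ramp.
  by apply: cvgB; [exact: cvg_cst|exact: cvg_id].
exact: (continuousMp h h).
Qed.

Lemma continuous_dbump : continuous dbump.
Proof.
move=> t; have h : {for t, continuous (fun t : R => ramp (1 - t))}.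
  apply: (continuous_compp (g := fun t : R => 1 - t)); last exact: continuous_ramp.
  by apply: cvgB; [exact: cvg_cst|exact: cvg_id].
exact: (continuousMp (@continuous_cstp _ _ t _) h).
Qed.

Lemma quotient_dist (E : normedModType R) (f : E -> R) (x v : E) (d h : R) : h != 0 ->
  `|d - h^-1 *: ((f \o shift x) (h *: v) - f x)| * `|h| = `|f (x + h *: v) - f x - d * h|.
Proof.
move=> h0; rewrite -normrM distrC [x + _]addrC mulrBl; congr (`|_|).
rewrite [in LHS]/= -[h^-1 *: _]/(h^-1 * _) mulrAC mulVf // mul1r.
by rewrite -[in RHS]opprB opprB -opprB; ring.
Qed.

(** An inequality without division instead of a limit of quotients: the form in which estimates
    under an integral sign arrive. *)
Lemma is_derive_bound (E : normedModType R) (f : E -> R) (x v : E) (d : R) :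
  (forall e, 0 < e -> exists2 r, 0 < r & forall h : R, `|h| < r ->
     `|f (x + h *: v) - f x - d * h| <= e * `|h|) -> is_derive x v f d.
Proof.
move=> H.
have cv : (fun h : R => h^-1 *: ((f \o shift x) (h *: v) - f x)) @ 0^' --> d.
  apply/cvgrPdist_le => e e0; have [r r0 Hr] := H e e0.
  apply/nbhs_normP; exists r => // h /=; rewrite sub0r normrN => hr h0.
  by rewrite -(ler_pM2r (x := `|h|)) ?normr_gt0 // quotient_dist //; exact: Hr.
have dx : derivable f x v by apply/cvg_ex; exists d.
by apply: DeriveDef => //; exact: (cvg_lim _ cv).
Qed.

Lemma is_derive_boundP (E : normedModType R) (f : E -> R) (x v : E) (d : R) : is_derive x v f d ->
  forall e, 0 < e -> exists2 r, 0 < r & forall h : R, `|h| < r ->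
     `|f (x + h *: v) - f x - d * h| <= e * `|h|.
Proof.
move=> [dx <-] e e0; move/cvgrPdist_le: (dx) => /(_ e e0) /nbhs_normP[r /= r0 Hr]; exists r => // h hr.
have [->|h0] := eqVneq h 0; first by rewrite scale0r addr0 mulr0 !subrr normr0 mulr0.
rewrite -quotient_dist //; apply: ler_wpM2r => //; apply: Hr => //.
by rewrite /= sub0r normrN.
Qed.

Variable m : nat.
Local Notation V := 'rV[R]_m.

Definition quad (g : 'I_m -> 'I_m -> R) (z : V) : R := \sum_i \sum_j g i j * (z 0 i * z 0 j).

Lemma quadZ g (a : R) z : quad g (a *: z) = a ^+ 2 * quad g z.
Proof.
rewrite /quad mulr_sumr; apply: eq_bigr => i _; rewrite mulr_sumr; apply: eq_bigr => j _.
rewrite !mxE; ring.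
Qed.

Lemma continuous_fstc (T U W : topologicalType) (f : T -> W) (p : T) (q : U) :
  {for p, continuous f} -> {for (p, q), continuous (fun x : T * U => f x.1)}.
Proof. by move=> h; apply: (cvg_comp (fun x : T * U => x.1) f) h; exact: cvg_fst. Qed.

Lemma continuous_sndc (T U W : topologicalType) (f : U -> W) (p : T) (q : U) :
  {for q, continuous f} -> {for (p, q), continuous (fun x : T * U => f x.2)}.
Proof. by move=> h; apply: (cvg_comp (fun x : T * U => x.2) f) h; exact: cvg_snd. Qed.

Lemma continuous_pairc (T U W : topologicalType) (f : T -> U) (g : T -> W) (p : T) :
  {for p, continuous f} -> {for p, continuous g} -> {for p, continuous (fun x => (f x, g x))}.
Proof. by move=> hf hg; apply: cvg_pair. Qed.

Lemma continuous_idp (T : topologicalType) (p : T) : {for p, continuous (fun x : T => x)}.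
Proof. exact: cvg_id. Qed.

Lemma continuous_constp (T U : topologicalType) (u : U) (p : T) : {for p, continuous (fun _ : T => u)}.
Proof. exact: cvg_cst. Qed.

Lemma near_compact_gt0 (X Q : topologicalType) (K : set X) (q0 : Q) (f : X * Q -> R) : compact K ->
  (forall z, K z -> {for (z, q0), continuous f}) -> (forall z, K z -> 0 < f (z, q0)) ->
  \forall q \near q0, forall z, K z -> 0 < f (z, q).
Proof.
move=> cK cf f0; apply: (proj1 (compact_near_coveringP K) cK) => z Kz.
have := cf z Kz; move/cvgrPdist_lt => /(_ _ (f0 z Kz)); apply: filterS => -[y q] /=.
by rewrite ltr_norml => /andP[_]; rewrite ltrBlDr -ltrBlDl subrr.
Qed.

Section Point.
Variables (P : topologicalType) (p0 : P).

Lemma continuous_quad (g : P -> 'I_m -> 'I_m -> R) z0 :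
  (forall i j, {for p0, continuous (fun p => g p i j)}) ->
  {for (p0, z0), continuous (fun pz : P * V => quad (g pz.1) pz.2)}.
Proof.
move=> Hg; apply: continuous_sumr => i _; apply: continuous_sumr => j _.
apply: continuousMp.
  exact: (continuous_fstc (q := z0) (Hg i j)).
have c k : {for (p0, z0), continuous (fun pz : P * V => pz.2 0 k)}.
  by apply: (continuous_sndc (f := fun z : V => z 0 k)); exact: coord_continuous.
exact: continuousMp (c i) (c j).
Qed.

Lemma uniform_near (X : topologicalType) (K : set X) (H : P -> X -> R) : compact K ->
  (forall z, K z -> {for (p0, z), continuous (fun pz : P * X => H pz.1 pz.2)}) ->
  forall e, 0 < e -> \forall p \near p0, forall z, K z -> `|H p z - H p0 z| <= e.
Proof.
move=> cK cH e e0; apply: (proj1 (compact_near_coveringP K) cK) => z Kz.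
have c1 : {for (z, p0), continuous (fun zp : X * P => H zp.2 zp.1 - H p0 zp.1)}.
  apply: continuousDp.
    apply: (continuous_compp (g := fun zp : X * P => (zp.2, zp.1)) (f := fun pz => H pz.1 pz.2)); last exact: cH.
    by apply: continuous_pairc; [apply: (continuous_sndc (f := id))|apply: (continuous_fstc (f := id))];
      exact: continuous_idp.
  apply: continuousNp.
  apply: (continuous_compp (g := fun zp : X * P => (p0, zp.1)) (f := fun pz => H pz.1 pz.2)); last exact: cH.
  apply: continuous_pairc; first exact: continuous_constp.
  by apply: (continuous_fstc (f := id)); exact: continuous_idp.
move: c1 => /cvgrPdist_le/(_ e e0); apply: filterS => zp /=.
by rewrite subrr sub0r normrN.
Qed.

Lemma elliptic (g : P -> 'I_m -> 'I_m -> R) : (forall i j, {for p0, continuous (fun p => g p i j)}) ->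
  (forall z, z != 0 -> 0 < quad (g p0) z) ->
  exists2 k : R, 0 < k & \forall p \near p0, forall z, k * `|z| ^+ 2 <= quad (g p) z.
Proof.
move=> Hg pos; pose K := [set z : V | `|z| = 1].
have cK : compact K.
  apply: bounded_closed_compact; first by exists 1; split=> // M M1 x /= ->; exact: ltW.
  by apply: (@closed_comp _ _ (fun x : V => `|x|) [set y | y = 1]); [move=> x _; exact: norm_continuous|exact: closed_eq].
(* The ellipticity constant is treated as a second parameter near 0, so that one compactness
   argument on the unit sphere yields both the neighbourhood of [p0] and the constant. *)
have cov := @near_compact_gt0 _ _ K (p0, 0 : R) (fun zp : V * (P * R) => quad (g zp.2.1) zp.1 - zp.2.2) cK.
have {}cov : \forall pk \near (p0, 0 : R), forall z, K z -> 0 < quad (g pk.1) z - pk.2.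
  apply: cov => z Kz; last first.
    by rewrite /= subr0; apply: pos; apply: contra_eq_neq Kz => ->; rewrite normr0 eq_sym oner_neq0.
  apply: continuousDp.
    apply: (continuous_compp (g := fun zp : V * (P * R) => (zp.2.1, zp.1)) (f := fun pz => quad (g pz.1) pz.2)).
      apply: continuous_pairc; last by apply: (continuous_fstc (f := id)); exact: continuous_idp.
      apply: (continuous_sndc (f := fun x : P * R => x.1)).
      by apply: (continuous_fstc (f := id)); exact: continuous_idp.
    exact: continuous_quad.
  apply: continuousNp.
  apply: (continuous_sndc (f := fun x : P * R => x.2)).
  by apply: (continuous_sndc (f := id)); exact: continuous_idp.
have [[B D] /= [nB nD] BD] := cov.
have /nbhs_normP[d /= d0 Hd] := nD.
exists (d / 2); first by rewrite divr_gt0.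
apply: filterS nB => p Bp z; have [->|z0] := eqVneq z 0.
  by rewrite normr0 expr0n mulr0 /quad big1 // => i _; rewrite big1 // => j _; rewrite !mxE !mulr0.
have nz : `|z| != 0 by rewrite normr_eq0.
have K1 : K (`|z|^-1 *: z) by rewrite /K /= normrZ normfV normr_id mulVf.
have h : 0 < quad (g p) (`|z|^-1 *: z) - d / 2.
  apply: (BD (p, d / 2)) => //; split=> //; apply: Hd => /=; rewrite sub0r normrN gtr0_norm ?divr_gt0 //.
  by rewrite ltr_pdivrMr // ltr_pMr // ltr1n.
have -> : quad (g p) z = `|z| ^+ 2 * quad (g p) (`|z|^-1 *: z).
  by rewrite quadZ mulrA -exprMn mulfV // expr1n mul1r.
by rewrite mulrC ler_pM2l ?exprn_gt0 ?normr_gt0 // ltW // -subr_gt0.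
Qed.

Lemma integral_continuous (H : P -> V -> R) b : (\forall p \near p0, test (H p) /\ supported b (H p)) ->
  (forall z, {for (p0, z), continuous (fun pz : P * V => H pz.1 pz.2)}) ->
  {for p0, continuous (fun p => integral (H p))}.
Proof.
move=> Hs cH; apply/cvgrPdist_le => e e0; pose K := [set x : V | `|x| <= b%:R].
have cK : compact K.
  apply: bounded_closed_compact; first by exists b%:R; split=> // M bM x /= /le_trans; apply; exact: ltW.
  by apply: (@closed_comp _ _ (fun x : V => `|x|) [set y | y <= b%:R]); [move=> x _; exact: norm_continuous|exact: closed_le].
have d0 : 0 < e / vol m b by rewrite divr_gt0 ?vol_gt0.
have [t0 s0] := nbhs_singleton Hs.
have N1 := uniform_near cK (fun z _ => cH z) d0.
apply: filterS2 Hs N1 => p [tp sp] Hp; rewrite distrC -[e](divfK (lt0r_neq0 (vol_gt0 m b))).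
apply: integral_dist => //; first exact: ltW.
move=> z; have [zb|zb] := lerP `|z| b%:R; first exact: Hp.
by rewrite sp // s0 // subrr normr0 ltW.
Qed.

End Point.

(** On the common compact support the continuity of [dH] in the parameter is uniform in [z]; the
    mean value bound for each [z] can therefore be integrated. *)
Lemma integral_derivable (l : nat) (V0 : set 'rV[R]_l) (H dH : 'rV[R]_l -> V -> R) (i : 'I_l) b x0 :
  open V0 -> V0 x0 ->
  (forall x, V0 x -> test (H x) /\ supported b (H x)) ->
  (forall x z, V0 x -> is_derive x (delta_mx 0 i) (H ^~ z) (dH x z)) ->
  test (dH x0) -> supported b (dH x0) ->
  (forall z, {for (x0, z), continuous (fun pz : 'rV[R]_l * V => dH pz.1 pz.2)}) ->
  is_derive x0 (delta_mx 0 i) (fun x => integral (H x)) (integral (dH x0)).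
Proof.
move=> oV0 Vx0 Hs Hd td sd cd; apply: is_derive_bound => e e0.
pose K := [set x : V | `|x| <= b%:R].
have cK : compact K.
  apply: bounded_closed_compact; first by exists b%:R; split=> // M bM x /= /le_trans; apply; exact: ltW.
  by apply: (@closed_comp _ _ (fun x : V => `|x|) [set y | y <= b%:R]); [move=> x _; exact: norm_continuous|exact: closed_le].
have d0 : 0 < e / vol m b by rewrite divr_gt0 ?vol_gt0.
have N1 := uniform_near cK (fun z _ => cd z) d0.
have N2 : \forall x \near x0, V0 x by exact: open_nbhs_nbhs.
have /nbhs_norm0P[r /= r0 Hr] : \forall y \near (0 : 'rV[R]_l), V0 (x0 + y) /\
    (forall z, K z -> `|dH (x0 + y) z - dH x0 z| <= e / vol m b).
  have : \forall x \near x0, V0 x /\ (forall z, K z -> `|dH x z - dH x0 z| <= e / vol m b).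
    by apply: filterS2 N2 N1.
  by move/nbhs_normP => [r /= r0 Hr]; apply/nbhs_norm0P; exists r => // y /= yr; apply: Hr => /=;
    rewrite opprD addrA subrr sub0r normrN.
exists r => // h hr.
have hn t : `|t| <= `|h| -> `|t *: (delta_mx 0 i : 'rV[R]_l)| < r.
  move=> th; apply: le_lt_trans hr; rewrite normrZ -[X in _ <= X]mulr1.
  by apply: ler_pM => //; exact: norm_delta_le.
have [Vh _] := Hr _ (hn h (lexx _)).
have [t1 s1] := Hs _ Vx0; have [t2 s2] := Hs _ Vh.
have tdh : test (fun z => h * dH x0 z) by exact: testZ.
rewrite mulrC -(integralZ h td) -(integralB t2 t1) -integralB //; last exact: testD t2 (testN t1).
rewrite -[e](divfK (lt0r_neq0 (vol_gt0 m b))) mulrAC.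
apply: integral_bound => //.
- by apply: testD; [exact: testD t2 (testN t1)|exact: testN].
- by move=> z zb; rewrite s1 // s2 // sd // mulr0 !subrr.
- by rewrite mulr_ge0 // ltW.
move=> z; have [zb|zb] := lerP `|z| b%:R; last first.
  by rewrite s1 // s2 // sd // mulr0 !subrr normr0 mulr_ge0 // ltW.
have mv := @mvt_bound R (fun t => H (x0 + t *: delta_mx 0 i) z) (dH x0 z) (e / vol m b) h.
rewrite (mulrC h); move: mv; rewrite scale0r addr0; apply => t th.
have [Vt Ht] := Hr _ (hn t th); exists (dH (x0 + t *: delta_mx 0 i) z); last exact: Ht.
have Hx := Hd _ z Vt; have ex : derivable (H ^~ z) (x0 + t *: delta_mx 0 i) (delta_mx 0 i) by case: Hx.
by have := is_derive_line ex; rewrite (derive_val (is_derive := Hx)).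
Qed.

End ParameterDerivative.

(** * The fibre integral of the bump and its derivatives *)

Section Density.
Context {R : realType}.
Variable m : nat.
Local Notation V := 'rV[R]_m.
Local Notation e_ i := (delta_mx 0 i : V).

Definition fibre_vol (g : 'I_m -> 'I_m -> R) : R := integral (fun z => bump (quad g z)).

Lemma continuous_mul (T : topologicalType) (f h : T -> R) :
  continuous f -> continuous h -> continuous (fun z => f z * h z).
Proof. by move=> cf ch z; exact: (continuousMp (cf z) (ch z)). Qed.

Lemma continuous_linear_form (c : 'I_m -> R) : continuous (fun z : V => \sum_j c j * z 0 j).
Proof.
move=> z; apply: continuous_sumr => j _; apply: continuousMp; first exact: continuous_cstp.
exact: coord_continuous.
Qed.

Lemma continuous_quadz g : continuous (quad g : V -> R).
Proof.
move=> z; apply: continuous_sumr => i _; apply: continuous_sumr => j _.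
apply: continuousMp; first exact: continuous_cstp.
by apply: continuousMp; exact: coord_continuous.
Qed.

Lemma continuous_bumpc (T : topologicalType) (q : T -> R) x :
  {for x, continuous q} -> {for x, continuous (fun y => bump (q y))}.
Proof. by move=> h; apply: (continuous_compp (f := bump) h); exact: continuous_bump. Qed.

Lemma continuous_dbumpc (T : topologicalType) (q : T -> R) x :
  {for x, continuous q} -> {for x, continuous (fun y => dbump (q y))}.
Proof. by move=> h; apply: (continuous_compp (f := dbump) h); exact: continuous_dbump. Qed.

Lemma continuous_bump_quad g : continuous (fun z : V => bump (quad g z)).
Proof. by move=> z; apply: continuous_bumpc; exact: continuous_quadz. Qed.

Lemma continuous_dbump_quad g : continuous (fun z : V => dbump (quad g z)).
Proof. by move=> z; apply: continuous_dbumpc; exact: continuous_quadz. Qed.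

Lemma sqr_out (k : R) : 0 < k -> exists b : nat, forall t, b%:R < t -> 1 <= k * t ^+ 2.
Proof.
move=> k0; exists (Num.trunc k^-1).+1 => t tb.
have b1 : k^-1 < (Num.trunc k^-1).+1%:R by rewrite truncnS_gt.
have b2 : 1 <= (Num.trunc k^-1).+1%:R :> R by rewrite ler1n.
rewrite -(mulVf (lt0r_neq0 k0)) mulrC; apply: ler_wpM2l; first exact: ltW.
have t1 : 1 <= t by apply: le_trans b2 (ltW tb).
by rewrite expr2 (le_trans (ltW (lt_trans b1 tb))) // ler_peMl // (le_trans ler01).
Qed.

(** Uniform ellipticity near [p0] puts the supports of all the functions [bump (quad (g p) z)] in
    one ball, as the lemmas on integrals with a parameter require. *)
Lemma near_supported (P : topologicalType) (p0 : P) (g : P -> 'I_m -> 'I_m -> R) :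
  (forall i j, {for p0, continuous (fun p => g p i j)}) -> (forall z, z != 0 -> 0 < quad (g p0) z) ->
  exists b : nat, \forall p \near p0, forall z, b%:R < `|z| -> 1 <= quad (g p) z.
Proof.
move=> cg pos; have [k k0 Hk] := elliptic cg pos.
have [b Hb] := sqr_out k0; exists b; apply: filterS Hk => p Hp z /Hb h; exact: le_trans h (Hp z).
Qed.

Lemma near_in_open (T : topologicalType) (A : set T) (P : T -> Prop) (x : T) : open A -> A x ->
  (\forall y \near x, P y) -> exists W, [/\ open W, W x & forall y, W y -> A y /\ P y].
Proof.
move=> oA Ax Px; exists (A `&` [set y | P y])°; split; first exact: open_interior.
  by apply: filterI => //; exact: open_nbhs_nbhs.
by move=> y /interior_subset.
Qed.

Lemma near_forall (T : topologicalType) (I : finType) (P : I -> T -> Prop) (x : T) :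
  (forall i, \forall y \near x, P i y) -> \forall y \near x, forall i, P i y.
Proof. exact: filter_forall. Qed.

Lemma bump_quad_test (g : 'I_m -> 'I_m -> R) : (forall z : V, z != 0 -> 0 < quad g z) ->
  test (fun z => bump (quad g z)).
Proof.
move=> pos; split; first exact: continuous_bump_quad.
have [b Hb] := @near_supported R 0 (fun _ => g) (fun i j => @continuous_cstp _ _ _ _) pos.
by exists b => z /(nbhs_singleton Hb); exact: bump_out.
Qed.

Lemma fibre_vol_gt0 g : (forall z : V, z != 0 -> 0 < quad g z) -> 0 < fibre_vol g.
Proof.
move=> pos; apply: (integral_gt0 (x0 := 0) (bump_quad_test pos)) => [z|]; first exact: bump_ge0.
rewrite /quad big1 ?bump0 ?ltr01 // => i _; rewrite big1 // => j _; by rewrite !mxE !mulr0.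
Qed.

Lemma fibre_vol_continuous (P : topologicalType) (p0 : P) (g : P -> 'I_m -> 'I_m -> R) :
  (forall i j, {for p0, continuous (fun p => g p i j)}) -> (forall z, z != 0 -> 0 < quad (g p0) z) ->
  {for p0, continuous (fun p => fibre_vol (g p))}.
Proof.
move=> cg pos; have [b Hb] := near_supported cg pos.
apply: (integral_continuous (b := b)) => [|z]; last first.
  by apply: continuous_bumpc; exact: continuous_quad.
apply: filterS Hb => p Hp; have sp : supported b (fun z => bump (quad (g p) z)).
  by move=> z /Hp; exact: bump_out.
by split=> //; split; [exact: continuous_bump_quad|exists b].
Qed.

Lemma is_derive_comp1 (E : normedModType R) (b : R -> R) (db : R) (q : E -> R) (x v : E) (dq : R) :
  is_derive (q x) (1 : R) b db -> is_derive x v q dq -> is_derive x v (fun y => b (q y)) (db * dq).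
Proof.
move=> hb hq; apply/is_derive_lineP.
have h1 := (is_derive_lineP _ _ _ _).1 hq.
have h0 : q (0 *: v + x) = q x by rewrite scale0r add0r.
have hb' : is_derive ((fun h : R => q (h *: v + x)) 0) (1 : R) b db by rewrite h0.
exact: (@is_derive1_comp _ b (fun h : R => q (h *: v + x)) 0 db dq hb' h1).
Qed.

Lemma bump_derive t : is_derive t (1 : R) bump (dbump t).
Proof.
apply: is_derive_bound => e e0; exists e => // h he.
rewrite -[h *: 1]/(h * 1) mulr1; apply: le_trans (bump_taylor t h) _.
by rewrite -(ger0_norm (sqr_ge0 h)) normrX expr2 ler_wpM2r // ltW.
Qed.

Lemma quad_derivez g i (z : V) : (forall i j, g i j = g j i) ->
  is_derive z (e_ i) (quad g) (2 * \sum_j g i j * z 0 j).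
Proof.
move=> gs; apply: is_derive_bound => e e0.
exists (e / (`|g i i| + 1)) => [|h hr]; first by rewrite divr_gt0 // ltr_wpDl.
have -> : quad g (z + h *: e_ i) - quad g z - 2 * (\sum_j g i j * z 0 j) * h = g i i * h * h.
  pose d (k : 'I_m) : R := (k == i)%:R.
  have dsum (f : 'I_m -> R) : \sum_k f k * d k = f i.
    rewrite (bigD1 i) //= big1 ?addr0 => [|k /negPf ki]; first by rewrite /d eqxx mulr1.
    by rewrite /d ki mulr0.
  have E k : (z + h *: e_ i) 0 k = z 0 k + h * d k by rewrite !mxE eqxx /= /d eq_sym.
  rewrite /quad; transitivity (\sum_k \sum_l (h * (g k l * z 0 l * d k) + h * (g k l * z 0 k * d l) +
      h * h * (g k l * d k * d l)) - 2 * (\sum_j g i j * z 0 j) * h).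
    congr (_ - _); rewrite -sumrB; apply: eq_bigr => k _; rewrite -sumrB; apply: eq_bigr => l _.
    by rewrite !E; ring.
  have -> : \sum_k \sum_l (h * (g k l * z 0 l * d k) + h * (g k l * z 0 k * d l) +
      h * h * (g k l * d k * d l)) = h * (\sum_j g i j * z 0 j) + h * (\sum_j g i j * z 0 j) + h * h * g i i.
    transitivity (\sum_k (h * ((\sum_l g k l * z 0 l) * d k) + h * (g k i * z 0 k) + h * h * (g k i * d k))).
      apply: eq_bigr => k _; rewrite !big_split /= -!mulr_sumr mulr_suml; congr (_ + _ + _); congr (_ * _).
        exact: (dsum (fun l => g k l * z 0 k)).
      exact: (dsum (fun l => g k l * d k)).
    rewrite !big_split /= -!mulr_sumr (dsum (fun k => \sum_l g k l * z 0 l)) (dsum (fun k => g k i)).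
    by congr (_ + _ + _); congr (_ * _); apply: eq_bigr => k _; rewrite gs.
  by ring.
rewrite !normrM -mulrA mulrA ler_wpM2r //.
have h1 : 0 < `|g i i| + 1 by rewrite ltr_wpDl.
apply: (@le_trans _ _ ((`|g i i| + 1) * `|h|)); first by rewrite ler_wpM2r // lerDl ler01.
by rewrite mulrC -ler_pdivlMr // ltW.
Qed.

Lemma coord_derive (i l : 'I_m) (z : V) : is_derive z (e_ l) (fun z => z 0 i) ((l == i)%:R : R).
Proof.
apply: is_derive_bound => e e0; exists 1 => // h _.
rewrite [X in `|X|](_ : _ = 0) ?normr0 ?mulr_ge0 // ?ltW //.
by rewrite !mxE eqxx /= (eq_sym i); ring.
Qed.

(* Integration by parts: [z_i d_l (bump (quad g))] has integral [- delta_il] times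
   that of [bump (quad g)]. *)
Lemma fibre_vol_parts g i l : (forall z : V, z != 0 -> 0 < quad g z) -> (forall i j, g i j = g j i) ->
  integral (fun z => z 0 i * (dbump (quad g z) * (2 * \sum_j g l j * z 0 j))) =
  - (l == i)%:R * fibre_vol g.
Proof.
move=> pos gs; have tb := bump_quad_test pos.
have [b Hb] := @near_supported R 0 (fun _ => g) (fun i j => @continuous_cstp _ _ _ _) pos.
have {}Hb := nbhs_singleton Hb.
have cc k : continuous (fun z : V => z 0 k) by exact: coord_continuous.
have td : test (fun z => z 0 i * (dbump (quad g z) * (2 * \sum_j g l j * z 0 j))).
  split; last by exists b => z zb; rewrite dbump_out ?Hb // mul0r mulr0.
  apply: continuous_mul; first exact: cc.
  apply: continuous_mul; first exact: continuous_dbump_quad.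
  by apply: continuous_mul; [exact: cst_continuous|exact: continuous_linear_form].
have t1 : test (fun z : V => z 0 i * bump (quad g z)) by apply: testM.
have t2 : test (fun z : V => (l == i)%:R * bump (quad g z)) by exact: testZ.
have := integral_derive (f := fun z => z 0 i * bump (quad g z))
  (df := fun z => z 0 i * (dbump (quad g z) * (2 * \sum_j g l j * z 0 j)) + (l == i)%:R * bump (quad g z)) (i := l).
move=> /(_ t1 (testD td t2)).
rewrite integralD // integralZ // => H; apply/eqP; rewrite -subr_eq0 mulNr opprK; apply/eqP/H => z.
have h1 := is_derive_comp1 (bump_derive (quad g z)) (quad_derivez l z gs).
have := @is_deriveM _ _ (fun z : V => z 0 i) (fun z => bump (quad g z)) z (e_ l) _ _ (coord_derive i l z) h1.
rewrite /= -[X in is_derive _ _ _ X]/(_ * _ + _ * _) [X in is_derive _ _ _ (_ + X)]mulrC.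
by move=> hd; exact: hd.
Qed.

Section Fields.
Variables (Om : set V) (g : V -> 'I_m -> 'I_m -> R).
Hypothesis oOm : open Om.
Hypothesis g1 : forall i j, Ck_on 1 Om (fun x => g x i j).
Hypothesis gpos : forall x, Om x -> forall z, z != 0 -> 0 < quad (g x) z.

Let dg a x i j : R := 'D_(e_ a) (fun y => g y i j) x.

Let cg x i j : Om x -> {for x, continuous (fun x => g x i j)}.
Proof. by move=> Ox; exact: (Ck_cont (g1 i j)). Qed.

Let cdg a x i j : Om x -> {for x, continuous (fun x => dg a x i j)}.
Proof. by move=> Ox; exact: (Ck_cont (Ck_derive a (g1 i j))). Qed.

Let dvol a x : R := integral (fun z => dbump (quad (g x) z) * quad (dg a x) z).

Let c_dq a x z : Om x ->
  {for (x, z), continuous (fun pz : V * V => dbump (quad (g pz.1) pz.2) * quad (dg a pz.1) pz.2)}.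
Proof.
move=> Ox; apply: continuousMp; last by apply: continuous_quad => i j; exact: cdg.
by apply: continuous_dbumpc; apply: continuous_quad => i j; exact: cg.
Qed.

Let dtest a x b : (forall z : V, b%:R < `|z| -> 1 <= quad (g x) z) ->
  test (fun z => dbump (quad (g x) z) * quad (dg a x) z) /\
  supported b (fun z => dbump (quad (g x) z) * quad (dg a x) z).
Proof.
move=> H; have s : supported b (fun z => dbump (quad (g x) z) * quad (dg a x) z).
  by move=> z /H h; rewrite dbump_out // mul0r.
split=> //; split; last by exists b.
by apply: continuous_mul; [exact: continuous_dbump_quad|exact: continuous_quadz].
Qed.

Lemma fibre_vol_derive a x : Om x -> is_derive x (e_ a) (fun x => fibre_vol (g x)) (dvol a x).
Proof.
move=> Ox; have [b Hb] := near_supported (fun i j => @cg x i j Ox) (gpos Ox).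
have [W [oW Wx HW]] := near_in_open oOm Ox Hb.
have [t1 s1] := dtest a (HW x Wx).2.
apply: (@integral_derivable _ _ _ _ (fun y z => bump (quad (g y) z))
  (fun y z => dbump (quad (g y) z) * quad (dg a y) z) a b x oW Wx) => // [y Wy|y z Wy|z].
- have s : supported b (fun z => bump (quad (g y) z)) by move=> z /((HW y Wy).2); exact: bump_out.
  by split=> //; split; [exact: continuous_bump_quad|exists b].
- apply: is_derive_comp1; first exact: bump_derive.
  have D i j : is_derive y (e_ a) (fun y => g y i j) (dg a y i j).
    exact: (Ck_derivable a (g1 i j) (HW y Wy).1).
  apply: is_derive_bound => e e0.
  (* [n0] dominates the sum of the [|z_i z_j|], plus 1 to be positive; [e / n0] is then the accuracy
     to ask of each coefficient of the form. *)
  pose n0 := \sum_(i < m) \sum_(j < m) `|z 0 i * z 0 j| + 1.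
  have n00 : 0 < n0 by rewrite ltr_wpDl // sumr_ge0 // => i _; exact: sumr_ge0.
  have d0 : 0 < e / n0 by rewrite divr_gt0.
  have [r r0 Hr] : exists2 r, 0 < r & forall h : R, `|h| < r -> forall i j,
     `|g (y + h *: e_ a) i j - g y i j - dg a y i j * h| <= e / n0 * `|h|.
    have near_ij (ij : 'I_m * 'I_m) : \forall h \near (0 : R),
        `|g (y + h *: e_ a) ij.1 ij.2 - g y ij.1 ij.2 - dg a y ij.1 ij.2 * h| <= e / n0 * `|h|.
      have [r r0 Hr] := is_derive_boundP (D ij.1 ij.2) d0.
      by apply/nbhs_norm0P; exists r.
    have /nbhs_norm0P[r r0 Hr] := near_forall near_ij.
    by exists r => // h hr i j; exact: (Hr h hr (i, j)).
  exists r => // h hr; rewrite /quad mulr_suml -!sumrB.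
  apply: (le_trans (ler_norm_sum _ _ _)).
  apply: (@le_trans _ _ (\sum_(i < m) \sum_(j < m) (e / n0 * `|h|) * `|z 0 i * z 0 j|)).
    apply: ler_sum => i _; rewrite mulr_suml -!sumrB; apply: (le_trans (ler_norm_sum _ _ _)).
    apply: ler_sum => j _; rewrite mulrAC -!mulrBl normrM ler_wpM2r //; exact: Hr.
  under eq_bigr do rewrite -mulr_sumr.
  rewrite -mulr_sumr mulrAC ler_wpM2r // -[X in _ <= X](divfK (lt0r_neq0 n00)) ler_wpM2l //.
    exact: ltW.
  by rewrite lerDl ler01.
- by apply: c_dq; exact: (HW x Wx).1.
Qed.

Lemma fibre_vol_C1 : Ck_on 1 Om (fun x => fibre_vol (g x)).
Proof.
have oc x : Om x -> {for x, continuous (fun x => fibre_vol (g x))}.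
  by move=> Ox; apply: fibre_vol_continuous; [move=> i j; exact: cg|exact: gpos].
apply: Ck_intro => // [x|a]; first by rewrite inE; exact: oc.
exists (dvol a); first by move=> x Ox; exact: fibre_vol_derive.
split=> // x; rewrite inE => Ox; have [b Hb] := near_supported (fun i j => @cg x i j Ox) (gpos Ox).
apply: (integral_continuous (b := b)) => [|z]; last exact: c_dq.
by apply: filterS Hb => y; exact: dtest.
Qed.

(** If [g] varies along [X] by [Gam], the integrand varies by the derivative of [bump (quad g)]
    along the linear field with matrix [Gam]. Integration by parts replaces this field by minus its
    trace. *)
Lemma fibre_vol_trace x (X : 'I_m -> R) (Gam : 'I_m -> 'I_m -> R) : Om x ->
  (forall i j, g x i j = g x j i) ->
  (forall i j, \sum_a X a * dg a x i j = \sum_l (Gam i l * g x l j + Gam j l * g x l i)) ->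
  \sum_a X a * 'D_(e_ a) (fun x => fibre_vol (g x)) x = - (\sum_i Gam i i) * fibre_vol (g x).
Proof.
move=> Ox gs H; have gp := gpos Ox.
have [b Hb] := @near_supported R 0 (fun _ => g x) (fun i j => @continuous_cstp _ _ _ _) gp.
have {}Hb := nbhs_singleton Hb.
have E a : 'D_(e_ a) (fun x => fibre_vol (g x)) x = dvol a x.
  exact: (derive_val (is_derive := fibre_vol_derive a Ox)).
pose t i l (z : V) := z 0 i * (dbump (quad (g x) z) * (2 * \sum_j g x l j * z 0 j)).
have cc k : continuous (fun z : V => z 0 k) by exact: coord_continuous.
have tt i l : test (t i l).
  split; last by exists b => z zb; rewrite /t dbump_out ?Hb // mul0r mulr0.
  apply: continuous_mul; first exact: cc.
  apply: continuous_mul; first exact: continuous_dbump_quad.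
  by apply: continuous_mul; [exact: cst_continuous|exact: continuous_linear_form].
transitivity (integral (fun z => \sum_i \sum_l Gam i l * t i l z)).
  transitivity (integral (fun z => \sum_a X a * (dbump (quad (g x) z) * quad (dg a x) z))).
    rewrite integral_sum => [|a]; last by apply: testZ; exact: (dtest a Hb).1.
    by apply: eq_bigr => a _; rewrite E -integralZ //; exact: (dtest a Hb).1.
  apply: eq_integral => z.
  transitivity (dbump (quad (g x) z) * \sum_i \sum_j (\sum_a X a * dg a x i j) * (z 0 i * z 0 j)).
    transitivity (dbump (quad (g x) z) * \sum_a X a * quad (dg a x) z).
      by rewrite mulr_sumr; apply: eq_bigr => a _; exact: mulrCA.
    congr (_ * _); rewrite /quad; under eq_bigr do rewrite mulr_sumr.
    rewrite exchange_big; apply: eq_bigr => i _; under eq_bigr do rewrite mulr_sumr.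
    rewrite exchange_big; apply: eq_bigr => j _; rewrite mulr_suml; apply: eq_bigr => a _.
    exact: mulrA.
  have -> : \sum_i \sum_j (\sum_a X a * dg a x i j) * (z 0 i * z 0 j) =
      2 * \sum_i \sum_l Gam i l * (z 0 i * \sum_j g x l j * z 0 j).
    under eq_bigr do under eq_bigr do rewrite H.
    transitivity (\sum_i \sum_j \sum_l (Gam i l * (z 0 i * (g x l j * z 0 j))) +
        \sum_i \sum_j \sum_l (Gam j l * (z 0 j * (g x l i * z 0 i)))).
      rewrite -big_split; apply: eq_bigr => i _; rewrite -big_split; apply: eq_bigr => j _ /=.
      rewrite -big_split mulr_suml; apply: eq_bigr => l _ /=; ring.
    rewrite [X in _ + X]exchange_big /= [RHS]mulr_natl -mulr2n; congr (_ *+ 2); apply: eq_bigr => i _.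
    rewrite exchange_big; apply: eq_bigr => l _; rewrite -mulr_sumr -mulr_sumr; by [].
  rewrite mulrCA mulr_sumr mulr_sumr; apply: eq_bigr => i _; rewrite mulr_sumr mulr_sumr.
  apply: eq_bigr => l _; rewrite /t; ring.
rewrite integral_sum => [|i]; last by apply: test_sum => l; exact: testZ.
rewrite mulNr mulr_suml -sumrN; apply: eq_bigr => i _.
rewrite integral_sum => [|l]; last exact: testZ.
rewrite (bigD1 i) //= big1 ?addr0 => [|l li].
  by rewrite (integralZ _ (tt i i)) /t fibre_vol_parts // eqxx mulN1r mulrN.
by rewrite (integralZ _ (tt i l)) /t fibre_vol_parts // (negPf li) oppr0 mul0r mulr0.
Qed.

End Fields.

End Density.

(** * Change of variables by a concentrating kernel *)

Section Transition.
Context {R : realType}.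
Variable m : nat.
Local Notation V := 'rV[R]_m.
Local Notation e_ i := (delta_mx 0 i : V).

(** [h] may be arbitrary outside [O]: there the product vanishes identically on the open complement
    of [C], and [O] together with this complement covers the space. *)
Lemma continuous_extension (T : topologicalType) (C O : set T) (a h : T -> R) : closed C -> C `<=` O ->
  continuous a -> (forall x, ~ C x -> a x = 0) -> (forall x, O x -> {for x, continuous h}) ->
  continuous (fun x => a x * h x).
Proof.
move=> clC CO ca a0 ch x; have [Cx|Cx] := pselect (C x).
  exact: (continuousMp (ca x) (ch x (CO x Cx))).
apply: (@eq_continuous_at _ _ (~` C) (fun=> 0)) => // [|y Cy|].
- exact: closed_openC.
- by rewrite a0 // mul0r.
- exact: continuous_cstp.
Qed.

Lemma continuous_normp (T : topologicalType) (E : normedModType R) (x : T) (f : T -> E) :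
  {for x, continuous f} -> {for x, continuous (fun y => `|f y|)}.
Proof. by move=> cf; apply: continuous_compp cf _; exact: norm_continuous. Qed.

Lemma continuous_addp (T : topologicalType) (E : normedModType R) (x : T) (f g : T -> E) :
  {for x, continuous f} -> {for x, continuous g} -> {for x, continuous (fun y => f y + g y)}.
Proof. by move=> cf cg; exact: cvgD. Qed.

Lemma continuous_subp (T : topologicalType) (E : normedModType R) (x : T) (f g : T -> E) :
  {for x, continuous f} -> {for x, continuous g} -> {for x, continuous (fun y => f y - g y)}.
Proof. by move=> cf cg; exact: cvgB. Qed.

Lemma continuous_scalep (T : topologicalType) (E : normedModType R) (x : T) (a : T -> R) (f : T -> E) :
  {for x, continuous a} -> {for x, continuous f} -> {for x, continuous (fun y => a y *: f y)}.
Proof. by move=> cf cg; exact: cvgZ. Qed.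

Lemma eq_continuous_for (T U : topologicalType) (f h : T -> U) (x : T) : (forall y, f y = h y) ->
  {for x, continuous f} -> {for x, continuous h}.
Proof. by move=> /funext ->. Qed.

Lemma continuous_linep (E : normedModType R) (F : E -> R) (x : E) (c : R) (w : E) :
  {for x + c *: w, continuous F} -> {for w, continuous (fun z => F (x + c *: z))}.
Proof.
move=> cF; apply: (continuous_compp (g := fun z => x + c *: z)); last exact: cF.
apply: continuous_addp; first exact: continuous_constp.
by apply: continuous_scalep; [exact: continuous_constp|exact: continuous_idp].
Qed.

Lemma continuous_affine (E : normedModType R) (F : E -> R) (x : E) (c : R) : continuous F ->
  continuous (fun z => F (x + c *: z)).
Proof. by move=> cF z; apply: continuous_linep; exact: cF. Qed.

Lemma continuous_tensor (T U : topologicalType) (f : T -> R) (h : U -> R) : continuous f ->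
  continuous h -> continuous (fun p : T * U => f p.1 * h p.2).
Proof.
move=> cf ch [x y]; apply: continuousMp; first by apply: (continuous_fstc (f := f)); exact: cf.
by apply: (continuous_sndc (f := h)); exact: ch.
Qed.

Lemma row_linear_bound (c : 'I_m -> R) (w : V) e : 0 <= e -> (forall i, `|c i| <= e) ->
  `|\sum_i w 0 i * c i| <= m%:R * e * `|w|.
Proof.
move=> e0 ce; apply: (le_trans (ler_norm_sum _ _ _)).
apply: (@le_trans _ _ (\sum_(i < m) e * `|w|)); last by rewrite sumr_const card_ord -[leLHS]mulr_natl mulrA.
apply: ler_sum => i _; rewrite normrM mulrC; apply: ler_pM => //; exact: row_coord_le.
Qed.

(** The value at [eta = 0] is the derivative, which makes the quotient jointly continuous up to
    [eta = 0]. *)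
Definition difference_quotient (p : V -> R) (eta : R) (x w : V) : R :=
  if eta == 0 then \sum_i w 0 i * 'D_(e_ i) p x else eta^-1 * (p (x + eta *: w) - p x).

(** The partial derivatives at [x0] serve as slopes for all nearby points, so [row_mvt] compares
    every quotient near [x0], and likewise the derivative at [eta = 0], with one linear form. *)
Lemma difference_quotient_continuous (Om : set V) (p : V -> R) x0 w0 : open Om -> Om x0 -> Ck_on 1 Om p ->
  {for ((0 : R, x0), w0), continuous (fun q : (R * V) * V => difference_quotient p q.1.1 q.1.2 q.2)}.
Proof.
move=> oO Ox p1; apply/cvgrPdist_le => e e0.
pose c i := 'D_(e_ i) p x0.
pose n0 := m%:R * (`|w0| + 1) + 1.
have n00 : 0 < n0 by rewrite ltr_wpDl // mulr_ge0 // addr_ge0.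
pose e' := e / 2 / n0.
have e'0 : 0 < e' by rewrite !divr_gt0.
have nd i : \forall y \near x0, `|'D_(e_ i) p y - c i| <= e'.
  by apply: continuous_dist => //; exact: (Ck_cont (Ck_derive i p1)).
have nO : \forall y \near x0, Om y by exact: open_nbhs_nbhs.
have : \forall y \near x0, Om y /\ forall i, `|'D_(e_ i) p y - c i| <= e'.
  by apply: filterS2 nO (near_forall nd) => y.
move=> /nbhs_normP[r /= r0 Hr].
have n1 : \forall q \near (((0 : R, x0), w0) : (R * V) * V), `|\sum_i c i * (q.2 : V) 0 i - \sum_i c i * w0 0 i| <= e / 2.
  apply: (continuous_dist (f := fun q : (R * V) * V => \sum_i c i * q.2 0 i)); first by rewrite divr_gt0.
  by apply: (continuous_sndc (f := fun w : V => \sum_i c i * w 0 i)); exact: continuous_linear_form.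
have n2 : \forall q \near (((0 : R, x0), w0) : (R * V) * V), `|(`|q.1.2 - x0| + `|q.1.1| * `|q.2|) - (`|x0 - x0| + `|0 : R| * `|w0|)| <= r / 2.
  apply: (continuous_dist (f := fun q : (R * V) * V => `|q.1.2 - x0| + `|q.1.1| * `|q.2|)); first by rewrite divr_gt0.
  apply: continuousDp.
    apply: (continuous_fstc (f := fun q : R * V => `|q.2 - x0|)).
    apply: (continuous_sndc (f := fun x : V => `|x - x0|)); apply: continuous_normp.
    by apply: continuous_subp; [exact: continuous_idp|exact: continuous_constp].
  apply: continuousMp.
    apply: (continuous_fstc (f := fun q : R * V => `|q.1|)).
    by apply: (continuous_fstc (f := fun x : R => `|x|)); apply: continuous_normp; exact: continuous_idp.
  by apply: (continuous_sndc (f := fun x : V => `|x|)); apply: continuous_normp; exact: continuous_idp.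
have n3 : \forall q \near (((0 : R, x0), w0) : (R * V) * V), `|(`|q.2| - `|w0|)| <= 1.
  apply: (continuous_dist (f := fun q : (R * V) * V => `|q.2|)) => //.
  by apply: (continuous_sndc (f := fun x : V => `|x|)); apply: continuous_normp; exact: continuous_idp.
have lin (q : (R * V) * V) : \sum_i q.2 0 i * c i = \sum_i c i * q.2 0 i.
  by apply: eq_bigr => i _; exact: mulrC.
have key : \forall q \near (((0 : R, x0), w0) : (R * V) * V),
    `|difference_quotient p q.1.1 q.1.2 q.2 - \sum_i c i * w0 0 i| <= e.
  apply: filterS3 n1 n2 n3 => -[[h x] w] /= h1; rewrite subrr !normr0 mul0r addr0 subr0.
  rewrite ger0_norm ?addr_ge0 ?mulr_ge0 // => h2 h3.
  have w1 : `|w| <= `|w0| + 1.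
    by rewrite -lerBlDl; apply: le_trans h3; exact: ler_norm.
  have r2 : r / 2 < r by rewrite ltr_pdivrMr // mulr_natr mulr2n ltrDr.
  have b1 : m%:R * e' * `|w| <= e / 2.
    rewrite mulrAC /e' mulrA ler_pdivrMr // mulrC; apply: ler_wpM2l; first by rewrite ltW // divr_gt0.
    by apply: (@le_trans _ _ (m%:R * (`|w0| + 1))); [rewrite ler_wpM2l|rewrite lerDl].
  have close y : `|y - x| <= `|h *: w| -> Om y /\ forall i, `|'D_(e_ i) p y - c i| <= e'.
    move=> yx; apply: Hr; rewrite /= distrC; apply: le_lt_trans (le_lt_trans h2 r2).
    by rewrite -(subrKA x) addrC; apply: (le_trans (ler_normD _ _)); rewrite -normrZ lerD2l.
  have d1 : `|difference_quotient p h x w - \sum_i c i * w 0 i| <= e / 2.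
    apply: le_trans b1; rewrite /difference_quotient; case: eqVneq => [h0|h0].
      rewrite -sumrB (eq_bigr (fun i => w 0 i * ('D_(e_ i) p x - c i))) => [|i _]; last by ring.
      apply: row_linear_bound => [|i]; first exact: ltW.
      by apply: (close x _).2; rewrite subrr normr0.
    have := row_mvt (f := p) (x := x) (h := h *: w) (c := c) (e := e') (fun y yx i =>
      conj (@ex_derive _ _ _ _ _ _ _ (Ck_derivable i p1 (close y yx).1)) ((close y yx).2 i)).
    rewrite normrZ => H; have hp : 0 < `|h| by rewrite normr_gt0.
    rewrite -(ler_pM2l hp) -normrM mulrBr mulrA mulfV // mul1r mulr_sumr mulrCA.
    by rewrite (eq_bigr (fun i => c i * (h *: w) 0 i)) => [//|i _]; rewrite mxE mulrCA.
  rewrite -[difference_quotient _ _ _ _](subrK (\sum_i c i * w 0 i)) -addrA [e]splitr.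
  exact: (le_trans (ler_normD _ _) (lerD d1 h1)).
have E0 : difference_quotient p 0 x0 w0 = \sum_i c i * w0 0 i.
  by rewrite /difference_quotient eqxx; apply: eq_bigr => i _; exact: mulrC.
by apply: filterS key => q hq; rewrite /= E0 distrC.
Qed.

Lemma compact_norm_le (K : set V) : compact K -> exists b : nat, forall x, K x -> `|x| <= b%:R.
Proof.
move=> /compact_bounded /= [M [Mr HM]]; exists (Num.trunc `|M|).+1 => x Kx.
apply: (HM _ _ x Kx); apply: le_lt_trans (ler_norm M) _; exact: truncnS_gt.
Qed.

(** The local constants of [elliptic] are replaced by inverses of integers, so that compactness can
    choose one integer valid on all of [K]. *)
Lemma elliptic_compact (K : set V) (g : V -> 'I_m -> 'I_m -> R) : compact K ->
  (forall x, K x -> forall i j, {for x, continuous (fun x => g x i j)}) ->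
  (forall x, K x -> forall z, z != 0 -> 0 < quad (g x) z) ->
  exists2 k : R, 0 < k & forall x, K x -> forall z, k * `|z| ^+ 2 <= quad (g x) z.
Proof.
move=> cK cg pos.
have near_k x : K x -> \forall y \near x & n \near \oo, (forall z, (n.+1%:R^-1 : R) * `|z| ^+ 2 <= quad (g y) z).
  move=> Kx; have [k k0 Hk] := elliptic (cg x Kx) (pos x Kx).
  have nk : \forall n \near \oo, (n.+1%:R^-1 : R) <= k.
    exists (Num.trunc k^-1) => // n /= kn; rewrite -[k]invrK lef_pV2 ?posrE ?invr_gt0 ?ltr0n //.
    by apply: ltW; apply: lt_le_trans (truncnS_gt _) _; rewrite ler_nat.
  exists ([set y : V | forall z, k * `|z| ^+ 2 <= quad (g y) z], [set n | (n.+1%:R^-1 : R) <= k]) => //.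
  by move=> [y n] /= [Hy nk'] z; apply: le_trans (Hy z); rewrite ler_wpM2r // exprn_ge0.
have := (compact_near_coveringP K).1 cK nat \oo (fun n y => forall z, (n.+1%:R^-1 : R) * `|z| ^+ 2 <= quad (g y) z) _.
move=> /(_ _ (fun x Kx => near_k x Kx)) [n _ Hn].
by exists (n.+1%:R^-1); [rewrite invr_gt0 ltr0n|move=> x Kx; exact: (Hn n (leqnn n) x Kx)].
Qed.

End Transition.
Section Change.
Context {R : realType}.
Variable m : nat.
Local Notation V := 'rV[R]_m.
Local Notation e_ i := (delta_mx 0 i : V).

Variables (Om Om' : set V) (psi phi : V -> V) (g gm : V -> 'I_m -> 'I_m -> R).
Hypotheses (oO : open Om) (oO' : open Om').
Hypothesis psiO : forall x, Om x -> Om' (psi x).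
Hypothesis phiO : forall y, Om' y -> Om (phi y).
Hypothesis phiK : forall x, Om x -> phi (psi x) = x.
Hypothesis psiK : forall y, Om' y -> psi (phi y) = y.
Hypothesis psi1 : forall j, Ck_on 1 Om (fun x => psi x 0 j).
Hypothesis phi1 : forall j, Ck_on 1 Om' (fun y => phi y 0 j).
Hypothesis cg : forall x, Om x -> forall i j, {for x, continuous (fun x => g x i j)}.
Hypothesis cgm : forall x, Om x -> forall i j, {for x, continuous (fun x => gm x i j)}.
Hypothesis gpos : forall x, Om x -> forall z, z != 0 -> 0 < quad (g x) z.
Hypothesis gmpos : forall x, Om x -> forall z, z != 0 -> 0 < quad (gm x) z.
Hypothesis isometry : forall x, Om x -> forall z : V,
  quad (gm x) (\row_j \sum_i z 0 i * 'D_(e_ i) (fun x => psi x 0 j) x) = quad (g x) z.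

Variables (K K' : set V) (f chi : V -> R).
Hypotheses (cK : compact K) (cK' : compact K') (KO : K `<=` Om) (KO' : K' `<=` Om').
Hypotheses (cf : continuous f) (cchi : continuous chi).
Hypotheses (f0 : forall x, ~ K x -> f x = 0) (chi0 : forall y, ~ K' y -> chi y = 0).

Let clK : closed K. Proof. exact: compact_closed. Qed.
Let clK' : closed K'. Proof. exact: compact_closed. Qed.

Let cpsi x : Om x -> {for x, continuous psi}.
Proof. by move=> Ox; apply: continuous_rowp => j; exact: (Ck_cont (psi1 j)). Qed.

Let cphi y : Om' y -> {for y, continuous phi}.
Proof. by move=> Oy; apply: continuous_rowp => j; exact: (Ck_cont (phi1 j)). Qed.

Let cgm' y : Om' y -> forall i j, {for y, continuous (fun y => gm (phi y) i j)}.
Proof.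
move=> Oy i j; apply: (continuous_compp (g := phi) (f := fun x => gm x i j)); first exact: cphi.
by apply: cgm; exact: phiO.
Qed.

(** The two functions multiplied by their densities. Both metrics are indexed by the point [x] of
    [Om]: [gm x] is the metric of the target coordinates at the point [psi x]. *)
Let a x := f x * (fibre_vol (g x))^-1.
Let a' y := chi y * (fibre_vol (gm (phi y)))^-1.

Let a0 x : ~ K x -> a x = 0. Proof. by move=> /f0 h; rewrite /a h mul0r. Qed.
Let a'0 y : ~ K' y -> a' y = 0. Proof. by move=> /chi0 h; rewrite /a' h mul0r. Qed.

Let ca : continuous a.
Proof.
apply: (continuous_extension clK KO) => // x Ox; apply: continuousVp.
  by apply: fibre_vol_continuous; [exact: cg|exact: gpos].
by rewrite gt_eqF // fibre_vol_gt0 //; exact: gpos.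
Qed.

Let ca' : continuous a'.
Proof.
apply: (continuous_extension clK' KO') => // y Oy; apply: continuousVp.
  by apply: fibre_vol_continuous; [exact: cgm'|exact: gmpos (phiO Oy)].
by rewrite gt_eqF // fibre_vol_gt0 //; exact: gmpos (phiO Oy).
Qed.

Let bounded_by : exists b : nat, forall x, K x \/ K' x -> `|x| <= b%:R.
Proof.
have [[b Hb] [c Hc]] := (compact_norm_le cK, compact_norm_le cK').
exists (b + c)%N => x [/Hb|/Hc] h; apply: (le_trans h); rewrite natrD ?lerDl ?lerDr //.
Qed.

(** For small [eta] this lives near the graph of [psi]. Divided by the [m]-th power of [eta], its
    integral in [y] tends to [a x * chi (psi x)] and its integral in [x] to [a' y * f (phi y)]. *)
Let ker eta (p : V * V) := a p.1 * a' p.2 * bump (quad (gm p.1) (eta^-1 *: (psi p.1 - p.2))).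

Let cker eta : continuous (ker eta).
Proof.
have clC : closed [set p : V * V | K p.1 /\ K' p.2].
  apply: closedI; [apply: (closed_comp (f := @fst V V)) clK|apply: (closed_comp (f := @snd V V)) clK'] => p _.
    exact: cvg_fst.
  exact: cvg_snd.
apply: (continuous_extension (O := [set p : V * V | Om p.1]) clC).
- by move=> p [/KO].
- by apply: continuous_tensor; [exact: ca|exact: ca'].
- move=> [x y] /= h; have [Kx|Kx] := pselect (K x); last by rewrite a0 // mul0r.
  by rewrite (a'0 (y := y)) ?mulr0 // => K'y; apply: h.
- move=> [x y] /= Ox; apply: continuous_bumpc.
  apply: (continuous_compp (g := fun p : V * V => (p, eta^-1 *: (psi p.1 - p.2)))
    (f := fun q : (V * V) * V => quad (gm q.1.1) q.2)).
    apply: continuous_pairc; first exact: continuous_idp.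
    apply: continuous_scalep; first exact: continuous_constp.
    apply: continuous_subp; first by apply: (continuous_fstc (f := psi)); exact: cpsi.
    by apply: (continuous_sndc (f := fun y : V => y)); exact: continuous_idp.
  apply: (@continuous_quad _ _ (V * V)%type (x, y) (fun p => gm p.1)) => i j.
  by apply: (continuous_fstc (f := fun x => gm x i j)); exact: cgm.
Qed.

Let ker_out : exists b : nat, forall eta x y, b%:R < `|x| \/ b%:R < `|y| -> ker eta (x, y) = 0.
Proof.
have [b Hb] := bounded_by; exists b => eta x y [] h; rewrite /ker /=.
  by rewrite a0 ?mul0r // => /or_introl /Hb; rewrite leNgt h.
by rewrite a'0 ?(mulr0, mul0r) // => /or_intror /Hb; rewrite leNgt h.
Qed.

(** The kernel without the factor [a] after the substitution [y = psi x + eta z]; the sign of [z] is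
    lost because the quadratic form is even. *)
Let HA (q : R * V) z := a' (psi q.2 + q.1 *: z) * bump (quad (gm q.2) z).

Let HA_cont x0 : Om x0 -> {for (0, x0), continuous (fun q => integral (HA q))}.
Proof.
move=> Ox; have [b Hb] := near_supported (cgm Ox) (gmpos Ox).
apply: (integral_continuous (b := b)) => [|z].
  have : \forall q \near ((0 : R), x0), forall z : V, b%:R < `|z| -> 1 <= quad (gm q.2) z.
    exists (setT, [set x | forall z : V, b%:R < `|z| -> 1 <= quad (gm x) z]) => /=.
      by split=> //; exact: filterT.
    by move=> [h x] /= [_].
  apply: filterS => -[h x] /= H; have s : supported b (HA (h, x)).
    by move=> z /H hz; rewrite /HA /= bump_out // mulr0.
  split=> //; split; last by exists b.
  apply: continuous_mul; last exact: continuous_bump_quad.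
  by apply: (continuous_affine (F := a')); exact: ca'.
apply: continuousMp.
  apply: (continuous_compp (g := fun q : (R * V) * V => psi q.1.2 + q.1.1 *: q.2)); last exact: ca'.
  apply: continuous_addp.
    by apply: (continuous_fstc (f := fun q : R * V => psi q.2)); apply: continuous_sndc; exact: cpsi.
  apply: continuous_scalep; last exact: (continuous_sndc (f := id)).
  by apply: (continuous_fstc (f := @fst R V)); exact: cvg_fst.
apply: continuous_bumpc; apply: (continuous_quad (g := fun q : R * V => gm q.2)) => i j.
by apply: (continuous_sndc (f := fun x => gm x i j)); exact: cgm.
Qed.

Let HA_0 x : Om x -> integral (HA (0, x)) = chi (psi x).
Proof.
move=> Ox; transitivity (integral (fun z => a' (psi x) * bump (quad (gm x) z))).
  by apply: eq_integral => z; rewrite /HA /= scale0r addr0.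
rewrite integralZ; last exact: bump_quad_test (gmpos Ox).
rewrite /a' phiK // mulfVK // gt_eqF // fibre_vol_gt0 //; exact: gmpos.
Qed.

Let quadN h z : quad h (- z : V) = quad h z.
Proof. by rewrite -scaleN1r quadZ sqrrN expr1n mul1r. Qed.

Let rescale_test F (x : V) j : test F -> test (fun z => F (x + half j *: z)).
Proof.
move=> [cF [b Hb]]; have hj : half j * (2 ^ j)%:R = 1 :> R by exact: halfK.
have [c xc] := normal_bounded x; split; first exact: (continuous_affine (F := F)).
exists (2 ^ j * (b + c))%N => z hz; apply: Hb; rewrite natrM in hz.
have h1 : (b + c)%:R < `|half j *: z|.
  by have := hz; rewrite normrZ ger0_norm ?half_ge0 // -(ltr_pM2l (half_gt0 j)) mulrA hj mul1r.
rewrite -(ltrD2r c%:R) -natrD; apply: (lt_le_trans h1).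
rewrite -[X in `|X| <= _](addKr x) addrC; apply: (le_trans (ler_normD _ _)).
by rewrite normrN lerD2l.
Qed.

Let rescale F (x : V) j : test F ->
  integral F = half j ^+ m * integral (fun z => F (x + half j *: z)).
Proof.
move=> tF; rewrite -integral_scale; last exact: rescale_test.
rewrite -(integral_shift x tF); apply: eq_integral => z.
by rewrite scalerA halfK scale1r addrC.
Qed.

Let ker_A j x :
  integral (fun y => ker (half j) (x, y)) = half j ^+ m * (a x * integral (HA (half j, x))).
Proof.
have [Kx|Kx] := pselect (K x); last first.
  rewrite a0 // mul0r mulr0 -[RHS](@integral0 R m); apply: eq_integral => y.
  by rewrite /ker /= a0 // !mul0r.
have Ox := KO Kx; have [b Hb] := ker_out.
have t : test (fun y => ker (half j) (x, y)) by exact: (fubini_testl (@cker (half j)) (Hb (half j))).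
rewrite (rescale (psi x) j t); congr (_ * _).
transitivity (integral (fun z => a x * HA (half j, x) z)).
  apply: eq_integral => z; rewrite /ker /HA /= -mulrA; congr (_ * (_ * bump _)).
  rewrite opprD addNKr scalerN scalerA mulVf ?scale1r ?quadN // gt_eqF // half_gt0 //.
rewrite integralZ //; have [b' sb'] := near_supported (cgm Ox) (gmpos Ox).
have sb := nbhs_singleton sb'; split; last first.
  by exists b' => z /sb hz; rewrite /HA /= bump_out // mulr0.
apply: continuous_mul; last exact: continuous_bump_quad.
by apply: (continuous_affine (F := a')); exact: ca'.
Qed.


Let Dq eta x (w : V) : V := \row_j difference_quotient (fun x => psi x 0 j) eta x w.

Let Dq_cont x0 w0 : Om x0 ->
  {for ((0 : R, x0), w0), continuous (fun q : (R * V) * V => Dq q.1.1 q.1.2 q.2)}.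
Proof.
move=> Ox; apply: continuous_rowp => j.
apply: (eq_continuous_for (f := fun q : (R * V) * V =>
  difference_quotient (fun x => psi x 0 j) q.1.1 q.1.2 q.2)) => [q|]; first by rewrite mxE.
by apply: difference_quotient_continuous (psi1 j).
Qed.

Let Dq_contw eta x w : Om x -> Om (x + eta *: w) -> {for w, continuous (Dq eta x)}.
Proof.
move=> Ox Ow; apply: continuous_rowp => j.
apply: (eq_continuous_for (f := fun w : V => difference_quotient (fun x => psi x 0 j) eta x w)) => [q|].
  by rewrite mxE.
rewrite /difference_quotient; case: eqP => e0.
  apply: (eq_continuous_for (f := fun w : V => \sum_i 'D_(e_ i) (fun x => psi x 0 j) x * w 0 i)) => [q|].
    by apply: eq_bigr => i _; exact: mulrC.
  exact: continuous_linear_form.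
apply: continuousMp; first exact: continuous_cstp.
apply: continuousDp; last exact: continuous_cstp.
apply: (continuous_linep (F := fun x => psi x 0 j)).
exact: (Ck_cont (psi1 j)).
Qed.

(** The kernel without the factor [a'] after the substitution [x = phi y + eta w]. The argument of
    the form is now a difference quotient of [psi], so at [eta = 0] the isometry of the transition
    brings back the metric [g]. *)
Let HB (q : R * V) w :=
  a (phi q.2 + q.1 *: w) * bump (quad (gm (phi q.2 + q.1 *: w)) (Dq q.1 (phi q.2) w)).

(* [phi] is Lipschitz near [y0], and away from [y0] both sides are bounded. *)
Let inverse_bound y0 : Om' y0 -> exists2 C : R, 0 < C & \forall y \near y0, forall x, K x ->
  `|x - phi y| <= C * `|psi x - y|.
Proof.
move=> Oy; pose c i j := 'D_(e_ i) (fun y => phi y 0 j) y0.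
have nd (ij : 'I_m * 'I_m) : \forall y \near y0, `|'D_(e_ ij.1) (fun y => phi y 0 ij.2) y - c ij.1 ij.2| <= 1.
  by apply: continuous_dist => //; exact: (Ck_cont (Ck_derive ij.1 (phi1 ij.2))).
have nO : \forall y \near y0, Om' y by exact: open_nbhs_nbhs.
have : \forall y \near y0, Om' y /\ forall ij : 'I_m * 'I_m,
    `|'D_(e_ ij.1) (fun y => phi y 0 ij.2) y - c ij.1 ij.2| <= 1.
  by apply: filterS2 nO (near_forall nd) => y.
move=> /nbhs_normP[r /= r0 Hr].
have [b Hb] := bounded_by.
have nphi : \forall y \near y0, `|phi y - phi y0| <= 1.
  have : \forall y \near y0, `|(`|phi y - phi y0| - `|phi y0 - phi y0|)| <= 1.
    apply: (continuous_dist (f := fun y => `|phi y - phi y0|)) => //; apply: continuous_normp.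
    by apply: continuous_subp; [exact: cphi|exact: continuous_constp].
  by apply: filterS => y; rewrite subrr normr0 subr0 normr_id.
pose cm := \sum_(i < m) \sum_(j < m) `|c i j|.
have cm0 : 0 <= cm by apply: sumr_ge0 => i _; exact: sumr_ge0.
pose L := m%:R * 1 + m%:R * cm : R.
have L0 : 0 <= L by rewrite addr_ge0 ?mulr_ge0.
pose D := b%:R + `|phi y0| + 1 : R.
have D0 : 0 < D by rewrite ltr_wpDl // addr_ge0.
have r3 : 0 < r / 3 by rewrite divr_gt0.
exists (L + D / (r / 3)); first by rewrite ltr_wpDl // divr_gt0.
have nb : \forall y \near y0, `|y - y0| < r / 3.
  by apply/nbhs_normP; exists (r / 3) => // y; rewrite /= distrC.
apply: filterS2 nphi nb => y hphi hy x Kx.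
have [xy|xy] := leP (r / 3) `|psi x - y|.
  apply: (@le_trans _ _ D).
    rewrite /D -addrA; apply: (le_trans (ler_normB _ _)); apply: lerD; first by apply: Hb; left.
    have := ler_normD (phi y - phi y0) (phi y0); rewrite subrK => h; apply: (le_trans h).
    by rewrite [leRHS]addrC lerD2r.
  rewrite -[X in X <= _](divfK (lt0r_neq0 r3)); apply: ler_pM => //.
  - by rewrite divr_ge0 // ltW.
  - exact: ltW.
  - by rewrite lerDr.
rewrite -{1}(phiK (KO Kx)).
have -> : psi x = y + (psi x - y) by rewrite addrC subrK.
set h := (psi x - y).
have close z : `|z - y| <= `|h| -> Om' z /\ forall ij : 'I_m * 'I_m,
    `|'D_(e_ ij.1) (fun y => phi y 0 ij.2) z - c ij.1 ij.2| <= 1.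
  move=> zy; apply: Hr; rewrite /= distrC -(subrKA y); apply: le_lt_trans (ler_normD _ _) _.
  apply: (@lt_le_trans _ _ (r / 3 + r / 3)); first by apply: ltrD => //; exact: le_lt_trans zy xy.
  by move: r0 => /ltW; lra.
apply: (@le_trans _ _ (L * `|h|)); last first.
  have -> : y + h - y = h by rewrite addrC addKr.
  by rewrite ler_wpM2r // lerDl divr_ge0 // ltW.
apply: row_norm_le => [|j]; first by rewrite mulr_ge0.
rewrite !mxE -[phi _ 0 j + _](subrK (\sum_i c i j * h 0 i)) mulrDl.
apply: (le_trans (ler_normD _ _)); apply: lerD.
  apply: (row_mvt (f := fun y => phi y 0 j) (c := fun i => c i j)) => z zy i.
  split; last exact: ((close z zy).2 (i, j)).
  exact: (@ex_derive _ _ _ _ _ _ _ (Ck_derivable i (phi1 j) (close z zy).1)).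
rewrite (eq_bigr (fun i => h 0 i * c i j)) => [|i _]; last exact: mulrC.
apply: row_linear_bound => // i; rewrite /cm (bigD1 i) //= (bigD1 j) //= -addrA lerDl addr_ge0 //.
  exact: sumr_ge0.
by apply: sumr_ge0 => k _; exact: sumr_ge0.
Qed.

(** For [eta] nonzero the argument of the bump is not quadratic in [w]; a lower bound for the
    difference quotient, from [inverse_bound], keeps the supports in one ball as [eta] tends to
    0. *)
Let HB_support y0 : Om' y0 -> exists b : nat, \forall q \near (0 : R, y0), Om' q.2 /\ supported b (HB q).
Proof.
move=> Oy; have [C C0 HC] := inverse_bound Oy.
have [k k0 Hk] := elliptic_compact cK (fun x Kx => cgm (KO Kx)) (fun x Kx => gmpos (KO Kx)).
have cgphi i j : {for y0, continuous (fun y => g (phi y) i j)}.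
  apply: (continuous_compp (g := phi) (f := fun x => g x i j)); first exact: cphi.
  by apply: cg; exact: phiO.
have [b1 Hb1] := near_supported cgphi (gpos (phiO Oy)).
have k' : 0 < k / C ^+ 2 by rewrite divr_gt0 // exprn_gt0.
have [b2 Hb2] := sqr_out k'.
have nO : \forall y \near y0, Om' y by exact: open_nbhs_nbhs.
exists (b1 + b2)%N.
have : \forall q \near ((0 : R), y0), [/\ Om' q.2, forall x, K x -> `|x - phi q.2| <= C * `|psi x - q.2| &
    forall z : V, b1%:R < `|z| -> 1 <= quad (g (phi q.2)) z].
  exists (setT, [set y | [/\ Om' y, forall x, K x -> `|x - phi y| <= C * `|psi x - y| &
    forall z : V, b1%:R < `|z| -> 1 <= quad (g (phi y)) z]]) => /=; last by move=> [h x] /= [_].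
  by split; [exact: filterT|apply: filterS3 nO HC Hb1 => y].
apply: filterS => -[eta y] /= [Oy' H1 H2]; split=> // w; rewrite natrD => hw.
have w1 : b1%:R < `|w| by apply: le_lt_trans hw; rewrite lerDl.
have w2 : b2%:R < `|w| by apply: le_lt_trans hw; rewrite lerDr.
rewrite /HB /=; have [Kx|Kx] := pselect (K (phi y + eta *: w)); last by rewrite a0 // mul0r.
(* At [eta = 0] the isometry reduces the claim to the support of the fibre bump for [g]; otherwise
   [|w| <= C |Dq|] is combined with uniform ellipticity on [K]. *)
rewrite bump_out ?mulr0 //; case: (eqVneq eta 0) => [e0|e0].
  rewrite e0 scale0r addr0 /Dq /difference_quotient eqxx isometry; [exact: H2|exact: phiO].
apply: le_trans (Hb2 _ w2) _; apply: le_trans (Hk _ Kx _).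
have E : `|w| <= C * `|Dq eta (phi y) w|.
  have eta0 : 0 < `|eta| by rewrite normr_gt0.
  have := H1 _ Kx; rewrite [_ + _ - phi y]addrAC subrr add0r normrZ => h.
  rewrite -(ler_pM2l eta0) mulrCA; apply: (le_trans h); rewrite -normrZ le_eqVlt; apply/orP; left.
  apply/eqP; congr (_ * `|_|); apply/rowP => j; rewrite !mxE /difference_quotient (negPf e0).
  by rewrite mulrA mulfV // mul1r psiK.
rewrite mulrAC ler_pdivrMr ?exprn_gt0 // -mulrA ler_wpM2l //; first exact: ltW.
by rewrite mulrC -exprMn lerXn2r // nnegrE // mulr_ge0 // ltW.
Qed.

Let HB_cont y0 : Om' y0 -> {for (0, y0), continuous (fun q => integral (HB q))}.
Proof.
move=> Oy; have Op := phiO Oy; have [b Hb] := HB_support Oy.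
apply: (integral_continuous (b := b)) => [|w].
  apply: filterS Hb => -[eta y] /= [Oy' s]; split=> //; split; last by exists b.
  pose C := [set w : V | K (phi y + eta *: w)].
  have caf (w : V) : {for w, continuous (fun u : V => phi y + eta *: u)}.
    apply: continuous_addp; first exact: continuous_constp.
    by apply: continuous_scalep; [exact: continuous_constp|exact: continuous_idp].
  apply: (continuous_extension (C := C) (O := [set w : V | Om (phi y + eta *: w)])).
  - by apply: (closed_comp (f := fun w : V => phi y + eta *: w)) clK => w _; exact: caf.
  - by move=> w /KO.
  - by apply: (continuous_affine (F := a)); exact: ca.
  - by move=> w; exact: a0.
  - move=> w /= Ow; apply: continuous_bumpc.
    apply: (continuous_compp (g := fun w => (w, Dq eta (phi y) w))
      (f := fun q : V * V => quad (gm (phi y + eta *: q.1)) q.2)).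
      by apply: continuous_pairc; [exact: continuous_idp|apply: Dq_contw => //; exact: phiO].
    apply: (@continuous_quad R m V w (fun u : V => gm (phi y + eta *: u))) => i j.
    by apply: (continuous_linep (F := fun x => gm x i j)); exact: cgm.
have cphi' : {for ((0 : R, y0), w), continuous (fun q : (R * V) * V => phi q.1.2)}.
  by apply: (continuous_fstc (f := fun q : R * V => phi q.2)); apply: (continuous_sndc (f := phi)); exact: cphi.
have ceta : {for ((0 : R, y0), w), continuous (fun q : (R * V) * V => q.1.1)}.
  by apply: (continuous_fstc (f := @fst R V)); exact: cvg_fst.
have cw : {for ((0 : R, y0), w), continuous (fun q : (R * V) * V => q.2)}.
  by apply: (continuous_sndc (f := fun w : V => w)); exact: continuous_idp.
have cline : {for ((0 : R, y0), w), continuous (fun q : (R * V) * V => phi q.1.2 + q.1.1 *: q.2)}.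
  exact: (continuous_addp cphi' (continuous_scalep ceta cw)).
apply: continuousMp.
  by apply: (continuous_compp cline (f := a)); exact: ca.
apply: continuous_bumpc.
apply: (continuous_compp (g := fun q : (R * V) * V => (q, Dq q.1.1 (phi q.1.2) q.2))
  (f := fun q : ((R * V) * V) * V => quad (gm (phi q.1.1.2 + q.1.1.1 *: q.1.2)) q.2)).
  apply: continuous_pairc; first exact: continuous_idp.
  apply: (continuous_compp (g := fun q : (R * V) * V => ((q.1.1, phi q.1.2), q.2))
    (f := fun q : (R * V) * V => Dq q.1.1 q.1.2 q.2)); last exact: Dq_cont.
  exact: (continuous_pairc (continuous_pairc ceta cphi') cw).
apply: (continuous_quad (g := fun q : (R * V) * V => gm (phi q.1.2 + q.1.1 *: q.2))) => i j.
apply: (continuous_compp cline (f := fun x => gm x i j)).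
by rewrite /= scale0r addr0; exact: cgm.
Qed.

Let HB_0 y : Om' y -> integral (HB (0, y)) = f (phi y).
Proof.
move=> Oy; have Op := phiO Oy; transitivity (integral (fun z => a (phi y) * bump (quad (g (phi y)) z))).
  apply: eq_integral => z; rewrite /HB /= scale0r addr0 /Dq /difference_quotient eqxx isometry //.
rewrite integralZ; last exact: bump_quad_test (gpos Op).
by rewrite /a mulfVK // gt_eqF // fibre_vol_gt0 //; exact: gpos.
Qed.

Let ker_B j y :
  integral (fun x => ker (half j) (x, y)) = half j ^+ m * (a' y * integral (HB (half j, y))).
Proof.
have [ay|ay] := eqVneq (a' y) 0.
  rewrite ay mul0r mulr0 -[RHS](@integral0 R m); apply: eq_integral => x.
  by rewrite /ker /= ay mulr0 mul0r.
have Oy : Om' y by apply: KO'; have [//|/a'0 h] := pselect (K' y); rewrite h eqxx in ay.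
have [b Hb] := ker_out.
have t : test (fun x => ker (half j) (x, y)) by exact: (fubini_testr (@cker (half j)) (Hb (half j))).
have E w : ker (half j) (phi y + half j *: w, y) = a' y * HB (half j, y) w.
  rewrite /ker /HB /= [a _ * a' _]mulrC -[LHS]mulrA; congr (_ * (_ * bump (quad _ _))); apply/rowP => i.
  by rewrite !mxE /difference_quotient gt_eqF ?half_gt0 // psiK.
have tB : test (HB (half j, y)).
  have -> : HB (half j, y) = fun w => (a' y)^-1 * ker (half j) (phi y + half j *: w, y).
    by apply/funext => w; rewrite E mulKf.
  exact: (testZ _ (rescale_test (phi y) j t)).
by rewrite (rescale (phi y) j t) -(integralZ (a' y) tB); congr (_ * _); apply: eq_integral.
Qed.

(** By [fubini] the double integral of the kernel is the same in both orders at each scale [half j];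
    the common power of [half j] cancels, and the two limits are the two sides. *)
Lemma change_of_variables : integral (fun x => a x * chi (psi x)) = integral (fun y => a' y * f (phi y)).
Proof.
have [b Hb] := ker_out; have [bd Hbd] := bounded_by.
(* Convergence of the inner integrals is uniform on the compact supports, hence passes under the
   outer ones. *)
have clim e : 0 < e -> \forall h \near (0 : R),
    (forall x, K x -> `|a x * integral (HA (h, x)) - a x * chi (psi x)| <= e) /\
    (forall y, K' y -> `|a' y * integral (HB (h, y)) - a' y * f (phi y)| <= e).
  move=> e0; have nA := uniform_near (P := R) (p0 := 0) (X := V) (H := fun h x => a x * integral (HA (h, x))) cK.
  have nB := uniform_near (P := R) (p0 := 0) (X := V) (H := fun h y => a' y * integral (HB (h, y))) cK'.
  have {}nA := nA _ e e0; have {}nB := nB _ e e0.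
  apply: filterS2 (nA _) (nB _) => [h hA hB|x Kx|y Ky].
  - split=> [x Kx|y Ky]; first by rewrite -(HA_0 (KO Kx)); exact: hA.
    by rewrite -(HB_0 (KO' Ky)); exact: hB.
  - apply: continuousMp; first by apply: (continuous_sndc (f := a)); exact: ca.
    exact: (HA_cont (KO Kx)).
  - apply: continuousMp; first by apply: (continuous_sndc (f := a')); exact: ca'.
    exact: (HB_cont (KO' Ky)).
have tA : test (fun x => a x * chi (psi x)).
  split; last first.
    by exists bd => x xb; rewrite a0 ?mul0r // => /or_introl /Hbd; rewrite leNgt xb.
  apply: (continuous_extension clK KO) => // x Ox.
  by apply: (continuous_compp (g := psi) (f := chi)); [exact: cpsi|exact: cchi].
have tB : test (fun y => a' y * f (phi y)).
  split; last first.
    by exists bd => x xb; rewrite a'0 ?mul0r // => /or_intror /Hbd; rewrite leNgt xb.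
  apply: (continuous_extension clK' KO') => // y Oy.
  by apply: (continuous_compp (g := phi) (f := f)); [exact: cphi|exact: cf].
apply/eqP; rewrite -subr_eq0 -normr_le0; apply/ler_addgt0Pl => e e0.
have d0 : 0 < e / 2 / vol m bd by rewrite !divr_gt0 ?vol_gt0.
have /nbhs_norm0P[r r0 Hr] := clim _ d0.
have [j jr] := half_lt r0.
have hjr : `|half j| < r :> R by rewrite ger0_norm ?half_ge0.
have [H1 H2] := Hr _ hjr.
have c0 : half j ^+ m != 0 :> R by rewrite gt_eqF // exprn_gt0 // half_gt0.
have cker' := @cker (half j); have Hb' := Hb (half j).
have tP : test (fun x => a x * integral (HA (half j, x))).
  have -> : (fun x => a x * integral (HA (half j, x))) =
      fun x => (half j ^+ m)^-1 * integral (fun y => ker (half j) (x, y)).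
    by apply/funext => x; rewrite ker_A mulKf.
  exact: (testZ _ (test_fubinil cker' Hb')).
have tQ : test (fun y => a' y * integral (HB (half j, y))).
  have -> : (fun y => a' y * integral (HB (half j, y))) =
      fun y => (half j ^+ m)^-1 * integral (fun x => ker (half j) (x, y)).
    by apply/funext => y; rewrite ker_B mulKf.
  exact: (testZ _ (test_fubinir cker' Hb')).
have PQ : integral (fun x => a x * integral (HA (half j, x))) =
    integral (fun y => a' y * integral (HB (half j, y))).
  apply: (mulfI c0).
  have E1 : integral (fun x => integral (fun y => ker (half j) (x, y))) =
      half j ^+ m * integral (fun x => a x * integral (HA (half j, x))).
    by rewrite -(integralZ _ tP); apply: eq_integral => x; exact: ker_A.
  have E2 : integral (fun y => integral (fun x => ker (half j) (x, y))) =
      half j ^+ m * integral (fun y => a' y * integral (HB (half j, y))).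
    by rewrite -(integralZ _ tQ); apply: eq_integral => y; exact: ker_B.
  exact: etrans (esym E1) (etrans (fubini cker' Hb') E2).
have aout x : bd%:R < `|x| -> a x = 0 by move=> xb; apply: a0 => /or_introl /Hbd; rewrite leNgt xb.
have a'out x : bd%:R < `|x| -> a' x = 0 by move=> xb; apply: a'0 => /or_intror /Hbd; rewrite leNgt xb.
have E : e / 2 / vol m bd * vol m bd = e / 2 by rewrite divfK // lt0r_neq0 // vol_gt0.
have D1 : `|integral (fun x => a x * chi (psi x)) - integral (fun x => a x * integral (HA (half j, x)))| <= e / 2.
  have s1 : supported bd (fun x => a x * chi (psi x)) by move=> x /aout ->; exact: mul0r.
  have s2 : supported bd (fun x => a x * integral (HA (half j, x))) by move=> x /aout ->; exact: mul0r.
  rewrite -[leRHS]E; apply: (integral_dist tA tP s1 s2 (ltW d0)) => x.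
  have [/H1|Kx] := pselect (K x); first by rewrite distrC.
  by rewrite (a0 Kx) !mul0r subrr normr0 ltW.
have D2 : `|integral (fun y => a' y * integral (HB (half j, y))) - integral (fun y => a' y * f (phi y))| <= e / 2.
  have s1 : supported bd (fun y => a' y * f (phi y)) by move=> x /a'out ->; exact: mul0r.
  have s2 : supported bd (fun y => a' y * integral (HB (half j, y))) by move=> x /a'out ->; exact: mul0r.
  rewrite -[leRHS]E; apply: (integral_dist tQ tB s2 s1 (ltW d0)) => y.
  have [/H2 //|Ky] := pselect (K' y).
  by rewrite (a'0 Ky) !mul0r subrr normr0 ltW.
apply: (le_trans (ler_distD (integral (fun x => a x * integral (HA (half j, x)))) _ _)).
by rewrite addr0 [leRHS]splitr; apply: lerD; [exact: D1|rewrite PQ; exact: D2].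
Qed.

End Change.

(** * Coordinate fields and integration in one chart *)

Section CoordinateFields.
Context (R : realType) (m : nat) (M : topologicalType).
Context (A : oriented_atlas R m M).
Local Notation C := R[i].
Local Notation e_ i := (delta_mx 0 i : 'rV[R]_m).
Variable c : chart R m M.
Hypothesis cc : charts A c.
Implicit Types (U : set M) (p q : M) (h : M -> R).

Let oc : open (cdom c) := chart_open_dom cc.

Lemma cpart_real j (f : M -> R) p : cpart c j (fun q => (f q)%:C) p = (rpart c j f p)%:C.
Proof. by apply: complex_eqP; rewrite /= ?rpart_cst. Qed.

(** The coordinate field of [c], written in the basis of [chart_at] that [vfield] prescribes. *)
Definition cfield (j : 'I_m) : vfield R m M := fun p => \row_i cpart c j (ccoord (chart_at A p) i) p.

Lemma dtan_cfield U j (f : M -> C) p : open U -> U p -> cdom c p -> ckC A 1 U f ->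
  dtan A p (cfield j p) f = cpart c j f p.
Proof.
move=> oU Up cp [f1 f2]; have cA := chart_at_charts A p; have Ap := chart_at_dom A p.
rewrite dtanE (eq_bigr (fun i => (rpart c j (rcoord (chart_at A p) i) p)%:C * cpart (chart_at A p) i f p)).
  apply: complex_eqP; rewrite (Re_sum, Im_sum) /= (rpart_chart j cc cA oU Up cp Ap) //.
    by apply: eq_bigr => i _; rewrite mul0r subr0.
  by apply: eq_bigr => i _; rewrite mul0r addr0.
by move=> i _; rewrite mxE cpart_real.
Qed.

Lemma cfield_real j p : conjv (cfield j p) = cfield j p.
Proof. by apply/rowP => i; rewrite !mxE cpart_real; apply: complex_eqP; rewrite /= ?oppr0. Qed.

Lemma cfield_smooth j : vsmooth_on A (cdom c) (cfield j).
Proof.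
move=> c' cc' i; have oc' : open (cdom c `&` cdom c') by apply: openI => //; exact: chart_open_dom cc'.
apply/smoothP => k; apply: (ckC_eq oc' (f := cpart c j (ccoord c' i))) => [p [cp cp']|].
  by rewrite vappE (dtan_cfield j (chart_open_dom cc') cp' cp (ckC_ccoord 1 i cc')).
apply: ckC_sub (ckC_cpart j cc oc' (ckC_sub _ (ckC_ccoord k.+1 i cc'))) => [p [cp cp']|p []] //.
Qed.

Lemma cfield_exp p (v : 'rV[C]_m) : cdom c p -> v = \sum_j dtan A p v (ccoord c j) *: cfield j p.
Proof.
move=> cp; apply: (@vec_ext _ _ _ A p) => i; have cA := chart_at_charts A p.
have [oA Ap] := (chart_open_dom cA, chart_at_dom A p).
rewrite (dtan_chart v cc oA Ap cp (ckC_ccoord 1 i cA)) dtan_suml; apply: eq_bigr => j _.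
by rewrite dtanZl (dtan_cfield j oA Ap cp (ckC_ccoord 1 i cA)).
Qed.

Lemma vapp_cfield_ccoord i j p : cdom c p -> vapp A (cfield i) (ccoord c j) p = (i == j)%:R.
Proof. by move=> cp; rewrite vappE (dtan_cfield i oc cp cp (ckC_ccoord 1 j cc)); exact: (cpart_ccoord i j cc cp). Qed.

(** Extended by 0 because [cinv c] means nothing outside the image of the chart; for functions
    supported in a compact set inside the chart the extension stays continuous. *)
Definition pull h (x : 'rV[R]_m) : R := if `[< (cmap c @` cdom c) x >] then h (cinv c x) else 0.

Lemma pullE h p : cdom c p -> pull h (cmap c p) = h p.
Proof. by move=> cp; rewrite /pull asboolT ?(cmapK cc) //; exists p. Qed.

Lemma pullP (P : 'rV[R]_m -> Prop) : (forall p, cdom c p -> P (cmap c p)) ->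
  (forall x, ~ (cmap c @` cdom c) x -> P x) -> forall x, P x.
Proof. by move=> h1 h2 x; have [[p cp <-]|nx] := pselect ((cmap c @` cdom c) x); [exact: h1|exact: h2]. Qed.

Lemma eq_pull h h' : (forall p, cdom c p -> h p = h' p) -> forall x, pull h x = pull h' x.
Proof.
move=> E; apply: pullP => [p cp|x nx]; first by rewrite !pullE // E.
by rewrite /pull asboolF.
Qed.

Section Support.
Variable K : set M.
Hypotheses (cK : compact K) (Kc : K `<=` cdom c) (hM : hausdorff_space M).

Let ccont p : cdom c p -> {for p, continuous (cmap c)}.
Proof. by case: (charts_chart cc) => _ _ _ h _ cp; apply: h; rewrite inE. Qed.

Lemma compact_image_chart : compact (cmap c @` K).
Proof.
apply: continuous_compact cK; apply: continuous_in_subspaceT => p; rewrite inE => Kp.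
exact: ccont (Kc Kp).
Qed.

Let clK : closed (cmap c @` K).
Proof. exact: compact_closed compact_image_chart. Qed.

Lemma pull_out h x : (forall p, ~ K p -> h p = 0) -> ~ (cmap c @` K) x -> pull h x = 0.
Proof.
move=> h0; move: x; apply: pullP => [p cp nK|x nx _]; last by rewrite /pull asboolF.
by rewrite pullE // h0 // => Kp; apply: nK; exists p.
Qed.

Lemma pull_test h : (forall p, cdom c p -> {for p, continuous h}) -> (forall p, ~ K p -> h p = 0) ->
  test (pull h).
Proof.
move=> ch h0; split.
  move=> x; have [[p Kp <-]|nK] := pselect ((cmap c @` K) x).
    have cp := Kc Kp.
    have oi : open (cmap c @` cdom c) by case: (charts_chart cc).
    apply: (eq_continuous_at oi (f := h \o cinv c)) => [|y iy|]; first by exists p.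
      by rewrite /pull asboolT.
    apply: (continuous_compp (g := cinv c)); last by rewrite (cmapK cc) //; exact: ch.
    by case: (charts_chart cc) => _ _ _ _; apply; rewrite inE; exists p.
  apply: (eq_continuous_at (closed_openC clK) (f := fun=> 0)) => // [y ny|].
    by rewrite (pull_out h0).
  exact: continuous_cstp.
have [b Hb] := compact_norm_le compact_image_chart.
by exists b => x xb; apply: (pull_out h0) => /Hb; rewrite leNgt xb.
Qed.

Lemma rpart_out a h p : (forall p, ~ K p -> h p = 0) -> cdom c p -> ~ K p -> rpart c a h p = 0.
Proof.
move=> h0 cp nK; have oK : open (~` K) by apply: closed_openC; exact: compact_closed.
by rewrite (rpart_eq a (g := fun=> 0) cc oK nK cp) ?rpart_cst.
Qed.

Lemma ckM_cont h U p : open U -> U p -> cdom c p -> ckM A 0 U h -> {for p, continuous h}.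
Proof.
move=> oU Up cp h0; have := @Ck_cont _ _ 0 _ _ (cmap c p) (h0 c cc) => /(_ _) h1.
apply: (eq_continuous_at (openI oU oc) (f := (h \o cinv c) \o cmap c)) => // [q [Uq cq]|].
  by rewrite /= (cmapK cc).
apply: (continuous_compp (g := cmap c) (f := h \o cinv c)); first exact: ccont.
by apply: h1; exists p.
Qed.

Lemma integral_rpart a h : ckM A 1 (cdom c) h -> (forall p, ~ K p -> h p = 0) ->
  integral (pull (rpart c a h)) = 0.
Proof.
(* [rpart c a h] is uncontrolled outside the chart domain, whereas [pull_test] wants a function that
   vanishes everywhere off [K]; [dh] agrees with it in the chart. *)
move=> h1 h0; pose dh p := if `[< K p >] then rpart c a h p else 0.
have E x : pull (rpart c a h) x = pull dh x.
  move: x; apply: eq_pull => p cp; rewrite /dh; case: asboolP => // nK; exact: rpart_out.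
have dh0 p : ~ K p -> dh p = 0 by move=> nK; rewrite /dh asboolF.
have cdh p : cdom c p -> {for p, continuous dh}.
  move=> cp; apply: (eq_continuous_at oc cp (f := rpart c a h)) => [q cq|].
    by rewrite /dh; case: asboolP => // nK; rewrite rpart_out.
  by apply: (ckM_cont (openI oc oc) _ cp (ckM_rpart a cc oc h1)).
rewrite (eq_integral E); apply: (integral_derive (f := pull h) (i := a)).
- by apply: pull_test => // p cp; exact: (ckM_cont oc cp cp (ckM_le (leq0n 1) h1)).
- exact: pull_test.
- move=> x; rewrite -E; move: x; apply: pullP => [p cp|x nx].
    have oi : open (cmap c @` cdom c) by case: (charts_chart cc).
    apply: (eq_is_derive oi (f := h \o cinv c)) => [|y iy|]; first by exists p.
      by rewrite /pull asboolT.
    by rewrite pullE //; exact: (rpartP a cc cp cp h1).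
  have nK : ~ (cmap c @` K) x by move=> [p /Kc cp E']; apply: nx; exists p.
  apply: (eq_is_derive (closed_openC clK) (f := fun=> 0)) => // [y ny|].
    by rewrite (pull_out h0).
  by rewrite {1}/pull asboolF //; exact: is_derive_cst.
Qed.
End Support.
End CoordinateFields.
#[local] Opaque metric.

Section MetricVolume.
Context (R : realType) (n : nat) (M : topologicalType) (A : oriented_atlas R n.*2.+1 M).
Context (T10 : M -> {vspace 'rV[R[i]]_(n.*2.+1)}) (theta : form1 R n.*2.+1 M).
Context (T : vfield R n.*2.+1 M).
Context (nabla : vfield R n.*2.+1 M -> vfield R n.*2.+1 M -> vfield R n.*2.+1 M).
Hypothesis S : sasakian A T10 theta T nabla.
Hypothesis hM : hausdorff_space M.
Local Notation C := R[i].
Local Notation d := n.*2.+1.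
Local Notation vfield := (vfield R d M).
Local Notation vec := 'rV[C]_d.
Local Notation vsm := (vsmooth_on A).
Local Notation met := (metric S).
Local Notation e_ i := (delta_mx 0 i : 'rV[R]_d).
Implicit Types (c : chart R d M) (h : M -> R).

Lemma metric0l p w : met p 0 w = 0.
Proof.
have := metric_linl S p 1 0 0 w; rewrite scaler0 addr0 mul1r => h.
by apply: (addrI (met p 0 w)); rewrite addr0.
Qed.

Lemma metric_suml (I : Type) (r : seq I) (a : I -> C) (v : I -> vec) p w :
  met p (\sum_(i <- r) a i *: v i) w = \sum_(i <- r) a i * met p (v i) w.
Proof.
elim: r => [|i r IH]; first by rewrite !big_nil metric0l.
by rewrite !big_cons metric_linl IH.
Qed.

Lemma metric_sumr (I : Type) (r : seq I) (a : I -> C) (v : I -> vec) p w :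
  met p w (\sum_(i <- r) a i *: v i) = \sum_(i <- r) conjc (a i) * met p w (v i).
Proof.
rewrite (metric_hermitian S p (\sum_(i <- r) a i *: v i) w) metric_suml rmorph_sum; apply: eq_bigr => i _.
by rewrite rmorphM /= -metric_hermitian.
Qed.

Definition gmetric c p i j : R := complex.Re (met p (cfield A c i p) (cfield A c j p)).

Lemma gmetric_sym c p i j : gmetric c p i j = gmetric c p j i.
Proof. by rewrite /gmetric (metric_hermitian S p (cfield A c i p)) ReJ. Qed.

Lemma quad_gmetric c p (z : 'rV[R]_d) (v := \sum_i (z 0 i)%:C *: cfield A c i p) :
  quad (gmetric c p) z = complex.Re (met p v v).
Proof.
rewrite /v metric_suml Re_sum; apply: eq_bigr => i _; rewrite ReM ReC ImC mul0r subr0 metric_sumr.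
rewrite Re_sum mulr_sumr; apply: eq_bigr => j _; rewrite ReM ReJ ImJ ReC ImC oppr0 mul0r subr0 /gmetric.
by rewrite mulrC mulrA.
Qed.

Section Chart.
Variable c : chart R d M.
Hypothesis cc : charts A c.
Let oc : open (cdom c) := chart_open_dom cc.

Lemma gmetric_C1 i j : ckM A 1 (cdom c) (fun p => gmetric c p i j).
Proof. exact: (smooth_ckC 1 (metric_smooth S oc (cfield_smooth cc i) (cfield_smooth cc j))).1. Qed.

Lemma gmetric_pos p z : cdom c p -> z != 0 -> 0 < quad (gmetric c p) z.
Proof.
move=> cp z0; rewrite quad_gmetric; set v := \sum_i _.
have v0 : v != 0.
  apply: contraNneq z0 => v0; apply/eqP/rowP => j; rewrite mxE.
  have := dtan0l A p (ccoord c j); rewrite -v0 dtan_suml (bigD1 j) //= big1 ?addr0 => [|k kj].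
    by rewrite dtanZl -vappE vapp_cfield_ccoord // eqxx mulr1 => /(congr1 (@complex.Re R)).
  by rewrite dtanZl -vappE vapp_cfield_ccoord // (negPf kj) mulr0.
by have := metric_gt0 S p v0; rewrite ltcE /= => /andP[].
Qed.

Definition density p : R := (fibre_vol (gmetric c p))^-1.

Lemma volume_gt0 p : cdom c p -> 0 < fibre_vol (gmetric c p).
Proof. by move=> cp; apply: fibre_vol_gt0 => z; exact: gmetric_pos. Qed.

Lemma volume_C1 : ckM A 1 (cdom c) (fun p => fibre_vol (gmetric c p)).
Proof.
move=> c' cc'; apply: (fibre_vol_C1 (g := fun x => gmetric c (cinv c' x))).
- by apply: open_chart_image cc' oc.
- by move=> i j; exact: gmetric_C1.
- by move=> x [p [cp cp'] <-] z z0; rewrite (cmapK cc') //; exact: gmetric_pos.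
Qed.

Lemma density_C1 : ckM A 1 (cdom c) density.
Proof. by apply: (ckM_inv oc) volume_C1 => p cp; rewrite gt_eqF // volume_gt0. Qed.

Lemma density_gt0 p : cdom c p -> 0 < density p.
Proof. by move=> cp; rewrite invr_gt0 volume_gt0. Qed.

Lemma rpart_density a p : cdom c p -> density p * rpart c a (fun p => fibre_vol (gmetric c p)) p =
  - (fibre_vol (gmetric c p) * rpart c a density p).
Proof.
move=> cp; have := rpartM a cc cp cp volume_C1 density_C1.
rewrite (rpart_eq (U := cdom c) a (g := fun=> 1) cc oc cp cp) ?rpart_cst => [/esym h|q cq].
  by apply/eqP; rewrite -addr_eq0 addrC h.
by rewrite mulfV // gt_eqF // volume_gt0.
Qed.

Section Divergence.
Variable X : vfield.
Hypotheses (Xs : vsm setT X) (Xr : conjf X = X).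

Let Xc : vsm (cdom c) X. Proof. exact: vsmooth_sub Xs. Qed.

Definition component a p : R := complex.Re (vapp A X (ccoord c a) p).

Lemma componentE a p : cdom c p -> vapp A X (ccoord c a) p = (component a p)%:C.
Proof.
move=> cp; apply: complex_eqP => //=.
have := vapp_ccoord_conj a X oc cc cp cp; rewrite Xr => /(congr1 (@complex.Im R)); rewrite ImJ => h.
by move: (complex.Im _) h => t; lra.
Qed.

Lemma component_C1 a : ckM A 1 (cdom c) (component a).
Proof. by apply: ckM_sub (smooth_ckC 1 (Xs cc a)).1 => p cp; split. Qed.

Lemma Re_scale (a b : R) (x y : C) : complex.Re (a%:C * x) + complex.Re (conjc b%:C * y) =
  a * complex.Re x + b * complex.Re y.
Proof. by rewrite !ReM ReJ ImJ !ReC !ImC oppr0 !mul0r !subr0. Qed.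

(** Already contracted with [X], and taken from the Tanaka-Webster connection, not from the
    Levi-Civita connection of the metric. *)
Definition christoffel p i l : R := complex.Re (dtan A p (nabla X (cfield A c i) p) (ccoord c l)).

Lemma Re_dtan p (f : M -> C) : cdom c p -> ckC A 1 (cdom c) f ->
  complex.Re (vapp A X f p) = \sum_a component a p * rpart c a (fun q => complex.Re (f q)) p.
Proof.
move=> cp fc; rewrite vappE (dtan_chart _ cc oc cp cp fc) Re_sum; apply: eq_bigr => a _.
by rewrite -vappE componentE // ReM ReC ImC mul0r subr0.
Qed.

Lemma gmetric_parallel p i j : cdom c p ->
  \sum_a component a p * rpart c a (fun q => gmetric c q i j) p =
  \sum_l (christoffel p i l * gmetric c p l j + christoffel p j l * gmetric c p l i).
Proof.
move=> cp; have fs k := cfield_smooth cc k.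
have ms := metric_smooth S oc (fs i) (fs j).
rewrite -(Re_dtan cp (smooth_ckC 1 ms)) (metric_parallel S oc cp Xc (fs i) (fs j)) Xr ReD.
have G k l : dtan A p (nabla X (cfield A c k) p) (ccoord c l) = (christoffel p k l)%:C.
  apply: complex_eqP => //=.
  have cX : conjf (cfield A c k) = cfield A c k by apply/funext => q; exact: cfield_real.
  have := nabla_conj S oc Xc (fs k) cp; rewrite Xr cX => h.
  have := dtan_conj cp (nabla X (cfield A c k) p) (ckC_ccoord 1 l cc); rewrite -h.
  rewrite (@dtan_eq _ _ _ A (cdom c) p oc cp _ _ (ccoord c l)) => [/(congr1 (@complex.Im R))|q _].
    by rewrite ImJ => t0; move: (complex.Im _) t0 => t; lra.
  by apply: complex_eqP; rewrite /= ?oppr0.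
have E k : nabla X (cfield A c k) p = \sum_l (christoffel p k l)%:C *: cfield A c l p.
  by rewrite [LHS](cfield_exp cc _ cp); apply: eq_bigr => l _; rewrite G.
rewrite !E metric_suml metric_sumr !Re_sum -big_split; apply: eq_bigr => l _ /=.
rewrite Re_scale; exact: (f_equal (fun t => _ + christoffel p j l * t) (gmetric_sym c p i l)).
Qed.

(** [fibre_vol_trace] with [nabla g = 0] as its hypothesis; the sign changes because the density is
    the inverse of the fibre volume. *)
Lemma volume_trace p : cdom c p -> \sum_a component a p * rpart c a density p =
  (\sum_i christoffel p i i) * density p.
Proof.
move=> cp; have oi : open (cmap c @` cdom c) by case: (charts_chart cc).
have ip : (cmap c @` cdom c) (cmap c p) by exists p.
have E q : cdom c q -> gmetric c (cinv c (cmap c q)) = gmetric c q by move=> cq; rewrite (cmapK cc).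
have g1 i j : Ck_on 1 (cmap c @` cdom c) (fun x => gmetric c (cinv c x) i j).
  by have := gmetric_C1 i j cc; rewrite setIid.
have gp x : (cmap c @` cdom c) x -> forall z, z != 0 -> 0 < quad (gmetric c (cinv c x)) z.
  by move=> [q cq <-] z; rewrite E //; exact: gmetric_pos.
have := fibre_vol_trace (X := component ^~ p) (Gam := christoffel p) oi g1 gp ip.
rewrite E // => /(_ (gmetric_sym c p)) /(_ (fun i j => gmetric_parallel i j cp)) h.
have N0 : fibre_vol (gmetric c p) != 0 by rewrite gt_eqF // volume_gt0.
apply: (mulfI N0); rewrite mulr_sumr mulrCA /density mulfV // mulr1.
rewrite (eq_bigr (fun a => - (density p * (component a p * rpart c a (fun p => fibre_vol (gmetric c p)) p)))).
  by rewrite sumrN -mulr_sumr [X in _ * X]h /density mulNr mulrN opprK mulrCA mulVf // mulr1.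
by move=> a _; rewrite mulrCA [density p * _]mulrCA rpart_density // mulrN opprK.
Qed.

(** By [volume_trace], this multiplied by the density is the sum of the coordinate derivatives of
    the components of [X] multiplied by the density. *)
Definition chart_div p : R := \sum_a (rpart c a (component a) p + christoffel p a a).

Lemma integral_chart_div (K : set M) h : compact K -> K `<=` cdom c -> ckM A 1 setT h ->
  (forall p, ~ K p -> h p = 0) ->
  integral (pull c (fun p => (\sum_a component a p * rpart c a h p + h p * chart_div p) * density p)) = 0.
Proof.
move=> cK Kc h1 h0; have h1c : ckM A 1 (cdom c) h by exact: ckM_sub h1.
(* The integrand is the Euclidean divergence of the field with components [k a], so each of its
   terms integrates to 0. *)
pose k a p := h p * (component a p * density p).
have kd a : ckM A 1 (cdom c) (fun p => component a p * density p).
  by apply: (ckM_mul oc); [exact: component_C1|exact: density_C1].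
have k1 a : ckM A 1 (cdom c) (k a) by exact: (ckM_mul oc).
have k0 a p : ~ K p -> k a p = 0 by move=> nK; rewrite /k h0 // mul0r.
have tk a : test (pull c (fun p => if `[< K p >] then rpart c a (k a) p else 0)).
  apply: (pull_test cc cK Kc) => [p cp|p nK]; last by rewrite asboolF.
  apply: (eq_continuous_at oc cp (f := rpart c a (k a))) => [q cq|].
    by case: asboolP => // nK; apply: (rpart_out cc cK hM) => //; exact: k0.
  by apply: (ckM_cont cc (openI oc oc) _ cp (ckM_rpart a cc oc (k1 a))).
transitivity (integral (fun x => \sum_a pull c (fun p => if `[< K p >] then rpart c a (k a) p else 0) x)).
  apply: eq_integral; apply: (pullP (c := c)) => [p cp|x nx]; last first.
    by rewrite /pull asboolF // big1 // => a _; rewrite asboolF.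
  rewrite (pullE cc) //; under [RHS]eq_bigr do rewrite (pullE cc) //.
  transitivity (\sum_a rpart c a (k a) p).
    under [RHS]eq_bigr => a _ do rewrite (rpartM a cc cp cp h1c (kd a)) (rpartM a cc cp cp (component_C1 a) density_C1).
    transitivity (h p * (\sum_a component a p * rpart c a density p +
        density p * \sum_a rpart c a (component a) p) + (\sum_a component a p * rpart c a h p) * density p).
      by rewrite (volume_trace cp) /chart_div big_split /=; ring.
    rewrite mulrDr mulrCA !mulr_sumr mulr_suml -!big_split; apply: eq_bigr => a _ /=; ring.
  by apply: eq_bigr => a _; case: asboolP => // nK; apply: (rpart_out cc cK hM) => //; exact: k0.
rewrite integral_sum // big1 // => a _; apply: etrans (integral_rpart cc cK Kc hM a (k1 a) (k0 a)).
apply: eq_integral; apply: (eq_pull cc) => p cp; case: asboolP => // nK.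
by apply/esym; apply: (rpart_out cc cK hM) => //; exact: k0.
Qed.

End Divergence.
End Chart.

Definition cintegral c h : R := integral (pull c (fun p => h p * density c p)).

Section Invariance.
Variables (c c' : chart R d M) (K : set M).
Hypotheses (cc : charts A c) (cc' : charts A c') (cK : compact K).
Hypotheses (Kc : K `<=` cdom c) (Kc' : K `<=` cdom c').

Let dom := cdom c `&` cdom c'.
Let odom : open dom. Proof. by apply: openI; [exact: chart_open_dom cc|exact: chart_open_dom cc']. Qed.

Let isom p (z : 'rV[R]_d) : dom p -> quad (gmetric c' p)
  (\row_j \sum_i z 0 i * 'D_(e_ i) (fun x => cmap c' (cinv c x) 0 j) (cmap c p)) = quad (gmetric c p) z.
Proof.
move=> [cp cp']; rewrite !quad_gmetric; set w := \row_j _.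
have -> : \sum_i (w 0 i)%:C *: cfield A c' i p = \sum_i (z 0 i)%:C *: cfield A c i p; last by [].
rewrite [RHS](cfield_exp cc' _ cp'); apply: eq_bigr => j _; congr (_ *: _); rewrite mxE dtan_suml.
rewrite rmorph_sum; apply: eq_bigr => i _; rewrite dtanZl.
rewrite (dtan_cfield cc i (chart_open_dom cc') cp' cp (ckC_ccoord 1 j cc')) cpart_real.
exact: rmorphM.
Qed.

(** [change_of_variables] involves a function on each side of the transition. Taking the square root
    of [h] on both sides recovers [h], and continuity of the root is all that is asked. *)
Lemma cintegral_invariant_ge0 h : (forall p, {for p, continuous h}) -> (forall p, ~ K p -> h p = 0) ->
  (forall p, 0 <= h p) -> cintegral c h = cintegral c' h.
Proof.
move=> ch h0 hp; pose s p := Num.sqrt (h p).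
have cs p : {for p, continuous s} by apply: (continuous_compp (ch p)); exact: sqrt_continuous.
have s0 p : ~ K p -> s p = 0 by move=> /h0 e; rewrite /s e sqrtr0.
have ss p : s p * s p = h p by rewrite -expr2 sqr_sqrtr.
have sd p : ~ dom p -> s p = 0 by move=> nd; apply: s0 => Kp; apply: nd; split; [exact: Kc|exact: Kc'].
pose psi x := cmap c' (cinv c x); pose phi y := cmap c (cinv c' y).
have E p : dom p -> psi (cmap c p) = cmap c' p by move=> [cp _]; rewrite /psi (cmapK cc).
have E' p : dom p -> phi (cmap c' p) = cmap c p by move=> [_ cp]; rewrite /phi (cmapK cc').
have cg (C : chart R d M) i j x : charts A C -> (cmap c @` dom) x -> (forall q, dom q -> cdom C q) ->
    {for x, continuous (fun x => gmetric C (cinv c x) i j)}.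
  move=> cC [p dp <-] dC.
  have := gmetric_C1 cC i j cc => h1.
  by apply: (Ck_cont h1); exists p => //; split; [exact: dC|exact: (proj1 dp)].
have tp := pull_test cc cK Kc (fun p _ => cs p) s0.
have tp' := pull_test cc' cK Kc' (fun p _ => cs p) s0.
have := @change_of_variables R d (cmap c @` dom) (cmap c' @` dom) psi phi
  (fun x => gmetric c (cinv c x)) (fun x => gmetric c' (cinv c x)) _ _ _ _ _ _ _ _ _ _ _ _
  (cmap c @` K) (cmap c' @` K) (pull c s) (pull c' s) _ _ _ _ _ _ _ _.
rewrite /cintegral => H; transitivity (integral (fun x => pull c s x / fibre_vol (gmetric c (cinv c x)) * pull c' s (psi x))).
  apply: eq_integral; apply: (pullP (c := c)) => [p cp|x nx]; last by rewrite /pull asboolF // !mul0r.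
  rewrite !(pullE cc) // (cmapK cc) // -ss; have [cp'|ncp'] := pselect (cdom c' p).
    by rewrite E // (pullE cc') // /density mulrAC.
  by rewrite sd ?mul0r // => -[].
rewrite H; last first.
all: try by [].
- by move=> y ny; apply: (pull_out cc' s0).
- by move=> x nx; apply: (pull_out cc s0).
- by case: tp'.
- by case: tp.
- by move=> _ [p Kp <-]; exists p => //; split; [exact: Kc|exact: Kc'].
- by move=> _ [p Kp <-]; exists p => //; split; [exact: Kc|exact: Kc'].
- exact: (compact_image_chart cc').
- exact: (compact_image_chart cc).
- by move=> _ [p [cp cp'] <-] z; rewrite (cmapK cc) //; exact: isom.
- by move=> _ [p [cp cp'] <-] z z0; rewrite (cmapK cc) //; exact: gmetric_pos.
- by move=> _ [p [cp cp'] <-] z z0; rewrite (cmapK cc) //; exact: gmetric_pos.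
- by move=> x ix i j; apply: cg => // q [].
- by move=> x ix i j; apply: cg => // q [].
- by move=> j; have := charts_smooth cc' cc j 1; rewrite setIC.
- by move=> j; exact: (charts_smooth cc cc' j 1).
- by move=> _ [p dp <-]; rewrite E' // E.
- by move=> _ [p dp <-]; rewrite E // E'.
- by move=> _ [p dp <-]; rewrite E' //; exists p.
- by have := open_chart_image cc' odom; rewrite /dom -setIA setIid.
- by have := open_chart_image cc odom; rewrite /dom setIAC setIid.
apply: eq_integral; apply: (pullP (c := c')) => [p cp|x nx]; last by rewrite /pull asboolF // !mul0r.
rewrite !(pullE cc') // -ss; have [cp'|ncp'] := pselect (cdom c p).
  by rewrite E' // (pullE cc) // (cmapK cc) // /density mulrAC.
by rewrite sd ?mul0r // => -[].
Qed.

(** The nonnegative case is applied to the positive and negative parts of [h], which are continuous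
    and vanish off [K]. *)
Lemma cintegral_invariant h : (forall p, {for p, continuous h}) -> (forall p, ~ K p -> h p = 0) ->
  cintegral c h = cintegral c' h.
Proof.
move=> ch h0; pose hm p := ramp (- h p); pose hp p := ramp (h p).
have cp p : {for p, continuous hp} by apply: (continuous_compp (ch p)); exact: continuous_ramp.
have cm p : {for p, continuous hm}.
  by apply: (continuous_compp (f := ramp) (continuousNp (ch p))); exact: continuous_ramp.
have p0 p : ~ K p -> hp p = 0 by move=> /h0 e; rewrite /hp e ramp_neg.
have m0 p : ~ K p -> hm p = 0 by move=> /h0 e; rewrite /hm e oppr0 ramp_neg.
have E p : h p = hp p - hm p.
  rewrite /hp /hm; case: (lerP 0 (h p)) => hs; first by rewrite ramp_pos // ramp_neg ?subr0 // oppr_le0.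
  by rewrite ramp_neg ?ltW // ramp_pos ?sub0r ?opprK // oppr_ge0 ltW.
have split (C : chart R d M) : charts A C -> K `<=` cdom C -> cintegral C h = cintegral C hp - cintegral C hm.
  move=> cC KC; have cd p : cdom C p -> {for p, continuous (density C)}.
    by move=> Cp; apply: (ckM_cont cC (chart_open_dom cC) Cp Cp); exact: ckM_le (density_C1 cC).
  rewrite /cintegral -integralB.
  - apply: eq_integral; apply: (pullP (c := C)) => [p Cp|x nx]; first by rewrite !(pullE cC) // E mulrBl.
    by rewrite /pull asboolF // subr0.
  - apply: (pull_test cC cK KC) => [p Cp|p /p0 ->]; last exact: mul0r.
    by apply: continuousMp; [exact: cp|exact: cd].
  - apply: (pull_test cC cK KC) => [p Cp|p /m0 ->]; last exact: mul0r.
    by apply: continuousMp; [exact: cm|exact: cd].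
rewrite (split c cc Kc) (split c' cc' Kc').
have e1 := cintegral_invariant_ge0 cp p0 (fun p => ramp_ge0 _).
have e2 := cintegral_invariant_ge0 cm m0 (fun p => ramp_ge0 _).
exact: (f_equal2 (fun x y => x - y) e1 e2).
Qed.
End Invariance.
End MetricVolume.

(** * The divergence in a chart as a trace in an adapted frame *)

Section TraceFormula.
Context (R : realType) (n : nat) (M : topologicalType) (A : oriented_atlas R n.*2.+1 M).
Context (T10 : M -> {vspace 'rV[R[i]]_(n.*2.+1)}) (theta : form1 R n.*2.+1 M).
Context (T : vfield R n.*2.+1 M).
Context (nabla : vfield R n.*2.+1 M -> vfield R n.*2.+1 M -> vfield R n.*2.+1 M).
Hypothesis S : sasakian A T10 theta T nabla.
Local Notation C := R[i].
Local Notation d := n.*2.+1.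
Local Notation vfield := (vfield R d M).
Local Notation vec := 'rV[C]_d.
Local Notation sec := (section_on A T10).
Local Notation Tor := (torsion A nabla).
Local Notation vsm := (vsmooth_on A).
Local Notation E := (full_frame T).

Let hc : connection A nabla := proj1 (sas_tw S).

Lemma torsion_sumr W (I : Type) (r : seq I) (f : I -> M -> C) (Y : I -> vfield) X p : open W ->
  (forall i, smooth_on A W (f i)) -> (forall i, vsm W (Y i)) -> vsm W X -> W p ->
  Tor X (fun q => \sum_(i <- r) f i q *: Y i q) p = \sum_(i <- r) f i p *: Tor X (Y i) p.
Proof.
move=> oW fs Ys Xs Wp; rewrite -[LHS]opprK -torsion_anti; elim: r => [|i r IH].
  rewrite big_nil (_ : (fun q => _) = fun=> 0); last by apply/funext => q; rewrite big_nil.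
  by rewrite (torsion0l S oW Xs Wp) oppr0.
rewrite big_cons -IH (_ : (fun q => _) = fun q => f i q *: Y i q + \sum_(j <- r) f j q *: Y j q).
  rewrite (torsion_combl hc oW (fs i) (Ys i) _ Xs Wp) ?opprD -?scalerN -?torsion_anti //.
  by apply: vsmooth_sum => // j _; exact: vsmooth_scale.
by apply/funext => q; rewrite big_cons.
Qed.

Lemma full_frame_coef U Z p (x : 'I_(n + n + 1) -> C) u w t : local_frame A T10 U Z -> U p ->
  u \in T10 p -> w \in T10 p -> \sum_a x a *: E Z a p = u + conjv w + t *: T p ->
  (forall k, x (lshift 1 (lshift n k)) = coframe Z k p u) /\
  (forall k, x (lshift 1 (rshift n k)) = conjc (coframe Z k p w)).
Proof.
move=> fr Up hu hw; rewrite full_frame_sum => e.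
have mem (y : 'I_n -> C) : \sum_k y k *: Z k p \in T10 p.
  by apply: rpred_sum => k _; apply: rpredZ; exact: (frame_mem fr).
have [e1 e2 _] := split_inj S (mem _) (mem _) hu hw e.
split=> k; first by rewrite -e1 (coframe_sum fr).
by rewrite -e2 (coframe_sum fr) // conjcK.
Qed.

Section Trace.
Variables (c : chart R d M) (U : set M) (Z : 'I_n -> vfield) (V : vfield) (p : M).
Hypotheses (cc : charts A c) (fr : local_frame A T10 U Z) (Up : U p) (cp : cdom c p).
Hypothesis Vs0 : sec setT V.

Let X : vfield := fun q => V q + conjf V q.
Let W := U `&` cdom c.
Let oW : open W. Proof. by apply: openI; [exact: frame_open fr|exact: chart_open_dom cc]. Qed.
Let Wp : W p. Proof. by split. Qed.
Let WU : W `<=` U. Proof. by move=> q []. Qed.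
Let Vs : sec W V. Proof. exact: sec_sub Vs0. Qed.
Let Vv : vsm W V := sec_smooth Vs.
Let Vv' : vsm W (conjf V) := vsmooth_conj oW Vv.
Let Xs : vsm W X. Proof. exact: vsmooth_add. Qed.
Let Zs k : sec W (Z k) := sec_sub WU (frame_sec fr k).
Let Zv k : vsm W (Z k) := sec_smooth (Zs k).
Let Zv' k : vsm W (conjf (Z k)) := vsmooth_conj oW (Zv k).
Let Ts : vsm W T. Proof. exact: (reeb_smooth S). Qed.
Let Es a : vsm W (E Z a) := vsmooth_sub WU (full_frame_smooth S a fr).
Let cs i : vsm W (cfield A c i). Proof. by apply: vsmooth_sub (cfield_smooth cc i) => q []. Qed.

(** Equal to [nabla X Y] minus the bracket of [X] and [Y], but linear over functions in [Y]. Its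
    trace in the coordinate frame is [chart_div], and in the adapted frame it can be read off the
    torsion axioms. *)
Let L (Y : vfield) : vec := nabla Y X p + Tor X Y p.

Let coef (i : 'I_d) q : {x : 'I_(n + n + 1) -> C | W q -> cfield A c i q = \sum_a x a *: E Z a q}.
Proof.
have [Wq|nW] := pselect (W q); last by exists (fun=> 0).
by have [x Hx] := cid (full_frame_span S (cfield A c i q) fr (WU Wq)); exists x.
Qed.

Let Q i a q := sval (coef i q) a.
Let QE i q : W q -> cfield A c i q = \sum_a Q i a q *: E Z a q := svalP (coef i q).

Let Qs i a : smooth_on A W (Q i a).
Proof.
apply: (smooth_coeffs oW Es) => [q Wq x /(full_frame_free S fr (WU Wq)) //|].
by apply: (vsmooth_eq oW _ (cs i)) => q; exact: QE.
Qed.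

Let LE i : L (cfield A c i) = \sum_a Q i a p *: L (E Z a).
Proof.
have sQE : vsm W (fun q => \sum_a Q i a q *: E Z a q).
  by apply: vsmooth_sum => // a _; exact: vsmooth_scale.
rewrite /L (nabla_eql hc oW (cs i) sQE Xs Wp (QE i)).
rewrite (torsion_eq hc oW Xs Xs (cs i) sQE Wp (fun q _ => erefl) (QE i)).
rewrite (nabla_suml hc oW) // (torsion_sumr _ oW) // -big_split; apply: eq_bigr => a _ /=.
exact: esym (scalerDr _ _ _).
Qed.

Let christoffelE i : (christoffel A nabla c X p i i + rpart c i (component A c X i) p) =
  complex.Re (dtan A p (L (cfield A c i)) (ccoord c i)).
Proof.
rewrite /L torsionE dtanDl !dtanBl ReD !(ReD, ReN).
have -> : dtan A p (bracket A X (cfield A c i) p) (ccoord c i) = - cpart c i (vapp A X (ccoord c i)) p.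
  have sx : smooth_on A W (ccoord c i) by exact: (@smooth_ccoord _ _ _ A U c i cc).
  rewrite -vappE (vapp_bracket oW Wp Xs (cs i) sx).
  have -> : vapp A X (vapp A (cfield A c i) (ccoord c i)) p = 0.
    transitivity (vapp A X (fun=> 1) p); last by rewrite vappE dtan_cst.
    by apply: (vapp_eq A oW Wp X) => q [_ cq]; rewrite (vapp_cfield_ccoord cc) // eqxx.
  rewrite sub0r vappE (dtan_cfield cc i oW Wp cp) //.
  exact: (smooth_ckC 1 (smooth_vapp oW Xs sx)).
rewrite /christoffel ReN /= /component; move: (complex.Re _) (complex.Re _) => x y; ring.
Qed.

Lemma coframe_conj_split k Y (u w : vec) t (x : 'I_(n + n + 1) -> C) : u \in T10 p -> w \in T10 p ->
  L Y = u + conjv w + t *: T p -> \sum_a x a *: E Z a p = L Y ->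
  x (lshift 1 (lshift n k)) = coframe Z k p u /\ x (lshift 1 (rshift n k)) = conjc (coframe Z k p w).
Proof.
move=> hu hw e1 e2; have [h1 h2] := full_frame_coef fr Up hu hw (etrans e2 e1).
by split; [exact: h1|exact: h2].
Qed.

Let al_sig a : {x : 'I_(n + n + 1) -> C | L (E Z a) = \sum_b x b *: E Z b p}.
Proof. exact: cid (full_frame_span S (L (E Z a)) fr Up). Qed.

Let al a := sval (al_sig a).
Let alE a : L (E Z a) = \sum_b al a b *: E Z b p := svalP (al_sig a).

(** A trace does not depend on the frame. The two frames are indexed by different types, so the
    matrices of the change of frame are shown to be inverse to each other by uniqueness of
    coefficients. *)
Let trace_swap : \sum_i dtan A p (L (cfield A c i)) (ccoord c i) = \sum_a al a a.
Proof.
pose P b i := dtan A p (E Z b p) (ccoord c i).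
have PQ a b : \sum_i P b i * Q i a p = (a == b)%:R.
  have h : \sum_a (\sum_i P b i * Q i a p - (a == b)%:R) *: E Z a p = 0.
    under eq_bigr do rewrite scalerBl.
    rewrite sumrB; apply/eqP; rewrite subr_eq0; apply/eqP/esym; rewrite (bigD1 b) //= eqxx scale1r.
    rewrite big1 ?addr0 => [|k /negPf ->]; last exact: scale0r.
    rewrite {1}[E Z b p](cfield_exp cc _ cp).
    under [RHS]eq_bigr do rewrite scaler_suml.
    rewrite exchange_big; apply: eq_bigr => i _; rewrite (QE i Wp) scaler_sumr; apply: eq_bigr => k _.
    exact: scalerA.
  by apply/eqP; rewrite -subr_eq0; apply/eqP; exact: (full_frame_free S fr Up h a).
transitivity (\sum_i \sum_a \sum_b al a b * (P b i * Q i a p)).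
  apply: eq_bigr => i _; rewrite LE dtan_suml; apply: eq_bigr => a _; rewrite dtanZl (alE a).
  by rewrite dtan_suml mulr_sumr; apply: eq_bigr => b _; rewrite dtanZl mulrC -mulrA.
rewrite exchange_big; apply: eq_bigr => a _; rewrite exchange_big (bigD1 a) //= [X in _ + X]big1 ?addr0 => [|b ba].
  by rewrite -mulr_sumr PQ eqxx mulr1.
by rewrite -mulr_sumr PQ eq_sym (negPf ba) mulr0.
Qed.

Let nX Y : vsm W Y -> nabla Y X p = nabla Y V p + conjv (nabla (conjf Y) V p).
Proof. by move=> Ys; rewrite (nablaDr hc oW Ys Vv Vv' Wp) (nabla_conjr S oW Ys Vv Wp). Qed.

Let tX Y : vsm W Y -> Tor X Y p = Tor V Y p + Tor (conjf V) Y p.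
Proof. by move=> Ys; exact: (torsionDl S oW Vv Vv' Ys Wp). Qed.

Let memN Y : vsm W Y -> nabla Y V p \in T10 p.
Proof. by move=> Ys; exact: (nabla_mem S oW Ys Vs Wp). Qed.

(** The [T10] block of the trace is the divergence of [V], the conjugate block is its conjugate, and
    the entry of [T] is 0. The torsions of [X] with the frame fields are multiples of [T] and vanish
    on [T] itself, so they never reach the diagonal. *)
Lemma chart_div_divergence : chart_div A nabla c X p = 2 * complex.Re (divergence nabla Z V p).
Proof.
rewrite /chart_div; under eq_bigr do rewrite addrC christoffelE.
rewrite -Re_sum trace_swap big_split_ord big_ord1 /= big_split_ord /=.
have hZ k : al (lshift 1 (lshift n k)) (lshift 1 (lshift n k)) = coframe Z k p (nabla (Z k) V p).
  have EZ : E Z (lshift 1 (lshift n k)) = Z k by rewrite /full_frame !(unsplitK (inl _)).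
  apply: (coframe_conj_split k (Y := Z k) (w := nabla (conjf (Z k)) V p)
    (t := - (2%:R * 'i%C * levi A theta (Z k) V p)) _ _ _ (etrans (esym (alE _)) (f_equal L EZ))).1.
  - exact: memN.
  - exact: memN.
  rewrite /L (nX (Zv k)) (tX (Zv k)) (tor20 S oW Vs (Zs k) Wp) add0r torsion_anti (tor11 S oW (Zs k) Vs Wp).
  by rewrite scaleNr.
have hZ' k : al (lshift 1 (rshift n k)) (lshift 1 (rshift n k)) = conjc (coframe Z k p (nabla (Z k) V p)).
  have EZ : E Z (lshift 1 (rshift n k)) = conjf (Z k) by rewrite /full_frame (unsplitK (inl _)) (unsplitK (inr _)).
  apply: (coframe_conj_split k (Y := conjf (Z k)) (u := nabla (conjf (Z k)) V p)
    (t := 2%:R * 'i%C * levi A theta V (Z k) p) _ _ _ (etrans (esym (alE _)) (f_equal L EZ))).2.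
  - exact: memN.
  - exact: memN.
  rewrite /L (nX (Zv' k)) (tX (Zv' k)) conjfK (tor11 S oW Vs (Zs k) Wp) (torsion_conj S oW Vv (Zv k) Wp).
  by rewrite (tor20 S oW Vs (Zs k) Wp) conjv0 addr0.
have hT : al (rshift (n + n) ord0) (rshift (n + n) ord0) = 0.
  have ET : E Z (rshift (n + n) ord0) = T by rewrite /full_frame (unsplitK (inr _)).
  have tT : Tor X T p = 0.
    rewrite (tX Ts) -[T in Tor (conjf V) T](conjf_reeb S) (torsion_conj S oW Vv Ts Wp).
    by rewrite torsion_anti (torsion_reeb S oW Vs Wp) oppr0 conjv0 addr0.
  have e : \sum_b al (rshift (n + n) ord0) b *: E Z b p =
      nabla T V p + conjv (nabla (conjf T) V p) + 0 *: T p.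
    by rewrite -(alE _) ET /L (nX Ts) tT scale0r.
  rewrite full_frame_sum in e.
  have mem (y : 'I_n -> C) : \sum_k y k *: Z k p \in T10 p.
    by apply: rpred_sum => k _; apply: rpredZ; exact: (frame_mem fr).
  have Ts' : vsm W (conjf T) by exact: vsmooth_conj.
  by have [_ _ ->] := split_inj S (mem _) (mem _) (memN Ts) (memN Ts') e.
rewrite hT addr0 (eq_bigr _ (fun k _ => hZ k)) (eq_bigr _ (fun k _ => hZ' k)) /=.
rewrite -/(divergence nabla Z V p) -rmorph_sum ReD [complex.Re (conjc _)]ReJ.
by rewrite -/(divergence nabla Z V p) mulr_natl mulr2n.
Qed.
End Trace.
End TraceFormula.
(** * The divergence theorem *)

Section Cutoff.
Context (R : realType) (m : nat) (M : topologicalType) (A : oriented_atlas R m M).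
Local Notation V := 'rV[R]_m.

Lemma bump_C1 (W : set V) (F : V -> R) : open W -> Ck_on 1 W F -> Ck_on 1 W (fun x => bump (F x)).
Proof.
move=> oW F1; apply: Ck_intro => // [x|i].
  by rewrite inE => Wx; apply: continuous_bumpc; exact: (Ck_cont F1).
exists (fun x => dbump (F x) * 'D_(delta_mx 0 i) F x) => [x Wx|].
  by apply: is_derive_comp1; [exact: bump_derive|exact: Ck_derivable F1 Wx].
split=> // x; rewrite inE => Wx.
have c1 : {for x, continuous (fun x => dbump (F x))} by apply: continuous_dbumpc; exact: (Ck_cont F1).
exact: (continuousMp c1 (Ck_cont (Ck_derive i F1) Wx)).
Qed.

Lemma continuous_distance (E : normedModType R) (x0 : E) : continuous (fun x : E => `|x - x0|).
Proof.
move=> x; have h : {for x, continuous (fun y : E => `|y - x0|)}.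
  by apply: continuous_normp; apply: continuous_subp; [exact: continuous_idp|exact: continuous_constp].
exact: h.
Qed.

Lemma compact_image (T U : topologicalType) (f : T -> U) (B : set T) :
  (forall x, B x -> {for x, continuous f}) -> compact B -> compact (f @` B).
Proof.
move=> cf; apply: continuous_compact; apply: continuous_in_subspaceT => x.
by rewrite inE; exact: cf.
Qed.

Lemma compact_finite_cover (T : topologicalType) (f : T -> set T) : compact [set: T] ->
  (forall p, open (f p)) -> (forall p, f p p) -> exists s : seq T, forall q, exists2 k, k \in s & f k q.
Proof.
(* The filter generated by the lists containing a given list: the near-covering form of compactness
   along it produces a finite subcover. *)
move=> cT fo fp; pose F : set_system (seq T) := [set P | exists s0 : seq T, forall s : seq T, {subset s0 <= s} -> P s].
have FF : Filter F.
  split; first by exists [::].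
    move=> P Q [s0 h0] [s1 h1]; exists (s0 ++ s1) => s hs.
    by split; [apply: h0|apply: h1] => x xs; apply: hs; rewrite mem_cat xs ?orbT.
  by move=> P Q PQ [s0 h0]; exists s0 => s /h0; exact: PQ.
have := (compact_near_coveringP _).1 cT (seq T) F (fun (s : seq T) q => exists2 k, k \in s & f k q) FF.
case=> [p _|s0 h0]; last by exists s0 => q; apply: (h0 s0).
exists (f p, [set s : seq T | p \in s]) => /=; last by move=> [q s] /= [fq ps]; exists p.
split; first by apply: open_nbhs_nbhs.
by exists [:: p] => s /(_ p); apply; rewrite mem_head.
Qed.

Lemma closed_ball_compact (x0 : V) (r : R) : compact [set x : V | `|x - x0| <= r].
Proof.
apply: bounded_closed_compact.
  exists (r + `|x0|); split=> [|N rN x /= xr]; first exact: num_real.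
  apply: le_trans (ltW rN); rewrite -{1}(subrK x0 x); apply: (le_trans (ler_normD _ _)).
  by rewrite lerD2r.
apply: (@closed_comp _ _ (fun x : V => `|x - x0|) [set y | y <= r]); last exact: closed_le.
by move=> x _; exact: continuous_distance.
Qed.

Definition cutoff (p : M) (K : set M) (t : M -> R) : Prop :=
  [/\ compact K, K `<=` cdom (chart_at A p), ckM A 1 setT t & 0 < t p] /\
  (forall q, 0 <= t q) /\ (forall q, ~ K q -> t q = 0).

(** The bump of a quadratic function of the coordinates is continuously differentiable and lives in
    a closed ball of the chart, whose image in [M] is compact, hence closed; it can therefore be
    extended by 0. *)
Lemma cutoff_exists p : hausdorff_space M -> exists K t, cutoff p K t.
Proof.
move=> hM; pose c := chart_at A p; have cc : charts A c by exact: chart_at_charts.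
have cp : cdom c p by exact: chart_at_dom.
have oc := chart_open_dom cc.
have [_ oi _ _ ci] := charts_chart cc; pose x0 := cmap c p.
have : nbhs x0 (cmap c @` cdom c) by apply: open_nbhs_nbhs; split=> //; exists p.
move=> /nbhs_normP[r /= r0 Hr]; have r2 : 0 < r / 2 by rewrite divr_gt0.
have rr : r / 2 < r by rewrite ltr_pdivrMr // mulr_natr mulr2n ltrDr.
pose B := [set x : V | `|x - x0| <= r / 2].
have BI x : B x -> (cmap c @` cdom c) x by move=> Bx; apply: Hr; rewrite /= distrC (le_lt_trans Bx).
(* This factor makes [F] at least 1 outside the max norm ball of radius [r / 2], where the bump
   vanishes. *)
pose k := (r / 2) ^- 2; have k0 : 0 < k by rewrite invr_gt0 exprn_gt0.
pose F (x : V) := \sum_i k * ((x 0 i - x0 0 i) * (x 0 i - x0 0 i)).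
have F1 : Ck_on 1 setT F.
  apply: Ck_sum => [|i _]; first exact: openT.
  have h : Ck_on 1 setT (fun x : V => x 0 i - x0 0 i).
    by apply: (Ck_add openT); [exact: (Ck_coord 1 i openT)|exact: (Ck_cst 1 _ openT)].
  by apply: (Ck_mul openT); [exact: (Ck_cst 1 _ openT)|exact: (Ck_mul openT)].
have Fout x : ~ B x -> 1 <= F x.
  move=> nB; rewrite leNgt; apply/negP => Fx; apply: nB; apply: row_norm_le => [|i]; first exact: ltW.
  have h : k * ((x 0 i - x0 0 i) * (x 0 i - x0 0 i)) < 1.
    apply: le_lt_trans Fx; rewrite /F (bigD1 i) //= lerDl sumr_ge0 // => j _.
    by rewrite mulr_ge0 ?sqr_ge0 // ltW.
  rewrite !mxE leNgt; apply/negP => hi; move: h; apply/negP; rewrite -leNgt.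
  rewrite -ler_pdivrMl // mulr1 invrK -expr2 -(real_normK (num_real (x 0 i - x0 0 i))).
  by rewrite lerXn2r // ?nnegrE // ltW.
pose t q := if `[< cdom c q >] then bump (F (cmap c q)) else 0.
pose K := cinv c @` B.
have KcB q : cdom c q -> ~ K q -> ~ B (cmap c q).
  by move=> cq nK Bq; apply: nK; exists (cmap c q) => //; exact: cmapK cc cq.
have tK q : ~ K q -> t q = 0.
  move=> nK; rewrite /t; case: asboolP => // cq; rewrite bump_out //; apply: Fout; exact: KcB.
have cK : compact K.
  rewrite /K; apply: (compact_image _ (@closed_ball_compact x0 (r / 2))) => x Bx.
  by apply: ci; rewrite inE; exact: BI.
exists K, t; split; [split=> //|split=> // q].
- by move=> _ [x Bx <-]; have [q cq <-] := BI x Bx; rewrite (cmapK cc).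
- apply: ckM_pointwise => q _; have [cq|nq] := pselect (cdom c q).
    exists (cdom c) => //; rewrite setTI; apply: (ckM_eq oc (f := fun q => bump (F (cmap c q)))) => [z cz|].
      by rewrite /t asboolT.
    move=> c' cc'; apply: (Ck_comp (W := setT) (f := fun x => bump (F x)) (g := fun x => cmap c (cinv c' x))).
    + exact: (open_chart_image cc' oc).
    + exact: openT.
    + by [].
    + by move=> j; have := charts_smooth cc' cc j 1; rewrite setIC.
    + by apply: bump_C1 => //; exact: openT.
  have oK : open (~` K) by apply: closed_openC; exact: compact_closed.
  exists (~` K); first by split=> // -[x Bx qx]; apply: nq; rewrite -qx; have [q' cq <-] := BI x Bx; rewrite (cmapK cc).
  by rewrite setTI; apply: (ckM_eq oK (f := fun=> 0)) => [z nz|]; [rewrite tK|exact: ckM_cst].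
- by rewrite /t asboolT // /F big1 ?bump0 ?ltr01 // => i _; rewrite subrr !mulr0.
- by rewrite /t; case: asboolP => // _; exact: bump_ge0.
Qed.
End Cutoff.

Section DivergenceTheorem.
Context (R : realType) (n : nat) (M : topologicalType) (A : oriented_atlas R n.*2.+1 M).
Context (T10 : M -> {vspace 'rV[R[i]]_(n.*2.+1)}) (theta : form1 R n.*2.+1 M).
Context (T : vfield R n.*2.+1 M).
Context (nabla : vfield R n.*2.+1 M -> vfield R n.*2.+1 M -> vfield R n.*2.+1 M).
Hypothesis S : sasakian A T10 theta T nabla.
Hypothesis clM : closed_manifold M.
Local Notation C := R[i].
Local Notation d := n.*2.+1.
Local Notation vfield := (vfield R d M).
Local Notation Lam := (cintegral S).
Implicit Types (c : chart R d M) (h : M -> R).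

Let hM : hausdorff_space M. Proof. by case: clM. Qed.

Lemma cintegral_test c (K : set M) h : charts A c -> compact K -> K `<=` cdom c ->
  (forall p, {for p, continuous h}) -> (forall p, ~ K p -> h p = 0) ->
  test (pull c (fun p => h p * density S c p)).
Proof.
move=> cc cK Kc ch h0; apply: (pull_test cc cK Kc) => [p cp|p /h0 ->]; last exact: mul0r.
apply: continuousMp; first exact: ch.
by apply: (ckM_cont cc (chart_open_dom cc) cp cp); exact: ckM_le (density_C1 S cc).
Qed.

Lemma cintegral_sum c (K : set M) (I : Type) (r : seq I) (f : I -> M -> R) : charts A c -> compact K ->
  K `<=` cdom c -> (forall i p, {for p, continuous (f i)}) -> (forall i p, ~ K p -> f i p = 0) ->
  Lam c (fun p => \sum_(i <- r) f i p) = \sum_(i <- r) Lam c (f i).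
Proof.
move=> cc cK Kc cf f0; rewrite /cintegral -integral_sum => [|i]; last exact: (cintegral_test cc cK Kc (cf i) (f0 i)).
apply: eq_integral; apply: (pullP (c := c)) => [p cp|x nx].
  by rewrite (pullE cc) // mulr_suml; apply: eq_bigr => i _; rewrite (pullE cc).
by rewrite /pull asboolF // big1 // => i _; rewrite asboolF.
Qed.

Lemma cintegralD c (K : set M) f h : charts A c -> compact K -> K `<=` cdom c ->
  (forall p, {for p, continuous f}) -> (forall p, {for p, continuous h}) ->
  (forall p, ~ K p -> f p = 0) -> (forall p, ~ K p -> h p = 0) ->
  Lam c (fun p => f p + h p) = Lam c f + Lam c h.
Proof.
move=> cc cK Kc cf ch f0 h0; rewrite /cintegral -integralD; try exact: (cintegral_test cc cK Kc).
apply: eq_integral; apply: (pullP (c := c)) => [p cp|x nx]; first by rewrite !(pullE cc) // mulrDl.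
by rewrite /pull !asboolF // addr0.
Qed.

Lemma eq_cintegral c h h' : charts A c -> (forall p, cdom c p -> h p = h' p) -> Lam c h = Lam c h'.
Proof. by move=> cc E; apply: eq_integral; apply: (eq_pull cc) => p cp; rewrite E. Qed.

Lemma continuous_ckM k h p : ckM A k setT h -> {for p, continuous h}.
Proof.
move=> hk; have cA := chart_at_charts A p.
by apply: (ckM_cont cA openT _ (chart_at_dom A p)); [|exact: ckM_le hk].
Qed.

(** With a partition of unity [g k], the integral of [X g_k + 2 g_k w] is 0 in the chart of [k]. The
    integrals of the [X g_k] add up to 0 because the [g k] add up to 1, so the nonnegative [g k * w]
    all have integral 0. *)
Lemma divergence_eq0 (V : vfield) (w : M -> R) : section_on A T10 setT V ->
  (forall p, exists U Z, [/\ local_frame A T10 U Z, U p, w p = complex.Re (divergence nabla Z V p) & 0 <= w p]) ->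
  forall p, w p = 0.
Proof.
move=> Vs Hw; pose X : vfield := fun q => V q + conjf V q.
have Xs : vsmooth_on A setT X.
  by apply: (vsmooth_add openT); [exact: sec_smooth Vs|apply: (vsmooth_conj openT); exact: sec_smooth Vs].
have Xr : conjf X = X by apply/funext => q; rewrite /conjf /X conjvD conjvK addrC.
have wE c p : charts A c -> cdom c p -> chart_div A nabla c X p = 2 * w p.
  move=> cc cp; have [U [Z [fr Up -> _]]] := Hw p.
  exact: (chart_div_divergence S cc fr Up cp Vs).
have w0 p : 0 <= w p by have [U [Z []]] := Hw p.
have cw p : {for p, continuous w}.
  have [U [Z [fr Up _ _]]] := Hw p; have oU := frame_open fr; have cA := chart_at_charts A p.
  have Vs' : section_on A T10 U V by exact: sec_sub Vs.
  apply: (eq_continuous_at oU Up (f := fun q => complex.Re (divergence nabla Z V q))) => [q Uq|].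
    apply: (mulfI (x := 2)) => //; rewrite -(wE _ q (chart_at_charts A q) (chart_at_dom A q)).
    by rewrite (chart_div_divergence S (chart_at_charts A q) fr Uq (chart_at_dom A q) Vs).
  exact: (ckM_cont cA oU Up (chart_at_dom A p) (smooth_ckC 0 (div_smooth S fr Vs')).1).
pose K p := sval (cid (cutoff_exists A p hM)); pose t p := sval (cid (svalP (cid (cutoff_exists A p hM)))).
have Kt p : cutoff A p (K p) (t p) := svalP (cid (svalP (cid (cutoff_exists A p hM)))).
pose c p := chart_at A p; have cc p : charts A (c p) := chart_at_charts A p.
have cK p : compact (K p) by have [[]] := Kt p.
have Kc p : K p `<=` cdom (c p) by have [[]] := Kt p.
have t1 p : ckM A 1 setT (t p) by have [[]] := Kt p.
have tpos p : 0 < t p p by have [[]] := Kt p.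
have t0 p q : 0 <= t p q by have [_ []] := Kt p.
have tK p q : ~ K p q -> t p q = 0 by have [_ [_]] := Kt p; exact.
have [ps Hps] : exists ps : seq M, forall q, exists2 k, k \in ps & 0 < t k q.
  have cM : compact [set: M] by case: clM.
  apply: (compact_finite_cover (f := fun p => [set q | 0 < t p q]) cM) => // p.
  apply: (open_comp (f := t p) (D := [set y | 0 < y])); last exact: open_gt.
  by move=> q _; exact: continuous_ckM (t1 p).
pose s q := \sum_(k <- ps) t k q.
have s0 q : 0 < s q.
  have [k kps tk] := Hps q; rewrite /s (big_rem k) //= ltr_pwDl // sumr_ge0 // => j _; exact: t0.
have s1 : ckM A 1 setT s by apply: (ckM_sum openT) => k _; exact: t1.
pose g k q := t k q * (s q)^-1.
have g1 k : ckM A 1 setT (g k).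
  by apply: (ckM_mul openT) => //; apply: (ckM_inv openT) => // q _; rewrite gt_eqF.
have gK k q : ~ K k q -> g k q = 0 by move=> /tK e; rewrite /g e mul0r.
have gsum q : \sum_(k <- ps) g k q = 1 by rewrite /g -mulr_suml -/(s q) mulfV // gt_eqF.
have g0 k q : 0 <= g k q by rewrite mulr_ge0 // invr_ge0 ltW.
pose Xg k q := complex.Re (vapp A X (fun p => (g k p)%:C) q).
have gC k : ckC A 1 setT (fun p => (g k p)%:C) by apply: (ckC_real openT).
have Xg_cont k p : {for p, continuous (Xg k)}.
  apply: (continuous_ckM (k := 0)); exact: (ckC_vapp openT ((vsmoothP _ _ _).1 Xs 0) (gC k)).1.
have XgK k q : ~ K k q -> Xg k q = 0.
  move=> nK; have oK : open (~` K k) by apply: closed_openC; exact: compact_closed.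
  rewrite /Xg; have -> // : vapp A X (fun p => (g k p)%:C) q = 0.
  transitivity (vapp A X (fun=> 0) q); last by rewrite vappE dtan_cst.
  by apply: (vapp_eq A oK nK X) => z nz; rewrite gK.
have Xgsum q : \sum_(k <- ps) Xg k q = 0.
  rewrite /Xg -Re_sum; have -> // : \sum_(k <- ps) vapp A X (fun p => (g k p)%:C) q = 0.
  have h := dtan_sum openT (p := q) I (X q) ps (P := xpredT) (fun k _ => gC k).
  rewrite -[LHS]h (@dtan_eq _ _ _ A setT q openT I _ _ (fun=> 1)) ?dtan_cst // => z _.
  by rewrite -rmorph_sum gsum.
pose gw k q := g k q * (2 * w q).
have gc k p : {for p, continuous (g k)} by exact: continuous_ckM (g1 k).
have gw_cont k p : {for p, continuous (gw k)}.
  by apply: continuousMp => //; apply: continuousMp => //; exact: continuous_constp.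
have gw0 k q : 0 <= gw k q by apply: mulr_ge0 (g0 k q) _; exact: mulr_ge0.
have gwK k q : ~ K k q -> gw k q = 0 by move=> /gK e; rewrite /gw e mul0r.
have H1 k : Lam (c k) (Xg k) + Lam (c k) (gw k) = 0.
  rewrite -(cintegralD (cc k) (cK k) (Kc k)) => [|p|p|p nK|p nK]; [|exact: Xg_cont|exact: gw_cont|exact: XgK|exact: gwK].
  rewrite -[RHS](integral_chart_div S hM (cc k) Xs Xr (cK k) (Kc k) (g1 k) (gK k)).
  apply: eq_cintegral => // p cp; rewrite (wE _ _ (cc k) cp) /Xg /gw; congr (_ + _).
  have gCk : ckC A 1 (cdom (c k)) (fun p => (g k p)%:C) by exact: ckC_sub (gC k).
  exact: (Re_dtan (cc k) Xr cp gCk).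
have gX_cont l k p : {for p, continuous (fun q => g l q * Xg k q)} by exact: continuousMp.
(* The terms are integrals in different charts. Inserting the sum of the [g l], and moving each
   product to the chart of [l] by invariance, allows the sum over [k] to be taken first. *)
have H2 k : Lam (c k) (Xg k) = \sum_(l <- ps) Lam (c l) (fun q => g l q * Xg k q).
  rewrite (eq_cintegral (h' := fun q => \sum_(l <- ps) g l q * Xg k q) (cc k)) => [|q _]; last first.
    by rewrite -mulr_suml gsum mul1r.
  have z l q : ~ K k q -> g l q * Xg k q = 0 by move=> /XgK ->; exact: mulr0.
  rewrite (cintegral_sum ps (f := fun l q => g l q * Xg k q) (cc k) (cK k) (Kc k) (fun l => gX_cont l k) z).
  apply: eq_bigr => l _; have cKl : compact (K k `&` K l).
    by apply: (compact_closedI (cK k)); exact: compact_closed (cK l).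
  have z' q : ~ (K k `&` K l) q -> g l q * Xg k q = 0.
    by move=> /not_andP[/XgK ->|/gK ->]; [exact: mulr0|exact: mul0r].
  have [sk sl] : K k `&` K l `<=` cdom (c k) /\ K k `&` K l `<=` cdom (c l).
    by split=> q [hk hl]; [exact: Kc hk|exact: Kc hl].
  exact: (cintegral_invariant S (cc k) (cc l) cKl sk sl (gX_cont l k) z').
have H3 : \sum_(k <- ps) Lam (c k) (Xg k) = 0.
  rewrite (eq_bigr _ (fun k _ => H2 k)) exchange_big big1 // => l _ /=.
  have z k q : ~ K l q -> g l q * Xg k q = 0 by move=> /gK ->; exact: mul0r.
  rewrite -(cintegral_sum ps (f := fun k q => g l q * Xg k q) (cc l) (cK l) (Kc l) (gX_cont l) z).
  rewrite (eq_cintegral (h' := fun=> 0) (cc l)) => [|q _]; last by rewrite -mulr_sumr Xgsum mulr0.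
  rewrite -[RHS](@integral0 R d); apply: eq_integral => x.
  by rewrite /pull; case: asboolP => // _; rewrite mul0r.
have H4 : \sum_(k <- ps) Lam (c k) (gw k) = 0.
  rewrite -[LHS]add0r -{1}H3 -big_split big1 //= => k _; exact: H1.
have tgw k := cintegral_test (cc k) (cK k) (Kc k) (gw_cont k) (gwK k).
have pos k x : 0 <= pull (c k) (fun p => gw k p * density S (c k) p) x.
  move: x; apply: (pullP (c := c k)) => [q cq|x nx]; last by rewrite /pull asboolF.
  by rewrite (pullE (cc k)) // mulr_ge0 // ltW // density_gt0.
move=> p; apply/eqP; rewrite eq_le w0 andbT leNgt; apply/negP => wp.
have [k kps tk] := Hps p.
have Kp : K k p by have [//|/tK e] := pselect (K k p); rewrite e ltxx in tk.
have cp := Kc k p Kp.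
have : 0 < \sum_(k <- ps) Lam (c k) (gw k).
  rewrite (big_rem k) //= ltr_pwDl // ?sumr_ge0 // => [|j _]; last exact: (integral_ge0 (tgw j)).
  apply: (integral_gt0 (x0 := cmap (c k) p) (tgw k)) => //.
  by rewrite (pullE (cc k)) // mulr_gt0 ?density_gt0 // !mulr_gt0 // invr_gt0.
by rewrite H4 ltxx.
Qed.
End DivergenceTheorem.
(** * The algebraic inequality *)

Section InnerProduct.
Context {R : realType} {n : nat}.
Local Notation C := R[i].
Implicit Types (x y z w : 'I_n -> C) (a b c : C).

Definition ip x y : C := \sum_i x i * conjc (y i).

Lemma ipC x y : ip y x = conjc (ip x y).
Proof. by rewrite rmorph_sum; apply: eq_bigr => i _; rewrite rmorphM /= conjcK mulrC. Qed.

Lemma ipDl x y z : ip (fun i => x i + y i) z = ip x z + ip y z.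
Proof. by rewrite -big_split; apply: eq_bigr => i _; exact: mulrDl. Qed.

Lemma ipZl a x z : ip (fun i => a * x i) z = a * ip x z.
Proof. by rewrite mulr_sumr; apply: eq_bigr => i _; rewrite mulrA. Qed.

Lemma ipDr x y z : ip z (fun i => x i + y i) = ip z x + ip z y.
Proof. by rewrite -big_split; apply: eq_bigr => i _; rewrite rmorphD mulrDr. Qed.

Lemma ipZr a x z : ip z (fun i => a * x i) = conjc a * ip z x.
Proof. by rewrite mulr_sumr; apply: eq_bigr => i _; rewrite rmorphM mulrCA. Qed.

Lemma ReV_sqr (c : C) : complex.Re (c * conjc c) = complex.Re c ^+ 2 + complex.Im c ^+ 2.
Proof. by rewrite ReM ReJ ImJ mulrN opprK -!expr2. Qed.

Lemma Re_ip_ge0 x : 0 <= complex.Re (ip x x).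
Proof. by rewrite Re_sum; apply: sumr_ge0 => i _; rewrite ReV_sqr addr_ge0 ?sqr_ge0. Qed.

Lemma Im_ip x : complex.Im (ip x x) = 0.
Proof. by rewrite Im_sum big1 // => i _; rewrite ImM ReJ ImJ; ring. Qed.

Lemma ip_eq0 x : complex.Re (ip x x) = 0 -> forall i, x i = 0.
Proof. by move=> h; apply: sum_norm0; apply: complex_eqP; [exact: h|exact: Im_ip]. Qed.

Definition mx_sqnorm (H : 'I_n -> 'I_n -> C) : R := \sum_i complex.Re (ip (H i) (H i)).

(* [|x|^2 |y|^2 - |<x,y>|^2] is, up to the factor [|y|^2], the squared norm of
   [|y|^2 x - <x,y> y]. *)
Lemma cauchy_schwarz x y :
  complex.Re (ip x y * conjc (ip x y)) <= complex.Re (ip y y) * complex.Re (ip x x).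
Proof.
pose s := complex.Re (ip y y); have := Re_ip_ge0 y; rewrite le_eqVlt => /orP[/eqP s0|s0].
  have y0 := ip_eq0 (esym s0); rewrite -s0 mul0r.
  have -> : ip x y = 0 by rewrite /ip big1 // => i _; rewrite y0 rmorph0 mulr0.
  by rewrite mul0r.
rewrite -(ler_pM2l s0) -/s -subr_ge0.
have := Re_ip_ge0 (fun i => s%:C * x i + (- ip x y) * y i).
rewrite !(ipDl, ipDr, ipZl, ipZr) (ipC x y).
have Sy : ip y y = s%:C by apply: complex_eqP => //; exact: Im_ip.
have Sx : ip x x = (complex.Re (ip x x))%:C by apply: complex_eqP => //; exact: Im_ip.
rewrite Sx Sy; move: (complex.Re (ip x x)) (ip x y) => X [u v].
rewrite !(ReD, ImD, ReM, ImM, ReJ, ImJ, ReN, ImN) /= => h; apply: le_trans h _.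
by rewrite le_eqVlt; apply/orP; left; apply/eqP; ring.
Qed.
End InnerProduct.

(** * The decomposition into nonnegative terms *)

Section Decomposition.
Context {R : realFieldType}.
Variables (m nu F L tau ric HH EE s JJ e2 tt d1 d2 o1 o2 j1 k2 m2 e1 : R).

(** With [m = n] and [nu = 1 / (alpha - 1)], positivity of [eps] is the condition
    [alpha < (n + 2) / n]. Below, [p] is the real part of the divergence of [G] divided by [m], and
    [kappa], [kH], [kE] are the shifts that complete squares. *)
Let eps := 2 * nu / m - 1.
Let p := (L - F - nu * s) / m.
Let b := 3 * eps / (m + 1).
Let kappa := (F + L) / (2 * m) + (eps + 3) * s / 12.
Let kH := 1 - m * b / 4.
Let kE := - (m * b / 4).

(** The three are expanded square norms of vectors: of [J + e / 2 - i t + (c + i tau / 2) g], of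
    [e + 2 i t + (c - i tau) g] and of [i t + (c - i tau / 2) g], each with its own [c]. *)
Definition square1 := let c := kappa - s - eps * s / 12 in
  JJ + e2 / 4 + tt + (c ^+ 2 + (tau / 2) ^+ 2) * s + j1 - 2 * k2 + 2 * (c * d1 + tau / 2 * d2)
  - m2 + c * e1 + 2 * (c * o2 - tau / 2 * o1).
Definition square2 := let c := eps * s / 6 - 2 * kappa in
  e2 + 4 * tt + (c ^+ 2 + tau ^+ 2) * s + 4 * m2 + 2 * c * e1 + 4 * (- tau * o1 - c * o2).
Definition square3 := let c := - kappa - eps * s / 6 in
  tt + (c ^+ 2 + (tau / 2) ^+ 2) * s + 2 * (- (tau / 2) * o1 - c * o2).
(** The square norms of the (2,0) Hessian minus [kH] times the tensor square of [g], and, in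
    [squareE], of the trace-free (1,1) Hessian minus [kE] times the trace-free part of [g] tensored
    with its conjugate. *)
Definition squareH := HH - 2 * kH * d1 + kH ^+ 2 * s ^+ 2.
Definition squareE := EE - 2 * kE * e1 + kE ^+ 2 * s ^+ 2 * (1 - m^-1).

(* The divergence of [pfield] at a point without its weight, as computed in
   [pfield_divergence]: [HH] and [EE] are the squared norms of the (2,0) part and of
   the trace-free (1,1) part of the Hessian of psi, [s], [JJ], [e2], [tt] those of
   [G] and of [J], [e], [t]; moreover [<J, g> = d1 + i d2], [<t, g> = o1 + i o2],
   [j1 = Re <J, e>], [k2 = Im <J, t>], [m2 = Im <e, t>] and [e1 = <e, g>]. *)
Definition real_omega : R :=
  let B := - (2 + eps) / m + b in
  let h := s + 2 / m * (F + L) in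
  let q1 := - s ^+ 2 + B * s * (F + L) - 6 * tau ^+ 2 in
  let q2 := (1 - 2 * eps) * s - 6 / m * (F + L) in
  let Q1 := q1 - h * p + 4 * tau ^+ 2 in
  let Q2 := h * tau + 4 * tau * p - tau * q2 in
  let N1 := e1 + p * s in
  let N2 := - (tau * s) in
  let S1 := N1 + d1 in
  let S2 := - d2 - tau * s in
  let JN1 := j1 + p * d1 - tau * d2 in
  let P1 := (- (F * s) - nu * S1) / m in
  let P2 := - (nu * S2 / m) in
  (2 * nu - 1) * (h * d1 - 4 * tau * d2 + (h * N1 + 4 * tau * N2) + 12 * tau * o1 + Q1 * s)
  + (h * (- (F * s) - nu * S1 + m * o2 + HH + 2 * o2 + ric) - 4 * tau * (nu * S2 - m * o1 - 2 * o1))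
  + (JJ + JN1 + 2 * tau * d2 + 2 / m * F * d1 - 4 * k2)
  + (h * (- (F * s) - nu * S1 - m * o2 + (EE + m * p ^+ 2 - m * tau ^+ 2))
      + 4 * tau * (- (nu * S2) - m * o1 - 2 * tau * m * p))
  + ((e2 + 2 * p * e1 + (p ^+ 2 + tau ^+ 2) * s) + JN1 + 2 * tau * N2 + 2 / m * F * N1
      + 4 * (m2 - p * o2 - tau * o1))
  + (12 * tau * (- (F * tau) - nu * (2 * o1)) + 12 * tt)
  + (Q1 * (m * p) + Q2 * (m * tau))
  + (- (2 * s * S1) + B * (S1 * (F + L) + s * F * s) - 12 * tau * o1 - o2 * q2
      + tau * ((1 - 2 * eps) * S2)
      - p * (S1 + 2 / m * F * s - 4 * o2) - tau * (S2 - 4 * o1)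
      + (h * (o2 - P1) + 4 * tau * (o1 - P2))).

(** A rational identity, arranged so that each summand has a sign: Cauchy-Schwarz for the first two
    differences, then squares, the Ricci term, and monomials in [s], [F], [L], [tau] whose
    coefficients are nonnegative for positive [eps]. *)
Lemma omega_decomposition : m != 0 -> m + 1 != 0 -> real_omega =
  s * HH - JJ + (s * EE - e2) + 2 / m * (F + L) * (squareH + squareE)
  + (2 * square1 + 3 / 2 * square2 + 4 * square3)
  + (s + 2 / m * (F + L)) * (ric - 2 * (m + 1) / m * L * s) + 3 * m * eps * s * tau ^+ 2
  + eps * (m + (m - 1) * eps) / 2 * s ^+ 3
  + (eps * ((1 + eps) / 2 + 1 - m^-1 + 3 * (m - 1) * (1 + eps) / (2 * (m + 1)))
      - (2 * m - 1) * b ^+ 2 / 8 + b) * s ^+ 2 * F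
  + (eps * ((1 + eps) / 2 - 1 + m^-1 + 3 * (m - 1) * (1 + eps) / (2 * (m + 1)))
      - (2 * m - 1) * b ^+ 2 / 8) * s ^+ 2 * L.
Proof.
move=> m0 m1'; rewrite /real_omega /square1 /square2 /square3 /squareH /squareE /kH /kE /kappa /b /p /eps.
by field; rewrite m0 m1'.
Qed.

Lemma omega_bound : 1 <= m -> 0 <= F -> 0 <= L <= m / 2 -> 0 < eps -> 0 <= s ->
  (m + 1) * s <= ric -> JJ <= s * HH -> e2 <= s * EE ->
  0 <= squareH -> 0 <= squareE -> 0 <= square1 -> 0 <= square2 -> 0 <= square3 ->
  m * eps / 2 * s ^+ 3 <= real_omega.
Proof.
move=> m1 F0 /andP[L0 Lm] e0 s0 hric hJ hE sH sE s1 s2 s3.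
have m0 : 0 < m by lra.
have mz : m != 0 by rewrite gt_eqF.
have mz' : m + 1 != 0 by rewrite gt_eqF //; lra.
rewrite omega_decomposition //.
have t1 : 0 <= 2 / m * (F + L) by rewrite mulr_ge0 ?addr_ge0 // divr_ge0 // ltW.
(* With the chosen [b = 3 eps / (m + 1)] this coefficient is [eps] times a sum of two fractions,
   nonnegative for [m >= 1]. *)
have cL : 0 <= eps * ((1 + eps) / 2 - 1 + m^-1 + 3 * (m - 1) * (1 + eps) / (2 * (m + 1)))
    - (2 * m - 1) * b ^+ 2 / 8.
  have -> : eps * ((1 + eps) / 2 - 1 + m^-1 + 3 * (m - 1) * (1 + eps) / (2 * (m + 1)))
      - (2 * m - 1) * b ^+ 2 / 8 = eps * ((m * (m - 1) + 1) / (m * (m + 1))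
      + eps * ((2 * m - 1) * (8 * m - 1)) / (8 * (m + 1) ^+ 2)).
    by rewrite /b; field; rewrite mz mz'.
  apply: mulr_ge0; first exact: ltW.
  apply: addr_ge0; apply: divr_ge0.
  - by rewrite addr_ge0 // mulr_ge0 //; lra.
  - by rewrite mulr_ge0 //; lra.
  - by rewrite mulr_ge0 ?mulr_ge0 //; lra.
  - by rewrite mulr_ge0 // exprn_ge0 //; lra.
(* This coefficient exceeds the previous one by [2 eps (1 - 1/m) + b]. *)
have cF : 0 <= eps * ((1 + eps) / 2 + 1 - m^-1 + 3 * (m - 1) * (1 + eps) / (2 * (m + 1)))
      - (2 * m - 1) * b ^+ 2 / 8 + b.
  have b0 : 0 <= b by rewrite /b divr_ge0 //; lra.
  have mi : m^-1 <= 1 by rewrite invf_le1.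
  have : 0 <= eps * (2 * (1 - m^-1)) by rewrite mulr_ge0 ?mulr_ge0 //; lra.
  by move: cL b0; lra.
(* At the extreme value [L = m / 2] the factor is exactly [m + 1], the constant of the Ricci bound:
   this is where the upper bound on lambda is used. *)
have hr : 0 <= ric - 2 * (m + 1) / m * L * s.
  rewrite subr_ge0; apply: le_trans hric; apply: ler_wpM2r => //.
  have Em : 2 * (m + 1) / m * (m / 2) = m + 1 by field; rewrite mz.
  by rewrite -[leRHS]Em; apply: ler_wpM2l => //; rewrite divr_ge0 //; lra.
have A1 : 0 <= 2 / m * (F + L) * (squareH + squareE) by rewrite mulr_ge0 // addr_ge0.
have A2 : 0 <= (s + 2 / m * (F + L)) * (ric - 2 * (m + 1) / m * L * s) by rewrite mulr_ge0 // addr_ge0.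
have A3 : 0 <= 3 * m * eps * s * tau ^+ 2.
  by rewrite mulr_ge0 ?sqr_ge0 // mulr_ge0 // mulr_ge0 ?mulr_ge0 // ltW.
have s2' : 0 <= s ^+ 2 by exact: sqr_ge0.
have A4 := mulr_ge0 (mulr_ge0 cF s2') F0; have A5 := mulr_ge0 (mulr_ge0 cL s2') L0.
have A6 : m * eps / 2 * s ^+ 3 <= eps * (m + (m - 1) * eps) / 2 * s ^+ 3.
  rewrite -subr_ge0; have -> : eps * (m + (m - 1) * eps) / 2 * s ^+ 3 - m * eps / 2 * s ^+ 3 =
      (m - 1) * eps ^+ 2 / 2 * s ^+ 3 by ring.
  by rewrite mulr_ge0 ?exprn_ge0 // divr_ge0 // mulr_ge0 ?sqr_ge0 // subr_ge0.
by move: A1 A2 A3 A4 A5 A6 hJ hE s1 s2 s3; lra.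
Qed.
End Decomposition.

Section Pointwise.
Context {R : realType} {n : nat}.
Local Notation C := R[i].
Variables (g t : 'I_n -> C) (H E : 'I_n -> 'I_n -> C).
Variables (nu F L tau ric : R).
Hypothesis Eh : forall i k, conjc (E i k) = E k i.
Hypothesis E0 : \sum_i E i i = 0.

Let m : R := n%:R.
Let J i := \sum_k conjc (g k) * H i k.
Let e i := \sum_k g k * E i k.
Let s := complex.Re (ip g g).
Let gb i := conjc (g i).

Let sE : ip g g = s%:C. Proof. by apply: complex_eqP => //; exact: Im_ip. Qed.

Let realE (x : 'I_n -> C) : ip x x = (complex.Re (ip x x))%:C.
Proof. by apply: complex_eqP => //; exact: Im_ip. Qed.

Let JE i : ip (H i) g = J i. Proof. by apply: eq_bigr => k _; exact: mulrC. Qed.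
Let eE i : ip (E i) gb = e i. Proof. by apply: eq_bigr => k _; rewrite /gb conjcK mulrC. Qed.
Let gbE : ip gb gb = s%:C.
Proof. by rewrite -sE /ip; apply: eq_bigr => k _; rewrite /gb conjcK mulrC. Qed.

Lemma ip_eg_real : complex.Im (ip e g) = 0.
Proof.
have h : conjc (ip e g) = ip e g.
  rewrite /ip rmorph_sum /=; under eq_bigr do rewrite rmorphM /= conjcK rmorph_sum mulr_suml.
  rewrite exchange_big; apply: eq_bigr => k _; rewrite mulr_suml; apply: eq_bigr => i _.
  by rewrite rmorphM /= Eh; ring.
by have := congr1 (@complex.Im R) h; rewrite ImJ; move: (complex.Im _) => x; lra.
Qed.

Lemma ipJJ_le : complex.Re (ip J J) <= s * mx_sqnorm H.
Proof.
rewrite Re_sum mulr_sumr; apply: ler_sum => i _; rewrite -JE; exact: cauchy_schwarz.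
Qed.

Lemma ipee_le : complex.Re (ip e e) <= s * mx_sqnorm E.
Proof.
rewrite Re_sum mulr_sumr; apply: ler_sum => i _; rewrite -eE.
by have := cauchy_schwarz (E i) gb; rewrite gbE.
Qed.

(** The difference of [H] and [k] times the tensor square of [g], with its square norm summed row by
    row. *)
Lemma squareH_ge0 (k : R) : 0 <= mx_sqnorm H - 2 * k * complex.Re (ip J g) + k ^+ 2 * s ^+ 2.
Proof.
have -> : mx_sqnorm H - 2 * k * complex.Re (ip J g) + k ^+ 2 * s ^+ 2 =
    \sum_i complex.Re (ip (fun l => H i l + (- k%:C * g i) * g l) (fun l => H i l + (- k%:C * g i) * g l)).
  have -> : k ^+ 2 * s ^+ 2 = \sum_i k ^+ 2 * s * complex.Re (g i * conjc (g i)).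
    by rewrite -mulr_sumr -Re_sum -/(ip g g) sE /= expr2; ring.
  rewrite /mx_sqnorm Re_sum mulr_sumr -sumrN -!big_split; apply: eq_bigr => i _ /=.
  rewrite !(ipDl, ipDr, ipZl, ipZr) (ipC (H i) g) sE JE; move: (ip (H i) (H i)) (g i) (J i) => [a1 a2] [b1 b2] [c1 c2].
  rewrite !(ReD, ImD, ReM, ImM, ReJ, ImJ, ReN, ImN) /=; ring.
by apply: sumr_ge0 => i _; exact: Re_ip_ge0.
Qed.

Let del (i k : 'I_n) : C := (k == i)%:R.

Let ip_del (x : 'I_n -> C) i : ip x (del i) = x i.
Proof.
rewrite /ip (bigD1 i) //= big1 ?addr0 => [|k /negPf ki]; first by rewrite /del eqxx rmorph1 mulr1.
by rewrite /del ki rmorph0 mulr0.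
Qed.

(** Since [E] has trace 0, subtracting only the trace-free part of [g] tensored with its conjugate
    leaves the cross term unchanged and improves the last one by the factor [1 - 1/m]. *)
Lemma squareE_ge0 (k : R) : (0 < n)%N ->
  0 <= mx_sqnorm E - 2 * k * complex.Re (ip e g) + k ^+ 2 * s ^+ 2 * (1 - m^-1).
Proof.
move=> n0; have m0 : m != 0 by rewrite pnatr_eq0 -lt0n.
(* [c] is the multiple of the identity that makes the subtracted rank one matrix trace-free. *)
pose c := k * s / m; pose v i l := E i l + (- k%:C * g i) * gb l + c%:C * del i l.
have -> : mx_sqnorm E - 2 * k * complex.Re (ip e g) + k ^+ 2 * s ^+ 2 * (1 - m^-1) =
    \sum_i complex.Re (ip (v i) (v i)).
  have h1 : \sum_i complex.Re (E i i) = 0 by rewrite -Re_sum E0.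
  have h2 : \sum_i complex.Re (g i * conjc (g i)) = s by rewrite -Re_sum.
  have h4 : \sum_i complex.Re (e i * conjc (g i)) = complex.Re (ip e g) by rewrite -Re_sum.
  have h3 : \sum_(i < n) c ^+ 2 = c ^+ 2 * m by rewrite sumr_const card_ord mulr_natr.
  transitivity (\sum_i (complex.Re (ip (E i) (E i)) - 2 * k * complex.Re (e i * conjc (g i)) +
      (k ^+ 2 * s - 2 * k * c) * complex.Re (g i * conjc (g i)) + 2 * c * complex.Re (E i i) + c ^+ 2)).
    rewrite !big_split /= h3 sumrN -!mulr_sumr h1 h2 h4 /mx_sqnorm /c.
    by field.
  apply: eq_bigr => i _; rewrite /v !(ipDl, ipDr, ipZl, ipZr) (ipC (E i) gb) gbE eE !ip_del.
  rewrite (ipC (E i) (del i)) (ipC gb (del i)) !ip_del /gb conjcK /del eqxx realE.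
  have Er : complex.Im (E i i) = 0.
    by have := congr1 (@complex.Im R) (Eh i i); rewrite ImJ; move: (complex.Im _) => x; lra.
  move: (complex.Re (ip _ _)) (g i) (e i) (E i i) Er => a [b1 b2] [c1 c2] [d1 d2] /= ->.
  ring.
by apply: sumr_ge0 => i _; exact: Re_ip_ge0.
Qed.

(** Instantiates the real variables of [omega_bound] by a vector and two matrices; the hypotheses on
    the squares become positivity of [ip], the pairing of [e] with [g] being real because [E] is
    Hermitian. *)
Lemma pointwise_bound : (0 < n)%N -> 0 <= F -> 0 <= L <= m / 2 -> m < 2 * nu -> (m + 1) * s <= ric ->
  m * (2 * nu / m - 1) / 2 * s ^+ 3 <=
  real_omega m nu F L tau ric (mx_sqnorm H) (mx_sqnorm E) s (complex.Re (ip J J))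
    (complex.Re (ip e e)) (complex.Re (ip t t)) (complex.Re (ip J g)) (complex.Im (ip J g))
    (complex.Re (ip t g)) (complex.Im (ip t g)) (complex.Re (ip J e)) (complex.Im (ip J t))
    (complex.Im (ip e t)) (complex.Re (ip e g)).
Proof.
move=> n0 F0 L0 hnu hr; have m1 : 1 <= m by rewrite ler1n.
have mp : 0 < m by lra.
apply: omega_bound => //; try exact: Re_ip_ge0; try exact: ipJJ_le; try exact: ipee_le.
- by rewrite subr_gt0 ltr_pdivlMr // mul1r.
- exact: squareH_ge0.
- exact: squareE_ge0.
- rewrite /square1; cbv zeta; set c := (X in (X ^+ 2 + (tau / 2) ^+ 2) * _).
  have := Re_ip_ge0 (fun i => ((J i + (2^-1)%:C * e i) + (- (0 +i* 1)) * t i) + (c +i* (tau / 2)) * g i).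
  rewrite !(ipDl, ipDr, ipZl, ipZr) (ipC J e) (ipC J t) (ipC J g) (ipC e t) (ipC e g) (ipC t g).
  rewrite sE (realE J) (realE e) (realE t); have := ip_eg_real.
  move: (complex.Re (ip J J)) (complex.Re (ip e e)) (complex.Re (ip t t)) => JJ ee tt.
  move: (ip J e) (ip J t) (ip J g) (ip e t) (ip e g) (ip t g) => [x1 x2] [y1 y2] [z1 z2] [w1 w2] [u1 u2] [r1 r2] /= ->.
  by move=> h; apply: le_trans h _; rewrite /c; lra.
- rewrite /square2; cbv zeta; set c := (X in (X ^+ 2 + tau ^+ 2) * _).
  have := Re_ip_ge0 (fun i => (e i + (0 +i* 2) * t i) + (c +i* (- tau)) * g i).
  rewrite !(ipDl, ipDr, ipZl, ipZr) (ipC e t) (ipC e g) (ipC t g).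
  rewrite sE (realE e) (realE t); have := ip_eg_real.
  move: (complex.Re (ip e e)) (complex.Re (ip t t)) => ee tt.
  move: (ip e t) (ip e g) (ip t g) => [w1 w2] [u1 u2] [r1 r2] /= ->.
  by move=> h; apply: le_trans h _; rewrite /c; lra.
- rewrite /square3; cbv zeta; set c := (X in (X ^+ 2 + (tau / 2) ^+ 2) * _).
  have := Re_ip_ge0 (fun i => (0 +i* 1) * t i + (c +i* (- (tau / 2))) * g i).
  rewrite !(ipDl, ipDr, ipZl, ipZr) (ipC t g) sE (realE t).
  move: (complex.Re (ip t t)) (ip t g) => tt [r1 r2] /=.
  by move=> h; apply: le_trans h _; rewrite /c; lra.
Qed.
End Pointwise.

(** * Coefficients of the vector field and their derivatives *)

Section Coefficients.
Context (R : realType) (d : nat) (M : topologicalType) (A : oriented_atlas R d M).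
Local Notation C := R[i].
Local Notation i := (0 +i* 1 : C).
Variables (m nu L : R) (s t f : M -> C).

Let eps := 2 * nu / m - 1.
Let B := - (2 + eps) / m + 3 * eps / (m + 1).

(* The coefficients of [pfield], chosen so that [omega_decomposition] holds. *)
Definition coef_h q : C := s q + (2 / m)%:C * (f q + L%:C).
Definition coef_plus q : C := coef_h q + (0 +i* 4) * t q.
Definition coef_minus q : C := coef_h q + (- (0 +i* 4)) * t q.
Definition coef_p q : C := (m^-1)%:C * (L%:C + (- 1) * f q + (- nu%:C) * s q).
Definition coef_q1 q : C := (- 1) * (s q * s q) + B%:C * (s q * (f q + L%:C)) + (- 6%:C) * (t q * t q).
Definition coef_q2 q : C := (1 - 2 * eps)%:C * s q + (- (6 / m)%:C) * (f q + L%:C).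
Definition coef_G q : C :=
  coef_q1 q + (- i) * (t q * coef_q2 q) + coef_minus q * (i * t q + (- 1) * coef_p q).

Hypotheses (ss : smooth_on A setT s) (ts : smooth_on A setT t) (fs : smooth_on A setT f).

Let smD (g h : M -> C) : smooth_on A setT g -> smooth_on A setT h -> smooth_on A setT (fun q => g q + h q).
Proof. exact: (smooth_add openT). Qed.
Let smM (g h : M -> C) : smooth_on A setT g -> smooth_on A setT h -> smooth_on A setT (fun q => g q * h q).
Proof. exact: (smooth_mul openT). Qed.
Let smC (a : C) : smooth_on A setT (fun=> a : C).
Proof. exact: (smooth_cst A openT). Qed.

Ltac sm := repeat first [assumption | exact: ss | exact: ts | exact: fs | exact: smC | apply: smD | apply: smM].

Lemma coef_plus_smooth : smooth_on A setT coef_plus.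
Proof. by rewrite /coef_plus /coef_h; sm. Qed.
Lemma coef_minus_smooth : smooth_on A setT coef_minus.
Proof. by rewrite /coef_minus /coef_h; sm. Qed.
Lemma coef_G_smooth : smooth_on A setT coef_G.
Proof. by rewrite /coef_G /coef_q1 /coef_q2 /coef_minus /coef_p /coef_h; sm. Qed.

Variables (X : vfield R d M) (p : M).
Let D g := vapp A X g p.

Let DD (g h : M -> C) : smooth_on A setT g -> smooth_on A setT h -> D (fun q => g q + h q) = D g + D h.
Proof. exact: (@vappD _ _ _ A setT p I X g h). Qed.
Let DM (g h : M -> C) : smooth_on A setT g -> smooth_on A setT h ->
  D (fun q => g q * h q) = g p * D h + h p * D g.
Proof. exact: (vappM openT I). Qed.
Let DC (a : C) : D (fun=> a) = 0.
Proof. by rewrite /D vappE dtan_cst. Qed.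

Let DZ a (g : M -> C) : smooth_on A setT g -> D (fun q => a * g q) = a * D g.
Proof. by move=> gs; rewrite DM // DC mulr0 addr0. Qed.

Let Dh : D coef_h = D s + (2 / m)%:C * D f.
Proof. by rewrite /coef_h DD ?DZ ?DD ?DC ?addr0 //; sm. Qed.

Lemma vapp_plus : D coef_plus = D s + (2 / m)%:C * D f + (0 +i* 4) * D t.
Proof. by rewrite /coef_plus DD ?DZ ?Dh // /coef_h; sm. Qed.

Lemma vapp_minus : D coef_minus = D s + (2 / m)%:C * D f - (0 +i* 4) * D t.
Proof. by rewrite /coef_minus DD ?DZ ?Dh ?mulNr // /coef_h; sm. Qed.

Lemma vapp_G : D coef_G = (- 1) * (2%:C * s p * D s) + B%:C * (D s * (f p + L%:C) + s p * D f)
  - 12%:C * t p * D t - i * (D t * coef_q2 p + t p * ((1 - 2 * eps)%:C * D s - (6 / m)%:C * D f))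
  + vapp A X coef_minus p * (i * t p - coef_p p)
  + coef_minus p * (i * D t + (m^-1)%:C * (D f + nu%:C * D s)).
Proof.
have q1s : smooth_on A setT coef_q1 by rewrite /coef_q1; sm.
have q2s : smooth_on A setT coef_q2 by rewrite /coef_q2; sm.
have ps : smooth_on A setT coef_p by rewrite /coef_p; sm.
have ms := coef_minus_smooth.
have Dq1 : D coef_q1 = (- 1) * (2%:C * s p * D s) + B%:C * (D s * (f p + L%:C) + s p * D f) - 12%:C * t p * D t.
  have fLs : smooth_on A setT (fun q => f q + L%:C) by sm.
  rewrite /coef_q1 DD ?DD ?DZ ?DM ?DD ?DC //; try by sm.
  rewrite addr0 (_ : (12 : R)%:C = 6%:C * 2%:C); last by apply: complex_eqP; rewrite /=; ring.
  rewrite (_ : (2 : R)%:C = 1 + 1); last by apply: complex_eqP; rewrite /=; ring.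
  by ring.
have Dq2 : D coef_q2 = (1 - 2 * eps)%:C * D s - (6 / m)%:C * D f.
  by rewrite /coef_q2 DD ?DZ ?DD ?DC ?addr0 ?mulNr //; sm.
have Dp : D coef_p = - ((m^-1)%:C * (D f + nu%:C * D s)).
  have e1 : smooth_on A setT (fun q => (-1) * f q) by sm.
  have e2 : smooth_on A setT (fun q => (- nu%:C) * s q) by sm.
  rewrite /coef_p DZ ?DD ?DZ ?DC //; try by sm.
  by ring.
(* The shape of [coef_G] is differentiated with arbitrary smooth factors, so that the rules act on
   the outer structure and leave the factors folded. *)
have gen (q1 q2 k r : M -> C) : smooth_on A setT q1 -> smooth_on A setT q2 -> smooth_on A setT k ->
    smooth_on A setT r -> D (fun q => q1 q + (- i) * (t q * q2 q) + r q * (i * t q + (- 1) * k q)) =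
    D q1 + (- i) * (t p * D q2 + q2 p * D t) + (r p * (i * D t + (- 1) * D k) + (i * t p + (- 1) * k p) * D r).
  move=> h1 h2 h3 h4; rewrite DD ?DD ?DZ ?DM ?DD ?DZ //; sm; done.
rewrite [LHS](gen _ _ _ _ q1s q2s ps ms) Dq1 Dq2 Dp -/(D coef_minus).
move: (D coef_minus) (coef_q2 p) (coef_p p) (coef_minus p) (D s) (D t) (D f) (s p) (t p) (f p).
move=> x1 x2 x3 x4 x5 x6 x7 x8 x9 x10; ring.
Qed.
End Coefficients.
(** * The divergence of the vector field *)

Section Casts.
Context {R : realType}.
Local Notation C := R[i].

Lemma natrC k : (k%:R : R)%:C = k%:R :> C.
Proof. by rewrite -[LHS]/(real_complex R k%:R) rmorph_nat. Qed.

Lemma sumrC (I : Type) (r : seq I) (f : I -> R) : (\sum_(k <- r) f k)%:C = \sum_(k <- r) (f k)%:C :> C.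
Proof. by rewrite -[LHS]/(real_complex R _) rmorph_sum. Qed.

Lemma ReZ (a : R) (z : C) : complex.Re (a%:C * z) = a * complex.Re z.
Proof. by case: z => x y /=; rewrite mul0r subr0. Qed.

Lemma mx_sqnormC n (H : 'I_n -> 'I_n -> C) : (mx_sqnorm H)%:C = \sum_i ip (H i) (H i).
Proof. by rewrite /mx_sqnorm sumrC; apply: eq_bigr => i _; apply: complex_eqP => //=; rewrite Im_ip. Qed.
End Casts.

Section PField.
Context (R : realType) (n : nat) (M : topologicalType) (A : oriented_atlas R n.*2.+1 M).
Context (T10 : M -> {vspace 'rV[R[i]]_(n.*2.+1)}) (theta : form1 R n.*2.+1 M).
Context (T : vfield R n.*2.+1 M).
Context (nabla : vfield R n.*2.+1 M -> vfield R n.*2.+1 M -> vfield R n.*2.+1 M).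
Hypothesis S : sasakian A T10 theta T nabla.
Local Notation C := R[i].
Local Notation i := (0 +i* 1 : C).
Local Notation vfield := (vfield R n.*2.+1 M).
Local Notation sec := (section_on A T10).
Local Notation lv := (levi A theta).
Local Notation vsm := (vsmooth_on A).
Local Notation m := (n%:R : R).

Variables (psi F w : M -> R) (nu L : R) (G : vfield).
Let psiC p : C := (psi p)%:C.
Let FC p : C := (F p)%:C.
Let wC p : C := (w p)%:C.
Hypotheses (psis : smooth_on A setT psiC) (Fs : smooth_on A setT FC) (ws : smooth_on A setT wC).
Hypothesis dF : forall X p, vapp A X FC p = FC p * vapp A X psiC p.
Hypothesis dw : forall X p, vapp A X wC p = wC p * ((2 * nu - 1)%:C * vapp A X psiC p).
Hypothesis Gs : sec setT G.
Hypothesis HG : forall U W p, open U -> sec U W -> U p -> lv W G p = vapp A W psiC p.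

Let sC : M -> C := lv G G.
Let tC : M -> C := vapp A T psiC.
Hypothesis divG : forall U Z p, local_frame A T10 U Z -> U p ->
  divergence nabla Z G p = L%:C - FC p - nu%:C * sC p - m%:C * i * tC p.

Let NG : vfield := nabla G G.
Let NJ : vfield := nabla (conjf G) G.
Let NT : vfield := nabla T G.

(** A field of the kind used by Jerison and Lee for the CR Yamabe equation. If [G] has weight one,
    and [T psi], [F] and [L] weight two, each summand without [wC] has weight five; its divergence
    then has weight six, as a lower bound by [|G|^6] demands. *)
Definition pfield : vfield := fun q => wC q *: (coef_plus m L sC tC FC q *: NJ q +
  (coef_minus m L sC tC FC q *: NG q + ((12%:C * tC q) *: NT q + coef_G m nu L sC tC FC q *: G q))).

Let Gv : vsm setT G := sec_smooth Gs.
Let Gv' : vsm setT (conjf G) := vsmooth_conj openT Gv.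
Let Ts : vsm setT T. Proof. exact: (reeb_smooth S). Qed.
Let NGs : sec setT NG. Proof. exact: (sec_nabla S openT Gv Gs). Qed.
Let NJs : sec setT NJ. Proof. exact: (sec_nabla S openT Gv' Gs). Qed.
Let NTs : sec setT NT. Proof. exact: (sec_nabla S openT Ts Gs). Qed.
Let ss : smooth_on A setT sC. Proof. exact: (levi_smooth S openT Gs Gs). Qed.
Let ts : smooth_on A setT tC. Proof. exact: (smooth_vapp openT Ts psis). Qed.
Let t12s : smooth_on A setT (fun q => 12%:C * tC q).
Proof. by apply: (smooth_mul openT) => //; exact: (smooth_cst A openT). Qed.
Let cps := coef_plus_smooth m L ss ts Fs.
Let cms := coef_minus_smooth m L ss ts Fs.
Let cGs := coef_G_smooth m nu L ss ts Fs.

Let V : vfield := fun q => coef_plus m L sC tC FC q *: NJ q +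
  (coef_minus m L sC tC FC q *: NG q + ((12%:C * tC q) *: NT q + coef_G m nu L sC tC FC q *: G q)).

Let V1 : sec setT (fun q => coef_plus m L sC tC FC q *: NJ q). Proof. exact: (sec_scale openT). Qed.
Let V2 : sec setT (fun q => coef_minus m L sC tC FC q *: NG q). Proof. exact: (sec_scale openT). Qed.
Let V3 : sec setT (fun q => (12%:C * tC q) *: NT q). Proof. exact: (sec_scale openT). Qed.
Let V4 : sec setT (fun q => coef_G m nu L sC tC FC q *: G q). Proof. exact: (sec_scale openT). Qed.
Let V34 := sec_add openT V3 V4.
Let V234 := sec_add openT V2 V34.
Let Vs : sec setT V := sec_add openT V1 V234.

Lemma pfield_sec : sec setT pfield.
Proof. exact: (sec_scale openT ws Vs). Qed.

Let psi_real p : conjc (psiC p) = psiC p. Proof. by apply: complex_eqP; rewrite /= ?oppr0. Qed.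

Let F_conj p : conjc (FC p) = FC p. Proof. by apply: complex_eqP; rewrite /= ?oppr0. Qed.

Let s_real p : sC p = (complex.Re (sC p))%:C.
Proof.
apply: complex_eqP => //=; have := congr1 (@complex.Im R) (levi_hermitian S openT Gs Gs (I : setT p)).
by rewrite ImJ -/(sC p); move: (complex.Im _) => x; lra.
Qed.

Let t_real p : tC p = (complex.Re (tC p))%:C.
Proof.
apply: complex_eqP => //=; have := vapp_conj_real psis psi_real openT T (I : setT p).
rewrite (conjf_reeb S) -/(tC p) => /(congr1 (@complex.Im R)).
by rewrite ImJ; move: (complex.Im _) => x; lra.
Qed.

Let s_conj p : conjc (sC p) = sC p. Proof. by rewrite s_real; apply: complex_eqP; rewrite /= ?oppr0. Qed.
Let t_conj p : conjc (tC p) = tC p. Proof. by rewrite t_real; apply: complex_eqP; rewrite /= ?oppr0. Qed.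

Section AtPoint.
Variables (U : set M) (Z : 'I_n -> vfield) (p : M).
Hypotheses (Up : U p) (fr : local_frame A T10 U Z) (hm : hmat A theta Z p = 1%:M).
Let oU : open U := frame_open fr.
Let sub W : sec setT W -> sec U W. Proof. exact: sec_sub. Qed.
Let Zs k : sec U (Z k) := frame_sec fr k.
Let cf (Y : vfield) k : C := coframe Z k p (Y p).

Let lvE Y W : sec U Y -> sec U W -> lv Y W p = ip (cf Y) (cf W).
Proof.
move=> Ys Ws; rewrite (levi_frame S fr oU _ Ys Ws Up) // hm; apply: eq_bigr => k _.
rewrite (bigD1 k) //= big1 ?addr0 => [|l /negPf lk]; first by rewrite mxE eqxx mul1r.
by rewrite mxE eq_sym lk !mul0r.
Qed.

Let cf_frame k l : cf (Z k) l = (l == k)%:R.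
Proof.
rewrite /cf -(coframe_sum fr (fun j => (j == k)%:R) l Up); congr (coframe _ _ _ _).
rewrite (bigD1 k) //= eqxx scale1r big1 ?addr0 // => j /negPf ->; exact: scale0r.
Qed.

Let lvZ k Y : sec U Y -> lv (Z k) Y p = conjc (cf Y k).
Proof.
move=> Ys; rewrite (lvE (Zs k) Ys) /ip (bigD1 k) //= big1 ?addr0 => [|l lk].
  by rewrite cf_frame eqxx mul1r.
by rewrite cf_frame (negPf lk) mul0r.
Qed.

Let g := cf G. Let J := cf NJ. Let N := cf NG. Let t := cf NT.
(** The frame being unitary at [p], [H] and [B] are, up to conjugation, the (2,0) and (1,1) Hessians
    of [psi]. The scalar [c] below is the divergence of [G] over [n], prescribed by the equation,
    and [E] is the trace-free rest of [B]. *)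
Let H j k : C := coframe Z j p (nabla (conjf (Z k)) G p).
Let B j k : C := coframe Z j p (nabla (Z k) G p).
Let s := complex.Re (sC p).
Let tau := complex.Re (tC p).
Let pr := (L - F p - nu * s) / m.
Let c : C := pr +i* (- tau).
Let E j k := B j k - c * (j == k)%:R.
Let e j := \sum_k g k * E j k.
Hypothesis n0 : (0 < n)%N.
Let mz : m != 0. Proof. by rewrite pnatr_eq0 -lt0n. Qed.

Let gE : ip g g = s%:C. Proof. by rewrite -(lvE (sub Gs) (sub Gs)) -/(sC p) s_real. Qed.

Let JE k : J k = \sum_l conjc (g l) * H k l.
Proof.
rewrite /J /cf /NJ (nablaJ_exp S fr (sub Gs) (sec_smooth (sub Gs)) Up) cf_sum.
by apply: eq_bigr => l _; rewrite cfZ.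
Qed.

Let NB k : N k = \sum_l g l * B k l.
Proof.
rewrite /N /cf /NG (nabla_exp S fr (sub Gs) (sec_smooth (sub Gs)) Up) cf_sum.
by apply: eq_bigr => l _; rewrite cfZ.
Qed.

Let NE k : N k = e k + c * g k.
Proof.
rewrite NB /e [X in _ = _ + X](_ : _ = \sum_l g l * (c * (k == l)%:R)).
  by rewrite -big_split; apply: eq_bigr => l _; rewrite /= -mulrDr /E subrK.
rewrite (bigD1 k) //= eqxx mulr1 mulrC big1 ?addr0 // => l /negPf; rewrite eq_sym => ->.
by rewrite !mulr0.
Qed.

Let ZJs l : sec U (nabla (conjf (Z l)) G).
Proof. exact: (sec_nabla S oU (vsmooth_conj oU (sec_smooth (Zs l))) (sub Gs)). Qed.
Let ZNs l : sec U (nabla (Z l) G).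
Proof. exact: (sec_nabla S oU (sec_smooth (Zs l)) (sub Gs)). Qed.

Let Hsym k l : H k l = H l k.
Proof.
have := hess20_sym S psis Gs HG oU Up (Zs k) (Zs l).
by rewrite !lvZ // => /(congr1 conjc); rewrite !conjcK.
Qed.

Let Bherm k l : conjc (B k l) - B l k = 2%:R * 'i%C * (k == l)%:R * tC p.
Proof.
have := hess11_comm S psis psi_real Gs HG oU Up (Zs k) (Zs l).
rewrite !lvZ // conjcK => ->; congr (_ * _ * _).
by rewrite cf_frame conjc_nat.
Qed.

(** [B] fails to be Hermitian only by the commutation term on the diagonal, which is exactly what
    subtracting the imaginary part [- tau] of [c] removes. *)
Let Eherm k l : conjc (E k l) = E l k.
Proof.
have := Bherm k l; rewrite /E t_real -/tau; have [->|kl] := eqVneq k l.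
  rewrite ?eqxx !mulr1; case: (B l l) => a1 a2 /eqP; rewrite eq_complex /= => /andP[/eqP h1 /eqP h2].
  by apply: complex_eqP => /=; move: h1 h2; rewrite /tau; lra.
rewrite ?[l == k]eq_sym ?(negPf kl) !mulr0 mul0r !subr0 => /eqP; rewrite subr_eq0 => /eqP //.
Qed.

Let divGE : divergence nabla Z G p = m%:C * c.
Proof.
rewrite (divG fr Up) s_real t_real -/s -/tau /FC /c /pr.
by apply: complex_eqP; rewrite /=; field; exact: mz.
Qed.

Let Etr : \sum_k E k k = 0.
Proof.
have := divGE; rewrite /divergence => h.
rewrite /E sumrB h; apply/eqP; rewrite subr_eq0; apply/eqP.
rewrite (eq_bigr (fun=> c)) => [|k _]; last by rewrite eqxx mulr1.
by rewrite sumr_const card_ord natrC mulr_natl.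
Qed.

Let HHE : \sum_k \sum_l conjc (H l k) * H k l = (mx_sqnorm H)%:C.
Proof.
rewrite mx_sqnormC; apply: eq_bigr => k _.
by apply: eq_bigr => l _; rewrite Hsym mulrC.
Qed.

Let trB2 : \sum_k \sum_l B l k * B k l = (mx_sqnorm E)%:C + m%:C * c ^+ 2.
Proof.
have BE k l : B k l = E k l + c * (k == l)%:R by rewrite /E subrK.
rewrite (_ : (mx_sqnorm E)%:C = \sum_k \sum_l E l k * E k l); last first.
  rewrite mx_sqnormC; apply: eq_bigr => k _.
  by apply: eq_bigr => l _; rewrite Eherm mulrC.
have row k : \sum_l B l k * B k l = \sum_l E l k * E k l + (2%:R * c * E k k + c ^+ 2).
  rewrite (bigD1 k) //= [in RHS](bigD1 k) //= -addrA [X in _ = _ + X]addrC addrA; congr (_ + _).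
    by rewrite !BE eqxx mulr1; ring.
  apply: eq_bigr => l /negPf lk; rewrite !BE lk [k == l]eq_sym lk !mulr0 !addr0 //.
rewrite (eq_bigr _ (fun k _ => row k)) big_split; congr (_ + _).
rewrite big_split /= -mulr_sumr Etr mulr0 add0r sumr_const card_ord natrC.
by rewrite mulr_natl.
Qed.
Let dpsi Y : sec setT Y -> vapp A Y psiC p = ip (cf Y) g.
Proof. by move=> Ys; rewrite -(HG openT Ys (I : setT p)) (lvE (sub Ys) (sub Gs)). Qed.

Let dt Y : sec setT Y -> vapp A Y tC p = ip (cf Y) t.
Proof.
by move=> Ys; rewrite -(levi_nablaT_grad S psis Gs HG openT I Ys) (lvE (sub Ys) (sub NTs)).
Qed.

(** Both halves of the derivative of the square norm of [G] become pairings of [Y] with [J] and [N]: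
    the (2,0) Hessian is symmetric, and exchanging the indices of the (1,1) Hessian costs the term
    with [T psi]. *)
Let ds Y : sec setT Y -> vapp A Y sC p =
  ip (cf Y) N + ip (cf Y) J - 2%:R * 'i%C * ip (cf Y) g * tC p.
Proof.
move=> Ys; have Yv := sec_smooth Ys.
have NYs : sec setT (nabla Y G) by exact: (sec_nabla S openT Yv Gs).
rewrite (levi_nabla S openT Yv Gs Gs I) (levi_hermitian S openT Gs NYs (I : setT p)).
rewrite (hess20_sym S psis Gs HG openT (I : setT p) Gs Ys) -/NJ.
have := hess11_comm S psis psi_real Gs HG openT (I : setT p) Ys Gs; rewrite -/NG -/(tC p).
rewrite !(lvE (sub Ys)) //; try exact: sub.
rewrite -/N -/J -/g => <-; ring.
Qed.

Let dF' Y : sec setT Y -> vapp A Y FC p = FC p * ip (cf Y) g.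
Proof. by move=> Ys; rewrite dF dpsi. Qed.

(** Here the equation removes the third derivatives of [psi]: the divergence of [G] is an explicit
    function of [F], the square norm of [G] and [T psi]. *)
Let dfix (X : vfield) : vapp A X (divergence nabla Z G) p =
  - vapp A X FC p - nu%:C * vapp A X sC p - m%:C * i * vapp A X tC p.
Proof.
rewrite (vapp_eq A oU Up X (fun q Uq => divG fr Uq)).
have sm (a : C) f : smooth_on A setT f -> smooth_on A setT (fun q => a * f q).
  by move=> fs; apply: (smooth_mul openT) => //; exact: (smooth_cst A openT).
have dm (a : C) f : smooth_on A setT f -> vapp A X (fun q => a * f q) p = a * vapp A X f p.
  move=> fs; rewrite (vappM openT I) //; last exact: (smooth_cst A openT).
  by rewrite [X in _ + _ * X]vappE dtan_cst mulr0 addr0.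
have sb f f' : smooth_on A setT f -> smooth_on A setT f' -> smooth_on A setT (fun q => f q - f' q).
  by move=> fs fs'; apply: (smooth_add openT fs); exact: (smooth_opp openT).
have db f f' : smooth_on A setT f -> smooth_on A setT f' ->
    vapp A X (fun q => f q - f' q) p = vapp A X f p - vapp A X f' p.
  by move=> fs fs'; exact: (vappB openT I).
have cs : smooth_on A setT (fun=> L%:C) := smooth_cst A openT _.
have h1 := sb _ _ cs Fs; have h2 := sm nu%:C _ ss; have h3 := sm (m%:C * i) _ ts.
have h12 := sb _ _ h1 h2.
rewrite [LHS](db _ _ h12 h3) (db _ _ h1 h2) (db _ _ cs Fs) (dm _ _ ss) (dm _ _ ts).
by rewrite [X in X - _ - _ - _]vappE dtan_cst sub0r.
Qed.

Let dJ f : smooth_on A setT f -> (forall q, conjc (f q) = f q) -> vapp A (conjf G) f p = conjc (vapp A G f p).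
Proof. by move=> fs fr'; exact: (vapp_conj_real fs fr' openT G (I : setT p)). Qed.

(** The second derivative of [psi] along [T] has no formula. Being real, it meets only an imaginary
    coefficient in the divergence and disappears from the real part. *)
Let dTt : exists x : R, vapp A T tC p = x%:C.
Proof.
exists (complex.Re (vapp A T tC p)); apply: complex_eqP => //=.
have := vapp_conj_real ts t_conj openT T (I : setT p).
rewrite (conjf_reeb S) => /(congr1 (@complex.Im R)).
by rewrite ImJ; move: (complex.Im _) => x; lra.
Qed.

Let dTs : vapp A T sC p = ip t g + ip g t.
Proof.
by rewrite (levi_nabla S openT Ts Gs Gs I) (conjf_reeb S) !(lvE (sub _) (sub _)).
Qed.

Variable rc : R.
Hypothesis ricE : \sum_i \sum_j ric A nabla Z i j p * g i * conjc (g j) = rc%:C.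

Let divN : divergence nabla Z NG p = vapp A G (divergence nabla Z G) p + ((mx_sqnorm E)%:C + m%:C * c ^+ 2).
Proof. by rewrite /NG (div_nablaG S fr Gs Up) trB2. Qed.

Let divJ : divergence nabla Z NJ p = vapp A (conjf G) (divergence nabla Z G) p + (mx_sqnorm H)%:C
  - 2%:R * 'i%C * ip t g + rc%:C.
Proof.
rewrite /NJ (div_nablaJ S fr Gs HG Up) HHE ricE; congr (_ + _ - _ + _).
rewrite mulr_sumr; apply: eq_bigr => k _.
rewrite -mulrA; congr (_ * _); rewrite mulrC; congr (_ * _).
by rewrite -(HG oU (Zs k) Up) (lvZ _ (sub Gs)).
Qed.

Let divT : divergence nabla Z NT p = vapp A T (divergence nabla Z G) p.
Proof. exact: (div_nablaT S fr Gs Up). Qed.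

Let divV : divergence nabla Z V p =
  coef_plus m L sC tC FC p * divergence nabla Z NJ p + vapp A NJ (coef_plus m L sC tC FC) p +
  (coef_minus m L sC tC FC p * divergence nabla Z NG p + vapp A NG (coef_minus m L sC tC FC) p +
  (12%:C * tC p * divergence nabla Z NT p + 12%:C * vapp A NT tC p +
  (coef_G m nu L sC tC FC p * divergence nabla Z G p + vapp A G (coef_G m nu L sC tC FC) p))).
Proof.
have su f : smooth_on A setT f -> smooth_on A U f by exact: smooth_sub.
rewrite /V (divD S fr (sub V1) (sub V234) Up) (divD S fr (sub V2) (sub V34) Up) (divD S fr (sub V3) (sub V4) Up).
rewrite (divZ S fr (su _ cps) (sub NJs) Up) (divZ S fr (su _ cms) (sub NGs) Up).
rewrite (divZ S fr (su _ t12s) (sub NTs) Up) (divZ S fr (su _ cGs) (sub Gs) Up).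
do 3 congr (_ + _); rewrite (vappM openT I) //; last exact: (smooth_cst A openT).
by rewrite [X in _ + _ * X]vappE dtan_cst mulr0 addr0.
Qed.

Let divP : divergence nabla Z pfield p = wC p * (divergence nabla Z V p + (2 * nu - 1)%:C * vapp A V psiC p).
Proof.
have su f : smooth_on A setT f -> smooth_on A U f by exact: smooth_sub.
by rewrite /pfield (divZ S fr (su _ ws) (sub Vs) Up) dw -mulrDr.
Qed.

Let Vpsi : vapp A V psiC p = coef_plus m L sC tC FC p * ip J g + (coef_minus m L sC tC FC p * ip N g
  + (12%:C * tC p * ip t g + coef_G m nu L sC tC FC p * ip g g)).
Proof. by rewrite !vappE !dtanDl !dtanZl -!vappE !dpsi. Qed.

Let NEf : N = fun k => e k + c * g k. Proof. by apply/funext => k; exact: NE. Qed.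
Let sE : sC p = s%:C. Proof. exact: s_real. Qed.
Let tE : tC p = tau%:C. Proof. exact: t_real. Qed.

Let ipRe (x : 'I_n -> C) : ip x x = (complex.Re (ip x x))%:C.
Proof. by apply: complex_eqP => //=; rewrite Im_ip. Qed.

Lemma pfield_divergence : complex.Re (divergence nabla Z pfield p) = w p *
  real_omega m nu (F p) L tau rc (mx_sqnorm H) (mx_sqnorm E) (complex.Re (ip g g))
    (complex.Re (ip J J)) (complex.Re (ip e e)) (complex.Re (ip t t))
    (complex.Re (ip J g)) (complex.Im (ip J g)) (complex.Re (ip t g)) (complex.Im (ip t g))
    (complex.Re (ip J e)) (complex.Im (ip J t)) (complex.Im (ip e t)) (complex.Re (ip e g)).
Proof.
rewrite divP ReZ; congr (_ * _); rewrite Vpsi divV divN divJ divT divGE !dfix.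
rewrite (dJ Fs F_conj) (dJ ss s_conj) (dJ ts t_conj).
rewrite (vapp_plus m L ss ts Fs NJ p) (vapp_minus m L ss ts Fs NG p) (vapp_G m nu L ss ts Fs G p).
rewrite (vapp_minus m L ss ts Fs G p).
rewrite (dF T) -/(tC p) dTs; have [x ->] := dTt.
rewrite (ds Gs) (ds NGs) (ds NJs) (dt Gs) (dt NGs) (dt NJs) (dt NTs) (dF' Gs) (dF' NGs) (dF' NJs).
rewrite -/J -/N -/g -/t.
rewrite NEf !(ipDl, ipDr, ipZl, ipZr).
rewrite (ipC J g) (ipC t g) (ipC e g) (ipC J e).
rewrite (ipRe J) (ipRe e) (ipRe t) (ipRe g).
have -> : ip e g = (complex.Re (ip e g))%:C by apply: complex_eqP => //=; exact: ip_eg_real.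
rewrite /coef_G /coef_q1 /coef_q2 /coef_minus /coef_plus /coef_p /coef_h sE tE /FC /wC.
have sg : s = complex.Re (ip g g) by rewrite gE.
rewrite /c /pr sg.
(* All relations have been used. The real and imaginary parts become independent variables, and a
   rational identity remains. *)
move: (complex.Re (ip g g)) (complex.Re (ip J J)) (complex.Re (ip e e)) (complex.Re (ip t t)).
move: (complex.Re (ip e g)) (ip J g) (ip t g) (ip J e) (ip J t) (ip e t).
move: (mx_sqnorm H) (mx_sqnorm E) tau (F p) => hh ee ta f0.
move=> eg [Jg1 Jg2] [tg1 tg2] [Je1 Je2] [Jt1 Jt2] [et1 et2] s0 jj e20 tt0.
have := mz; have : m + 1 != 0 by rewrite natr1 pnatr_eq0.
move: (n%:R : R) => mm m1 m0.
have two : (2%:R : R[i]) = (2%:R : R)%:C by rewrite natrC.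
rewrite !two.
rewrite /real_omega /=.
by field; rewrite m0 m1.
Qed.

Hypotheses (F0 : 0 <= F p) (L0 : 0 <= L <= m / 2) (nu0 : m < 2 * nu) (w0 : 0 <= w p).

Lemma pfield_bound_at : (m + 1) * s <= rc ->
  w p * (m * (2 * nu / m - 1) / 2 * s ^+ 3) <= complex.Re (divergence nabla Z pfield p).
Proof.
move=> rcb; rewrite pfield_divergence; apply: ler_wpM2l => //.
have sg : s = complex.Re (ip g g) by rewrite gE.
have -> : J = fun k => \sum_l conjc (g l) * H k l by apply/funext => k; exact: JE.
by rewrite sg; apply: pointwise_bound => //; rewrite -sg.
Qed.

End AtPoint.

Hypotheses (n0 : (0 < n)%N) (F0 : forall p, 0 <= F p) (L0 : 0 <= L <= m / 2) (nu0 : m < 2 * nu).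
Hypothesis w0 : forall p, 0 <= w p.
Hypothesis hRic : ric_bound A T10 theta nabla.

(** The frame varies with [p], since it is unitary at that point only; [divergence_eq0] accepts a
    different frame at each point. *)
Lemma pfield_bound p : exists U Z, [/\ local_frame A T10 U Z, U p &
  w p * (m * (2 * nu / m - 1) / 2 * complex.Re (lv G G p) ^+ 3) <= complex.Re (divergence nabla Z pfield p)].
Proof.
have [U [Z [Up fr hm]]] := unitary_frame S p; exists U, Z; split=> //.
have Us : sec U G by apply: sec_sub Gs => ? _.
pose g k := coframe Z k p (G p); pose rc := \sum_i \sum_j ric A nabla Z i j p * g i * conjc (g j).
have hr : (m + 1)%:C * lv G G p <= rc.
  suff -> : (m + 1)%:C * lv G G p = n.+1%:R * (\sum_i \sum_j hmat A theta Z p i j * g i * conjc (g j)).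
    by have h := hRic; exact: (h U Z fr p Up).
  rewrite (levi_frame S fr (frame_open fr) (fun _ => id) Us Us Up) natr1 natrC; congr (_ * _).
have := hr; rewrite lecE -/(sC p) s_real => /andP[/eqP hi hre].
have rcE : rc = (complex.Re rc)%:C by apply: complex_eqP => //=; rewrite hi /=; ring.
apply: (pfield_bound_at Up fr hm n0 rcE) => //.
by move: hre => /=; rewrite mul0r subr0.
Qed.
End PField.
(** * Proof of the theorem *)

Section ExpLog.
Context {R : realType} {m : nat}.
Local Notation V := 'rV[R]_m.

Lemma Ck_expR k (W : set V) (f : V -> R) : open W -> Ck_on k W f -> Ck_on k W (fun x => expR (f x)).
Proof.
have ce (y : R) : {for y, continuous (@expR R)} by exact: continuous_expR.
move=> oW; elim: k f => [|k IH] f Cf.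
  by split=> // x /set_mem Wx; exact: (continuous_compp (Ck_cont Cf Wx) (ce _)).
apply: Ck_intro => // [x /set_mem Wx|i]; first exact: (continuous_compp (Ck_cont Cf Wx) (ce _)).
exists (fun x => expR (f x) * 'D_(delta_mx 0 i) f x) => [x Wx|].
  exact: (is_derive_comp1 (is_derive_expR _) (Ck_derivable i Cf Wx)).
by apply: Ck_mul => //; [exact: IH (Ck_pred Cf)|exact: Ck_derive].
Qed.

Lemma Ck_ln k (W : set V) (f : V -> R) : open W -> (forall x, W x -> 0 < f x) -> Ck_on k W f ->
  Ck_on k W (fun x => ln (f x)).
Proof.
move=> oW f0; have cl x : W x -> {for x, continuous f} -> {for x, continuous (fun x => ln (f x))}.
  by move=> Wx cf; exact: (continuous_compp cf (continuous_ln (f0 _ Wx))).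
case: k => [|k] Cf.
  by split=> // x /set_mem Wx; apply: cl => //; exact: (Ck_cont Cf Wx).
apply: Ck_intro => // [x /set_mem Wx|i]; first by apply: cl => //; exact: (Ck_cont Cf Wx).
exists (fun x => (f x)^-1 * 'D_(delta_mx 0 i) f x) => [x Wx|].
  exact: (is_derive_comp1 (is_derive1_ln (f0 x Wx)) (Ck_derivable i Cf Wx)).
apply: Ck_mul => //; last exact: Ck_derive.
by apply: (Ck_inv oW _ (Ck_pred Cf)) => x Wx; rewrite gt_eqF // f0.
Qed.
End ExpLog.

Section ExpLogManifold.
Context (R : realType) (m : nat) (M : topologicalType) (A : oriented_atlas R m M).
Implicit Types f : M -> R.

Lemma smoothR_expR U f : open U -> smoothR_on A U f -> smoothR_on A U (fun q => expR (f q)).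
Proof.
move=> oU fs c cc k; apply: Ck_expR; [exact: open_chart_image cc oU|exact: fs].
Qed.

Lemma smoothR_ln U f : open U -> (forall p, U p -> 0 < f p) -> smoothR_on A U f ->
  smoothR_on A U (fun q => ln (f q)).
Proof.
move=> oU f0 fs c cc k; apply: Ck_ln; [exact: open_chart_image cc oU| |exact: fs].
by move=> _ [q [Uq cq] <-] /=; rewrite (cmapK cc cq); exact: f0.
Qed.

Lemma rpart_expR c i f p : charts A c -> cdom c p -> ckM A 1 setT f ->
  rpart c i (fun q => expR (f q)) p = expR (f p) * rpart c i f p.
Proof.
move=> cc cp F; have D := rpartP i cc (I : setT p) cp F.
have [_ E] := is_derive_comp1 (is_derive_expR _) D.
by rewrite [LHS]E /= (cmapK cc cp).
Qed.

Lemma vapp_expR X f p : smoothR_on A setT f ->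
  vapp A X (fun q => (expR (f q))%:C) p = (expR (f p))%:C * vapp A X (fun q => (f q)%:C) p.
Proof.
move=> /smoothRP fs; rewrite !vappE !dtanE mulr_sumr; apply: eq_bigr => j _.
rewrite mulrCA; congr (_ * _); rewrite /cpart rpart_expR //; try exact: chart_at_charts; last exact: chart_at_dom.
by apply: complex_eqP; rewrite /= !(rpart_cst, mul0r, mulr0, subr0, addr0).
Qed.
End ExpLogManifold.

Section Uniqueness.
Context (R : realType) (n : nat) (M : topologicalType) (A : oriented_atlas R n.*2.+1 M).
Context (T10 : M -> {vspace 'rV[R[i]]_(n.*2.+1)}) (theta : form1 R n.*2.+1 M).
Context (T : vfield R n.*2.+1 M).
Context (nabla : vfield R n.*2.+1 M -> vfield R n.*2.+1 M -> vfield R n.*2.+1 M).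
Hypothesis S : sasakian A T10 theta T nabla.
Hypothesis clM : closed_manifold M.
Hypothesis hRic : ric_bound A T10 theta nabla.
Hypothesis n0 : (0 < n)%N.
Local Notation C := R[i].
Local Notation sec := (section_on A T10).
Local Notation lv := (levi A theta).
Local Notation m := (n%:R : R).

Variables (alpha lambda : R).
Hypotheses (alpha1 : 1 < alpha) (alpha2 : alpha < (m + 2) / m).
Hypotheses (lambda0 : 0 < lambda) (lambda1 : lambda <= m / (2 * (alpha - 1))).
Variable u : M -> R.
Hypotheses (us : smoothR_on A setT u) (u0 : forall p, 0 < u p).
Hypothesis sol : solution A T10 theta nabla lambda alpha u.

Let a := alpha - 1.
Let nu := a^-1.
Let psi q := a * ln (u q).
Let F q := a * expR (psi q).
(** Equal to [u^(3 - alpha)], because [(2 nu - 1) a = 2 - a]. *)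
Let w q := expR ((2 * nu - 1) * psi q).
Let L := a * lambda.

Let a0 : 0 < a. Proof. by rewrite subr_gt0. Qed.
Let nua : nu * a = 1. Proof. by rewrite mulVf // gt_eqF. Qed.
Let uE q : u q = expR (nu * psi q).
Proof. by rewrite /psi mulrA nua mul1r lnK // posrE. Qed.
Let FE q : F q = a * u q `^ a.
Proof. by rewrite /F /psi /powR gt_eqF. Qed.

Let smul (b : R) (f : M -> R) : smoothR_on A setT f -> smoothR_on A setT (fun q => b * f q).
Proof.
move=> fs; apply/smoothRP => k; apply: (ckM_mul openT); first by apply: ckM_cst; exact: openT.
by have h := (smoothRP A setT f).1 fs.
Qed.

Let psis : smoothR_on A setT psi.
Proof. by apply: smul; apply: (smoothR_ln openT). Qed.
Let psiC p : C := (psi p)%:C.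
Let psiCs : smooth_on A setT psiC := smooth_real openT psis.

Let vmul (b : R) (f : M -> R) X p : smoothR_on A setT f ->
  vapp A X (fun q => (b * f q)%:C) p = b%:C * vapp A X (fun q => (f q)%:C) p.
Proof.
move=> fs; have -> : (fun q => (b * f q)%:C) = (fun q => b%:C * (f q)%:C).
  by apply/funext => q; apply: complex_eqP; rewrite /=; ring.
rewrite (vappM openT I); [|exact: (smooth_cst A openT)|exact: (smooth_real openT fs)].
by rewrite [X in _ + _ * X]vappE dtan_cst mulr0 addr0.
Qed.

Let dF X p : vapp A X (fun q => (F q)%:C) p = (F p)%:C * vapp A X psiC p.
Proof.
rewrite (vmul _ _ _ (smoothR_expR openT psis)) (vapp_expR _ _ psis) mulrA; congr (_ * _).
by apply: complex_eqP; rewrite /= /F; ring.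
Qed.

Let dexp (b : R) X p : vapp A X (fun q => (expR (b * psi q))%:C) p =
  (expR (b * psi p))%:C * (b%:C * vapp A X psiC p).
Proof. by rewrite (vapp_expR _ _ (smul b psis)) (vmul _ _ _ psis). Qed.

Let du X p : vapp A X (fun q => (u q)%:C) p = (u p)%:C * (nu%:C * vapp A X psiC p).
Proof.
have -> : (fun q => (u q)%:C) = (fun q => (expR (nu * psi q))%:C : C) by apply/funext => q; rewrite -uE.
by rewrite dexp -uE.
Qed.

Let upow p : u p `^ alpha = u p * u p `^ a.
Proof.
have -> : alpha = 1 + a by rewrite addrC subrK.
by rewrite powRD ?powRr1 ?ltW // (gt_eqF (u0 p)) implybT.
Qed.

(** [G] is the gradient of [psi]. The last clause is kept in the statement because, once [G]
    vanishes, it is the equation [F = L]. *)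
Lemma log_gradient_eq0 : exists G, [/\ sec setT G, forall p, G p = 0 & forall U Z p, local_frame A T10 U Z ->
  U p -> complex.Re (divergence nabla Z G p) = L - F p].
Proof.
have [G Gs HG] := gradient S psiCs.
pose s := lv G G; pose t := vapp A T psiC.
have us' := smooth_real openT us.
have nus : smooth_on A setT (fun q => (nu * u q)%:C) by apply: (smooth_real openT); exact: smul.
(* [Gu] is the gradient of [u]; the sub-Laplacian of [u] is the real part of its divergence, which
   the product rule expresses by the divergence of [G]. *)
pose Gu q := (nu * u q)%:C *: G q.
have Gus : sec setT Gu by exact: (sec_scale openT nus Gs).
have HGu U W p : open U -> sec U W -> U p -> lv W Gu p = vapp A W (fun q => (u q)%:C) p.
  move=> oU Ws Up; rewrite (levi_scaler S oU (smooth_sub _ nus) Ws (sec_sub _ Gs) Up) //.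
  rewrite (HG U W p oU Ws Up).
  rewrite du mulrA; congr (_ * _); apply: complex_eqP; rewrite /=; ring.
have ureal p : conjc ((u p)%:C : C) = (u p)%:C by apply: complex_eqP; rewrite /= ?oppr0.
have psireal p : conjc (psiC p) = psiC p by apply: complex_eqP; rewrite /= ?oppr0.
have sIm p : complex.Im (s p) = 0.
  by have := levi_ge0 S openT Gs (I : setT p); rewrite lecE => /andP[/eqP].
have ReG U Z p : local_frame A T10 U Z -> U p ->
    complex.Re (divergence nabla Z G p) = L - F p - nu * complex.Re (s p).
  move=> fr Up; have oU := frame_open fr.
  have := sol fr Up; rewrite /sublaplacian (trace_hess S fr Gus HGu Up) ReJ.
  have -> : divergence nabla Z Gu p = (nu * u p)%:C * (divergence nabla Z G p + nu%:C * s p).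
    rewrite /Gu (divZ S fr (smooth_sub _ nus) (sec_sub _ Gs) Up) //.
    rewrite (vmul _ _ _ us) du -(HG _ _ _ openT Gs (I : setT p)) -/(s p).
    have -> : (nu * u p)%:C = nu%:C * (u p)%:C :> C by apply: complex_eqP; rewrite /=; ring.
    by ring.
  rewrite ReZ ReD ReZ FE upow; move: (complex.Re _) (complex.Re _) (u p `^ a) => r d x h.
  have {}h : nu * (d + nu * r) = lambda - x.
    apply: (mulfI (lt0r_neq0 (u0 p))); apply/eqP; rewrite -subr_eq0; apply/eqP; rewrite -[RHS]h; ring.
  have -> : d = a * (nu * (d + nu * r)) - nu * r by rewrite mulrA [a * nu]mulrC nua; ring.
  by rewrite h /L; ring.
(* The equation for [u] supplies the real part only; the imaginary part is the traced commutation
   relation [div_grad_comm]. *)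
have divG U Z p : local_frame A T10 U Z -> U p ->
  divergence nabla Z G p = L%:C - (F p)%:C - nu%:C * s p - m%:C * (0 +i* 1) * t p.
  move=> fr Up.
  have := div_grad_comm S fr psiCs psireal Gs HG Up; rewrite -/(t p).
  have := ReG U Z p fr Up; have := sIm p.
  rewrite -(natrC n) -(natrC 2); move: (divergence nabla Z G p) (s p) (t p) => [d1 d2] [s1 s2] [t1 t2] /=.
  move=> -> d1E /eqP; rewrite eq_complex /= => /andP[/eqP h1 /eqP h2].
  have t20 : m * t2 = 0 by move: h1; lra.
  by apply: complex_eqP; rewrite /= ?d1E; move: h2 t20; lra.
have ws : smooth_on A setT (fun q => (w q)%:C).
  by apply: (smooth_real openT); apply: (smoothR_expR openT); exact: smul.
have Fs : smooth_on A setT (fun q => (F q)%:C).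
  by apply: (smooth_real openT); apply: smul; exact: (smoothR_expR openT psis).
have F0 p : 0 <= F p by rewrite mulr_ge0 ?expR_ge0 ?ltW.
have w0 p : 0 <= w p by exact: expR_ge0.
have mp : 0 < m by rewrite ltr0n.
(* This and [nu0] are the hypotheses on lambda and alpha, rewritten in terms of [L] and [nu]. *)
have L0 : 0 <= L <= m / 2.
  apply/andP; split; first by rewrite mulr_ge0 // ltW.
  have := lambda1; rewrite ler_pdivlMr ?mulr_gt0 // ler_pdivlMr // => h.
  by rewrite (_ : L * 2 = lambda * (2 * (alpha - 1))) // /L /a; ring.
have nu0 : m < 2 * nu.
  rewrite /nu ltr_pdivlMr //; have := alpha2; rewrite ltr_pdivlMr // => h.
  by rewrite /a mulrBr mulr1 ltrBlDl mulrC.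
pose V := pfield A theta T nabla psi F w nu L G.
have Vs : sec setT V by exact: (pfield_sec S nu L psiCs Fs ws Gs).
have bound := pfield_bound S psiCs Fs ws dF (fun X p => dexp _ X p) Gs HG divG n0 F0 L0 nu0 w0 hRic.
(* [divergence] mentions a frame, whereas [divergence_eq0] asks for a function on [M]: [Q] takes at
   each point the real part computed in the frame given by [bound]. *)
have /choice [Q HQ] : forall p, exists r, exists U Z, [/\ local_frame A T10 U Z, U p,
    r = complex.Re (divergence nabla Z V p) &
    w p * (m * (2 * nu / m - 1) / 2 * complex.Re (s p) ^+ 3) <= r].
  by move=> p; have [U [Z [fr Up h]]] := bound p; exists (complex.Re (divergence nabla Z V p)), U, Z.
have s0 p : 0 <= complex.Re (s p).
  by have := levi_ge0 S openT Gs (I : setT p); rewrite lecE => /andP[].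
have k0 : 0 < m * (2 * nu / m - 1) / 2.
  by rewrite divr_gt0 // mulr_gt0 // subr_gt0 ltr_pdivlMr // mul1r.
have Q0 : forall p, Q p = 0.
  apply: (divergence_eq0 S clM Vs) => p; have [U [Z [fr Up QE hQ]]] := HQ p.
  exists U, Z; split => //; apply: le_trans hQ; apply: mulr_ge0 => //.
  by apply: mulr_ge0; [exact: ltW|exact: exprn_ge0].
have sz p : s p = 0.
  have [U [Z [fr Up QE]]] := HQ p; rewrite Q0 => hQ.
  apply: complex_eqP; last exact: sIm.
  apply/eqP; rewrite eq_le s0 andbT leNgt; apply/negP => sp.
  by move: hQ; rewrite leNgt => /negP; apply; rewrite mulr_gt0 ?expR_gt0 // mulr_gt0 // exprn_gt0.
have G0 p : G p = 0.
  exact: (levi_eq0 S openT Gs (I : setT p) (sz p)).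
by exists G; split=> // U Z p fr Up; rewrite (ReG U Z p fr Up) sz mulr0 subr0.
Qed.

(** A zero gradient already forces [F p = L] at each single point, so the value of [u] follows from
    the equation itself, without connectedness of [M]. *)
Lemma solution_constant p : u p = lambda `^ (alpha - 1)^-1.
Proof.
have [G [Gs G0 ReG]] := log_gradient_eq0.
have [U [Z [Up fr]]] := framePt S p.
have := ReG U Z p fr Up.
have -> : divergence nabla Z G p = 0.
  (* [G] is replaced by 0 times itself so that the product rule [divZ] computes its divergence. *)
  have -> : G = (fun q => (0 : C) *: G q) by apply/funext => q; rewrite scale0r.
  rewrite (divZ S fr (smooth_cst A (frame_open fr) 0) (sec_sub _ Gs) Up) //.
  by rewrite mul0r add0r vappE dtan_cst.
rewrite /L FE /= => /esym/eqP; rewrite subr_eq0 => /eqP h.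
have {}h : u p `^ a = lambda by apply: (mulfI _ (esym h)); rewrite gt_eqF.
by rewrite -h -powRrM mulfV ?gt_eqF // powRr1 // ltW.
Qed.
End Uniqueness.
Unset Implicit Arguments.
Theorem theorem1p6 (R : realType) (n : nat) (hn : (1 <= n)%N)
  (M : topologicalType) (A : oriented_atlas R n.*2.+1 M)
  (hM : closed_manifold M)
  (T10 : M -> {vspace 'rV[R[i]]_(n.*2.+1)}) (hT10 : cr_structure A T10)
  (theta : form1 R n.*2.+1 M) (htheta : contact_form A theta)
  (htheta10 : annihilates_T10 T10 theta)
  (hspc : strictly_pseudoconvex A T10 theta)
  (T : vfield R n.*2.+1 M) (hT : reeb_field A theta T)
  (nabla : vfield R n.*2.+1 M -> vfield R n.*2.+1 M -> vfield R n.*2.+1 M)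
  (hnabla : tanaka_webster A T10 theta T nabla)
  (hRic : ric_bound A T10 theta nabla)
  (hTor : torsion_free A T10 theta T nabla)
  (alpha lambda : R)
  (halpha1 : 1 < alpha) (halpha2 : alpha < (n%:R + 2) / n%:R)
  (hlambda1 : 0 < lambda) (hlambda2 : lambda <= n%:R / (2 * (alpha - 1)))
  (u : M -> R) :
  [/\ smoothR_on A setT u, (forall p, 0 < u p) &
      solution A T10 theta nabla lambda alpha u]
  <-> (forall p, u p = lambda `^ (alpha - 1)^-1).
Proof.
have S : sasakian A T10 theta T nabla.
  by have [hs _ _] := htheta; exact: (Sasakian hT10 hs htheta10 hspc hT hnabla hTor).
split=> [[us u0 sol] p|uE].
  exact: (solution_constant S hM hRic hn halpha1 halpha2 hlambda1 hlambda2 us u0 sol).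
have c0 : 0 < lambda `^ (alpha - 1)^-1 by exact: powR_gt0.
have -> : u = fun=> lambda `^ (alpha - 1)^-1 by apply/funext => p; exact: uE.
split=> [|//|U Z fr p Up].
  by apply/smoothRP => k; apply: ckM_cst; exact: openT.
(* For a constant [c] the Hessian vanishes, and the equation reduces to [c^alpha = lambda c]. *)
rewrite /sublaplacian big1 => [|i _]; last first.
  rewrite big1 // => j _; rewrite /hess [X in _ - X]vappE dtan_cst subr0.
  have -> : vapp A (Z i) (fun=> (lambda `^ (alpha - 1)^-1)%:C) = fun=> 0.
    by apply/funext => q; rewrite vappE dtan_cst.
  by rewrite vappE dtan_cst mulr0.
rewrite /= sub0r; set c := lambda `^ _ in c0 *.
have cE : c `^ (alpha - 1) = lambda.
  by rewrite /c -powRrM mulVf ?powRr1 ?(ltW hlambda1) // gt_eqF // subr_gt0.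
have -> : alpha = 1 + (alpha - 1) by rewrite addrC subrK.
rewrite powRD; last by rewrite (gt_eqF c0) implybT.
by rewrite cE powRr1 ?(ltW c0) // mulrC addNr.
Qed.
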